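(* Let $\lambda>0$ and let $\mathcal{H}^{(2)}$ be the semi-infinite matrix with entries, for $m,n\in\mathbb{N}_0$, $$\mathcal{H}^{(2)}_{m,n}=(-1)^{m(m-1)/2+n(n-1)/2}\sqrt{\frac{\Gamma(m+2\lambda)\Gamma(n+2\lambda)}{m!\,n!}}\;\frac{\Gamma((m+n+1)/2)}{\Gamma(2\lambda+(m+n+1)/2)}$$ if $m+n$ is even, and $\mathcal{H}^{(2)}_{m,n}=0$ if $m+n$ is odd. Then $\mathcal{H}^{(2)}$ determines a unique self-adjoint operator $H^{(2)}$ on $\ell^2(\mathbb{N}_0)$, which is unitarily equivalent, via the unitary mapping $U:\ell^2(\mathbb{N}_0)\to L^2(\mathbb{R},d\mu)$ determined by $Ue_n=\hat P_n$ for all $n\in\mathbb{N}_0$ (where $\{\hat P_n\mid n\in\mathbb{N}_0\}$ is an orthonormal basis of $L^2(\mathbb{R},d\mu)$), to the operator $T_h$ of multiplication by $h$ on $L^2(\mathbb{R},d\mu)$, i.e. $UH^{(2)}U^{-1}=T_h$. Here $\mu$ is absolutely continuous, supported on $\mathbb{R}$, with density $$\frac{d\mu}{dx}(x)=\frac{2^{2\lambda-1}}{\pi\,\Gamma(2\lambda)}\left|\Gamma(\lambda+\mathrm{i}x)\right|^{2},$$ $$h(x)=\frac{2^{2\lambda-1}}{\Gamma(2\lambda)}\left|\Gamma(\lambda+\mathrm{i}x)\right|^{2},$$ and $$\hat P_n(x)=\left(\frac{\Gamma(2\lambda)\,n!}{\Gamma(n+2\lambda)}\right)^{1/2}P_n^{(\lambda)}\!\left(x;\frac{\pi}{2}\right),$$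 for $x\in\mathbb{R}$. Consequently, $H^{(2)}$ is a bounded operator with $$\operatorname{spec}(H^{(2)})=\operatorname{spec}_{\mathrm{ac}}(H^{(2)})=\left[0,\frac{\sqrt{\pi}\,\Gamma(\lambda)}{\Gamma(\lambda+1/2)}\right]\quad\text{and}\quad\|H^{(2)}\|=\frac{\sqrt{\pi}\,\Gamma(\lambda)}{\Gamma(\lambda+1/2)}.$$
   Context: $\mathbb{N}_0=\{0,1,2,\dots\}$; $\{e_n\mid n\in\mathbb{N}_0\}$ is the standard basis of $\ell^2(\mathbb{N}_0)$; $(a)_n=a(a+1)\cdots(a+n-1)$, $(a)_0=1$. Meixner--Pollaczek polynomials ($\phi\in(0,\pi)$, $\lambda>0$): $P_n^{(\lambda)}(x;\phi)=\frac{(2\lambda)_n}{n!}e^{\mathrm{i}n\phi}\,{}_2F_1(-n,\lambda+\mathrm{i}x;2\lambda\,|\,1-e^{-2\mathrm{i}\phi})$, where ${}_2F_1(a,b;c\,|\,z)=\sum_{j\ge0}\frac{(a)_j(b)_j}{(c)_j}\frac{z^j}{j!}$. A real symmetric semi-infinite matrix $\mathcal{A}$ whose columns belong to $\ell^2(\mathbb{N}_0)$ is said to determine a unique self-adjoint operator $A$ on $\ell^2(\mathbb{N}_0)$ if $A_{\min}=A_{\max}=:A$. Here $A_{\min}$ is the closure of the operator $x\mapsto\mathcal{A}x$ (formal matrix product) with domain $\operatorname{span}\{e_n\mid n\in\mathbb{N}_0\}$, and $A_{\max}x=\mathcal{A}x$ with domain $\{x\in\ell^2(\mathbb{N}_0)\mid\mathcal{A}x\in\ell^2(\mathbb{N}_0)\}$.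 $T_h$ is the multiplication operator $T_h\psi=h\psi$ with domain $\{\psi\in L^2(\mathbb{R},d\mu)\mid h\psi\in L^2(\mathbb{R},d\mu)\}$. $\operatorname{spec}$ and $\operatorname{spec}_{\mathrm{ac}}$ denote the spectrum and the absolutely continuous spectrum. *)

(* Defs.v *)
From HB Require Import structures.
From mathcomp Require Import all_boot all_order all_algebra.
From mathcomp Require Import complex ring lra.
From mathcomp Require Import all_classical all_reals all_analysis.
From mathcomp Require Import measurable_realfun.

Set Implicit Arguments.
Unset Strict Implicit.
Unset Printing Implicit Defensive.

Import Order.TTheory GRing.Theory Num.Theory.
Import numFieldNormedType.Exports.

Local Open Scope classical_set_scope.
Local Open Scope ring_scope.
Local Open Scope complex_scope.
Local Open Scope quotient_scope.

(* The R-valued real and imaginary parts, instead of the R[i]-valued Num.Re and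
   Num.Im. *)
Notation Re := complex.Re.
Notation Im := complex.Im.

HB.mixin Record isInnerProductSpace (R : rcfType) V of GRing.Lmodule R[i] V := {
  dotp : V -> V -> R[i]; (* linear in the first argument *)
  dotp_linear : forall w, scalar (dotp^~ w);
  dotpC : forall u v, dotp u v = (dotp v u)^*;
  dotp_ge0 : forall u, 0 <= dotp u u;
  dotp_eq0 : forall u, dotp u u = 0 -> u = 0 }.

#[short(type="innerProductSpace")]
HB.structure Definition InnerProductSpace (R : rcfType) :=
  {V of isInnerProductSpace R V & GRing.Lmodule R[i] V}.


(* |z|^2 as an element of R; the library norm `|z| is an element of R[i]. *)
Definition sqrmod {R : rcfType} (z : R[i]) : R := Re z ^+ 2 + Im z ^+ 2.

Section complex_series.
Context {R : realType}.
Implicit Types (a b : nat -> R[i]) (s t z : R[i]).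

(* Complex series are summed through their real and imaginary parts. *)
Definition is_csum a s : Prop :=
  series (fun n => Re (a n)) @ \oo --> Re s /\
  series (fun n => Im (a n)) @ \oo --> Im s.

Definition csum a : R[i] :=
  limn (series (fun n => Re (a n))) +i* limn (series (fun n => Im (a n))).

Lemma is_csum_unique a s : is_csum a s -> csum a = s.
Proof.
by case: s => s1 s2 [/= h1 h2]; rewrite /csum (cvg_lim _ h1)// (cvg_lim _ h2).
Qed.

Lemma is_csumP a : cvgn (series (fun n => Re (a n))) ->
  cvgn (series (fun n => Im (a n))) -> is_csum a (csum a).
Proof. by []. Qed.

Let series_ext (f g : nat -> R) (l : R) : f =1 g ->
  series f @ \oo --> l -> series g @ \oo --> l.
Proof. by move=> /funext ->. Qed.

Lemma is_csum_lin a b s t z :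
  is_csum a s -> is_csum b t -> is_csum (fun n => z * a n + b n) (z * s + t).
Proof.
case: s t z => [s1 s2] [t1 t2] [z1 z2] [/= a1 a2] [/= b1 b2].
have aux (f g : nat -> R) l m c1 c2 : series f @ \oo --> l ->
    series g @ \oo --> m ->
    series (fun n => c1 * f n + c2 * g n) @ \oo --> c1 * l + c2 * m.
  move=> fl gm; have -> : series (fun n => c1 * f n + c2 * g n) =
      (fun n => c1 * series f n + c2 * series g n).
    apply/funext => n; rewrite /series /= big_split /=.
    by rewrite -!mulr_sumr.
  by apply: cvgD; apply: cvgMr.
split => /=.
- have := aux _ _ _ _ 1 1 (aux _ _ _ _ z1 (- z2) a1 a2) b1.
  rewrite !mul1r mulNr; apply: series_ext => n.
  by case: (a n) (b n) => [? ?] [? ?] /=; ring.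
- have := aux _ _ _ _ 1 1 (aux _ _ _ _ z2 z1 a1 a2) b2.
  rewrite !mul1r [z2 * s1 + _]addrC; apply: series_ext => n.
  by case: (a n) (b n) => [? ?] [? ?] /=; ring.
Qed.

Lemma is_csum_conj a s : is_csum a s -> is_csum (fun n => (a n)^*) s^*.
Proof.
case: s => [s1 s2] [/= a1 a2]; split => /=.
  by apply: series_ext a1 => n; case: (a n).
have : - series (fun n => Im (a n)) @ \oo --> - s2 by exact: cvgN.
rewrite -seriesN; apply: series_ext => n.
by rewrite [LHS]/GRing.opp /=; case: (a n).
Qed.

Lemma sqrmod_ge0 z : 0 <= sqrmod z.
Proof. by rewrite /sqrmod addr_ge0 ?sqr_ge0. Qed.

Lemma sqrmodM s z : sqrmod (s * z) = sqrmod s * sqrmod z.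
Proof. case: s z => [a b] [c d]; rewrite /sqrmod /=; ring. Qed.

Lemma sqrmodD s z : sqrmod (s + z) <= 2 * sqrmod s + 2 * sqrmod z.
Proof.
case: s z => [a b] [c d]; rewrite /sqrmod /= -subr_ge0.
rewrite (_ : _ - _ = (a - c) ^+ 2 + (b - d) ^+ 2); last by ring.
by rewrite addr_ge0 ?sqr_ge0.
Qed.

Lemma sqrmod_eq0 z : sqrmod z = 0 -> z = 0.
Proof.
case: z => a b /= /eqP; rewrite /sqrmod /= paddr_eq0 ?sqr_ge0//.
by rewrite !sqrf_eq0 => /andP[/eqP -> /eqP ->].
Qed.

Lemma mulcJ z : z * z^* = (sqrmod z)%:C.
Proof.
case: z => a b; rewrite /sqrmod; apply/eqP; rewrite eq_complex /=.
by apply/andP; split; apply/eqP; ring.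
Qed.

Lemma ReMJ_le s z : `|Re (s * z^*)| <= sqrmod s + sqrmod z.
Proof.
case: s z => [a b] [c d]; rewrite /sqrmod /= ler_norml.
have := (sqr_ge0 (a - c), sqr_ge0 (a + c), sqr_ge0 (b - d), sqr_ge0 (b + d)).
have := (sqr_ge0 a, sqr_ge0 b, sqr_ge0 c, sqr_ge0 d).
by move=> [[[? ?] ?] ?] [[[? ?] ?] ?]; apply/andP; split; nra.
Qed.

Lemma ImMJ_le s z : `|Im (s * z^*)| <= sqrmod s + sqrmod z.
Proof.
case: s z => [a b] [c d]; rewrite /sqrmod /= ler_norml.
have := (sqr_ge0 (a - d), sqr_ge0 (a + d), sqr_ge0 (b - c), sqr_ge0 (b + c)).
have := (sqr_ge0 a, sqr_ge0 b, sqr_ge0 c, sqr_ge0 d).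
by move=> [[[? ?] ?] ?] [[[? ?] ?] ?]; apply/andP; split; nra.
Qed.

End complex_series.

Section ell2.
Context {R : realType}.

Definition square_summable : {pred nat -> R[i]} :=
  fun u => `[< cvgn (series (fun n => sqrmod (u n))) >].

Lemma square_summable_submod : submod_closed square_summable.
Proof.
split.
  apply/asboolP; rewrite (_ : (fun n => _) = cst 0).
    by rewrite (_ : series _ = cst 0);
      [exact: is_cvg_cst|apply/funext => n; rewrite /series /= big1].
  by apply/funext => n; rewrite /sqrmod /= expr0n addr0.
move=> a u v /asboolP su /asboolP sv; apply/asboolP.
apply: (@series_le_cvg _ _ ((2 * sqrmod a) *: (fun n => sqrmod (u n)) +
   2 *: (fun n => sqrmod (v n)))) => [n|n|n|].
- exact: sqrmod_ge0.
- by rewrite !fctE addr_ge0// mulr_ge0 ?sqrmod_ge0// mulr_ge0// sqrmod_ge0.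
- by rewrite (le_trans (sqrmodD _ _))// fctE sqrmodM !fctE mulrA.
- by apply: is_cvg_seriesD; exact: is_cvg_seriesZ.
Qed.

HB.instance Definition _ := GRing.isSubmodClosed.Build R[i] (nat -> R[i])
  square_summable square_summable_submod.

Record ell2 := Ell2 { ell2_val :> nat -> R[i];
                      ell2P : ell2_val \in square_summable }.

HB.instance Definition _ := [isSub for ell2_val].
HB.instance Definition _ := [Choice of ell2 by <:].
HB.instance Definition _ := [SubChoice_isSubLmodule of ell2 by <:].

Definition ell2_dot (u v : ell2) : R[i] := csum (fun n => u n * (v n)^*).

Lemma ell2_dotP (u v : ell2) :
  is_csum (fun n => u n * (v n)^*) (ell2_dot u v).
Proof.
have su := asboolW (ell2P u); have sv := asboolW (ell2P v).
have aux (f : nat -> R) :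
    (forall n, `|f n| <= sqrmod (u n) + sqrmod (v n)) -> cvgn (series f).
  move=> fle; apply: normed_cvg.
  apply: series_le_cvg (is_cvg_seriesD su sv) => n; [exact: normr_ge0| |exact: fle].
  by rewrite fctE addr_ge0 ?sqrmod_ge0.
by apply: is_csumP; apply: aux => n; [exact: ReMJ_le|exact: ImMJ_le].
Qed.

Lemma ell2_dot_linear (w : ell2) : scalar (ell2_dot^~ w).
Proof.
move=> a u v; apply: is_csum_unique.
have := is_csum_lin a (ell2_dotP u w) (ell2_dotP v w).
by congr is_csum; apply/funext => n; rewrite mulrDl mulrA.
Qed.

Lemma ell2_dotC u v : ell2_dot u v = (ell2_dot v u)^*.
Proof.
apply: is_csum_unique; have := is_csum_conj (ell2_dotP v u).
by congr is_csum; apply/funext => n; rewrite rmorphM /= conjcK mulrC.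
Qed.

Lemma ell2_dotuu (u : ell2) :
  ell2_dot u u = (limn (series (fun n => sqrmod (u n))))%:C.
Proof.
apply: is_csum_unique; split => /=.
  rewrite (_ : (fun n => Re _) = fun n => sqrmod (u n)).
    exact: asboolW (ell2P u).
  by apply/funext => n; rewrite mulcJ.
rewrite (_ : series _ = cst 0); first exact: cvg_cst.
by apply/funext => n; rewrite /series /= big1// => i _; rewrite mulcJ.
Qed.

Let nondec (u : ell2) :
  nondecreasing_seq (series (fun n => sqrmod (u n))).
Proof. by apply: nondecreasing_series => n _ _; exact: sqrmod_ge0. Qed.

Lemma ell2_dot_ge0 u : 0 <= ell2_dot u u.
Proof.
rewrite ell2_dotuu ler0c.
have := nondecreasing_cvgn_le (nondec u) (asboolW (ell2P u)) 0%N.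
by rewrite /series /= big_geq.
Qed.

Lemma ell2_dot_eq0 u : ell2_dot u u = 0 -> u = 0.
Proof.
rewrite ell2_dotuu => -[lim0]; apply/val_inj/funext => n /=.
apply: sqrmod_eq0; apply/eqP; rewrite eq_le sqrmod_ge0 andbT -lim0.
apply: le_trans (nondecreasing_cvgn_le (nondec u) (asboolW (ell2P u)) n.+1).
by rewrite /series /= big_nat_recr//= lerDr sumr_ge0// => i _; exact: sqrmod_ge0.
Qed.

HB.instance Definition _ := isInnerProductSpace.Build R ell2
  ell2_dot_linear ell2_dotC ell2_dot_ge0 ell2_dot_eq0.

End ell2.
Arguments ell2 : clear implicits.

Section complex_integral.
Context d (T : measurableType d) (R : realType).
Variable mu : {measure set T -> \bar R}.
Implicit Types f g : T -> R[i].

Definition cintegral f : R[i] :=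
  (\int[mu]_x Re (f x)) +i* (\int[mu]_x Im (f x)).

Definition cintegrable f :=
  mu.-integrable setT (EFin \o (fun x => Re (f x))) /\
  mu.-integrable setT (EFin \o (fun x => Im (f x))).

Let int_lin (f g : T -> R) a b :
  mu.-integrable setT (EFin \o f) -> mu.-integrable setT (EFin \o g) ->
  mu.-integrable setT (EFin \o (fun x => a * f x + b * g x)) /\
  (\int[mu]_x (a * f x + b * g x) = a * \int[mu]_x f x + b * \int[mu]_x g x)%R.
Proof.
move=> fi gi.
have afi : mu.-integrable setT (EFin \o (fun x => a * f x)).
  by rewrite (_ : _ \o _ = (fun x => a%:E * (EFin \o f) x)%E)//; exact: integrableZl.
have bgi : mu.-integrable setT (EFin \o (fun x => b * g x)).
  by rewrite (_ : _ \o _ = (fun x => b%:E * (EFin \o g) x)%E)//; exact: integrableZl.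
split; first exact: (integrableD measurableT afi bgi).
by rewrite RintegralD// !RintegralZl.
Qed.

Lemma cintegral_lin f g z : cintegrable f -> cintegrable g ->
  cintegrable (fun x => z * f x + g x) /\
  cintegral (fun x => z * f x + g x) = z * cintegral f + cintegral g.
Proof.
case: z => a b [f1 f2] [g1 g2].
have [u1 u2] := int_lin a (- b) f1 f2; have [v1 v2] := int_lin b a f1 f2.
have [r1 r2] := int_lin 1 1 u1 g1; have [s1 s2] := int_lin 1 1 v1 g2.
have re : (fun x => Re ((a +i* b) * f x + g x)) =
   (fun x => 1 * (a * Re (f x) + - b * Im (f x)) + 1 * Re (g x)).
  by apply/funext => x; case: (f x) (g x) => [? ?] [? ?] /=; ring.
have im : (fun x => Im ((a +i* b) * f x + g x)) =
   (fun x => 1 * (b * Re (f x) + a * Im (f x)) + 1 * Im (g x)).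
  by apply/funext => x; case: (f x) (g x) => [? ?] [? ?] /=; ring.
split; first by split; rewrite (re, im).
rewrite /cintegral re im r2 s2 u2 v2.
by apply/eqP; rewrite eq_complex /=; apply/andP; split; apply/eqP; ring.
Qed.

Lemma cintegral_conj f : cintegrable f ->
  cintegral (fun x => (f x)^*) = (cintegral f)^*.
Proof.
move=> [_ fi]; rewrite /cintegral /=; congr (_ +i* _).
  by congr (Rintegral mu setT _); apply/funext => x; case: (f x).
rewrite (_ : (fun x => Im (f x)^*) = (fun x => (-1) * Im (f x))).
  by rewrite RintegralZl// mulN1r.
by apply/funext => x; rewrite mulN1r; case: (f x).
Qed.

Lemma ae_eq_cintegral f g : cintegrable f -> cintegrable g ->
  f = g %[ae mu] -> cintegral f = cintegral g.
Proof.
move=> [f1 f2] [g1 g2] fg; rewrite /cintegral /Rintegral.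
rewrite (@ae_eq_integral _ _ _ mu setT (EFin \o (fun x => Re (g x)))
  (EFin \o (fun x => Re (f x))))//; [|exact: measurable_int f1|exact: measurable_int g1|].
rewrite (@ae_eq_integral _ _ _ mu setT (EFin \o (fun x => Im (g x)))
  (EFin \o (fun x => Im (f x))))//; [exact: measurable_int f2|exact: measurable_int g2|].
all: by apply: filterS fg => x /= /(_ I) ->.
Qed.

End complex_integral.

Section L2.
Context d (T : measurableType d) (R : realType).
Variable mu : {measure set T -> \bar R}.

(* Measurable with \int |f|^2 dmu < +oo, through the real and imaginary parts. *)
Definition square_integrable : {pred T -> R[i]} := fun f =>
  ((fun x => Re (f x)) \in Lfun mu 2%:E) && ((fun x => Im (f x)) \in Lfun mu 2%:E).

Let Lfun_lin (f g : T -> R) a b : f \in Lfun mu 2%:E -> g \in Lfun mu 2%:E ->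
  (fun x => a * f x + b * g x) \in Lfun mu 2%:E.
Proof.
have [h0 hlin] := Lfun_submod_closed mu (lee1n 2).
move=> fL gL; have bg := hlin b g 0 gL h0.
rewrite (_ : (fun x => _) = a *: f + (b *: g + 0)); first exact: hlin.
by apply/funext => x; rewrite !fctE addr0.
Qed.

Lemma square_integrable_submod : submod_closed square_integrable.
Proof.
split.
  have [h0 _] := Lfun_submod_closed mu (lee1n 2).
  by apply/andP.
move=> [a b] f g /andP[f1 f2] /andP[g1 g2]; apply/andP; split.
  rewrite (_ : (fun x => _) =
    fun x => 1 * (a * Re (f x) + - b * Im (f x)) + 1 * Re (g x)).
    by apply: Lfun_lin => //; exact: Lfun_lin.
  apply/funext => x; rewrite !fctE.
  by case: (f x) (g x) => [? ?] [? ?] /=; ring.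
rewrite (_ : (fun x => _) =
  fun x => 1 * (b * Re (f x) + a * Im (f x)) + 1 * Im (g x)).
  by apply: Lfun_lin => //; exact: Lfun_lin.
apply/funext => x; rewrite !fctE.
by case: (f x) (g x) => [? ?] [? ?] /=; ring.
Qed.

HB.instance Definition _ := GRing.isSubmodClosed.Build R[i] (T -> R[i])
  square_integrable square_integrable_submod.

Record L2fun := MkL2fun { L2fun_val :> T -> R[i];
                          L2funP : L2fun_val \in square_integrable }.

HB.instance Definition _ := [isSub for L2fun_val].
HB.instance Definition _ := [Choice of L2fun by <:].
HB.instance Definition _ := [SubChoice_isSubLmodule of L2fun by <:].

Definition ae_null : {pred L2fun} := fun f => `[< {ae mu, forall x, f x = 0} >].

Lemma ae_null_zmod : zmod_closed ae_null.
Proof.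
split; first by apply/asboolP; exact: aeW.
move=> f g /asboolP f0 /asboolP g0; apply/asboolP.
by apply: filterS2 f0 g0 => x f0 g0 /=; rewrite !fctE f0 g0 subrr.
Qed.

HB.instance Definition _ := GRing.isZmodClosed.Build L2fun ae_null ae_null_zmod.

Definition L2 := Quotient.quot ae_null.
HB.instance Definition _ := GRing.Zmodule.on L2.
HB.instance Definition _ := EqQuotient.on L2.

(* An element of L2 is used as a function through a chosen representative of
   its class; only its values up to a null set are meaningful. *)
Definition L2_fun (p : L2) : T -> R[i] := repr p.
Coercion L2_fun : L2 >-> Funclass.

Lemma L2P (p q : L2) : {ae mu, forall x, p x = q x} -> p = q.
Proof.
move=> pq; rewrite -[p]reprK -[q]reprK; apply/eqP.
rewrite -Quotient.idealrBE; apply/asboolP.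
by apply: filterS pq => x /= pq; rewrite !fctE [X in X - _]pq subrr.
Qed.

Lemma L2_piE (f : L2fun) : {ae mu, forall x, (\pi_L2 f : L2) x = f x}.
Proof.
have : repr (\pi_L2 f : L2) == f %[mod L2] by rewrite reprK.
rewrite -Quotient.idealrBE => /asboolP; apply: filterS => x /=.
by rewrite !fctE => /eqP; rewrite subr_eq0 => /eqP.
Qed.

Lemma L2_addE (p q : L2) : {ae mu, forall x, (p + q : L2) x = p x + q x}.
Proof.
have -> : p + q = \pi_L2 (repr p + repr q) by rewrite raddfD /= !reprK.
exact: L2_piE.
Qed.

Definition L2_scale (a : R[i]) (p : L2) : L2 := \pi_L2 (a *: repr p).

Lemma L2_scaleE a p : {ae mu, forall x, L2_scale a p x = a * p x}.
Proof. exact: L2_piE. Qed.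

Lemma L2_scaleA a b p : L2_scale a (L2_scale b p) = L2_scale (a * b) p.
Proof.
apply: L2P; have := L2_scaleE (a * b) p; have := L2_scaleE b p.
by apply: filterS3 (L2_scaleE a (L2_scale b p)) => x -> -> ->; rewrite mulrA.
Qed.

Lemma L2_scale1 : left_id 1 L2_scale.
Proof.
by move=> p; apply: L2P; apply: filterS (L2_scaleE 1 p) => x ->; rewrite mul1r.
Qed.

Lemma L2_scaleDr : right_distributive L2_scale +%R.
Proof.
move=> a p q; apply: L2P.
have h1 := L2_scaleE a p; have h2 := L2_scaleE a q.
have h3 := L2_addE (L2_scale a p) (L2_scale a q).
have h4 := L2_scaleE a (p + q); have h5 := L2_addE p q.
near=> x; rewrite (near h3 x)// (near h4 x)// (near h5 x)// (near h1 x)//.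
by rewrite (near h2 x)// mulrDr.
Unshelve. all: by end_near. Qed.

Lemma L2_scaleDl p : {morph L2_scale^~ p : a b / a + b}.
Proof.
move=> a b; apply: L2P.
have h1 := L2_scaleE a p; have h2 := L2_scaleE b p.
have h3 := L2_addE (L2_scale a p) (L2_scale b p).
have h4 := L2_scaleE (a + b) p.
near=> x; rewrite (near h3 x)// (near h4 x)// (near h1 x)// (near h2 x)//.
by rewrite mulrDl.
Unshelve. all: by end_near. Qed.

HB.instance Definition _ := GRing.Zmodule_isLmodule.Build R[i] L2
  L2_scaleA L2_scale1 L2_scaleDr L2_scaleDl.

Definition L2_dot (p q : L2) : R[i] := cintegral mu (fun x => p x * (q x)^*).

Lemma L2_dot_integrable (p q : L2) :
  cintegrable mu (fun x => p x * (q x)^*).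
Proof.
have /andP[p1 p2] := L2funP (repr p); have /andP[q1 q2] := L2funP (repr q).
have aux (f g : T -> R) : f \in Lfun mu 2%:E -> g \in Lfun mu 2%:E ->
    mu.-integrable setT (EFin \o (fun x => f x * g x)).
  by move=> fL gL; apply/Lfun1_integrable/Lfun2_mul_Lfun1.
split.
  have h := integrableD measurableT (aux _ _ p1 q1) (aux _ _ p2 q2).
  apply: eq_integrable h => // x _ /=; rewrite /L2_fun -EFinD; congr EFin.
  by case: (repr p x) (repr q x) => [? ?] [? ?] /=; ring.
have h := integrableB measurableT (aux _ _ p2 q1) (aux _ _ p1 q2).
apply: eq_integrable h => // x _ /=; rewrite /L2_fun -EFinB; congr EFin.
by case: (repr p x) (repr q x) => [? ?] [? ?] /=; ring.
Qed.

Lemma L2_dot_linear (w : L2) : scalar (L2_dot^~ w).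
Proof.
move=> a p q.
have [h1 h2] := cintegral_lin a (L2_dot_integrable p w) (L2_dot_integrable q w).
rewrite -[RHS]h2; apply: ae_eq_cintegral => //; first exact: L2_dot_integrable.
apply: filterS2 (L2_addE (a *: p) q) (L2_scaleE a p) => x /= e1 e2 _.
by rewrite e1 e2 mulrDl mulrA.
Qed.

Lemma L2_dotC p q : L2_dot p q = (L2_dot q p)^*.
Proof.
rewrite -cintegral_conj; last exact: L2_dot_integrable.
congr cintegral; apply/funext => x.
by rewrite rmorphM /= conjcK mulrC.
Qed.

Lemma L2_dotpp p : L2_dot p p = (\int[mu]_x sqrmod (p x))%:C.
Proof.
rewrite /L2_dot /cintegral; congr (_ +i* _).
  by congr (Rintegral mu setT _); apply/funext => x; rewrite mulcJ.
rewrite -[RHS](mul0r (fine (mu setT))) -(Rintegral_cst _ measurableT).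
by congr (Rintegral mu setT _); apply/funext => x; rewrite mulcJ.
Qed.

Lemma L2_dot_ge0 p : 0 <= L2_dot p p.
Proof.
by rewrite L2_dotpp ler0c Rintegral_ge0// => x _; exact: sqrmod_ge0.
Qed.

Lemma L2_dot_eq0 p : L2_dot p p = 0 -> p = 0.
Proof.
have [iR _] := L2_dot_integrable p p.
have {}iR : mu.-integrable setT (EFin \o (fun x => sqrmod (p x))).
  by apply: eq_integrable iR => // x _ /=; rewrite mulcJ.
rewrite L2_dotpp => -[int0]; apply: L2P.
have h0 : {ae mu, forall x, (0 : L2) x = 0}.
  have -> : (0 : L2) = \pi_L2 0 by rewrite raddf0.
  exact: L2_piE.
have : ae_eq mu setT (EFin \o (fun x => sqrmod (p x))) (cst 0%E).
  apply/(ae_eq_integral_abs mu measurableT (measurable_int mu iR)).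
  under eq_integral do rewrite /= ger0_norm ?sqrmod_ge0//.
  rewrite -[LHS]fineK; last exact: integrable_fin_num iR.
  by congr EFin.
apply: filterS2 h0 => x -> /(_ I) [sq0].
exact: sqrmod_eq0.
Qed.

HB.instance Definition _ := isInnerProductSpace.Build R L2
  L2_dot_linear L2_dotC L2_dot_ge0 L2_dot_eq0.

End L2.


(* A (possibly unbounded, partially defined) operator on V is its graph. *)
Section operators.
Context {R : realType} {V : innerProductSpace R}.
Implicit Types (A : set (V * V)) (W : set V).

Definition hnorm (u : V) : R := Num.sqrt (Re (dotp u u)).

Definition op_dom A : set V := [set x | exists y, A (x, y)].

Definition op_closure A : set (V * V) :=
  [set p | forall e, 0 < e ->
    exists2 q, A q & hnorm (p.1 - q.1) < e /\ hnorm (p.2 - q.2) < e].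

Definition dense_in_norm W : Prop :=
  forall x e, 0 < e -> exists2 y, W y & hnorm (x - y) < e.

(* The adjoint, provided that the domain of A is dense. *)
Definition op_adjoint A : set (V * V) :=
  [set p | forall q, A q -> dotp q.2 p.1 = dotp q.1 p.2].

Definition self_adjoint A : Prop := dense_in_norm (op_dom A) /\ op_adjoint A = A.

Definition op_bounded A : Prop :=
  op_dom A = setT /\ exists K, forall p, A p -> hnorm p.2 <= K * hnorm p.1.

Definition op_norm A : R :=
  sup [set hnorm p.2 | p in [set p | A p /\ hnorm p.1 <= 1]].

(* Resolvent set and spectrum of A viewed as an operator on the subspace W
   (A being contained in W * W): z is in the resolvent set if A - z is a
   bijection from the domain of A onto W with bounded inverse. *)
Definition resolvent_set_on W A : set R[i] :=
  [set z | (forall w, W w -> exists! x, A (x, w + z *: x)) /\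
           (exists K, forall x w, W w -> A (x, w + z *: x) ->
              hnorm x <= K * hnorm w)].

Definition spectrum_on W A : set R[i] := ~` resolvent_set_on W A.

Definition spectrum A : set R[i] := spectrum_on setT A.

(* E is the projection-valued spectral measure of the self-adjoint operator A
   and m x is the scalar measure B |-> <E(B) x, x>, so that A = \int t dE(t);
   sigma-additivity of E is carried by the type of m. *)
Definition is_spectral_measure A (E : set (measurableTypeR R) -> V -> V)
    (m : V -> {measure set (measurableTypeR R) -> \bar R}) : Prop :=
  [/\ forall B x, measurable B -> E B (E B x) = E B x,
      forall B x y, measurable B -> dotp (E B x) y = dotp x (E B y),
      forall x, E setT x = x,
      forall B x, measurable B -> m x B = (Re (dotp (E B x) x))%:E &
      (forall x, op_dom A x <-> (\int[m x]_t ((t : R) ^+ 2)%:E < +oo)%E) /\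
      (forall x y, A (x, y) -> dotp y x = (\int[m x]_t (t : R))%:C)].

Definition ac_subspace A : set V :=
  [set x | exists E m, is_spectral_measure A E m /\ m x `<< @lebesgue_measure R].

(* The spectrum of the part of A in its absolutely continuous subspace. *)
Definition spectrum_ac A : set R[i] :=
  spectrum_on (ac_subspace A)
    [set p | [/\ A p, ac_subspace A p.1 & ac_subspace A p.2]].

Definition orthonormal_basis (phi : nat -> V) : Prop :=
  (forall m n, dotp (phi m) (phi n) = (m == n)%:R) /\
  dense_in_norm [set x | exists N (c : nat -> R[i]),
    x = \sum_(i < N) c i *: phi i].

End operators.

Section unitary.
Context {R : realType} {V W : innerProductSpace R}.

Definition unitary (U : V -> W) : Prop :=
  [/\ linear U, forall x y, dotp (U x) (U y) = dotp x y &
      forall w, exists x, U x = w].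

(* The graph of U A U^-1. *)
Definition op_conj (U : V -> W) (A : set (V * V)) : set (W * W) :=
  [set (U p.1, U p.2) | p in A].

End unitary.

Section matrix_operators.
Context {R : realType}.
Implicit Types A : nat -> nat -> R.

Lemma ell2_delta_subproof n :
  (fun k => (k == n)%:R : R[i]) \in @square_summable R.
Proof.
apply/asboolP/cvg_ex; exists (1 : R); apply: cvg_near_cst.
exists n.+1 => // k /= nk; rewrite /series /= (big_cat_nat (n := n.+1))//=.
rewrite big_nat_recr//= eqxx big_nat_cond big1 => [|i /andP[/andP[_ ilt] _]].
  rewrite big_nat_cond big1 => [|i /andP[/andP[nlt _] _]].
    by rewrite /sqrmod /= expr1n expr0n /= add0r !addr0.
  by rewrite gtn_eqF// /sqrmod /= expr0n addr0.
by rewrite ltn_eqF// /sqrmod /= expr0n addr0.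
Qed.

Definition ell2_basis n : ell2 R := Ell2 (ell2_delta_subproof n).

(* The operators determined by the formal matrix product: (x, A x) with maximal
   domain, and the closure of its restriction to span {e_n}. *)
Definition op_max A : set (ell2 R * ell2 R) :=
  [set p : ell2 R * ell2 R | forall m, is_csum (fun n => (A m n)%:C * p.1 n) (p.2 m)].

Definition op_min A : set (ell2 R * ell2 R) :=
  op_closure [set p | op_max A p /\
    exists N (c : nat -> R[i]), p.1 = \sum_(i < N) c i *: ell2_basis i].

(* A is symmetric with columns in ell2, and A_min = A_max =: H. *)
Definition determines_operator A (H : set (ell2 R * ell2 R)) : Prop :=
  [/\ forall m n, A m n = A n m,
      forall n, (fun m => (A m n)%:C) \in square_summable,
      op_min A = op_max A & H = op_max A].

End matrix_operators.

(* The domain condition h * psi \in L2 is implied by p.2 being in L2. *)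
Definition mul_op d (T : measurableType d) (R : realType)
    (mu : {measure set T -> \bar R}) (h : T -> R) : set (L2 mu * L2 mu) :=
  [set p : L2 mu * L2 mu | {ae mu, forall x, p.2 x = (h x)%:C * p.1 x}].
Arguments mul_op {d T R} mu h.

Section parametric_integral.
Context d1 d2 (T1 : measurableType d1) (T2 : measurableType d2) (R : realType).
Variable m2 : {sigma_finite_measure set T2 -> \bar R}.

Lemma measurable_Rintegral_param (D : set T2) (f : T1 * T2 -> R) :
  measurable D -> measurable_fun setT f ->
  measurable_fun setT (fun x => \int[m2]_(t in D) f (x, t))%R.
Proof.
move=> mD mf.
pose g (p : T1 * T2) : \bar R := (f p * \1_D p.2)%:E.
have mg : measurable_fun setT g.
  apply/measurable_EFinP; apply: measurable_funM => //.
  by apply: (measurableT_comp (measurable_indic mD)).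
have E : (fun x => \int[m2]_(t in D) f (x, t))%R =
  (fun x => fine (fubini_F m2 g^\+ x - fubini_F m2 g^\- x)%E).
  apply/funext => x; rewrite Rintegral_mkcond /Rintegral.
  rewrite (_ : (fun t => _) = (fun t => g (x, t))).
    rewrite integralE /fubini_F; congr (fine (_ - _)%E).
      by apply: eq_integral => t _; rewrite funepos_comp.
    by apply: eq_integral => t _; rewrite funeneg_comp.
  apply/funext => t; rewrite /g /= patchE indicE.
  by case: (t \in D); rewrite ?mulr1 ?mulr0.
rewrite E; apply: (measurableT_comp (fine_measurable measurableT)).
apply: emeasurable_funB; apply: measurable_fun_fubini_tonelli_F => //.
- exact: measurable_funepos.
- exact: measurable_funeneg.
Qed.

End parametric_integral.

Section special_functions.
Context {R : realType}.
Implicit Types (s t x lambda phi : R) (a b c z : R[i]).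

(* Euler's integral of the second kind, meaningful for s > 0. *)
Definition Gamma s : R :=
  (\int[lebesgue_measure]_(t in `]0%R, +oo[) (t `^ (s - 1) * expR (- t)))%R.

(* Euler's integral for Re z > 0, with
   t^(z-1) = t^(Re z - 1) (cos (Im z * ln t) + i sin (Im z * ln t)). *)
Definition cGamma z : R[i] :=
  (\int[lebesgue_measure]_(t in `]0%R, +oo[)
     (t `^ (Re z - 1) * expR (- t) * cos (Im z * ln t)))%R +i*
  (\int[lebesgue_measure]_(t in `]0%R, +oo[)
     (t `^ (Re z - 1) * expR (- t) * sin (Im z * ln t)))%R.

Definition pochhammer a n : R[i] := \prod_(k < n) (a + k%:R).

Definition hyp2F1 a b c z : R[i] :=
  csum (fun j => pochhammer a j * pochhammer b j / pochhammer c j *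
                 (z ^+ j / j`!%:R)).

Definition cexpi t : R[i] := cos t +i* sin t.

Definition meixner_pollaczek lambda phi n x : R[i] :=
  pochhammer (2 * lambda)%:C n / n`!%:R * cexpi (n%:R * phi) *
  hyp2F1 (- n%:R) (lambda +i* x) (2 * lambda)%:C (1 - cexpi (- 2 * phi)).

Definition MP_normalized lambda n x : R[i] :=
  (Num.sqrt (Gamma (2 * lambda) * n`!%:R / Gamma (n%:R + 2 * lambda)))%:C *
  meixner_pollaczek lambda (pi / 2) n x.

Definition MP_density lambda x : R :=
  2 `^ (2 * lambda - 1) / (pi * Gamma (2 * lambda)) *
  sqrmod (cGamma (lambda +i* x)).

Definition MP_symbol lambda x : R :=
  2 `^ (2 * lambda - 1) / Gamma (2 * lambda) * sqrmod (cGamma (lambda +i* x)).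

Definition matrix_H2 lambda (m n : nat) : R :=
  if odd (m + n)%N then 0 else
    (-1) ^+ (m * (m - 1) %/ 2 + n * (n - 1) %/ 2)%N *
    Num.sqrt (Gamma (m%:R + 2 * lambda) * Gamma (n%:R + 2 * lambda) /
              (m`!%:R * n`!%:R)) *
    (Gamma ((m + n + 1)%N%:R / 2) / Gamma (2 * lambda + (m + n + 1)%N%:R / 2)).

Lemma Gamma_ge0 s : 0 <= Gamma s.
Proof. by apply: Rintegral_ge0 => t _; rewrite mulr_ge0 ?powR_ge0 ?expR_ge0. Qed.

Lemma MP_density_ge0 lambda x : 0 <= MP_density lambda x.
Proof.
rewrite mulr_ge0 ?sqrmod_ge0// divr_ge0 ?powR_ge0// mulr_ge0 ?pi_ge0//.
exact: Gamma_ge0.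
Qed.

Let kernel_measurable lambda (f : R -> R) : continuous f ->
  measurable_fun setT (fun x : measurableTypeR R =>
    \int[lebesgue_measure]_(t in `]0%R, +oo[)
      (t `^ (lambda - 1) * expR (- t) * f (x * ln t)))%R.
Proof.
move=> cf; apply: (@measurable_Rintegral_param _ _ (measurableTypeR R)
  (measurableTypeR R) R lebesgue_measure _
  (fun p => p.2 `^ (lambda - 1) * expR (- p.2) * f (p.1 * ln p.2))) => //.
apply: measurable_funM; first apply: measurable_funM.
- by apply: (measurableT_comp (measurable_powR (lambda - 1))).
- by apply: measurableT_comp => //; exact: measurableT_comp.
- apply: measurableT_comp; first exact: continuous_measurable_fun.
  by apply: measurable_funM => //; apply: (measurableT_comp (@measurable_ln R)).
Qed.

Lemma measurable_MP_density lambda :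
  measurable_fun (setT : set (measurableTypeR R)) (MP_density lambda).
Proof.
apply: measurable_funM => //; apply: measurable_funD; apply: measurable_funX.
- exact: (kernel_measurable lambda (@continuous_cos R)).
- exact: (kernel_measurable lambda (@continuous_sin R)).
Qed.

Definition MP_measure lambda (B : set (measurableTypeR R)) : \bar R :=
  (\int[lebesgue_measure]_(x in B) (MP_density lambda x)%:E)%E.

Let MP_measure0 lambda : MP_measure lambda set0 = 0%E.
Proof. exact: integral_set0. Qed.

Let MP_measure_ge0 lambda B : (0 <= MP_measure lambda B)%E.
Proof. by apply: integral_ge0 => x _; rewrite lee_fin MP_density_ge0. Qed.

Let MP_measure_sigma_additive lambda : semi_sigma_additive (MP_measure lambda).
Proof.
apply: semi_sigma_additive_nng_induced => [|x].
  by apply/measurable_EFinP; exact: measurable_MP_density.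
by rewrite lee_fin MP_density_ge0.
Qed.

HB.instance Definition _ lambda := isMeasure.Build _ _ _ (MP_measure lambda)
  (MP_measure0 lambda) (@MP_measure_ge0 lambda)
  (@MP_measure_sigma_additive lambda).

Definition measure_support (mu : {measure set (measurableTypeR R) -> \bar R}) :
    set R :=
  [set x | forall B : set R, open B -> B x -> (0 < mu B)%E].

End special_functions.

(* Main.v *)
From HB Require Import structures.
Require Import Defs.
From mathcomp Require Import all_boot all_order all_algebra.
From mathcomp Require Import complex ring lra.
From mathcomp Require Import all_classical all_reals all_analysis.
From mathcomp Require Import measurable_realfun.

Set Implicit Arguments.
Unset Strict Implicit.
Unset Printing Implicit Defensive.

Import Order.TTheory GRing.Theory Num.Theory.
Import numFieldNormedType.Exports.

Local Open Scope classical_set_scope.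
Local Open Scope ring_scope.
Local Open Scope complex_scope.

(** Everything rests on one substitution.  With t = e^p Euler's integral reads
Gamma(s + ix) = int exp(sp - e^p) e^(ixp) dp, so that x |-> Gamma(s + ix) is the
Fourier transform of the rapidly decreasing function [gamma_fun s].  Since
(lam + ix)_j Gamma(lam + ix) = Gamma(lam + j + ix), the product of the n-th
polynomial with Gamma(lam + ix) is, up to a constant, the transform of a linear
combination [lag n] of the functions [gamma_fun (lam + j)], j <= n (a Laguerre
function in the variable e^p), and |Gamma(lam + ix)|^2 is the transform of the
autocorrelation of [gamma_fun lam], which is Gamma(2 lam) e^(lam y) / (1 + e^y)^(2 lam)
([convol_gamma_fun]).  Parseval's identity turns integrals against mu into
integrals over p:

- orthonormality becomes the evaluation of int lag_m lag_n, a finite difference of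
  order n of a polynomial of degree at most m ([Rint_lag]);
- the coefficient of h P_n along P_m becomes the integral of
  (e^y / (1 + e^y)^2)^(2 lam) tanh(y/2)^(m + n) up to a constant ([Rint_beta_lag]).
  It depends on m + n only, vanishes when m + n is odd, and satisfies a two-term
  recursion whose initial value comes from the duplication formula
  ([tanh_moment_rec], [tanh_moment_even]).  This gives exactly the matrix
  ([MP_matrix_entry]).

Completeness.  The even moments of |Gamma(lam + ix)|^2 are at most
C q^n (2n)!, so mu has an exponential moment ([exp_moment_MP]), and then the
polynomials are dense in L^2(mu) ([poly_approx_all]): the bounded functions which
multiply the closure of the polynomials into itself form an algebra closed under
bounded pointwise limits; it contains x |-> sin (s (x - a)) for small s by Taylor
expansion, hence the indicators of half-lines, hence those of all Borel sets.
With the Riesz-Fischer theorem the coefficient map is the unitary U.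

The operator.  Its m-th column lists the coefficients of h P_m, so by Parseval
the maximal operator is U^-1 T_h U ([op_maxP]).  As h is bounded, that operator is
everywhere defined and bounded, and approximating vectors by finite ones shows
that the minimal operator is the same ([op_min_max]).

The spectrum.  The function h is continuous, tends to 0 at infinity and attains
its maximum at 0, and mu charges every open set; indicators of the sets on
which h is close to c are approximate eigenvectors for each c in [0, h 0], and
outside that segment 1 / (h - z) is bounded.  The extremal property
at 0, and more precisely the monotonicity of |Gamma(s + ix)|^2 in |x|, follows by
iterating |Gamma(s + 1 + ix)|^2 = (s^2 + x^2) |Gamma(s + ix)|^2 up to large s, where
|Gamma(s + n + ix)| / Gamma(s + n) tends to 1 ([sq_tr_gamma_homo]).  Applied at
s + 1 it says that (s^2 + x^2) |Gamma(s + ix)|^2 decreases in |x| as well, so h decreases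
at a definite rate away from 0 and infinity ([MP_symbol_expansive]).
Consequently h^-1 of a null set is null, the spectral measures (images under h of
|U x|^2 mu) are absolutely continuous, and the absolutely continuous spectrum is
the whole spectrum. *)

(** * Integrals over the line *)

Section line_integrals.
Context {R : realType}.
Implicit Types (f g : R -> R) (a b c d x y : R).

Notation leb := (@lebesgue_measure R).
Definition integrable_line f := leb.-integrable setT (EFin \o f).

Lemma measurable_continuous f : continuous f -> measurable_fun setT f.
Proof. exact: continuous_measurable_fun. Qed.

Lemma integrable_line_le f g : measurable_fun setT f ->
  (forall x, `|f x| <= g x) -> integrable_line g -> integrable_line f.
Proof.
move=> mf fg ig; apply: le_integrable ig => //; first exact/measurable_EFinP.
by move=> x _; rewrite lee_fin (le_trans (fg x))// ler_norm.
Qed.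

Lemma integrable_lineD f g : integrable_line f -> integrable_line g ->
  integrable_line (fun x => f x + g x).
Proof. by move=> hf hg; exact: (integrableD measurableT hf hg). Qed.

Lemma integrable_lineB f g : integrable_line f -> integrable_line g ->
  integrable_line (fun x => f x - g x).
Proof. by move=> hf hg; exact: (integrableB measurableT hf hg). Qed.

Lemma integrable_lineZ c f : integrable_line f ->
  integrable_line (fun x => c * f x).
Proof.
move=> hf; rewrite /integrable_line.
rewrite (_ : _ \o _ = (fun x => c%:E * (EFin \o f) x)%E)//.
exact: integrableZl.
Qed.

Lemma integrable_line_measurable f : integrable_line f -> measurable_fun setT f.
Proof. by move=> /measurable_int/measurable_EFinP. Qed.

Lemma integrable_line_abs f : integrable_line f -> integrable_line (fun x => `|f x|).
Proof. by move=> hf; exact: (integrable_abse hf). Qed.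

Lemma integrable_lineM f g K : integrable_line f -> measurable_fun setT g ->
  (forall x, `|g x| <= K) -> integrable_line (fun x => f x * g x).
Proof.
move=> hf mg gK; apply: (@integrable_line_le _ (fun x => K * `|f x|)).
- by apply: measurable_funM => //; exact: integrable_line_measurable.
- by move=> x; rewrite normrM mulrC ler_wpM2r.
- exact/integrable_lineZ/integrable_line_abs.
Qed.

Lemma eq_Rint f g : f =1 g -> \int[leb]_x f x = \int[leb]_x g x.
Proof. by move=> fg; apply: eq_Rintegral => x _; exact: fg. Qed.

Lemma RintD f g : integrable_line f -> integrable_line g ->
  \int[leb]_x (f x + g x) = \int[leb]_x f x + \int[leb]_x g x.
Proof. by move=> hf hg; rewrite RintegralD. Qed.

Lemma RintB f g : integrable_line f -> integrable_line g ->
  \int[leb]_x (f x - g x) = \int[leb]_x f x - \int[leb]_x g x.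
Proof. by move=> hf hg; rewrite RintegralB. Qed.

Lemma RintZ c f : integrable_line f ->
  \int[leb]_x (c * f x) = c * \int[leb]_x f x.
Proof. by move=> hf; rewrite RintegralZl. Qed.

Lemma Rint_sum n (F : nat -> R -> R) : (forall i, (i < n)%N -> integrable_line (F i)) ->
  integrable_line (fun x => \sum_(i < n) F i x) /\
  \int[leb]_x (\sum_(i < n) F i x) = \sum_(i < n) \int[leb]_x F i x.
Proof.
elim: n => [|n ih] hF.
  split.
    rewrite (_ : (fun x => _) = cst 0); first exact: integrable0.
    by apply/funext => x; rewrite big_ord0.
  rewrite big_ord0 (@eq_Rint _ (cst 0)); last by move=> x; rewrite big_ord0.
  by rewrite Rintegral_cst//= mul0r.
have [i1 i2] := ih (fun i hi => hF i (ltnW hi)).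
have E x : \sum_(i < n.+1) F i x = \sum_(i < n) F i x + F n x by rewrite big_ord_recr.
split.
  by under [X in integrable_line X]funext do rewrite E; apply: integrable_lineD => //; exact: hF.
by rewrite (eq_Rint E) RintD// ?i2 ?big_ord_recr//; exact: hF.
Qed.

Lemma Rint_ge0 f : (forall x, 0 <= f x) -> 0 <= \int[leb]_x f x.
Proof. by move=> f0; apply: Rintegral_ge0. Qed.

Lemma le_Rint f g : integrable_line f -> integrable_line g ->
  (forall x, f x <= g x) -> \int[leb]_x f x <= \int[leb]_x g x.
Proof. by move=> hf hg fg; apply: le_Rintegral. Qed.

Lemma EFin_Rint f : integrable_line f ->
  (\int[leb]_x (f x)%:E)%E = (\int[leb]_x f x)%:E.
Proof. by move=> hf; rewrite /Rintegral fineK//; exact: integrable_fin_num hf. Qed.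

Lemma Rint_gt0 f : integrable_line f -> (forall x, 0 < f x) ->
  0 < \int[leb]_x f x.
Proof.
move=> hf f0; rewrite lt_neqAle Rint_ge0 ?andbT; last by move=> x; exact: ltW.
apply/eqP => I0.
have : ae_eq leb setT (EFin \o f) (cst 0%E).
  apply/(ae_eq_integral_abs leb measurableT (measurable_int leb hf)).
  under eq_integral do rewrite /= ger0_norm ?(ltW (f0 _))//.
  by rewrite EFin_Rint// -I0.
move=> [N [mN N0 sN]].
have : (setT : set R) `<=` N.
  by move=> x _; apply: sN => /= /(_ I) [fx0]; have := f0 x; rewrite fx0 ltxx.
rewrite subTset => NT; move: N0; rewrite NT.
by have := @lebesgue_measure_itv R `]-oo, +oo[; rewrite set_itvE /= => ->.
Qed.

Lemma Rint_le_norm f g : integrable_line f -> integrable_line g ->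
  (forall x, `|f x| <= g x) -> `|\int[leb]_x f x| <= \int[leb]_x g x.
Proof.
move=> hf hg fg; apply: (le_trans (le_normr_Rintegral _ hf)) => //.
by apply: le_Rint => //; exact: integrable_line_abs.
Qed.

Lemma lebesgue_affine c d (A : set R) : 0 < c -> measurable A ->
  (c%:E * leb ((fun x => c * x + d)%R @^-1` A) = leb A)%E.
Proof.
move=> c0 mA.
pose phi := (fun x : R => c * x + d : measurableTypeR R).
have mphi : measurable_fun setT phi.
  apply: continuous_measurable_fun => x.
  by apply: cvgD; [apply: cvgMr; exact: cvg_id|exact: cvg_cst].
have E (B : set R) : (mscale (NngNum (ltW c0)) (pushforward leb phi) B =
    c%:E * leb (phi @^-1` B))%E by [].
rewrite -[LHS]E; apply/esym; apply: lebesgue_measure_unique => // _ [[a b]] _ <-.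
transitivity (c%:E * leb (phi @^-1` `]a, b]))%E; last by [].
have -> : phi @^-1` `]a, b] = `](a - d) / c, (b - d) / c]%classic.
  apply/seteqP; split => x /=; rewrite !in_itv/= /phi ltr_pdivrMr// ler_pdivlMr//;
    by rewrite ltrBlDr lerBrDr [x * c]mulrC.
rewrite !lebesgue_measure_itv/= !lte_fin ltr_pM2r ?invr_gt0// ltrD2r.
case: ifP => _; last by rewrite mule0.
by rewrite -!EFinB -EFinM -mulrBl mulrC divfK ?gt_eqF//; congr EFin; ring.
Qed.

Lemma ge0_integral_affine c d f : 0 < c -> measurable_fun setT f ->
  (forall x, 0 <= f x) ->
  (\int[leb]_x (f x)%:E = c%:E * \int[leb]_x (f (c * x + d))%:E)%E.
Proof.
move=> c0 mf f0.
pose phi := (fun x : R => c * x + d : measurableTypeR R).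
have mphi : measurable_fun setT phi.
  apply: continuous_measurable_fun => x.
  by apply: cvgD; [apply: cvgMr; exact: cvg_id|exact: cvg_cst].
rewrite (@eq_measure_integral _ _ _ setT (mscale (NngNum (ltW c0)) (pushforward leb phi))); last first.
  by move=> A mA _; rewrite /= -(lebesgue_affine d c0 mA).
rewrite ge0_integral_mscale//=; last 2 first.
- exact/measurable_EFinP.
- by move=> x _; rewrite lee_fin.
by rewrite ge0_integral_pushforward//=; [exact/measurable_EFinP|move=> x _; rewrite lee_fin].
Unshelve. all: exact: mphi.
Qed.

(** Splits f into |f| + f and |f| - f: a substitution rule known for nonnegative integrands
    extends to integrable ones.  Used for affine maps and for the reflection. *)
Lemma change_of_variable_line (phi : R -> R) c : 0 < c ->
  measurable_fun setT phi ->
  (forall g, measurable_fun setT g -> (forall x, 0 <= g x) ->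
    (\int[leb]_x (g x)%:E = c%:E * \int[leb]_x (g (phi x))%:E)%E) ->
  forall f, integrable_line f -> integrable_line (fun x => f (phi x)) /\
    \int[leb]_x f (phi x) = c^-1 * \int[leb]_x f x.
Proof.
move=> c0 mphi ge0.
have ip f : integrable_line f -> integrable_line (fun x => f (phi x)).
  move=> hf; have mf := integrable_line_measurable hf.
  apply/integrableP; split; first by apply/measurable_EFinP; apply: measurableT_comp.
  have /integrableP[_] := hf.
  rewrite (_ : (fun x => `|(EFin \o f) x|%E) = (fun x => `|f x|%:E))//.
  rewrite (ge0 (fun x => `|f x|))//; last exact: measurableT_comp.
  move=> h; rewrite ltNge; apply/negP; rewrite leye_eq => /eqP e; move: h.
  have {}e : (\int[leb]_x `|f (phi x)%R|%:E)%E = +oo%E := e.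
  by rewrite e gt0_muley// lte_fin.
move=> f hf; have hfa := ip _ hf; split=> //.
have {}ge0 g : integrable_line g -> (forall x, 0 <= g x) ->
    \int[leb]_x g (phi x) = c^-1 * \int[leb]_x g x.
  move=> hg g0.
  have := ge0 g (integrable_line_measurable hg) g0.
  rewrite EFin_Rint// EFin_Rint; last exact: ip.
  by move=> [->]; rewrite mulrA mulVf ?mul1r// gt_eqF.
pose p x := (`|f x| + f x); pose n x := (`|f x| - f x).
have ha := integrable_line_abs hf.
have hp : integrable_line p by exact: integrable_lineD.
have hn : integrable_line n by exact: integrable_lineB.
have p0 x : 0 <= p x by rewrite /p -lerBlDr sub0r -normrN ler_norm.
have n0 x : 0 <= n x by rewrite /n subr_ge0 ler_norm.
have E g : integrable_line (fun x => `|g x| + g x) -> integrable_line (fun x => `|g x| - g x) ->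
    \int[leb]_x g x = 2^-1 * (\int[leb]_x (`|g x| + g x) - \int[leb]_x (`|g x| - g x)).
  move=> h1 h2; rewrite -RintB// -RintZ; last exact: integrable_lineB.
  by apply: eq_Rint => x; rewrite -[LHS](mulKf (x := 2))// ; congr (_ * _); ring.
rewrite (E (fun x => f (phi x))); last 2 first.
- exact: (ip _ hp).
- exact: (ip _ hn).
by rewrite (E f)// (ge0 p)// (ge0 n)//; ring.
Qed.

Lemma integrable_affine c d f : 0 < c -> integrable_line f ->
  integrable_line (fun x => f (c * x + d)) /\
  \int[leb]_x f (c * x + d) = c^-1 * \int[leb]_x f x.
Proof.
move=> c0; apply: change_of_variable_line => //.
  apply: continuous_measurable_fun => x.
  by apply: cvgD; [apply: cvgMr; exact: cvg_id|exact: cvg_cst].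
by move=> g mg g0; exact: ge0_integral_affine.
Qed.

Lemma integrable_shift d f : integrable_line f ->
  integrable_line (fun x => f (x + d)) /\ \int[leb]_x f (x + d) = \int[leb]_x f x.
Proof.
move=> hf; have [] := integrable_affine d ltr01 hf.
rewrite invr1 mul1r (_ : (fun x => f (1 * x + d)) = (fun x => f (x + d)))//.
by apply/funext => x; rewrite mul1r.
Qed.

Lemma integrable_reflect f : integrable_line f ->
  integrable_line (fun x => f (- x)) /\ \int[leb]_x f (- x) = \int[leb]_x f x.
Proof.
have mN : measurable_fun setT (-%R : R -> measurableTypeR R).
  by apply: continuous_measurable_fun; exact: opp_continuous.
move=> hf; rewrite -[RHS]mul1r -[X in X * _]invr1.
apply: change_of_variable_line => // g mg g0; rewrite mul1e.
rewrite (@eq_measure_integral _ _ _ setT (pushforward leb (-%R : R -> measurableTypeR R))); last first.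
  by move=> A mA _; apply/esym/lebesgue_measureN.
by rewrite ge0_integral_pushforward//=; [exact/measurable_EFinP|move=> x _; rewrite lee_fin].
Unshelve. all: exact: mN.
Qed.

Lemma Rint_odd f : integrable_line f -> (forall x, f (- x) = - f x) ->
  \int[leb]_x f x = 0.
Proof.
move=> hf fo; have [_] := integrable_reflect hf.
rewrite (@eq_Rint _ (fun x => -1 * f x)); last by move=> x; rewrite fo mulN1r.
rewrite RintZ// mulN1r => /eqP; rewrite eq_sym -subr_eq0 opprK -mulr2n mulrn_eq0 /=.
by move/eqP.
Qed.

Lemma nat_cvgy (F : R -> R) (l : R) : F x @[x --> +oo] --> l ->
  (fun n : nat => F n%:R) @ \oo --> l.
Proof. by move=> h; apply: cvg_comp h; exact: cvgr_idn. Qed.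

Lemma FTC_half_line f F (l : R) : continuous f -> (forall x, is_derive x 1 F (f x)) ->
  F x @[x --> +oo] --> l -> leb.-integrable `[0, +oo[ (EFin \o f) ->
  \int[leb]_(x in `[0, +oo[) f x = l - F 0.
Proof.
move=> cf dF Fl hf.
have cF : continuous F.
  by move=> x; apply: differentiable_continuous; apply/derivable1_diffP; have [] := dF x.
have e n : (0 < n)%N -> (\int[leb]_(x in `[0%R, n%:R]) (f x)%:E = (F n%:R - F 0)%:E)%E.
  move=> n0; rewrite (@continuous_FTC2 _ f F)//.
  - by rewrite ltr0n.
  - exact: continuous_subspaceT.
  - split; first by move=> x _; have [] := dF x.
    + by apply: cvg_at_right_filter; exact: cF.
    + by apply: cvg_at_left_filter; exact: cF.
  - by move=> x _; rewrite derive1E; have [_ ->] := dF x.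
have c1 : (\int[leb]_(x in `[0%R, n%:R]) (f x)%:E)%E @[n --> \oo] --> (l - F 0)%:E.
  have h : (F n%:R - F 0)%:E @[n --> \oo] --> (l - F 0)%:E.
    by apply: cvg_EFin; [exact: nearW|apply: cvgB; [exact: nat_cvgy|exact: cvg_cst]].
  apply: cvg_trans h; apply: near_eq_cvg; near=> n; rewrite e//.
  by near: n; exists 1%N.
have E n : (\int[leb]_(x in `[0%R, n%:R]) (f x)%:E =
    \int[leb]_(x in `[0%R, +oo[) ((f x * \1_(`[0%R, n%:R]) x)%:E))%E.
  rewrite integral_mkcond [RHS]integral_mkcond; apply: eq_integral => x _ /=.
  rewrite !patchE !indicE !mem_setE !in_itv /= andbT.
  case: (leP 0 x) => x0 /=; last by [].
  by case: ifP => h; rewrite ?mulr1 ?mulr0.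
have c2 : (\int[leb]_(x in `[0%R, n%:R]) (f x)%:E)%E @[n --> \oo] -->
    (\int[leb]_(x in `[0%R, +oo[) (f x)%:E)%E.
  rewrite (_ : (fun n : nat => _) = (fun n : nat =>
     \int[leb]_(x in `[0%R, +oo[) ((f x * \1_(`[0%R, n%:R]) x)%:E))%E); last exact/funext.
  apply: (@dominated_cvg _ _ _ leb _ _ _ _ (fun x => `|f x|%:E)) => //.
  - move=> n; apply/measurable_EFinP; apply: measurable_funM.
      by apply: measurable_funTS; exact: measurable_continuous.
    by apply: measurable_funTS; exact: measurable_indic.
  - move=> x /=; rewrite in_itv /= andbT => x0.
    apply: cvg_near_cst; near=> n; rewrite indicE mem_setE in_itv /= x0 /=.
    have -> : x <= n%:R; last by rewrite mulr1.
    near: n; exact: nbhs_infty_ger.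
  - exact: (integrable_abse hf).
  - move=> n x _; rewrite lee_fin normrM ler_piMr//.
    by rewrite indicE; case: (_ \in _); rewrite ?normr1 ?normr0.
rewrite /Rintegral; have := cvg_unique _ c1 c2 => <- //.
Unshelve. all: by end_near. Qed.

Lemma integrable_line_on D f : measurable D -> integrable_line f ->
  leb.-integrable D (EFin \o f).
Proof. by move=> mD; apply: integrableS. Qed.

Lemma Rint_split f : integrable_line f -> \int[leb]_x f x =
  \int[leb]_(x in `[0, +oo[) f x + \int[leb]_(x in `[0, +oo[) f (- x).
Proof.
move=> hf.
have [hr _] := integrable_reflect hf.
pose g x := f x * \1_(`[0, +oo[) x; pose h x := f x * \1_(`]-oo, 0[) x.
have ind (D : set R) : forall x, `|\1_D x| <= 1 :> R.
  by move=> x; rewrite indicE; case: (_ \in _); rewrite ?normr1 ?normr0.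
have hg : integrable_line g.
  by apply: (@integrable_lineM _ _ 1) => //; exact: measurable_indic.
have hh : integrable_line h.
  by apply: (@integrable_lineM _ _ 1) => //; exact: measurable_indic.
rewrite (@eq_Rint _ (fun x => g x + h x)); last first.
  move=> x; rewrite /g /h !indicE !mem_setE !in_itv /= andbT.
  by case: (leP 0 x); rewrite ?mulr1 ?mulr0 ?addr0 ?add0r.
rewrite RintD//; congr (_ + _).
  rewrite [RHS]Rintegral_mkcond; apply: eq_Rint => x.
  by rewrite patchE /g indicE; case: (_ \in _); rewrite ?mulr1 ?mulr0.
rewrite -Rintegral_itv_obnd_cbnd; last first.
  exact: integrable_line_on.
have [_ <-] := integrable_reflect hh.
rewrite [RHS]Rintegral_mkcond; apply: eq_Rint => x.
rewrite patchE /h indicE !mem_setE !in_itv /= oppr_lt0 andbT.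
by case: (0 < x); rewrite ?mulr1 ?mulr0.
Qed.

(** The half-line x < 0 is handled through x |-> F (- x), so that only limits at +oo are
    involved. *)
Lemma FTC_line f F (l1 l2 : R) : continuous f -> (forall x, is_derive x 1 F (f x)) ->
  F x @[x --> +oo] --> l1 -> F (- x) @[x --> +oo] --> l2 -> integrable_line f ->
  \int[leb]_x f x = l1 - l2.
Proof.
move=> cf dF F1 F2 hf; rewrite Rint_split//.
rewrite (FTC_half_line cf dF F1); last exact: integrable_line_on.
have dG x : is_derive x 1 (fun x => - F (- x)) (f (- x)).
  have dN : is_derive x 1 (-%R : R -> R) (-1) by exact: is_deriveN.
  have h := is_derive1_comp (dF (- x)) dN.
  by apply: is_derive_eq (is_deriveN h) _; rewrite /GRing.scale/= mulrN1 opprK.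
have cg : continuous (fun x => f (- x)).
  by move=> x; apply: continuous_comp; [exact: opp_continuous|exact: cf].
have hi : leb.-integrable `[0, +oo[ (EFin \o (fun x => f (- x))).
  by apply: integrable_line_on => //; have [] := integrable_reflect hf.
rewrite (FTC_half_line cg dG (cvgN F2) hi) oppr0; ring.
Qed.

Lemma is_derive_chain f g x df dg : is_derive (g x) 1 f df -> is_derive x 1 g dg ->
  is_derive x 1 (fun t => f (g t)) (df * dg).
Proof. by move=> hf hg; exact: is_derive1_comp. Qed.

Lemma is_derive_scale c x : is_derive x 1 (fun t : R => c * t) c.
Proof.
apply: is_derive_eq (is_deriveZ c (is_derive_id x 1)) _.
by rewrite -[LHS]/(c * 1) mulr1.
Qed.

Lemma is_derive_expRM c x : is_derive x 1 (fun t : R => expR (c * t)) (c * expR (c * x)).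
Proof.
by rewrite mulrC; exact: (is_derive_chain (is_derive_expR _) (is_derive_scale _ _)).
Qed.

Lemma continuous_of_derive F f : (forall x, is_derive x 1 F (f x)) -> continuous F.
Proof.
by move=> dF x; apply: differentiable_continuous; apply/derivable1_diffP; have [] := dF x.
Qed.

Lemma cvg_expRNM c : 0 < c -> expR (- (c * x)) @[x --> +oo] --> (0 : R).
Proof.
move=> c0; have h : (c * x) @[x --> +oo] --> +oo by apply: gt0_cvgMry => //; exact: cvg_id.
exact: cvg_comp h (@cvgr_expR R).
Qed.

Lemma integrable_expRN c : 0 < c -> integrable_line (fun x => expR (- (c * `|x|))).
Proof.
move=> c0.
have ce : continuous (fun x : R => expR (- (c * x))).
  under [X in continuous X]funext do rewrite -mulNr.
  by apply: continuous_of_derive => x; exact: is_derive_expRM.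
have ca : continuous (fun x : R => expR (- (c * `|x|))).
  by move=> x; apply: (@continuous_comp _ _ _ (fun t : R => `|t|) (fun t => expR (- (c * t)))); [exact: norm_continuous|exact: ce].
apply/integrableP; split; first by apply/measurable_EFinP; exact: measurable_continuous.
rewrite (_ : (fun x => _) = (fun x => (expR (- (c * `|x|)))%:E)); last first.
  by apply/funext => x /=; rewrite ger0_norm// expR_ge0.
rewrite ge0_symfun_integralT//; last by move=> x /=; rewrite normrN.
rewrite -set_itvcy.
have -> : (\int[leb]_(x in `[0%R, +oo[) (expR (- (c * `|x|)))%:E =
    \int[leb]_(x in `[0%R, +oo[) (expR (- (c * x)))%:E)%E.
  by apply: eq_integral => x; rewrite inE /= in_itv /= andbT => x0; rewrite ger0_norm.
rewrite (@ge0_continuous_FTC2y _ _ (fun x => - c^-1 * expR (- c * x)) 0 0).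
- by rewrite -EFinB -EFinM ltry.
- by move=> x _; exact: expR_ge0.
- exact: continuous_subspaceT.
- rewrite -[X in _ --> X](mulr0 (- c^-1)); apply: cvgMr.
  by under eq_fun do rewrite mulNr; exact: cvg_expRNM.
- move=> x _; have h := is_derive_expRM (- c) x.
  by apply: derivableZ; case: h.
- apply: cvg_at_right_filter; apply: cvgMr.
  by apply: (@continuous_of_derive (fun x => expR (- c * x))) => x; exact: is_derive_expRM.
- move=> x _; rewrite derive1E; have h := is_derive_expRM (- c) x.
  have [_ ->] := is_deriveZ (- c^-1) h.
  transitivity (- c^-1 * (- c * expR (- c * x))); first by [].
  by rewrite mulrA mulrNN mulVf ?gt_eqF// mul1r mulNr.
Qed.

(** The class in which all Fourier analysis below takes place.  It contains the kernels of the
    Gamma and beta integrals, and it is stable under sums, shifts, bounded continuous factors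
    and correlation ([exp_decay_convol]); integrals of its members converge absolutely, which
    justifies the exchanges of integrals. *)
Definition exp_decay f : Prop :=
  continuous f /\ exists C c : R, 0 < c /\ forall x, `|f x| <= C * expR (- (c * `|x|)).

Lemma decay_cst_ge0 f C c : (forall x, `|f x| <= C * expR (- (c * `|x|))) -> 0 <= C.
Proof.
by move=> /(_ 0); rewrite normr0 mulr0 oppr0 expR0 mulr1; apply: le_trans; exact: normr_ge0.
Qed.

Lemma exp_decay_integrable f : exp_decay f -> integrable_line f.
Proof.
move=> [cf [C [c [c0 fC]]]]; apply: integrable_line_le fC _; first exact: measurable_continuous.
exact/integrable_lineZ/integrable_expRN.
Qed.

Lemma exp_decay_cvg f : exp_decay f ->
  f x @[x --> +oo] --> (0 : R) /\ f (- x) @[x --> +oo] --> (0 : R).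
Proof.
move=> [cf [C [c [c0 fC]]]].
have h : (C * expR (- (c * x))) @[x --> +oo] --> (0 : R).
  by rewrite -[X in _ --> X](mulr0 C); apply: cvgMr; exact: cvg_expRNM.
have aux (g : R -> R) : (forall x, 0 <= x -> `|g x| <= C * expR (- (c * x))) ->
    g x @[x --> +oo] --> (0 : R).
  move=> gC; apply/norm_cvg0P; apply: (squeeze_cvgr _ (cvg_cst 0) h).
  near=> x; rewrite normr_ge0 /=; apply: gC; near: x; exact: nbhs_pinfty_ge.
split; apply: aux => x x0; first by have := fC x; rewrite (ger0_norm x0).
by have := fC (- x); rewrite normrN (ger0_norm x0).
Unshelve. all: by end_near. Qed.

Lemma exp_decayD f g : exp_decay f -> exp_decay g -> exp_decay (fun x => f x + g x).
Proof.
move=> [cf [C [c [c0 fC]]]] [cg [D [d [d0 gD]]]]; split.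
  by move=> x; apply: cvgD; [exact: cf|exact: cg].
have C0 := decay_cst_ge0 fC.
have D0 := decay_cst_ge0 gD.
exists (C + D), (Num.min c d); split; first by rewrite lt_min c0.
move=> x; apply: (le_trans (ler_normD _ _)); rewrite mulrDl; apply: lerD.
- apply: (le_trans (fC x)); apply: ler_wpM2l => //; rewrite ler_expR lerN2.
  by apply: ler_wpM2r => //; rewrite ge_min lexx.
- apply: (le_trans (gD x)); apply: ler_wpM2l => //; rewrite ler_expR lerN2.
  by apply: ler_wpM2r => //; rewrite ge_min lexx orbT.
Qed.

Lemma exp_decayM f g K : exp_decay f -> continuous g -> (forall x, `|g x| <= K) ->
  exp_decay (fun x => f x * g x).
Proof.
move=> [cf [C [c [c0 fC]]]] cg gK; split.
  by move=> x; apply: cvgM; [exact: cf|exact: cg].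
exists (C * K), c; split=> // x; rewrite normrM mulrAC.
by apply: ler_pM => //; exact: fC.
Qed.

Lemma exp_decayZ f c : exp_decay f -> exp_decay (fun x => c * f x).
Proof.
move=> hf; under [X in exp_decay X]funext do rewrite mulrC.
by apply: (@exp_decayM _ (cst c) `|c|) => //; exact: cst_continuous.
Qed.

Lemma exp_decay_sum n (F : nat -> R -> R) : (forall i, (i < n)%N -> exp_decay (F i)) ->
  exp_decay (fun x => \sum_(i < n) F i x).
Proof.
elim: n => [|n ih] hF.
  under [X in exp_decay X]funext do rewrite big_ord0.
  split; first exact: cst_continuous.
  by exists 0, 1; split => // x; rewrite normr0 mul0r.
under [X in exp_decay X]funext do rewrite big_ord_recr /=.
by apply: exp_decayD; [apply: ih => i hi; apply: hF; exact: ltnW|exact: hF].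
Qed.

Lemma exp_decay_bounded f : exp_decay f -> exists K : R, 0 < K /\ forall x, `|f x| <= K.
Proof.
move=> [cf [C [c [c0 fC]]]]; exists (C + 1).
have C0 := decay_cst_ge0 fC.
split; first exact: ltr_wpDl.
move=> x; apply: (le_trans (fC x)); apply: (@le_trans _ _ C); last by rewrite lerDl.
by rewrite ler_piMr// -expR0 ler_expR oppr_le0 mulr_ge0// ltW.
Qed.

Lemma exp_decay_shift f a : exp_decay f -> exp_decay (fun x => f (x + a)).
Proof.
move=> [cf [C [c [c0 fC]]]]; split.
  move=> x; apply: (@continuous_comp _ _ _ (fun x => x + a) f); last exact: cf.
  by apply: cvgD; [exact: cvg_id|exact: cvg_cst].
have C0 := decay_cst_ge0 fC.
exists (C * expR (c * `|a|)), c; split => // x.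
apply: (le_trans (fC _)); rewrite -mulrA -expRD; apply: ler_wpM2l => //.
rewrite ler_expR -mulrN -mulrN -mulrDr; apply: ler_wpM2l; first exact: ltW.
rewrite lerNl opprD opprK addrC lerBlDr.
by rewrite -[X in `|X| <= _](addrK a); apply: ler_normB.
Qed.

Lemma is_derive_sinM y x : is_derive x 1 (fun t : R => sin (y * t)) (y * cos (y * x)).
Proof.
by rewrite mulrC; exact: (is_derive_chain (is_derive_sin _) (is_derive_scale _ _)).
Qed.

Lemma is_derive_cosM y x : is_derive x 1 (fun t : R => cos (y * t)) (- (y * sin (y * x))).
Proof.
by rewrite mulrC -mulNr; exact: (is_derive_chain (is_derive_cos _) (is_derive_scale _ _)).
Qed.

(** The transform of the regularising factor exp(- e |x|): the Poisson kernel, which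
    concentrates at 0 as e tends to 0. *)
Lemma abel_kernel e y : 0 < e ->
  \int[leb]_x (expR (- (e * `|x|)) * cos (y * x)) = 2 * (e / (e ^+ 2 + y ^+ 2)).
Proof.
move=> e0.
have cc : continuous (fun x : R => cos (y * x)).
  by apply: continuous_of_derive => x; exact: is_derive_cosM.
have ce : continuous (fun x : R => expR (- e * x)).
  by apply: continuous_of_derive => x; exact: is_derive_expRM.
have hi : integrable_line (fun x => expR (- (e * `|x|)) * cos (y * x)).
  apply: (@integrable_lineM _ _ 1); first exact: integrable_expRN.
    exact: measurable_continuous.
  by move=> x; rewrite ler_norml cos_geN1 cos_le1.
have D0 : e ^+ 2 + y ^+ 2 != 0 by rewrite gt_eqF// ltr_pwDl ?exprn_gt0 ?sqr_ge0.
pose f x := expR (- e * x) * cos (y * x).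
(* F is the real part of the primitive e^((iy - e) x) / (iy - e) *)
pose F x := (e ^+ 2 + y ^+ 2)^-1 * (expR (- e * x) * (y * sin (y * x) - e * cos (y * x))).
have dF x : is_derive x 1 F (f x).
  have h1 := is_derive_expRM (- e) x.
  have h2 := is_deriveB (is_deriveZ y (is_derive_sinM y x)) (is_deriveZ e (is_derive_cosM y x)).
  apply: is_derive_eq (is_deriveZ _ (is_deriveM h1 h2)) _.
  transitivity ((e ^+ 2 + y ^+ 2)^-1 * (expR (- e * x) * (y * (y * cos (y * x)) -
      e * - (y * sin (y * x))) + (y * sin (y * x) - e * cos (y * x)) *
      (- e * expR (- e * x)))); first by [].
  by rewrite /f; field.
have half : \int[leb]_(x in `[0, +oo[) f x = e / (e ^+ 2 + y ^+ 2).
  rewrite (@FTC_half_line f F 0).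
  - by rewrite /F !mulr0 sin0 cos0 !mulr0 expR0 mulr1; field.
  - by move=> x; apply: cvgM; [exact: ce|exact: cc].
  - pose K := `|y| + e.
    have h : ((e ^+ 2 + y ^+ 2)^-1 * (expR (- (e * x)) * K)) @[x --> +oo] --> (0 : R).
      rewrite -[X in _ --> X](mulr0 (e ^+ 2 + y ^+ 2)^-1); apply: cvgMr.
      by rewrite -[X in _ --> X](mul0r K); apply: cvgMl; exact: cvg_expRNM.
    apply/norm_cvg0P; apply: (squeeze_cvgr _ (cvg_cst 0) h).
    near=> x; rewrite normr_ge0 /= /F !normrM (ger0_norm (expR_ge0 _)) mulNr.
    rewrite ger0_norm ?invr_ge0 ?addr_ge0 ?sqr_ge0//.
    apply: ler_wpM2l; first by rewrite invr_ge0 ?addr_ge0 ?sqr_ge0.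
    apply: ler_wpM2l; first exact: expR_ge0.
    apply: (le_trans (ler_normB _ _)); rewrite !normrM (gtr0_norm e0).
    by apply: lerD; rewrite ler_piMr// ?(ltW e0)// ler_norml ?sin_geN1 ?sin_le1 ?cos_geN1 ?cos_le1.
  - have := integrable_line_on (D := `[0, +oo[%classic) _ hi; rewrite /= => /(_ (measurable_itv _)).
    apply: eq_integrable => // x; rewrite inE /= in_itv /= andbT => x0.
    by rewrite /f ger0_norm// mulNr.
rewrite Rint_split//.
have -> : \int[leb]_(x in `[0, +oo[) (expR (- (e * `|- x|)) * cos (y * - x)) = e / (e ^+ 2 + y ^+ 2).
  rewrite -half; apply: eq_Rintegral => x; rewrite inE /= in_itv /= andbT => x0.
  by rewrite normrN mulrN cosN ger0_norm// /f mulNr.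
have -> : \int[leb]_(x in `[0, +oo[) (expR (- (e * `|x|)) * cos (y * x)) = e / (e ^+ 2 + y ^+ 2).
  rewrite -half; apply: eq_Rintegral => x; rewrite inE /= in_itv /= andbT => x0.
  by rewrite ger0_norm// /f mulNr.
by rewrite mulr2n mulrDl !mul1r.
Unshelve. all: by end_near. Qed.

Lemma continuous_lorentz : continuous (fun x : R => (1 + x ^+ 2)^-1).
Proof. exact: continuous_oneDsqrV. Qed.

Lemma lorentz_gt0 x : 0 < (1 + x ^+ 2)^-1.
Proof. by rewrite invr_gt0 ltr_pwDl ?sqr_ge0. Qed.

Lemma integrable_lorentz : integrable_line (fun x => (1 + x ^+ 2)^-1).
Proof.
apply/integrableP; split.
  by apply/measurable_EFinP; apply: measurable_continuous; exact: continuous_lorentz.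
rewrite (_ : (fun x => _) = (fun x => ((1 + x ^+ 2)^-1)%:E)); last first.
  by apply/funext => x /=; rewrite ger0_norm// ltW// lorentz_gt0.
rewrite ge0_symfun_integralT//; last 3 first.
- by move=> x; rewrite ltW// lorentz_gt0.
- exact: continuous_lorentz.
- by move=> x /=; rewrite sqrrN.
rewrite -set_itvcy.
rewrite (@ge0_continuous_FTC2y _ _ atan 0 (pi / 2)).
- by rewrite -EFinB -EFinM ltry.
- by move=> x _; rewrite ltW// lorentz_gt0.
- by apply: continuous_subspaceT; exact: continuous_lorentz.
- exact: cvgy_atan.
- by move=> x _; case: (is_derive1_atan x).
- by apply: cvg_at_right_filter; exact: continuous_atan.
- by move=> x _; rewrite derive1E derive_val.
Qed.

Lemma Rint_lorentz : \int[leb]_x (1 + x ^+ 2)^-1 = pi.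
Proof.
rewrite (FTC_line continuous_lorentz (@is_derive1_atan R) (@cvgy_atan R) (l2 := - (pi / 2))).
- by field.
- by under eq_fun do rewrite atanN; apply: cvgN; exact: (@cvgy_atan R).
- exact: integrable_lorentz.
Qed.

End line_integrals.

(** * Fourier transforms and Parseval's identity *)

Section fourier.
Context {R : realType}.
Implicit Types (f g k : R -> R) (a b c d x y : R).
Notation leb := (@lebesgue_measure R).

Lemma dominated_line (fn : nat -> R -> R) f g :
  (forall n, measurable_fun setT (fn n)) -> measurable_fun setT f ->
  (forall x, fn n x @[n --> \oo] --> f x) -> integrable_line g ->
  (forall n x, `|fn n x| <= g x) ->
  integrable_line f /\ (fun n => \int[leb]_x fn n x) @ \oo --> \int[leb]_x f x.
Proof.
move=> mfn mf fnf hg fg.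
have [|||||i1 _ i2] := @dominated_convergence _ _ _ leb setT measurableT
    (fun n => EFin \o fn n) (EFin \o f) (EFin \o g).
- by move=> n; apply/measurable_EFinP; exact: mfn.
- by apply/measurable_EFinP; exact: mf.
- by apply: aeW => x _; apply: cvg_EFin; [exact: nearW|exact: fnf].
- exact: hg.
- by apply: aeW => x n _; rewrite lee_fin.
split; first exact: i1.
have {}i2 : (fun n => \int[leb]_x (fn n x)%:E)%E @ \oo --> (\int[leb]_x f x)%:E.
  by rewrite -EFin_Rint.
exact: (fine_cvg i2).
Qed.

(** Phrased with an integrable bound b of the inner integrals, so that only integrals over the
    line have to be checked. *)
Lemma Fubini_line (F : R -> R -> R) (b : R -> R) :
  measurable_fun setT (fun z : R * R => F z.1 z.2) ->
  (forall x, integrable_line (F x)) ->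
  (forall y, integrable_line (F ^~ y)) ->
  (forall x, \int[leb]_y `|F x y| <= b x) -> integrable_line b ->
  [/\ integrable_line (fun x => \int[leb]_y F x y),
      integrable_line (fun y => \int[leb]_x F x y) &
      \int[leb]_x \int[leb]_y F x y = \int[leb]_y \int[leb]_x F x y].
Proof.
move=> mF i1 i2 Fb hb.
pose G (z : R * R) := (F z.1 z.2)%:E.
have mG : measurable_fun setT G by exact/measurable_EFinP.
have iG : (leb \x leb)%E.-integrable setT G.
  apply/integrable12ltyP => //.
  have e x : (\int[leb]_y `|G (x, y)| = (\int[leb]_y `|F x y|)%:E)%E.
    by rewrite -EFin_Rint//; exact: integrable_line_abs.
  under eq_integral do rewrite e.
  have mb : measurable_fun setT (fun x => \int[leb]_y `|F x y|).
    apply: (@measurable_Rintegral_param _ _ (measurableTypeR R) (measurableTypeR R) R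
      leb setT (fun z => `|F z.1 z.2|)) => //.
    exact: measurableT_comp mF.
  have : integrable_line (fun x => \int[leb]_y `|F x y|).
    apply: integrable_line_le hb => // x; rewrite ger0_norm ?Fb//.
    exact: Rint_ge0.
  move=> /integrableP[_]; apply: le_lt_trans; apply: ge0_le_integral => //.
  - by move=> x _; rewrite lee_fin; exact: Rint_ge0.
  - exact/measurable_EFinP.
  - by apply: measurableT_comp => //; exact/measurable_EFinP.
  - by move=> x _; rewrite lee_fin ler_norm.
have eF x : fubini_F leb G x = (\int[leb]_y F x y)%:E by rewrite /fubini_F -EFin_Rint.
have eG y : fubini_G leb G y = (\int[leb]_x F x y)%:E by rewrite /fubini_G -EFin_Rint//; exact: i2.
have hF := integrable_fubini_F iG.
have {hF} hF : integrable_line (fun x => \int[leb]_y F x y).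
  by apply: eq_integrable hF => // x _; exact: (eF x).
have hG : integrable_line (fun y => \int[leb]_x F x y).
  have sw : measurable_fun setT (fun z : R * R => F z.2 z.1).
    have -> : (fun z : R * R => F z.2 z.1) =
      (fun z : R * R => F z.1 z.2) \o (fun z => (z.2, z.1)) by [].
    by apply: measurableT_comp => //; exact: measurable_swap.
  apply/integrableP; split.
    apply/measurable_EFinP.
    exact: (@measurable_Rintegral_param _ _ (measurableTypeR R) (measurableTypeR R) R
      leb setT (fun z => F z.2 z.1)).
  have h21 := (integrable21ltyP leb leb mG).1 iG.
  apply: le_lt_trans h21.
  apply: ge0_le_integral => //.
  - apply: measurableT_comp => //; apply/measurable_EFinP.
    exact: (@measurable_Rintegral_param _ _ (measurableTypeR R) (measurableTypeR R) R
      leb setT (fun z => F z.2 z.1)).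
  - under eq_fun do under eq_integral do rewrite /G /=.
    apply: eq_measurable_fun (_ : measurable_fun _ (fun y => (\int[leb]_x `|F x y|)%:E)) => [y _|].
      by rewrite -EFin_Rint//; exact: integrable_line_abs.
    apply/measurable_EFinP.
    apply: (@measurable_Rintegral_param _ _ (measurableTypeR R) (measurableTypeR R) R
      leb setT (fun z => `|F z.2 z.1|)) => //.
    exact: measurableT_comp sw.
  - move=> y _.
    have -> : (\int[leb]_x `|G (x, y)| = (\int[leb]_x `|F x y|)%:E)%E.
      by rewrite -EFin_Rint//; exact: integrable_line_abs.
    rewrite /= lee_fin; apply: Rint_le_norm => //.
    exact: integrable_line_abs.
have e1 : (\int[leb]_x \int[leb]_y G (x, y) = \int[leb]_x (\int[leb]_y F x y)%:E)%E.
  by apply: eq_integral => x _; exact: eF.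
have e2 : (\int[leb]_y \int[leb]_x G (x, y) = \int[leb]_y (\int[leb]_x F x y)%:E)%E.
  by apply: eq_integral => y _; exact: eG.
split=> //; apply: EFin_inj; rewrite -(EFin_Rint hF) -(EFin_Rint hG) -e1 -e2.
exact: (Fubini iG).
Qed.

Lemma Rint_lin a b f g : integrable_line f -> integrable_line g ->
  \int[leb]_x (a * f x + b * g x) = a * \int[leb]_x f x + b * \int[leb]_x g x.
Proof. by move=> hf hg; rewrite RintD ?RintZ//; exact: integrable_lineZ. Qed.

(** A correlation rather than a convolution, because its transform is the product of the
    transform of f by the conjugate of the transform of g. *)
Definition convol f g y := \int[leb]_q (f (q + y) * g q).
(** Real and imaginary parts of the Fourier transform int f(p) e^(ixp) dp of a real function are
    kept apart, since the integral theory is real. *)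
Definition cos_tr f x := \int[leb]_p (f p * cos (x * p)).
Definition sin_tr f x := \int[leb]_p (f p * sin (x * p)).

Lemma norm_cos_le1 x : `|cos x| <= 1.
Proof. by rewrite ler_norml cos_geN1 cos_le1. Qed.

Lemma norm_sin_le1 x : `|sin x| <= 1.
Proof. by rewrite ler_norml sin_geN1 sin_le1. Qed.

Lemma continuous_cosM x : continuous (fun p : R => cos (x * p)).
Proof. by apply: continuous_of_derive => p; exact: is_derive_cosM. Qed.

Lemma continuous_sinM x : continuous (fun p : R => sin (x * p)).
Proof. by apply: continuous_of_derive => p; exact: is_derive_sinM. Qed.

Lemma exp_decay_cos f x : exp_decay f -> exp_decay (fun p => f p * cos (x * p)).
Proof.
by move=> hf; apply: (@exp_decayM _ _ _ 1) => //;
  [exact: continuous_cosM|move=> p; exact: norm_cos_le1].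
Qed.

Lemma exp_decay_sin f x : exp_decay f -> exp_decay (fun p => f p * sin (x * p)).
Proof.
by move=> hf; apply: (@exp_decayM _ _ _ 1) => //;
  [exact: continuous_sinM|move=> p; exact: norm_sin_le1].
Qed.

Lemma measurable_fun_tr (phi : R -> R) f : continuous phi -> measurable_fun setT f ->
  measurable_fun setT (fun x => \int[leb]_p (f p * phi (x * p))).
Proof.
move=> cphi mf.
apply: (@measurable_Rintegral_param _ _ (measurableTypeR R) (measurableTypeR R) R
  leb setT (fun z => f z.2 * phi (z.1 * z.2))) => //.
apply: measurable_funM; first by apply: measurableT_comp mf _; exact: measurable_snd.
apply: measurableT_comp; first exact: continuous_measurable_fun.
by apply: measurable_funM; [exact: measurable_fst|exact: measurable_snd].
Qed.

(** All four facts come from Fubini's theorem.  The last one, integration of a correlation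
    against a bounded function, yields the transforms of correlations as well as their
    integrability. *)
Lemma convol_props f g : exp_decay f -> exp_decay g ->
  [/\ continuous (convol f g), integrable_line (convol f g),
      exists K : R, forall y, `|convol f g y| <= K &
      forall phi K, continuous phi -> (forall x, `|phi x| <= K) ->
      \int[leb]_y (convol f g y * phi y) =
      \int[leb]_q (g q * \int[leb]_p (f p * phi (p - q)))].
Proof.
move=> hf hg.
have [Kf [Kf0 fK]] := exp_decay_bounded hf.
have ig := exp_decay_integrable hg; have jf := exp_decay_integrable hf.
have [cf _] := hf; have [cg _] := hg.
have mf := measurable_continuous cf; have mg := measurable_continuous cg.
have is1 y : integrable_line (fun q => f (q + y)) by have [] := integrable_shift y jf.
have hM y : integrable_line (fun q => f (q + y) * g q).
  under [X in integrable_line X]funext do rewrite mulrC.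
  by apply: (@integrable_lineM _ _ _ Kf) => //; exact: integrable_line_measurable (is1 y).
(* pairing with phi = 1 gives integrability, pairing with a general phi the last clause *)
have test phi K : continuous phi -> (forall x, `|phi x| <= K) ->
    integrable_line (fun y => \int[leb]_q (g q * f (q + y) * phi y)) /\
    \int[leb]_y \int[leb]_q (g q * f (q + y) * phi y) =
    \int[leb]_q (g q * \int[leb]_p (f p * phi (p - q))).
  move=> cphi phiK.
  have mphi := measurable_continuous cphi.
  have i1 q : integrable_line (fun y => g q * f (q + y) * phi y).
    apply: (@integrable_lineM _ _ _ K) => //; apply: integrable_lineZ.
    by under [X in integrable_line X]funext do rewrite addrC; exact: is1.
  have [|||||h1 h2 h3] := @Fubini_line (fun q y => g q * f (q + y) * phi y)
      (fun q => `|g q| * (K * \int[leb]_p `|f p|)).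
  - apply: measurable_funM; last by apply: measurableT_comp mphi _; exact: measurable_snd.
    apply: measurable_funM; first by apply: measurableT_comp mg _; exact: measurable_fst.
    apply: measurableT_comp mf _; apply: measurable_funD; [exact: measurable_fst|exact: measurable_snd].
  - exact: i1.
  - move=> y; under [X in integrable_line X]funext do rewrite mulrC [g _ * _]mulrC.
    exact: integrable_lineZ.
  - move=> q.
    have -> : `|g q| * (K * \int[leb]_p `|f p|) = \int[leb]_y (`|g q| * (K * `|f (y + q)|)).
      have [i2 e2] := integrable_shift q (integrable_line_abs jf).
      by rewrite RintZ ?RintZ ?e2//; exact: integrable_lineZ.
    apply: le_Rint.
    + exact: integrable_line_abs.
    + have [i2 e2] := integrable_shift q (integrable_line_abs jf).
      by do 2 apply: integrable_lineZ.
    + move=> y; rewrite !normrM -mulrA [y + q]addrC [K * _]mulrC.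
      by apply: ler_wpM2l => //; apply: ler_wpM2l.
  - under [X in integrable_line X]funext do rewrite mulrC.
    exact/integrable_lineZ/integrable_line_abs.
  split=> //; rewrite -h3; apply: eq_Rint => q.
  have hs : integrable_line (fun p => f p * phi (p - q)).
    apply: (@integrable_lineM _ _ _ K) => //.
    apply: measurableT_comp mphi _; apply: measurable_continuous => x.
    by apply: cvgB; [exact: cvg_id|exact: cvg_cst].
  rewrite -(integrable_shift q hs).2 -RintZ; last exact: (integrable_shift q hs).1.
  by apply: eq_Rint => y; rewrite addrK [y + q]addrC mulrA.
have E phi y : convol f g y * phi y = \int[leb]_q (g q * f (q + y) * phi y).
  rewrite mulrC -RintZ//; apply: eq_Rint => q; ring.
split.
- move=> y.
  have := @continuity_under_integral _ _ _ leb (fun y q => f (q + y) * g q) setT measurableT (y - 1) (y + 1) _ _ (fun q => Kf * `|g q|) _ _ y.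
  apply.
  + by move=> x _; exact: hM.
  + apply: aeW => q _ x _; apply: cvgM; last exact: cvg_cst.
    apply: (@continuous_comp _ _ _ (fun x => q + x) f); last exact: cf.
    by apply: cvgD; [exact: cvg_cst|exact: cvg_id].
  + exact/integrable_lineZ/integrable_line_abs.
  + by move=> x _; apply: aeW => q _; rewrite normrM ler_wpM2r.
  + by rewrite inE /= in_itv /= ltrDl ltrBlDr ltrDl ltr01.
- have n1 (x : R) : `|(cst 1 : R -> R) x| <= 1 by rewrite /= normr1.
  have [h _] := test (cst 1) 1 (@cst_continuous _ _ _) n1.
  by apply: eq_integrable h => // y _ /=; rewrite -E mulr1.
- exists (Kf * \int[leb]_q `|g q|) => y; rewrite -RintZ; last exact: integrable_line_abs.
  apply: Rint_le_norm => //; first exact/integrable_lineZ/integrable_line_abs.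
  by move=> q; rewrite normrM ler_wpM2r.
- move=> phi K cphi phiK; have [_ <-] := test phi K cphi phiK.
  exact: eq_Rint.
Qed.

(** Fourier inversion at the single point 0.  The transform is multiplied by exp(- e |x|);
    exchanging the integrals produces the Poisson kernel, which reproduces k 0 in the limit. *)
Lemma Rint_cos_tr k : continuous k -> integrable_line k ->
  (exists K : R, forall x, `|k x| <= K) -> integrable_line (cos_tr k) ->
  \int[leb]_x cos_tr k x = 2 * pi * k 0.
Proof.
move=> ck ik [K kK] iC.
have mk := measurable_continuous ck.
pose e (n : nat) : R := n.+1%:R^-1.
have e0 n : 0 < e n by rewrite invr_gt0 ltr0n.
have ecvg : e n @[n --> \oo] --> (0 : R) by exact: cvg_harmonic.
have mE c : measurable_fun setT (fun x : R => expR (- (c * `|x|))).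
  apply: measurableT_comp => //; apply: measurable_funN.
  by apply: measurable_funM => //; exact: measurableT_comp.
have eK n x : `|expR (- (e n * `|x|))| <= 1.
  by rewrite ger0_norm ?expR_ge0// -expR0 ler_expR oppr_le0 mulr_ge0// ltW.
have [_ c1] : integrable_line (cos_tr k) /\
    (fun n => \int[leb]_x (expR (- (e n * `|x|)) * cos_tr k x)) @ \oo -->
    \int[leb]_x cos_tr k x.
  apply: (@dominated_line _ _ (fun x => `|cos_tr k x|)).
  - by move=> n; apply: measurable_funM => //; exact: integrable_line_measurable.
  - exact: integrable_line_measurable.
  - move=> x; rewrite -[X in _ --> X]mul1r; apply: cvgMl.
    rewrite -[X in _ --> X]expR0.
    apply: (@cvg_comp _ _ _ (fun n => - (e n * `|x|)) expR _ (nbhs (0 : R))); last first.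
      by apply: continuous_expR.
    by rewrite -oppr0; apply: cvgN; rewrite -[X in _ --> X](mul0r `|x|); apply: cvgMl.
  - exact: integrable_line_abs.
  - by move=> n x; rewrite normrM ler_piMl.
(* after Fubini and the substitution p = e n * u the kernel no longer depends on n *)
have lhsE n : \int[leb]_x (expR (- (e n * `|x|)) * cos_tr k x) =
    \int[leb]_u (2 * (k (e n * u) * (1 + u ^+ 2)^-1)).
  have ie := integrable_expRN (e0 n).
  have [||||| _ _ h3] := @Fubini_line (fun x p => expR (- (e n * `|x|)) * (k p * cos (x * p)))
      (fun x => expR (- (e n * `|x|)) * \int[leb]_p `|k p|).
  - apply: measurable_funM; first by apply: measurableT_comp (mE _) _; exact: measurable_fst.
    apply: measurable_funM; first by apply: measurableT_comp mk _; exact: measurable_snd.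
    apply: measurableT_comp; first by apply: continuous_measurable_fun; exact: continuous_cos.
    by apply: measurable_funM; [exact: measurable_fst|exact: measurable_snd].
  - move=> x; apply: integrable_lineZ; apply: (@integrable_lineM _ _ _ 1) => //.
      by apply: measurable_continuous; exact: continuous_cosM.
    by move=> p; exact: norm_cos_le1.
  - move=> p; apply: (@integrable_lineM _ _ _ K) => //.
      apply: measurable_funM => //; apply: measurable_continuous.
      by under [X in continuous X]funext do rewrite mulrC; exact: continuous_cosM.
    move=> x; rewrite normrM; apply: le_trans (kK p); apply: ler_piMr => //.
    exact: norm_cos_le1.
  - move=> x; rewrite -RintZ; last exact: integrable_line_abs.
    apply: le_Rint.
    + apply: integrable_line_abs; apply: integrable_lineZ; apply: (@integrable_lineM _ _ _ 1) => //.
        by apply: measurable_continuous; exact: continuous_cosM.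
      by move=> p; exact: norm_cos_le1.
    + exact/integrable_lineZ/integrable_line_abs.
    + move=> p; rewrite !normrM ger0_norm ?expR_ge0//; apply: ler_wpM2l; first exact: expR_ge0.
      by apply: ler_piMr => //; exact: norm_cos_le1.
  - under [X in integrable_line X]funext do rewrite mulrC.
    exact: integrable_lineZ.
  transitivity (\int[leb]_x \int[leb]_p (expR (- (e n * `|x|)) * (k p * cos (x * p)))).
    apply: eq_Rint => x; rewrite RintZ//; apply: (@integrable_lineM _ _ _ 1) => //.
      by apply: measurable_continuous; exact: continuous_cosM.
    by move=> p; exact: norm_cos_le1.
  rewrite h3.
  have E p : \int[leb]_x (expR (- (e n * `|x|)) * (k p * cos (x * p))) =
      k p * (2 * (e n / (e n ^+ 2 + p ^+ 2))).
    rewrite -abel_kernel// -RintZ.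
      by apply: eq_Rint => x; rewrite mulrCA [x * p]mulrC.
    apply: (@integrable_lineM _ _ _ 1) => //.
      by apply: measurable_continuous; exact: continuous_cosM.
    by move=> x; exact: norm_cos_le1.
  rewrite (eq_Rint E).
  have en0 : e n != 0 by rewrite gt_eqF.
  have L p : k p * (2 * (e n / (e n ^+ 2 + p ^+ 2))) =
      (e n)^-1 * (2 * (k p * (1 + ((e n)^-1 * p) ^+ 2)^-1)).
    have : e n ^+ 2 + p ^+ 2 != 0 by rewrite gt_eqF// ltr_pwDl ?exprn_gt0 ?sqr_ge0.
    have -> : 1 + ((e n)^-1 * p) ^+ 2 = (e n ^+ 2 + p ^+ 2) / e n ^+ 2 by field.
    by move=> D0; rewrite invf_div; field; rewrite en0 D0.
  rewrite (eq_Rint L).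
  have iL : integrable_line (fun u => 2 * (k (e n * u) * (1 + u ^+ 2)^-1)).
    apply: integrable_lineZ; under [X in integrable_line X]funext do rewrite mulrC.
    apply: (@integrable_lineM _ _ _ K) => //; first exact: integrable_lorentz.
    apply: measurableT_comp mk _; exact: measurable_funM.
  have ei : 0 < (e n)^-1 by rewrite invr_gt0.
  have [j1 j2] := integrable_affine 0 ei iL.
  rewrite invrK in j2.
  rewrite -[RHS](mulKf en0) -j2 -RintZ//.
  by apply: eq_Rint => p; rewrite addr0 (mulVKf en0).
have [_ c2] : integrable_line (fun u => 2 * (k 0 * (1 + u ^+ 2)^-1)) /\
    (fun n => \int[leb]_u (2 * (k (e n * u) * (1 + u ^+ 2)^-1))) @ \oo -->
    \int[leb]_u (2 * (k 0 * (1 + u ^+ 2)^-1)).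
  have ml : measurable_fun setT (fun u : R => (1 + u ^+ 2)^-1).
    by apply: measurable_continuous; exact: continuous_lorentz.
  apply: (@dominated_line _ _ (fun u => 2 * (K * (1 + u ^+ 2)^-1))).
  - move=> n; apply: measurable_funM => //; apply: measurable_funM => //.
    by apply: measurableT_comp mk _; exact: measurable_funM.
  - by apply: measurable_funM => //; exact: measurable_funM.
  - move=> u; apply: cvgMr; apply: cvgMl.
    apply: (@cvg_comp _ _ _ (fun n => e n * u) k _ (nbhs (0 : R))); last exact: ck.
    have : e n * u @[n --> \oo] --> 0 * u by apply: cvgMl.
    by rewrite mul0r.
  - by do 2 apply: integrable_lineZ; exact: integrable_lorentz.
  - move=> n u; rewrite !normrM ger0_norm//; apply: ler_wpM2l => //.
    by rewrite (ger0_norm (ltW (lorentz_gt0 u))); apply: ler_wpM2r => //; exact/ltW/lorentz_gt0.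
have {}c1 : (fun n => \int[leb]_u (2 * (k (e n * u) * (1 + u ^+ 2)^-1))) @ \oo -->
    \int[leb]_x cos_tr k x.
  by under eq_fun do rewrite -lhsE.
have -> := cvg_unique _ c1 c2 => //.
rewrite RintZ; last by apply: integrable_lineZ; exact: integrable_lorentz.
by rewrite RintZ ?Rint_lorentz; [ring|exact: integrable_lorentz].
Qed.

Lemma cos_tr_convol f g x : exp_decay f -> exp_decay g ->
  cos_tr (convol f g) x = cos_tr f x * cos_tr g x + sin_tr f x * sin_tr g x.
Proof.
move=> hf hg; have [_ _ _ test] := convol_props hf hg.
have ic u (hu : exp_decay u) := exp_decay_integrable (exp_decay_cos x hu).
have is_ u (hu : exp_decay u) := exp_decay_integrable (exp_decay_sin x hu).
rewrite /cos_tr (test _ 1); last 2 first.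
- exact: continuous_cosM.
- by move=> y; exact: norm_cos_le1.
rewrite -/(cos_tr f x) -/(cos_tr g x).
rewrite -(Rint_lin (cos_tr f x) (sin_tr f x) (ic _ hg) (is_ _ hg)).
apply: eq_Rint => q.
have -> : \int[leb]_p (f p * cos (x * (p - q))) =
    cos (x * q) * cos_tr f x + sin (x * q) * sin_tr f x.
  rewrite -(Rint_lin _ _ (ic _ hf) (is_ _ hf)).
  by apply: eq_Rint => p; rewrite mulrBr cosB; ring.
ring.
Qed.

Lemma sin_tr_convol f g x : exp_decay f -> exp_decay g ->
  sin_tr (convol f g) x = sin_tr f x * cos_tr g x - cos_tr f x * sin_tr g x.
Proof.
move=> hf hg; have [_ _ _ test] := convol_props hf hg.
have ic u (hu : exp_decay u) := exp_decay_integrable (exp_decay_cos x hu).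
have is_ u (hu : exp_decay u) := exp_decay_integrable (exp_decay_sin x hu).
rewrite /sin_tr (test _ 1); last 2 first.
- exact: continuous_sinM.
- by move=> y; exact: norm_sin_le1.
rewrite -/(sin_tr f x) -/(sin_tr g x) -mulNr.
rewrite -(Rint_lin (sin_tr f x) (- cos_tr f x) (ic _ hg) (is_ _ hg)).
apply: eq_Rint => q.
have -> : \int[leb]_p (f p * sin (x * (p - q))) =
    cos (x * q) * sin_tr f x + (- sin (x * q)) * cos_tr f x.
  rewrite -(Rint_lin _ _ (is_ _ hf) (ic _ hf)).
  by apply: eq_Rint => p; rewrite mulrBr sinB; ring.
ring.
Qed.

(** Inversion at 0 for the correlation of f and g, whose value at 0 is int f g. *)
Lemma parseval f g : exp_decay f -> exp_decay g -> integrable_line (cos_tr (convol f g)) ->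
  \int[leb]_x cos_tr (convol f g) x = 2 * pi * \int[leb]_p (f p * g p).
Proof.
move=> hf hg hi; have [c1 c2 c3 _] := convol_props hf hg.
rewrite Rint_cos_tr// /convol; congr (_ * _).
by apply: eq_Rint => p; rewrite addr0.
Qed.

End fourier.

(** * The Gamma function as a Fourier transform *)

Section gamma.
Context {R : realType}.
Implicit Types (f g k G : R -> R) (a b c d s t x y p : R).
Notation leb := (@lebesgue_measure R).

Lemma derive1_ln : {in `]0, +oo[, (@ln R)^`()%classic =1 (fun t => t^-1)}.
Proof.
move=> t; rewrite in_itv /= andbT => t0.
by rewrite derive1E; have [_ ->] := is_derive1_ln t0.
Qed.

Lemma ln_cvgy : (ln t : R) @[t --> +oo] --> +oo.
Proof.
apply/cvgryPge => A; near=> t.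
have t0 : 0 < t by near: t; exact: nbhs_pinfty_gt.
by rewrite -ler_expR lnK ?posrE//; near: t; exact: nbhs_pinfty_ge.
Unshelve. all: by end_near. Qed.

Lemma measurable_ln_div G : measurable_fun setT G ->
  measurable_fun (`]0, +oo[%classic : set R) (fun t => G (ln t) / t).
Proof.
move=> mG.
have h : measurable_fun (`]0, +oo[%classic : set R) (fun t => G (ln t) * expR (- ln t)).
  apply: measurable_funTS; apply: measurable_funM.
    by apply: measurableT_comp => //; exact: measurable_ln.
  apply: measurableT_comp => //; apply: measurable_funN; exact: measurable_ln.
apply: eq_measurable_fun h => t; rewrite inE /= in_itv /= andbT => t0.
by rewrite expRN lnK ?posrE.
Qed.

(** The substitution p = ln t.  It is performed on [1/(n+1), +oo[, where ln is regular up to the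
    boundary, and n tends to infinity on both sides. *)
Lemma ge0_integral_ln G : continuous G -> (forall x, 0 <= G x) ->
  (\int[leb]_(t in `]0%R, +oo[) (G (ln t) / t)%:E = \int[leb]_p (G p)%:E)%E.
Proof.
move=> cG G0.
pose a n : R := n.+1%:R^-1.
have a0 n : 0 < a n by rewrite invr_gt0 ltr0n.
have adec n m : (n <= m)%N -> a m <= a n by move=> nm; rewrite lef_pV2 ?posrE ?ltr0n// ler_nat.
have mG := measurable_continuous cG.
have mGl (D : set R) : measurable D -> D `<=` `]0, +oo[%classic ->
    measurable_fun D (fun t => (G (ln t) / t)%:E).
  move=> mD D0; apply/measurable_EFinP; apply: measurable_funS D0 _ => //.
  exact: measurable_ln_div.
have e n : (\int[leb]_(t in `[a n, +oo[) (G (ln t) / t)%:E =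
    \int[leb]_(p in `[ln (a n), +oo[) (G p)%:E)%E.
  rewrite (@increasing_ge0_integration_by_substitutiony _ (@ln R) G (a n)).
  - apply: eq_integral => t; rewrite inE /= in_itv /= andbT => ta.
    congr EFin; rewrite -[RHS]/(G (ln t) * (@ln R)^`()%classic t) derive1_ln//.
    by rewrite in_itv /= andbT; exact: lt_le_trans ta.
  - move=> x y; rewrite !in_itv /= !andbT => ax ay xy.
    by rewrite ltr_ln// posrE; [exact: lt_le_trans ax|exact: lt_le_trans ay].
  - move=> x; rewrite in_itv /= andbT => ax; have x0 : 0 < x by exact: lt_trans ax.
    have : (x^-1) @[x --> x] --> x^-1 by apply: cvgV; [rewrite gt_eqF|exact: cvg_id].
    move=> h; rewrite /continuous_at derive1_ln; last by rewrite in_itv /= x0.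
    apply: cvg_trans h; apply: near_eq_cvg; near=> z; apply/esym/derive1_ln.
    by rewrite in_itv /= andbT; near: z; exact: lt_nbhsr.
  - apply/cvg_ex; exists (a n)^-1.
    have : (x^-1) @[x --> (a n)^'+] --> (a n)^-1.
      by apply: cvg_at_right_filter; apply: cvgV; [rewrite gt_eqF|exact: cvg_id].
    apply: cvg_trans; apply: near_eq_cvg; near=> z; apply/esym/derive1_ln.
    rewrite in_itv /= andbT; apply: lt_trans (a0 n) _; near: z; exact: nbhs_right_gt.
  - apply/cvg_ex; exists 0.
    have := cvg_comp _ _ ln_cvgy (@cvgr_expR R).
    apply: cvg_trans; apply: near_eq_cvg; near=> z.
    have z0 : 0 < z by near: z; apply: nbhs_pinfty_gt; exact: num_real.
    by rewrite /= derive1_ln ?in_itv ?andbT//= expRN lnK ?posrE.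
  - split.
      move=> x; rewrite in_itv /= andbT => ax; have x0 : 0 < x by exact: lt_trans ax.
      by have [] := is_derive1_ln x0.
    by apply: cvg_at_right_filter; exact: continuous_ln.
  - exact: ln_cvgy.
  - exact: continuous_subspaceT.
  - by move=> x _; exact: G0.
have nn (b : nat -> R) : (forall n m, (n <= m)%N -> b m <= b n) ->
    nondecreasing_seq (fun n => `[b n, +oo[%classic : set R).
  move=> bd n m nm; rewrite subsetEset => x /=; rewrite !in_itv /= !andbT.
  by apply: le_trans; exact: bd.
have c1 : (\int[leb]_(t in `[a n, +oo[) (G (ln t) / t)%:E)%E @[n --> \oo] -->
    (\int[leb]_(t in `]0%R, +oo[) (G (ln t) / t)%:E)%E.
  have <- : \bigcup_n `[a n, +oo[%classic = `]0, +oo[%classic :> set R.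
    apply/seteqP; split => x /=.
      by move=> [n _]; rewrite /= !in_itv /= !andbT; exact: lt_le_trans.
    rewrite in_itv /= andbT => x0; have [n] := ltr_add_invr x0; rewrite add0r => xn.
    by exists n => //=; rewrite in_itv /= andbT ltW.
  apply: ge0_nondecreasing_set_cvg_integral => //; first exact: nn.
  - move=> n; apply: mGl => // x /=; rewrite !in_itv /= !andbT; exact: lt_le_trans.
  - move=> n x /=; rewrite in_itv /= andbT => ax; rewrite lee_fin divr_ge0//.
    by rewrite (le_trans _ ax)// ltW.
have c2 : (\int[leb]_(t in `[a n, +oo[) (G (ln t) / t)%:E)%E @[n --> \oo] -->
    (\int[leb]_p (G p)%:E)%E.
  under eq_fun do rewrite e.
  have <- : \bigcup_n `[ln (a n), +oo[%classic = setT :> set R.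
    apply/seteqP; split => x //= _; have [n] := ltr_add_invr (expR_gt0 x); rewrite add0r => xn.
    exists n => //=; rewrite in_itv /= andbT.
    by rewrite -[X in _ <= X]expRK ler_ln ?posrE ?expR_gt0// ltW.
  apply: ge0_nondecreasing_set_cvg_integral => //; first apply: nn.
  - by move=> n m nm; rewrite ler_ln ?posrE// adec.
  - by move=> n; apply/measurable_EFinP; exact: measurable_funTS.
  - by move=> n x _; rewrite lee_fin.
exact: cvg_unique c1 c2.
Unshelve. all: by end_near. Qed.

Lemma Rint_ln G : continuous G -> integrable_line G ->
  \int[leb]_(t in `]0, +oo[) (G (ln t) / t) = \int[leb]_p G p.
Proof.
move=> cG iG.
have ge0 (H : R -> R) : continuous H -> integrable_line H -> (forall x, 0 <= H x) ->
    leb.-integrable `]0, +oo[ (fun t => (H (ln t) / t)%:E) /\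
    \int[leb]_(t in `]0, +oo[) (H (ln t) / t) = \int[leb]_p H p.
  move=> cH iH H0; have e := ge0_integral_ln cH H0.
  split; last by rewrite /Rintegral e.
  apply/integrableP; split.
    by apply/measurable_EFinP; apply: measurable_ln_div; exact: measurable_continuous.
  have -> : (\int[leb]_(t in `]0%R, +oo[) `|(H (ln t) / t)%:E| =
      \int[leb]_(t in `]0%R, +oo[) (H (ln t) / t)%:E)%E.
    apply: eq_integral => t; rewrite inE /= in_itv /= andbT => t0; rewrite ger0_norm//.
    by rewrite divr_ge0// ltW.
  by rewrite e EFin_Rint// ltry.
have cA : continuous (fun x => `|G x|).
  by move=> x; apply: continuous_comp; [exact: cG|exact: norm_continuous].
have iA := integrable_line_abs iG.
have [i1 e1] := ge0 _ cA iA (fun x => normr_ge0 _).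
have [|||i2 e2] := ge0 (fun x => `|G x| + G x).
- by move=> x; apply: cvgD; [exact: cA|exact: cG].
- exact: integrable_lineD.
- by move=> x; rewrite -lerBlDr sub0r -normrN ler_norm.
have -> : \int[leb]_(t in `]0, +oo[) (G (ln t) / t) =
    \int[leb]_(t in `]0, +oo[) ((`|G (ln t)| + G (ln t)) / t - `|G (ln t)| / t).
  by apply: eq_Rintegral => t _; rewrite -mulrBl addrAC subrr add0r.
by rewrite RintegralB// e1 e2 RintD// addrAC subrr add0r.
Qed.

(** Euler's integrand t^s e^(-t) in the variable p = ln t, for the measure dt / t. *)
Definition gamma_fun s p := expR (s * p - expR p).

Lemma is_derive_gamma_fun s p : is_derive p 1 (gamma_fun s) ((s - expR p) * gamma_fun s p).
Proof.
rewrite mulrC; apply: (is_derive_chain (is_derive_expR _)).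
exact: (is_deriveB (is_derive_scale s p) (is_derive_expR p)).
Qed.

Lemma gamma_funS s p : expR p * gamma_fun s p = gamma_fun (s + 1) p.
Proof. by rewrite /gamma_fun -expRD; congr expR; ring. Qed.

Lemma gamma_fun_gt0 s p : 0 < gamma_fun s p. Proof. exact: expR_gt0. Qed.

Lemma gamma_fun_decay s : 0 < s -> exp_decay (gamma_fun s).
Proof.
move=> s0; split; first exact: continuous_of_derive (is_derive_gamma_fun s).
exists (expR (2 * s ^+ 2)), s; split=> // p.
rewrite ger0_norm ?expR_ge0// -expRD ler_expR.
case: (leP 0 p) => p0.
  rewrite ger0_norm//; have := @expR_ge1Dxn R p 1 p0.
  rewrite (_ : (2`!)%:R = 2 :> R)// => h.
  have := sqr_ge0 (p - 2 * s); nra.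
rewrite ltr0_norm//; have := expR_gt0 p; have := sqr_ge0 s; lra.
Qed.

Lemma powR_gamma_fun s t : 0 < t -> t `^ (s - 1) * expR (- t) = gamma_fun s (ln t) / t.
Proof.
move=> t0; rewrite /powR gt_eqF// /gamma_fun -expRD lnK ?posrE//.
by rewrite -[X in _ / X](lnK (x := t)) ?posrE// -expRN -expRD; congr expR; ring.
Qed.

Lemma GammaE s : 0 < s -> Gamma s = \int[leb]_p gamma_fun s p.
Proof.
move=> s0; have hd := gamma_fun_decay s0.
rewrite -Rint_ln; [|by case: hd|exact: exp_decay_integrable].
by apply: eq_Rintegral => t; rewrite inE /= in_itv /= andbT => t0; rewrite powR_gamma_fun.
Qed.

Lemma cGammaE s x : 0 < s ->
  cGamma (s +i* x) = cos_tr (gamma_fun s) x +i* sin_tr (gamma_fun s) x.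
Proof.
move=> s0; have hd := gamma_fun_decay s0.
rewrite /cGamma /cos_tr /sin_tr /=; congr (_ +i* _).
- rewrite -(@Rint_ln (fun p => gamma_fun s p * cos (x * p))).
  + by apply: eq_Rintegral => t; rewrite inE /= in_itv /= andbT => t0; rewrite powR_gamma_fun// mulrAC.
  + by have [] := exp_decay_cos x hd.
  + exact/exp_decay_integrable/exp_decay_cos.
- rewrite -(@Rint_ln (fun p => gamma_fun s p * sin (x * p))).
  + by apply: eq_Rintegral => t; rewrite inE /= in_itv /= andbT => t0; rewrite powR_gamma_fun// mulrAC.
  + by have [] := exp_decay_sin x hd.
  + exact/exp_decay_integrable/exp_decay_sin.
Qed.

Lemma Gamma_gt0 s : 0 < s -> 0 < Gamma s.
Proof.
move=> s0; rewrite GammaE//; apply: Rint_gt0; last by move=> p; exact: gamma_fun_gt0.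
exact/exp_decay_integrable/gamma_fun_decay.
Qed.

Lemma Gamma_neq0 s : 0 < s -> Gamma s != 0.
Proof. by move=> s0; apply: lt0r_neq0; exact: Gamma_gt0. Qed.

(** The functional equation Gamma(z + 1) = z Gamma(z) at z = s + ix, split into real and
    imaginary parts: the derivative of exp(sp - e^p) e^(ixp) has integral zero. *)
Lemma gamma_tr_rec s x : 0 < s ->
  cos_tr (gamma_fun (s + 1)) x = s * cos_tr (gamma_fun s) x - x * sin_tr (gamma_fun s) x /\
  sin_tr (gamma_fun (s + 1)) x = s * sin_tr (gamma_fun s) x + x * cos_tr (gamma_fun s) x.
Proof.
move=> s0; have hd := gamma_fun_decay s0.
have hd1 : exp_decay (gamma_fun (s + 1)) by apply: gamma_fun_decay; rewrite addr_gt0.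
have ic := exp_decay_cos x hd; have is_ := exp_decay_sin x hd.
have ic1 := exp_decay_cos x hd1; have is1 := exp_decay_sin x hd1.
have jc := exp_decay_integrable ic; have js := exp_decay_integrable is_.
have jc1 := exp_decay_integrable ic1; have js1 := exp_decay_integrable is1.
(* both identities are integrals of derivatives of decaying functions *)
have vanish f F : exp_decay F -> (forall p, is_derive p 1 F (f p)) -> exp_decay f ->
    \int[leb]_p f p = 0.
  move=> hF dF hf; have [F1 F2] := exp_decay_cvg hF.
  by rewrite (FTC_line hf.1 dF F1 F2) ?subrr//; exact: exp_decay_integrable.
split.
- have := vanish (fun p => (s * (gamma_fun s p * cos (x * p)) + (- x) * (gamma_fun s p * sin (x * p)))
      + (-1) * (gamma_fun (s + 1) p * cos (x * p))) (fun p => gamma_fun s p * cos (x * p)) ic.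
  rewrite RintD ?Rint_lin ?RintZ//; last 2 first.
  + by apply: integrable_lineD; exact: integrable_lineZ.
  + exact: integrable_lineZ.
  rewrite -!/(cos_tr _ _) -!/(sin_tr _ _) => h; apply/eqP; rewrite eq_sym -subr_eq0; apply/eqP.
  have -> : s * cos_tr (gamma_fun s) x - x * sin_tr (gamma_fun s) x -
    cos_tr (gamma_fun (s + 1)) x = s * cos_tr (gamma_fun s) x + - x * sin_tr (gamma_fun s) x +
    -1 * cos_tr (gamma_fun (s + 1)) x by ring.
  apply: h; last first.
    by do 2 (apply: exp_decayD; last exact: exp_decayZ); exact: exp_decayZ.
  move=> p; have h := is_deriveM (is_derive_gamma_fun s p) (is_derive_cosM x p).
  apply: is_derive_eq h _.
  transitivity (gamma_fun s p * (- (x * sin (x * p))) + cos (x * p) * ((s - expR p) * gamma_fun s p)); first by [].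
  by rewrite -gamma_funS; ring.
- have := vanish (fun p => (s * (gamma_fun s p * sin (x * p)) + x * (gamma_fun s p * cos (x * p)))
      + (-1) * (gamma_fun (s + 1) p * sin (x * p))) (fun p => gamma_fun s p * sin (x * p)) is_.
  rewrite RintD ?Rint_lin ?RintZ//; last 2 first.
  + by apply: integrable_lineD; exact: integrable_lineZ.
  + exact: integrable_lineZ.
  rewrite -!/(cos_tr _ _) -!/(sin_tr _ _) => h; apply/eqP; rewrite eq_sym -subr_eq0; apply/eqP.
  have -> : s * sin_tr (gamma_fun s) x + x * cos_tr (gamma_fun s) x -
    sin_tr (gamma_fun (s + 1)) x = s * sin_tr (gamma_fun s) x + x * cos_tr (gamma_fun s) x +
    -1 * sin_tr (gamma_fun (s + 1)) x by ring.
  apply: h; last first.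
    by do 2 (apply: exp_decayD; last exact: exp_decayZ); exact: exp_decayZ.
  move=> p; have h := is_deriveM (is_derive_gamma_fun s p) (is_derive_sinM x p).
  apply: is_derive_eq h _.
  transitivity (gamma_fun s p * (x * cos (x * p)) + sin (x * p) * ((s - expR p) * gamma_fun s p)); first by [].
  by rewrite -gamma_funS; ring.
Qed.

Lemma cos_tr0 f : cos_tr f 0 = \int[leb]_p f p.
Proof. by apply: eq_Rint => p; rewrite mul0r cos0 mulr1. Qed.

Lemma sin_tr0 f : sin_tr f 0 = 0.
Proof.
rewrite /sin_tr (@eq_Rint _ _ (cst 0)) ?Rintegral_cst//= ?mul0r// => p.
by rewrite mul0r sin0 mulr0.
Qed.

Lemma GammaS s : 0 < s -> Gamma (s + 1) = s * Gamma s.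
Proof.
move=> s0; have s1 : 0 < s + 1 by rewrite addr_gt0.
have [+ _] := gamma_tr_rec 0 s0; rewrite !cos_tr0 mul0r subr0.
by rewrite -!GammaE.
Qed.

Lemma Gamma1 : Gamma 1 = 1 :> R.
Proof.
rewrite GammaE//.
have d p : is_derive p 1 (fun p : R => - expR (- expR p)) (gamma_fun 1 p).
  have h := is_deriveN (is_derive_chain (g := fun p => - expR p) (is_derive_expR (- expR p)) (is_deriveN (is_derive_expR p))).
  apply: is_derive_eq h _; rewrite mulrN opprK -expRD; congr expR; ring.
have hd := gamma_fun_decay (@ltr01 R).
rewrite (FTC_line hd.1 d (l1 := 0) (l2 := -1)) ?sub0r ?opprK//.
- rewrite -oppr0; apply: cvgN.
  have h : expR p @[p --> +oo] --> (+oo : set_system R).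
    apply/cvgryPge => A; near=> p; apply: (@le_trans _ _ (1 + p)); last exact: expR_ge1Dx.
    apply: (@le_trans _ _ p); last by rewrite lerDr.
    by near: p; apply: nbhs_pinfty_ge; exact: num_real.
  exact: cvg_comp h (@cvgr_expR R).
- have h : - expR (- p) @[p --> +oo] --> (0 : R) by rewrite -oppr0; apply: cvgN; exact: cvgr_expR.
  apply: cvgN; rewrite -[X in _ --> X]expR0.
  exact: (cvg_comp (fun p : R => - expR (- p)) expR h (@continuous_expR R 0)).
- exact: exp_decay_integrable.
Unshelve. all: by end_near. Qed.

End gamma.

#[local] Opaque Gamma.

(** * The beta kernel and square-integrable transforms *)

Section beta.
Context {R : realType}.
Implicit Types (f g k G : R -> R) (a b c d s t x y p : R).
Notation leb := (@lebesgue_measure R).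

(** The rate of decay is half the smaller of the two rates; the other half keeps the integral
    over q finite. *)
Lemma exp_decay_convol f g : exp_decay f -> exp_decay g -> exp_decay (convol f g).
Proof.
move=> hf hg; have [cc _ _ _] := convol_props hf hg; split=> //.
have [cf [C [c [c0 fC]]]] := hf; have [cg [D [d [d0 gD]]]] := hg.
have [m [m0 mc md]] : exists m, [/\ 0 < m, 2 * m <= c & 2 * m <= d].
  exists (Num.min c d / 2); split; first by rewrite divr_gt0// lt_min c0.
    by rewrite mulrC divfK// ge_min lexx.
  by rewrite mulrC divfK// ge_min lexx orbT.
have C0 := decay_cst_ge0 fC.
have D0 := decay_cst_ge0 gD.
have im := integrable_expRN m0.
exists (C * D * \int[leb]_q expR (- (m * `|q|))), m; split=> // y.
rewrite -mulrA [X in _ * X]mulrC mulrA -RintZ//.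
have [Kf [Kf0 fK]] := exp_decay_bounded hf.
have ifg : integrable_line (fun q => f (q + y) * g q).
  under [X in integrable_line X]funext do rewrite mulrC.
  apply: (@integrable_lineM _ _ _ Kf) => //; first exact: exp_decay_integrable.
  by apply: measurable_continuous; have [] := exp_decay_shift y hf.
apply: Rint_le_norm => //; first exact: integrable_lineZ.
move=> q; rewrite normrM.
apply: (@le_trans _ _ ((C * expR (- (c * `|q + y|))) * (D * expR (- (d * `|q|))))).
  by apply: ler_pM.
rewrite mulrACA -!mulrA; do 2 (apply: ler_wpM2l => //).
rewrite -!expRD ler_expR.
have h1 : `|y| <= `|q + y| + `|q|.
  by rewrite -[X in `|X| <= _](addKr q) addrC; apply: (le_trans (ler_normB _ _)); rewrite addrC.
have h2 := normr_ge0 (q + y); have h3 := normr_ge0 q.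
nra.
Qed.

(** This is e^(sy) / (1 + e^y)^(s + t), the beta density in the logit variable. *)
Definition beta_fun s t y := expR (s * y - (s + t) * ln (1 + expR y)).

Lemma expR1_gt0 y : 0 < 1 + expR y. Proof. by rewrite addr_gt0 ?expR_gt0. Qed.

Lemma ln1expR_ge0 y : 0 <= ln (1 + expR y).
Proof. by rewrite ln_ge0// lerDl expR_ge0. Qed.

Lemma ln1expR_ge y : y <= ln (1 + expR y).
Proof. by rewrite -ler_expR lnK ?posrE ?expR1_gt0// lerDr. Qed.

Lemma continuous_ln1expR : continuous (fun y : R => ln (1 + expR y)).
Proof.
move=> y; apply: (@continuous_comp _ _ _ (fun y => 1 + expR y) (@ln R)).
  by apply: cvgD; [exact: cvg_cst|exact: continuous_expR].
by apply: continuous_ln; exact: expR1_gt0.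
Qed.

Lemma beta_fun_decay s t : 0 < s -> 0 < t -> exp_decay (beta_fun s t).
Proof.
move=> s0 t0; split.
  move=> y; apply: (@continuous_comp _ _ _ (fun y => s * y - (s + t) * ln (1 + expR y)) expR); last exact: continuous_expR.
  apply: cvgB; first by apply: cvgMr; exact: cvg_id.
  by apply: cvgMr; exact: continuous_ln1expR.
exists 1, (Num.min s t); split; first by rewrite lt_min s0.
move=> y; rewrite mul1r ger0_norm ?expR_ge0// ler_expR.
have h0 := ln1expR_ge0 y; have h1 := ln1expR_ge y.
have ms : Num.min s t <= s by rewrite ge_min lexx.
have mt : Num.min s t <= t by rewrite ge_min lexx orbT.
case: (leP 0 y) => y0; [rewrite ger0_norm//|rewrite ltr0_norm//]; nra.
Qed.

(** Since e^(q + y) + e^q = e^(q + ln(1 + e^y)), shifting q leaves a Gamma integral. *)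
Lemma convol_gamma_fun s t y : 0 < s -> 0 < t ->
  convol (gamma_fun s) (gamma_fun t) y = Gamma (s + t) * beta_fun s t y.
Proof.
move=> s0 t0; have st0 : 0 < s + t by rewrite addr_gt0.
have hi := exp_decay_integrable (gamma_fun_decay st0).
have [i1 e1] := integrable_shift (ln (1 + expR y)) hi.
rewrite (GammaE st0) -e1 mulrC -(RintZ _ i1); apply: eq_Rint => q.
rewrite /gamma_fun /beta_fun -!expRD; congr expR.
rewrite (expRD q (ln _)) (lnK (x := 1 + expR y)); last by rewrite posrE expR1_gt0.
by rewrite (expRD q y); ring.
Qed.

(** The value at 0 of the transform of a correlation is the product of the two integrals. *)
Lemma Rint_beta_fun s t : 0 < s -> 0 < t ->
  \int[leb]_y beta_fun s t y = Gamma s * Gamma t / Gamma (s + t).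
Proof.
move=> s0 t0; have st0 : 0 < s + t by rewrite addr_gt0.
have G0 : Gamma (s + t) != 0 by exact: Gamma_neq0.
have := cos_tr_convol 0 (gamma_fun_decay s0) (gamma_fun_decay t0).
rewrite !sin_tr0 mulr0 addr0 !cos_tr0 -(GammaE s0) -(GammaE t0) => <-.
have hb := exp_decay_integrable (beta_fun_decay s0 t0).
by rewrite (eq_Rint (fun y => convol_gamma_fun y s0 t0)) (RintZ _ hb) mulrC (mulKf G0).
Qed.

Lemma beta_funM s t s' t' y :
  beta_fun s t y * beta_fun s' t' y = beta_fun (s + s') (t + t') y.
Proof. by rewrite /beta_fun -expRD; congr expR; ring. Qed.

(** Shifting p by ln 2 turns 2 e^p into e^p. *)
Lemma Rint_gamma_funM s t : 0 < s -> 0 < t ->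
  \int[leb]_p (gamma_fun s p * gamma_fun t p) = expR (- ((s + t) * ln 2)) * Gamma (s + t).
Proof.
move=> s0 t0; have st0 : 0 < s + t by rewrite addr_gt0.
have hi := exp_decay_integrable (gamma_fun_decay st0).
have [i1 e1] := integrable_shift (ln 2) hi.
rewrite (GammaE st0) -e1 -(RintZ _ i1); apply: eq_Rint => q.
rewrite /gamma_fun -!expRD; congr expR.
rewrite (expRD q (ln _)) (lnK (x := 2)); last by rewrite posrE.
set u := ln 2; ring.
Qed.

Definition sq_tr f x := cos_tr f x ^+ 2 + sin_tr f x ^+ 2.
(** Parseval's identity also asks that the transform of the correlation be integrable; by the
    inequality between means it is enough that both squared transforms are. *)
Definition sqi_tr f : Prop := exp_decay f /\ integrable_line (sq_tr f).

Lemma sq_tr_ge0 f x : 0 <= sq_tr f x. Proof. by rewrite addr_ge0 ?sqr_ge0. Qed.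

Lemma measurable_cos_tr f : exp_decay f -> measurable_fun setT (cos_tr f).
Proof.
by move=> [cf _]; apply: measurable_fun_tr; [exact: continuous_cos|exact: measurable_continuous].
Qed.

Lemma measurable_sin_tr f : exp_decay f -> measurable_fun setT (sin_tr f).
Proof.
by move=> [cf _]; apply: measurable_fun_tr; [exact: continuous_sin|exact: measurable_continuous].
Qed.

Lemma cos_trD f g x : exp_decay f -> exp_decay g ->
  cos_tr (fun p => f p + g p) x = cos_tr f x + cos_tr g x.
Proof.
move=> hf hg; rewrite -RintD; [|exact/exp_decay_integrable/exp_decay_cos..].
by apply: eq_Rint => p; rewrite mulrDl.
Qed.

Lemma sin_trD f g x : exp_decay f -> exp_decay g ->
  sin_tr (fun p => f p + g p) x = sin_tr f x + sin_tr g x.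
Proof.
move=> hf hg; rewrite -RintD; [|exact/exp_decay_integrable/exp_decay_sin..].
by apply: eq_Rint => p; rewrite mulrDl.
Qed.

Lemma cos_trZ c f x : exp_decay f -> cos_tr (fun p => c * f p) x = c * cos_tr f x.
Proof.
move=> hf; rewrite -RintZ; last exact/exp_decay_integrable/exp_decay_cos.
by apply: eq_Rint => p; rewrite mulrA.
Qed.

Lemma sin_trZ c f x : exp_decay f -> sin_tr (fun p => c * f p) x = c * sin_tr f x.
Proof.
move=> hf; rewrite -RintZ; last exact/exp_decay_integrable/exp_decay_sin.
by apply: eq_Rint => p; rewrite mulrA.
Qed.

Lemma measurable_sq_tr f : exp_decay f -> measurable_fun setT (sq_tr f).
Proof.
by move=> hf; apply: measurable_funD; apply: measurable_funX;
  [exact: measurable_cos_tr|exact: measurable_sin_tr].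
Qed.

Lemma sqi_trZ c f : sqi_tr f -> sqi_tr (fun p => c * f p).
Proof.
move=> [hf hi]; split; first exact: exp_decayZ.
rewrite (_ : sq_tr _ = (fun x => c ^+ 2 * sq_tr f x)); first exact: integrable_lineZ.
by apply/funext => x; rewrite /sq_tr cos_trZ// sin_trZ//; ring.
Qed.

Lemma sqi_trD f g : sqi_tr f -> sqi_tr g -> sqi_tr (fun p => f p + g p).
Proof.
move=> [hf hi] [hg hj]; have hd := exp_decayD hf hg; split=> //.
apply: (@integrable_line_le _ _ (fun x => 2 * sq_tr f x + 2 * sq_tr g x)).
- exact: measurable_sq_tr.
- move=> x; rewrite ger0_norm ?sq_tr_ge0// /sq_tr cos_trD// sin_trD//.
  have := sqr_ge0 (cos_tr f x - cos_tr g x); have := sqr_ge0 (sin_tr f x - sin_tr g x); nra.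
- by apply: integrable_lineD; exact: integrable_lineZ.
Qed.

Lemma sqi_tr_sum n (F : nat -> R -> R) : (forall i, (i < n)%N -> sqi_tr (F i)) ->
  sqi_tr (fun x => \sum_(i < n) F i x).
Proof.
elim: n => [|n ih] hF.
  under [X in sqi_tr X]funext do rewrite big_ord0.
  have d0 : exp_decay (fun _ : R => 0 : R).
    split; first exact: cst_continuous.
    by exists 0, 1; split => // x; rewrite normr0 mul0r.
  split=> //; rewrite (_ : sq_tr _ = cst 0); first exact: integrable0.
  apply/funext => x; rewrite /sq_tr.
  have -> : cos_tr (fun=> 0) x = 0 :> R.
    by rewrite /cos_tr (@eq_Rint _ _ (cst 0)) ?Rintegral_cst//= ?mul0r// => p; rewrite mul0r.
  have -> : sin_tr (fun=> 0) x = 0 :> R.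
    by rewrite /sin_tr (@eq_Rint _ _ (cst 0)) ?Rintegral_cst//= ?mul0r// => p; rewrite mul0r.
  by rewrite expr0n addr0.
under [X in sqi_tr X]funext do rewrite big_ord_recr /=.
by apply: sqi_trD; [apply: ih => i hi; apply: hF; exact: ltnW|exact: hF].
Qed.

Lemma sq_tr_bound f : exp_decay f -> exists K : R, forall x, sq_tr f x <= K.
Proof.
move=> hf; have ia := integrable_line_abs (exp_decay_integrable hf).
pose K := \int[leb]_p `|f p|; exists (K ^+ 2 + K ^+ 2) => x.
have aux (u : R) : `|u| <= K -> u ^+ 2 <= K ^+ 2.
  by move=> h; rewrite -(real_normK (num_real u)); apply: lerXn2r; rewrite ?nnegrE// Rint_ge0.
apply: lerD; apply: aux; apply: Rint_le_norm => //.
- exact/exp_decay_integrable/exp_decay_cos.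
- by move=> p; rewrite normrM ler_piMr// norm_cos_le1.
- exact/exp_decay_integrable/exp_decay_sin.
- by move=> p; rewrite normrM ler_piMr// norm_sin_le1.
Qed.

Lemma sq_tr_convol f g x : exp_decay f -> exp_decay g ->
  sq_tr (convol f g) x = sq_tr f x * sq_tr g x.
Proof. by move=> hf hg; rewrite /sq_tr cos_tr_convol// sin_tr_convol//; ring. Qed.

Lemma sqi_tr_convol f g : sqi_tr f -> sqi_tr g -> sqi_tr (convol f g).
Proof.
move=> [hf hi] [hg hj]; split; first exact: exp_decay_convol.
have [K gK] := sq_tr_bound hg.
rewrite (_ : sq_tr _ = (fun x => sq_tr f x * sq_tr g x)); last first.
  by apply/funext => x; exact: sq_tr_convol.
apply: (@integrable_lineM _ _ _ K) => //; first exact: measurable_sq_tr.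
by move=> x; rewrite ger0_norm ?sq_tr_ge0.
Qed.

Lemma sqi_tr_integrable f g : sqi_tr f -> sqi_tr g ->
  integrable_line (cos_tr (convol f g)) /\ integrable_line (sin_tr (convol f g)).
Proof.
move=> [hf hi] [hg hj]; have hd := exp_decay_convol hf hg.
have hs := integrable_lineD hi hj.
split; apply: integrable_line_le hs.
- exact: measurable_cos_tr.
- move=> x; rewrite cos_tr_convol// /sq_tr.
  set a := cos_tr f x; set b := sin_tr f x; set c := cos_tr g x; set d := sin_tr g x.
  have := (sqr_ge0 (a - c), sqr_ge0 (a + c), sqr_ge0 (b - d), sqr_ge0 (b + d)).
  have := (sqr_ge0 a, sqr_ge0 b, sqr_ge0 c, sqr_ge0 d).
  by move=> [[[? ?] ?] ?] [[[? ?] ?] ?]; rewrite ler_norml; apply/andP; split; nra.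
- exact: measurable_sin_tr.
- move=> x; rewrite sin_tr_convol// /sq_tr.
  set a := cos_tr f x; set b := sin_tr f x; set c := cos_tr g x; set d := sin_tr g x.
  have := (sqr_ge0 (a - d), sqr_ge0 (a + d), sqr_ge0 (b - c), sqr_ge0 (b + c)).
  have := (sqr_ge0 a, sqr_ge0 b, sqr_ge0 c, sqr_ge0 d).
  by move=> [[[? ?] ?] ?] [[[? ?] ?] ?]; rewrite ler_norml; apply/andP; split; nra.
Qed.

Lemma sqi_tr_parseval f g : sqi_tr f -> sqi_tr g ->
  \int[leb]_x cos_tr (convol f g) x = 2 * pi * \int[leb]_p (f p * g p) /\
  \int[leb]_x sin_tr (convol f g) x = 0.
Proof.
move=> hf hg; have [ic is_] := sqi_tr_integrable hf hg; split.
  by apply: parseval => //; [case: hf|case: hg].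
apply: Rint_odd => // x.
have hx := exp_decay_integrable (exp_decay_sin x (exp_decay_convol hf.1 hg.1)).
rewrite /sin_tr -[RHS]mulN1r -(RintZ _ hx).
by apply: eq_Rint => p; rewrite mulNr sinN mulN1r mulrN.
Qed.

Lemma sq_tr_gammaS s x : 0 < s ->
  sq_tr (gamma_fun (s + 1)) x = (s ^+ 2 + x ^+ 2) * sq_tr (gamma_fun s) x.
Proof. by move=> s0; have [e1 e2] := gamma_tr_rec x s0; rewrite /sq_tr e1 e2; ring. Qed.

Lemma sqrmod_cGamma s x : 0 < s -> sqrmod (cGamma (s +i* x)) = sq_tr (gamma_fun s) x.
Proof. by move=> s0; rewrite cGammaE. Qed.

(** The squared modulus of a transform is the transform of the autocorrelation. *)
Lemma sq_tr_gamma s x : 0 < s ->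
  sq_tr (gamma_fun s) x = Gamma (2 * s) * cos_tr (beta_fun s s) x.
Proof.
move=> s0; have hd := gamma_fun_decay s0.
have -> : sq_tr (gamma_fun s) x = cos_tr (convol (gamma_fun s) (gamma_fun s)) x.
  by rewrite cos_tr_convol.
rewrite mulr2n mulrDl mul1r -cos_trZ; last exact: beta_fun_decay.
by apply: eq_Rint => p; rewrite convol_gamma_fun.
Qed.

Lemma sq_tr_gamma_le s x : 0 < s -> sq_tr (gamma_fun s) x <= Gamma s ^+ 2.
Proof.
move=> s0; have hd := gamma_fun_decay s0; have hb := beta_fun_decay s0 s0.
have G2 : 0 < Gamma (2 * s) by rewrite Gamma_gt0// mulr_gt0.
rewrite sq_tr_gamma//.
have -> : Gamma s ^+ 2 = Gamma (2 * s) * \int[leb]_y beta_fun s s y.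
  by rewrite Rint_beta_fun// [s + s](_ : _ = 2 * s); [field; rewrite gt_eqF|ring].
apply: ler_wpM2l; first exact: ltW.
apply: le_Rint.
- exact/exp_decay_integrable/exp_decay_cos.
- exact: exp_decay_integrable.
- by move=> p; rewrite ler_piMr ?expR_ge0// cos_le1.
Qed.

(** The functional equation and the trivial bound at s + 1 bound |Gamma(s + ix)|^2 by Gamma(s +
    1)^2 / (s^2 + x^2). *)
Lemma sqi_tr_gamma s : 0 < s -> sqi_tr (gamma_fun s).
Proof.
move=> s0; have hd := gamma_fun_decay s0; split=> //.
pose m := Num.min 1 (s ^+ 2).
have m0 : 0 < m by rewrite lt_min ltr01 exprn_gt0.
have m1 : m <= 1 by rewrite ge_min lexx.
have m2 : m <= s ^+ 2 by rewrite ge_min lexx orbT.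
apply: (@integrable_line_le _ _ (fun x => (Gamma (s + 1) ^+ 2 / m) * (1 + x ^+ 2)^-1)).
- exact: measurable_sq_tr.
- move=> x; rewrite ger0_norm ?sq_tr_ge0//.
  have h := @sq_tr_gamma_le (s + 1) x (addr_gt0 s0 ltr01).
  rewrite sq_tr_gammaS// in h.
  rewrite -mulrA -invfM ler_pdivlMr; last by rewrite mulr_gt0// ltr_pwDl ?sqr_ge0.
  apply: le_trans h; rewrite mulrC; apply: ler_wpM2r; first exact: sq_tr_ge0.
  by have := sqr_ge0 x; nra.
- exact/integrable_lineZ/integrable_lorentz.
Qed.

End beta.

(** * The Gaussian integral and the duplication formula *)

Section duplication.
Context {R : realType}.
Implicit Types (f g k G : R -> R) (a b c d s t x y p : R).
Notation leb := (@lebesgue_measure R).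

Lemma sqr1_gt0 x : 0 < 1 + x ^+ 2. Proof. by rewrite ltr_pwDl ?sqr_ge0. Qed.

Lemma Rint_gauss c : 0 < c ->
  integrable_line (fun x => expR (- (c * x) ^+ 2)) /\
  \int[leb]_x expR (- (c * x) ^+ 2) = c^-1 * Num.sqrt pi.
Proof.
move=> c0; have hi : integrable_line (@gauss_fun R) by exact: integrableT_gauss.
have [i1 e1] := integrable_affine 0 c0 hi.
have E : (fun x => expR (- (c * x) ^+ 2)) = (fun x => gauss_fun (c * x + 0)).
  by apply/funext => x; rewrite addr0.
rewrite E; split=> //; rewrite e1; congr (_ * _).
by apply: EFin_inj; rewrite -(EFin_Rint hi); exact: integralT_gauss.
Qed.

(** The double integral of exp(sp - (1 + x^2) e^p) over p and x, with s = a + 1/2: integrating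
    first over x gives a Gaussian integral, integrating first over p a Gamma integral. *)
Lemma gamma_gauss a : 0 < a ->
  Gamma (a + 1 / 2) * \int[leb]_x expR (- ((a + 1 / 2) * ln (1 + x ^+ 2))) =
  Num.sqrt pi * Gamma a.
Proof.
move=> a0; set s := a + 1 / 2.
have s0 : 0 < s by rewrite addr_gt0// divr_gt0.
have hi := exp_decay_integrable (gamma_fun_decay s0).
have ha := exp_decay_integrable (gamma_fun_decay a0).
pose F (p x : R) := expR (s * p - expR p * (1 + x ^+ 2)).
have EF p x : F p x = gamma_fun s p * expR (- (expR (p / 2) * x) ^+ 2).
  rewrite /F /gamma_fun -expRD; congr expR; rewrite exprMn -expRM_natl.
  by rewrite [2 * _]mulrC divfK//; ring.
have EG p x : F p x = expR (- (s * ln (1 + x ^+ 2))) * gamma_fun s (p + ln (1 + x ^+ 2)).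
  rewrite /F /gamma_fun -expRD; congr expR.
  by rewrite (expRD p (ln _)) (lnK (x := 1 + x ^+ 2)) ?posrE ?sqr1_gt0//; ring.
(* for fixed p, a Gaussian of parameter e^(p/2); for fixed x, a shift by ln(1 + x^2) *)
have ix p : integrable_line (F p) /\ \int[leb]_x F p x = Num.sqrt pi * gamma_fun a p.
  have [i1 e1] := Rint_gauss (expR_gt0 (p / 2)).
  rewrite (_ : F p = (fun x => gamma_fun s p * expR (- (expR (p / 2) * x) ^+ 2))); last exact/funext.
  split; first exact: integrable_lineZ.
  rewrite (RintZ _ i1) e1 -expRN mulrCA mulrA mulrC; congr (_ * _).
  by rewrite /gamma_fun -expRD; congr expR; rewrite /s; field.
have ip x : integrable_line (F ^~ x) /\
    \int[leb]_p F p x = Gamma s * expR (- (s * ln (1 + x ^+ 2))).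
  have [i1 e1] := integrable_shift (ln (1 + x ^+ 2)) hi.
  rewrite (_ : F ^~ x = (fun p => expR (- (s * ln (1 + x ^+ 2))) * gamma_fun s (p + ln (1 + x ^+ 2)))); last exact/funext.
  split; first exact: integrable_lineZ.
  by rewrite (RintZ _ i1) e1 (GammaE s0) mulrC.
have [||||| h1 h2 h3] := @Fubini_line _ F (fun p => Num.sqrt pi * gamma_fun a p).
- apply: measurableT_comp => //; apply: measurable_funB.
    by apply: measurable_funM => //; exact: measurable_fst.
  apply: measurable_funM; first by apply: measurableT_comp => //; exact: measurable_fst.
  by apply: measurable_funD => //; apply: measurable_funX; exact: measurable_snd.
- by move=> p; have [] := ix p.
- by move=> x; have [] := ip x.
- move=> p; have [_ <-] := ix p; rewrite le_eqVlt; apply/orP; left; apply/eqP.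
  by apply: eq_Rint => x; rewrite ger0_norm ?expR_ge0.
- exact: integrable_lineZ.
have G0 : Gamma s != 0 by exact: Gamma_neq0.
have il : integrable_line (fun x => expR (- (s * ln (1 + x ^+ 2)))).
  rewrite (_ : (fun x => _) = (fun x => (Gamma s)^-1 * \int[leb]_p F p x)).
    exact: integrable_lineZ.
  by apply/funext => x; rewrite (ip x).2 (mulKf G0).
rewrite -(RintZ _ il) -(eq_Rint (fun x => (ip x).2)) -h3.
by rewrite (eq_Rint (fun p => (ix p).2)) (RintZ _ ha) (GammaE a0).
Qed.

(** At a = 1/2 the remaining integral is that of 1 / (1 + x^2). *)
Lemma Gamma_half : Gamma (1 / 2) = Num.sqrt pi :> R.
Proof.
have h : 0 < 1 / 2 :> R by rewrite divr_gt0.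
have := gamma_gauss h; rewrite (_ : 1 / 2 + 1 / 2 = 1 :> R); last by field.
rewrite Gamma1 mul1r (@eq_Rint _ _ (fun x => (1 + x ^+ 2)^-1)); last first.
  by move=> x; rewrite mul1r expRN lnK ?posrE ?sqr1_gt0.
rewrite Rint_lorentz => e.
have p0 : Num.sqrt pi != 0 :> R by rewrite gt_eqF// sqrtr_gt0 pi_gt0.
by apply: (mulfI p0); rewrite -e -expr2 sqr_sqrtr// pi_ge0.
Qed.

Let r x : R := Num.sqrt (1 + x ^+ 2).
Let w x : R := x + r x.

Let r_gt0 x : 0 < r x. Proof. by rewrite sqrtr_gt0 sqr1_gt0. Qed.
Let r_sqr x : r x ^+ 2 = 1 + x ^+ 2. Proof. by rewrite sqr_sqrtr// ltW// sqr1_gt0. Qed.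

Let r_gt x : `|x| < r x.
Proof.
rewrite -ltr_sqr ?nnegrE ?normr_ge0 ?(ltW (r_gt0 _))// r_sqr real_normK ?num_real//.
by rewrite ltrDr.
Qed.

Let w_gt0 x : 0 < w x.
Proof. by have := r_gt x; rewrite ltr_norml => /andP[h _]; rewrite /w -ltrBlDr sub0r. Qed.

Let is_derive_r x : is_derive x 1 r (x / r x).
Proof.
have h : is_derive x 1 (fun x : R => 1 + x ^+ 2) (2 * x).
  have h1 : is_derive x 1 (fun x : R => x ^+ 2) (2 * x).
    rewrite (_ : (fun x : R => x ^+ 2) = (fun x => x * x)); last by apply/funext => y; rewrite expr2.
    have h0 := is_deriveM (is_derive_id x (1 : R)) (is_derive_id x (1 : R)).
    apply: is_derive_eq h0 _; transitivity (x * 1 + x * 1); first by [].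
    ring.
  by apply: is_derive_eq (is_deriveD (is_derive_cst (1 : R) x 1) h1) _; rewrite add0r.
have := is_derive_chain (g := fun x => 1 + x ^+ 2) (is_derive1_sqrt (sqr1_gt0 x)) h.
move=> h2; apply: is_derive_eq h2 _; rewrite -/(r x).
by field; rewrite gt_eqF.
Qed.

Let asinh2 x : R := 2 * ln (w x).

Let is_derive_asinh2 x : is_derive x 1 asinh2 (2 / r x).
Proof.
have hw : is_derive x 1 w (1 + x / r x) by exact: is_deriveD (is_derive_id x 1) (is_derive_r x).
have h := is_derive_chain (is_derive1_ln (w_gt0 x)) hw.
apply: is_derive_eq (is_deriveZ (2 : R) h) _.
transitivity (2 * ((w x)^-1 * (1 + x / r x))); first by [].
have := w_gt0 x; have := r_gt0 x; rewrite /w => h1 h2.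
by field; rewrite !gt_eqF.
Qed.

(** The substitution y = 2 asinh x turns e^y / (1 + e^y)^2 into 1 / (4 (1 + x^2)). *)
Lemma Rint_beta_lorentz a : 0 < a -> \int[leb]_y beta_fun a a y =
  expR ((1 - 2 * a) * ln 2) * \int[leb]_x expR (- ((a + 1 / 2) * ln (1 + x ^+ 2))).
Proof.
move=> a0.
have hb := beta_fun_decay a0 a0; have ib := exp_decay_integrable hb.
have cr : continuous r by exact: continuous_of_derive is_derive_r.
have dE : asinh2^`()%classic = (fun x => 2 / r x).
  by apply/funext => x; rewrite derive1E; have [_ ->] := is_derive_asinh2 x.
have ry : r x @[x --> +oo] --> +oo.
  apply/cvgryPge => A; near=> x.
  have : x <= r x by apply: le_trans (ler_norm x) _; exact: ltW.
  by apply: le_trans; near: x; apply: nbhs_pinfty_ge; exact: num_real.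
have rN x : r (- x) = r x by rewrite /r sqrrN.
have cV : (2 / r x) @[x --> +oo] --> (0 : R).
  rewrite -[X in _ --> X](mulr0 2); apply: cvgMr.
  have := cvg_comp _ _ (cvg_comp _ _ ry ln_cvgy) (@cvgr_expR R).
  by apply: cvg_trans; apply: near_eq_cvg; near=> x; rewrite /= expRN lnK ?posrE.
have wy : asinh2 x @[x --> +oo] --> +oo.
  apply: gt0_cvgMry => //; last first.
  apply: (@cvg_comp _ _ _ w (@ln R) _ +oo); last exact: ln_cvgy.
  apply/cvgryPge => A; near=> x; apply: (@le_trans _ _ x); last by rewrite lerDl ltW.
  by near: x; apply: nbhs_pinfty_ge; exact: num_real.
have wN x : asinh2 (- x) = - asinh2 x.
  have h := w_gt0 x.
  have -> : asinh2 (- x) = 2 * ln (w x)^-1.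
    rewrite /asinh2; congr (2 * ln _); apply: (mulfI (x := w x)); first by rewrite gt_eqF.
    rewrite (divff (lt0r_neq0 h)) /w rN.
    have -> : (x + r x) * (- x + r x) = r x ^+ 2 - x ^+ 2 by ring.
    by rewrite r_sqr; ring.
  by rewrite lnV ?posrE// mulrN.
have pos x : 0 <= beta_fun a a x by exact: expR_ge0.
have winc x y : x < y -> asinh2 x < asinh2 y.
  move=> xy; rewrite /asinh2 ltr_pM2l// ltr_ln ?posrE// -subr_gt0.
  rewrite -(pmulr_lgt0 _ (addr_gt0 (r_gt0 x) (r_gt0 y))).
  have -> : (w y - w x) * (r x + r y) = (y - x) * (w x + w y) + ((r y ^+ 2 - r x ^+ 2) - (y ^+ 2 - x ^+ 2)).
    by rewrite /w; ring.
  rewrite !r_sqr.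
  have -> : 1 + y ^+ 2 - (1 + x ^+ 2) - (y ^+ 2 - x ^+ 2) = 0 by ring.
  by rewrite addr0 mulr_gt0 ?subr_gt0// addr_gt0.
have H : (\int[leb]_y (beta_fun a a y)%:E =
    \int[leb]_x (((beta_fun a a \o asinh2) * (fun x : R => 2 / r x)) x)%:E)%E.
  rewrite -dE; apply: increasing_ge0_integration_by_substitutionT => //; rewrite ?dE.
  - move=> x; apply: cvgMr; apply: cvgV; last exact: cr.
    by rewrite gt_eqF.
  - apply/cvg_ex; exists 0; apply/cvgNy_compNP.
    by rewrite (_ : _ \o _ = (fun x => 2 / r x))//; apply/funext => x /=; rewrite rN.
  - by apply/cvg_ex; exists 0.
  - by move=> x; have [] := is_derive_asinh2 x.
  - apply/cvgNy_compNP; rewrite (_ : _ \o _ = (fun x => - asinh2 x)); last by apply/funext => x /=; rewrite wN.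
    exact/cvgNrNy.
  - exact: hb.1.
have E x : ((beta_fun a a \o asinh2) * (fun x : R => 2 / r x)) x =
    expR ((1 - 2 * a) * ln 2) * expR (- ((a + 1 / 2) * ln (1 + x ^+ 2))).
  rewrite -[LHS]/(beta_fun a a (asinh2 x) * (2 / r x)).
  have e2 : expR (asinh2 x) = w x ^+ 2 by rewrite /asinh2 expRM_natl lnK ?posrE.
  have e3 : 1 + w x ^+ 2 = 2 * r x * w x.
    by have := r_sqr x; rewrite /w => h; ring: h.
  have lr : ln (1 + x ^+ 2) = 2 * ln (r x) by rewrite -r_sqr lnXn// mulr_natl.
  rewrite /beta_fun e2 e3 !lnM ?posrE ?mulr_gt0// lr /asinh2.
  have -> : 2 / r x = expR (ln 2 - ln (r x)) by rewrite expRB !lnK ?posrE.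
  by rewrite -!expRD; congr expR; field.
have il : integrable_line (fun x => expR ((1 - 2 * a) * ln 2) * expR (- ((a + 1 / 2) * ln (1 + x ^+ 2)))).
  apply/integrableP; split.
    apply/measurable_EFinP; apply: measurable_funM => //.
    apply: measurableT_comp => //; apply: measurable_funN; apply: measurable_funM => //.
    apply: (measurableT_comp (@measurable_ln R)); apply: measurable_continuous => x.
    by apply: cvgD; [exact: cvg_cst|exact: exprn_continuous].
  have -> : (\int[leb]_x `|(EFin \o (fun x => expR ((1 - 2 * a) * ln 2) * expR (- ((a + 1 / 2) * ln (1 + x ^+ 2))))%R) x| =
      \int[leb]_x (((beta_fun a a \o asinh2) * (fun x : R => 2 / r x))%R x)%:E)%E.
    by apply: eq_integral => x _; rewrite E /= ger0_norm// mulr_ge0 ?expR_ge0.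
  by rewrite -H (EFin_Rint ib) ltry.
have il2 : integrable_line (fun x => expR (- ((a + 1 / 2) * ln (1 + x ^+ 2)))).
  have := integrable_lineZ (expR ((1 - 2 * a) * ln 2))^-1 il.
  by apply: eq_integrable => // x _ /=; rewrite mulKf// gt_eqF ?expR_gt0.
apply: EFin_inj; rewrite -(EFin_Rint ib) H -(RintZ _ il2) -(EFin_Rint il).
by apply: eq_integral => x _; rewrite E.
Unshelve. all: by end_near. Qed.

(** Two evaluations of the integral of the beta kernel at s = t = a: by the Gamma function, and
    through the powers of 1 / (1 + x^2). *)
Lemma duplication a : 0 < a ->
  expR ((2 * a - 1) * ln 2) * (Gamma a ^+ 2 / Gamma (2 * a)) =
  Num.sqrt pi * Gamma a / Gamma (a + 1 / 2).
Proof.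
move=> a0; have h : 0 < a + 1 / 2 :> R by rewrite addr_gt0// divr_gt0.
have -> : Gamma a ^+ 2 / Gamma (2 * a) = \int[leb]_y beta_fun a a y.
  by rewrite (Rint_beta_fun a0 a0) (_ : a + a = 2 * a) ?expr2//; ring.
rewrite (Rint_beta_lorentz a0) mulrA -expRD (_ : _ + _ = 0); last by ring.
rewrite expR0 mul1r -(gamma_gauss a0).
by rewrite [RHS]mulrC (mulKf (Gamma_neq0 h)).
Qed.

End duplication.

(** * Monotonicity and moments of the modulus of Gamma *)

Section modulus.
Context {R : realType}.
Implicit Types (f g k G : R -> R) (a b c d s t x y p : R).
Notation leb := (@lebesgue_measure R).
Notation S := (fun s => sq_tr (gamma_fun s)).

Lemma sin_sqr_le x : sin x ^+ 2 <= x ^+ 2.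
Proof.
have pos (z : R) : 0 <= z -> `|sin z| <= z.
  rewrite le_eqVlt => /predU1P[<-|z0]; first by rewrite sin0 normr0.
  have [|c _] := @MVT R (@sin R) (@cos R) 0 z z0.
    by apply: continuous_subspaceT; exact: continuous_sin.
  rewrite sin0 !subr0 => ->; rewrite normrM (gtr0_norm z0).
  by rewrite ler_piMl ?(ltW z0) ?norm_cos_le1.
have h : `|sin x| <= `|x|.
  case: (leP 0 x) => x0; first by rewrite (ger0_norm x0) pos.
  by rewrite -normrN -sinN (ltr0_norm x0) pos// oppr_ge0 ltW.
by rewrite -(real_normK (num_real (sin x))) -(real_normK (num_real x)) lerXn2r// nnegrE.
Qed.

Lemma cos_ge x : 1 - x ^+ 2 / 2 <= cos x.
Proof.
have -> : cos x = 1 - 2 * sin (x / 2) ^+ 2.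
  have := cosD (x / 2) (x / 2); rewrite -splitr => ->.
  by have := cos2sin2 (x / 2); rewrite expr2 => ->; ring.
have := sin_sqr_le (x / 2); rewrite (_ : (x / 2) ^+ 2 = x ^+ 2 / 4); last by field.
lra.
Qed.

(** Bounds y^2 by a combination of exponentials whose integral against the beta kernel is again
    a beta integral. *)
Lemma sqr_le_expR p : p ^+ 2 / 2 <= expR p + expR (- p) - 2.
Proof.
have pos (z : R) : 0 <= z -> z ^+ 2 / 2 <= expR z + expR (- z) - 2.
  move=> z0; have e1 := expR_ge1Dx (- z).
  have h : 1 + z + z ^+ 2 / 2 <= expR z.
    have F0 (u : R) : is_derive u 1 (fun u : R => expR u - 1 - u ^+ 2 / 2 - u) (expR u - u - 1).
      have d2 : is_derive u 1 (fun u : R => u ^+ 2 / 2) u.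
        rewrite (_ : (fun u : R => u ^+ 2 / 2) = (fun u => 2^-1 * (u * u))); last first.
          by apply/funext => v; rewrite expr2 mulrC.
        have h0 := is_deriveM (is_derive_id u (1 : R)) (is_derive_id u (1 : R)).
        have h1 := is_deriveZ (2^-1 : R) h0.
        apply: is_derive_eq h1 _; transitivity (2^-1 * (u * 1 + u * 1)); first by [].
        by field.
      have h := is_deriveB (is_deriveB (is_deriveB (is_derive_expR u) (is_derive_cst (1 : R) u 1)) d2) (is_derive_id u 1).
      by apply: is_derive_eq h _; rewrite subr0.
    move: z0; rewrite le_eqVlt => /predU1P[<-|z0]; first by rewrite expR0 expr0n mul0r !addr0.
    have [|c cI] := @MVT R (fun u : R => expR u - 1 - u ^+ 2 / 2 - u) (fun u => expR u - u - 1) 0 z z0.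
      by apply: continuous_subspaceT; exact: (continuous_of_derive F0).
    rewrite expR0 expr0n mul0r !subr0 subrr subr0 => e.
    have : 0 <= (expR c - c - 1) * z.
      by rewrite mulr_ge0 ?(ltW z0)//; have := expR_ge1Dx c; lra.
    rewrite -e; lra.
  lra.
case: (leP 0 p) => p0; first exact: pos.
have := pos (- p); rewrite sqrrN opprK => h.
have : p ^+ 2 / 2 <= expR (- p) + expR p - 2 by apply: h; rewrite oppr_ge0 ltW.
by rewrite [expR (- p) + _]addrC.
Qed.

Lemma sq_tr_gamma0 s : 0 < s -> S s 0 = Gamma s ^+ 2.
Proof. by move=> s0; rewrite /sq_tr sin_tr0 cos_tr0 -(GammaE s0) expr0n addr0. Qed.

(** Since 1 - cos(xy) <= x^2 y^2 / 2, the transform of the beta kernel at x differs from its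
    value at 0 by at most x^2 times half a second moment, and this moment is O(1/s) relative to
    the mass. *)
Lemma sq_tr_gamma_ge s x : 0 < s ->
  Gamma (s + 1) ^+ 2 * (1 - 2 * x ^+ 2 / s) <= S (s + 1) x.
Proof.
move=> s0; have s1 : 0 < s + 1 by rewrite addr_gt0.
set s' := s + 1 in s1 *.
have hb := beta_fun_decay s1 s1; have hb' := beta_fun_decay s0 s0.
have ib := exp_decay_integrable hb; have ib' := exp_decay_integrable hb'.
have ic := exp_decay_integrable (exp_decay_cos x hb).
have G2 : 0 < 2 * s' by rewrite mulr_gt0.
(* (1 + e^y)^2 / e^y = e^y + e^-y + 2 relates the beta kernels at s and s + 1, so the bound
   of [sqr_le_expR] is integrated exactly *)
have E y : beta_fun s s y = beta_fun s' s' y * (expR y + expR (- y) + 2).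
  have -> : expR y + expR (- y) + 2 = expR (- y + 2 * ln (1 + expR y)).
    rewrite expRD expRM_natl lnK ?posrE ?expR1_gt0// expRN.
    by field; rewrite gt_eqF ?expR_gt0.
  by rewrite /beta_fun -expRD; congr expR; rewrite /s'; ring.
have bnd : \int[leb]_y beta_fun s' s' y - cos_tr (beta_fun s' s') x <=
    x ^+ 2 * (\int[leb]_y beta_fun s s y - 4 * \int[leb]_y beta_fun s' s' y).
  rewrite /cos_tr -(RintB ib ic) -(RintZ 4 ib) -RintB//; last exact: integrable_lineZ.
  rewrite -RintZ; last by apply: integrable_lineB => //; exact: integrable_lineZ.
  apply: le_Rint.
  - exact: integrable_lineB.
  - by apply: integrable_lineZ; apply: integrable_lineB => //; exact: integrable_lineZ.
  move=> y; have := cos_ge (x * y); have := sqr_le_expR y; have := expR_gt0 (s' * y - (s' + s') * ln (1 + expR y)).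
  rewrite -/(beta_fun s' s' y) E exprMn; set u := expR y + _; move=> b0 h1 h2.
  have x2 := sqr_ge0 x.
  have -> : x ^+ 2 * (beta_fun s' s' y * (u + 2) - 4 * beta_fun s' s' y) =
    beta_fun s' s' y * (x ^+ 2 * (u - 2)) by ring.
  have -> : beta_fun s' s' y - beta_fun s' s' y * cos (x * y) =
    beta_fun s' s' y * (1 - cos (x * y)) by ring.
  apply: ler_wpM2l; first exact: ltW.
  apply: (@le_trans _ _ (x ^+ 2 * (y ^+ 2 / 2))); first lra.
  exact: ler_wpM2l.
have GG : 0 < Gamma (2 * s') by exact: Gamma_gt0.
have := ler_wpM2l (ltW GG) bnd.
rewrite mulrBr -sq_tr_gamma// (Rint_beta_fun s1 s1) (Rint_beta_fun s0 s0).
have s20 : 0 < 2 * s by rewrite mulr_gt0.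
have s21 : 0 < 2 * s + 1 by rewrite addr_gt0.
have -> : s + s = 2 * s by ring.
have -> : s' + s' = 2 * s' by ring.
have -> : Gamma s' = s * Gamma s by exact: GammaS.
have -> : Gamma (2 * s') = (2 * s + 1) * (2 * s) * Gamma (2 * s).
  rewrite (_ : 2 * s' = 2 * s + 1 + 1); last by rewrite /s'; ring.
  by rewrite (GammaS s21) (GammaS s20) mulrA.
have := Gamma_neq0 s20; have := Gamma_gt0 s0; set G := Gamma s; set G3 := Gamma (2 * s) => g0 g3.
have -> : (2 * s + 1) * (2 * s) * G3 * (s * G * (s * G) / ((2 * s + 1) * (2 * s) * G3)) = (s * G) ^+ 2.
  by field; rewrite g3 !gt_eqF.
have -> : (2 * s + 1) * (2 * s) * G3 * (x ^+ 2 * (G * G / G3 - 4 * (s * G * (s * G) / ((2 * s + 1) * (2 * s) * G3)))) =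
    (s * G) ^+ 2 * (2 * x ^+ 2 / s).
  by field; rewrite g3 !gt_eqF.
by move=> h; rewrite mulrBr mulr1; lra.
Qed.

(** In the limit of large s the modulus of Gamma(s + ix) no longer depends on x; this is the end
    from which positivity and monotonicity are transported back along the functional equation.
    *)
Lemma sq_tr_gamma_cvg s x : 0 < s ->
  S (s + n%:R) x / Gamma (s + n%:R) ^+ 2 @[n --> \oo] --> (1 : R).
Proof.
move=> s0; rewrite -(cvg_shiftS _).
have sn n : 0 < s + n%:R by rewrite ltr_wpDr.
have sS n : s + n.+1%:R = s + n%:R + 1 by rewrite -natr1 addrA.
have G2 n : 0 < Gamma (s + n%:R) ^+ 2.
  by apply: exprn_gt0; apply: Gamma_gt0; exact: sn.
pose m := Num.min s 1.
have m0 : 0 < m by rewrite lt_min s0 ltr01.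
have [ms m1] : m <= s /\ m <= 1 by rewrite !ge_min !lexx orbT.
have l1 : (1 - 2 * x ^+ 2 * (s + n%:R)^-1) @[n --> \oo] --> (1 : R).
  rewrite -[X in _ --> X]subr0 -[X in _ - X](mulr0 (2 * x ^+ 2)).
  apply: cvgB; first exact: cvg_cst.
  apply: cvgMr.
  have h : m^-1 * harmonic n @[n --> \oo] --> (0 : R).
    by rewrite -[X in _ --> X](mulr0 m^-1); apply: cvgMr; exact: cvg_harmonic.
  apply: (squeeze_cvgr _ (cvg_cst 0) h).
  apply: nearW => n; rewrite invr_ge0 (ltW (sn n)) /= /harmonic -invfM.
  rewrite lef_pV2 ?posrE ?mulr_gt0 ?ltr0n// -natr1.
  have := ler0n R n; nra.
have : (fun n => S (s + n.+1%:R) x / Gamma (s + n.+1%:R) ^+ 2) @ \oo --> (1 : R); last by [].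
have l2 : (fun _ : nat => 1 : R) @ \oo --> (1 : R) by exact: cvg_cst.
refine (squeeze_cvgr _ l1 l2).
apply: nearW => n; rewrite ler_pdivlMr; last exact: G2.
rewrite ler_pdivrMr; last exact: G2.
rewrite mul1r sS mulrC sq_tr_gamma_ge; last exact: sn.
by rewrite sq_tr_gamma_le// -sS.
Qed.

Lemma sq_tr_gammaSn s n x : 0 < s ->
  S (s + n.+1%:R) x = ((s + n%:R) ^+ 2 + x ^+ 2) * S (s + n%:R) x.
Proof.
by move=> s0; rewrite -natr1 addrA sq_tr_gammaS// ltr_wpDr.
Qed.

Lemma sq_tr_gamma_gt0 s x : 0 < s -> 0 < S s x.
Proof.
move=> s0.
have [n hn] : exists n, 0 < S (s + n%:R) x.
  have h := cvgr_gt (1 : R) (sq_tr_gamma_cvg x s0) 0 ltr01.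
  have [n _ /(_ n (leqnn n)) /=] := h; rewrite pmulr_lgt0; first by exists n.
  rewrite invr_gt0; apply: exprn_gt0; apply: Gamma_gt0; exact: ltr_wpDr.
elim: n hn => [|n ih]; first by rewrite addr0.
rewrite (sq_tr_gammaSn n x s0) pmulr_rgt0; first exact: ih.
by rewrite ltr_pwDl ?sqr_ge0// exprn_gt0// ltr_wpDr.
Qed.

(** For x^2 <= y^2 the factors s^2 + x^2 of the functional equation are ordered in the same way,
    so the inequality at s + n, which becomes an equality in the limit, propagates down to s. *)
Lemma sq_tr_gamma_homo s x y : 0 < s -> x ^+ 2 <= y ^+ 2 -> S s y <= S s x.
Proof.
move=> s0 xy.
(* the claim at n = 0 is an equality; dividing by Gamma(s + n)^2 and letting n grow gives the
   lemma *)
have claim n : S s y * S (s + n%:R) x <= S s x * S (s + n%:R) y.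
  elim: n => [|n ih]; first by rewrite addr0 mulrC.
  rewrite (sq_tr_gammaSn n x s0) (sq_tr_gammaSn n y s0) mulrCA [X in _ <= X]mulrCA.
  apply: ler_pM.
  - by rewrite addr_ge0 ?sqr_ge0.
  - by rewrite mulr_ge0 ?sq_tr_ge0.
  - by rewrite lerD2l.
  - exact: ih.
rewrite -[X in X <= _]mulr1 -[X in _ <= X]mulr1.
have c1 : (fun n => S s y * (S (s + n%:R) x / Gamma (s + n%:R) ^+ 2)) @ \oo --> S s y * 1.
  by apply: cvgMr; exact: sq_tr_gamma_cvg.
have c2 : (fun n => S s x * (S (s + n%:R) y / Gamma (s + n%:R) ^+ 2)) @ \oo --> S s x * 1.
  by apply: cvgMr; exact: sq_tr_gamma_cvg.
refine (ler_cvg_to c1 c2 _).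
apply: nearW => n; rewrite !mulrA; apply: ler_wpM2r => //.
by rewrite invr_ge0 sqr_ge0.
Qed.

(** Monotonicity at s + 1 says that (s^2 + x^2) |Gamma(s + ix)|^2 is also decreasing in |x|;
    this quantifies how fast |Gamma(s + ix)|^2 itself decreases. *)
Lemma sq_tr_gamma_gap s x y : 0 < s -> x ^+ 2 <= y ^+ 2 ->
  S s x * ((y ^+ 2 - x ^+ 2) / (s ^+ 2 + y ^+ 2)) <= S s x - S s y.
Proof.
move=> s0 xy; have s1 : 0 < s + 1 by rewrite addr_gt0.
have := sq_tr_gamma_homo s1 xy; rewrite (sq_tr_gammaS x s0) (sq_tr_gammaS y s0) => h.
have D0 : 0 < s ^+ 2 + y ^+ 2 by rewrite ltr_pwDl ?sqr_ge0 ?exprn_gt0.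
rewrite mulrA ler_pdivrMr// mulrBl; nra.
Qed.

Lemma continuous_cos_tr f : exp_decay f -> continuous (cos_tr f).
Proof.
move=> hf x; have hi := exp_decay_integrable hf.
have := @continuity_under_integral _ _ _ leb (fun x p => f p * cos (x * p)) setT measurableT (x - 1) (x + 1) _ _ (fun p => `|f p|) _ _ x.
apply.
- by move=> z _; exact/exp_decay_integrable/exp_decay_cos.
- apply: aeW => p _ z _; apply: cvgM; first exact: cvg_cst.
  apply: (@continuous_comp _ _ _ (fun x => x * p) (@cos R)); last exact: continuous_cos.
  by apply: cvgMl; exact: cvg_id.
- exact: integrable_line_abs.
- by move=> z _; apply: aeW => p _; rewrite normrM ler_piMr// norm_cos_le1.
- by rewrite inE /= in_itv /= ltrDl ltrBlDr ltrDl ltr01.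
Qed.

Lemma continuous_sq_tr_gamma s : 0 < s -> continuous (S s).
Proof.
move=> s0 x; have h := continuous_cos_tr (beta_fun_decay s0 s0).
rewrite (_ : S s = (fun x => Gamma (2 * s) * cos_tr (beta_fun s s) x)).
  by apply: cvgMr; exact: h.
by apply/funext => z; rewrite sq_tr_gamma.
Qed.

Lemma Rint_sq_tr_gamma s : 0 < s ->
  \int[leb]_x S s x = 2 * pi * (expR (- (2 * s * ln 2)) * Gamma (2 * s)).
Proof.
move=> s0; have h := sqi_tr_gamma s0; have [e _] := sqi_tr_parseval h h.
have ss : s + s = 2 * s by ring.
rewrite -ss -(Rint_gamma_funM s0 s0) -e; apply: eq_Rint => x.
by rewrite (cos_tr_convol x h.1 h.1) /sq_tr !expr2.
Qed.

(** Iterating the functional equation, x^(2n) |Gamma(s + ix)|^2 <= |Gamma(s + n + ix)|^2, whose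
    integral is explicit. *)
Lemma moment_sq_tr_gamma s n : 0 < s ->
  integrable_line (fun x => x ^+ (2 * n) * S s x) /\
  \int[leb]_x (x ^+ (2 * n) * S s x) <=
    2 * pi * (expR (- (2 * (s + n%:R) * ln 2)) * Gamma (2 * (s + n%:R))).
Proof.
move=> s0; have sn : 0 < s + n%:R by rewrite ltr_wpDr.
have le x : x ^+ (2 * n) * S s x <= S (s + n%:R) x.
  elim: n {sn} => [|n ih]; first by rewrite muln0 expr0 mul1r addr0.
  rewrite (sq_tr_gammaSn n x s0) mulnS exprD -mulrA; apply: ler_pM.
  - exact: sqr_ge0.
  - by rewrite mulr_ge0 ?sq_tr_ge0// exprM exprn_ge0 ?sqr_ge0.
  - by rewrite lerDr sqr_ge0.
  - exact: ih.
have [hd hi] := sqi_tr_gamma s0; have [hd' hi'] := sqi_tr_gamma sn.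
have h0 x : 0 <= x ^+ (2 * n) * S s x.
  by rewrite mulr_ge0 ?sq_tr_ge0// exprM exprn_ge0 ?sqr_ge0.
have hx : integrable_line (fun x => x ^+ (2 * n) * S s x).
  apply: integrable_line_le hi'.
    by apply: measurable_funM; [exact: measurable_funX|exact: measurable_sq_tr].
  by move=> x; rewrite (ger0_norm (h0 x)).
by split=> //; rewrite -(Rint_sq_tr_gamma sn); exact: le_Rint.
Qed.

(** The ratio of consecutive bounds is at most (2s + 1)^2 / 4 times (2n + 2)(2n + 1). *)
Lemma moment_fact_bound s n : 0 < s ->
  2 * pi * (expR (- (2 * (s + n%:R) * ln 2)) * Gamma (2 * (s + n%:R))) <=
  2 * pi * (expR (- (2 * s * ln 2)) * Gamma (2 * s)) *
    ((2 * s + 1) ^+ 2 / 4) ^+ n * (2 * n)`!%:R.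
Proof.
move=> s0; elim: n => [|n ih]; first by rewrite addr0 muln0 expr0 !mulr1.
set A := 2 * pi * (_ * Gamma (2 * s)) in ih *.
have s2 : 0 < 2 * (s + n%:R) by rewrite mulr_gt0// ltr_wpDr.
have s3 : 0 < 2 * (s + n%:R) + 1 by rewrite addr_gt0.
have -> : Gamma (2 * (s + n.+1%:R)) = (2 * (s + n%:R) + 1) * (2 * (s + n%:R)) * Gamma (2 * (s + n%:R)).
  rewrite (_ : 2 * (s + n.+1%:R) = 2 * (s + n%:R) + 1 + 1); last by rewrite -natr1; ring.
  by rewrite (GammaS s3) (GammaS s2) mulrA.
have -> : expR (- (2 * (s + n.+1%:R) * ln 2)) = 4^-1 * expR (- (2 * (s + n%:R) * ln 2)).
  rewrite (_ : - _ = - (2 * ln 2) - 2 * (s + n%:R) * ln 2); last by rewrite -natr1; ring.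
  rewrite expRD; congr (_ * _); rewrite expRN expRM_natl lnK ?posrE//.
  by congr (_^-1); ring.
have -> : (2 * n.+1)`!%:R = (2 * n%:R + 2) * (2 * n%:R + 1) * (2 * n)`!%:R :> R.
  rewrite mulnS !factS !natrM mulrA; congr (_ * _ * _); rewrite -?natr1 natrM; ring.
set B := 2 * pi * _ in ih; set g := Gamma _ in B ih *; set e := expR _ in B ih *.
have -> : 2 * pi * (4^-1 * e * ((2 * (s + n%:R) + 1) * (2 * (s + n%:R)) * g)) =
  ((2 * (s + n%:R) + 1) * (2 * (s + n%:R)) / 4) * B by rewrite /B; ring.
rewrite exprSr.
set P := _ ^+ n in ih *; set F := (2 * n)`!%:R in ih *.
have -> : A * (P * ((2 * s + 1) ^+ 2 / 4)) * ((2 * n%:R + 2) * (2 * n%:R + 1) * F) =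
  ((2 * s + 1) * (2 * n%:R + 2) * ((2 * s + 1) * (2 * n%:R + 1)) / 4) * (A * P * F) by ring.
have n0 : 0 <= n%:R :> R by [].
apply: ler_pM => //.
- by rewrite divr_ge0// mulr_ge0// ltW.
- by rewrite /B mulr_ge0 ?mulr_ge0 ?pi_ge0 ?expR_ge0// ltW// Gamma_gt0.
- rewrite ler_pM2r ?invr_gt0//; apply: ler_pM; [exact: ltW|exact: ltW|nra|nra].
Qed.

End modulus.

(** * Laguerre functions *)

Section laguerre.
Context {R : realType}.
Implicit Types (f g G : R -> R) (a b c d s t x y p : R).
Notation leb := (@lebesgue_measure R).

(** The real Pochhammer symbol; the one of the statement is complex. *)
Definition rising x j : R := \prod_(i < j) (x + i%:R).

Lemma risingS x j : rising x j.+1 = x * rising (x + 1) j.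
Proof.
rewrite /rising big_ord_recl /= addr0; congr (_ * _); apply: eq_bigr => i _.
by rewrite /bump leq0n add1n -natr1; ring.
Qed.

Lemma risingSr x j : rising x j.+1 = rising x j * (x + j%:R).
Proof. by rewrite /rising big_ord_recr. Qed.

Lemma rising_diff x j : rising (x + 1) j - rising x j = j%:R * rising (x + 1) j.-1.
Proof.
case: j => [|j]; first by rewrite /rising !big_ord0 subrr mul0r.
by rewrite risingSr risingS /= -natr1; ring.
Qed.

(** Pascal's rule in the form needed for inductions on n: the weights c^k C(n + 1, k) are those
    of order n applied to g k + c g (k + 1). *)
Lemma binomial_recurrence n c (g : nat -> R) :
  \sum_(k < n.+2) c ^+ k * 'C(n.+1, k)%:R * g k =
  \sum_(k < n.+1) c ^+ k * 'C(n, k)%:R * (g k + c * g k.+1).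
Proof.
rewrite big_ord_recl /= bin0 expr0 !mul1r.
under eq_bigr => k _ do rewrite /bump /= add1n binS natrD mulrDr mulrDl.
rewrite big_split /= addrA.
under [RHS]eq_bigr => k _ do rewrite mulrDr.
rewrite [RHS]big_split /=; congr (_ + _).
  rewrite big_ord_recr /= bin_small// mulr0 mul0r addr0.
  by rewrite [RHS]big_ord_recl /= bin0 expr0 !mul1r.
by apply: eq_bigr => k _; rewrite exprS; ring.
Qed.

(** Each difference lowers the order of a rising factorial by one ([rising_diff]).
    Orthogonality rests on this form of the Chu-Vandermonde identity, whose right-hand side
    vanishes when j < n. *)
Lemma rising_difference n j x :
  \sum_(k < n.+1) (-1) ^+ k * 'C(n, k)%:R * rising (x + k%:R) j =
  (-1) ^+ n * (j ^_ n)%:R * rising (x + n%:R) (j - n).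
Proof.
elim: n j x => [|n ih] j x.
  by rewrite big_ord1 /= bin0 ffactn0 !mul1r addr0 subn0.
rewrite (binomial_recurrence n (-1) (fun k => rising (x + k%:R) j)).
have E (k : nat) : rising (x + k%:R) j + -1 * rising (x + k.+1%:R) j = - (j%:R * rising (x + 1 + k%:R) j.-1).
  have := rising_diff (x + k%:R) j.
  by rewrite [x + k%:R + 1]addrAC -natr1 [k%:R + 1]addrC [x + (1 + _)]addrA => <-; ring.
under eq_bigr => k _ do rewrite E mulrN mulrCA.
rewrite sumrN -mulr_sumr ih ffactnS natrM exprS.
rewrite -[X in rising X]addrA -natr1 [1 + _]addrC.
case: j {E} => [|j]; first by rewrite !mul0r !mulr0 mul0r oppr0.
by rewrite subSS /=; ring.
Qed.

Variable lam : R.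
Hypothesis lam_gt0 : 0 < lam.
Let a := 2 * lam.
Let a_gt0 : 0 < a. Proof. by rewrite mulr_gt0. Qed.
Let an_gt0 n : 0 < a + n%:R. Proof. by rewrite ltr_wpDr. Qed.
Let two_neq0 : 2 != 0 :> R. Proof. by rewrite pnatr_eq0. Qed.

(** The coefficient of (lam + ix)_j in the terminating series 2F1(-n, lam + ix; 2 lam | 2). *)
Definition lag_coef n j : R :=
  (-1) ^+ j * 'C(n, j)%:R * 2 ^+ j * (Gamma a / Gamma (a + j%:R)).

Definition lag n p : R := \sum_(j < n.+1) lag_coef n j * gamma_fun (lam + j%:R) p.

Let lamn_gt0 n : 0 < lam + n%:R. Proof. by rewrite ltr_wpDr. Qed.

Lemma sqi_tr_lag n : sqi_tr (lag n).
Proof.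
by apply: (@sqi_tr_sum _ n.+1 (fun j p => lag_coef n j * gamma_fun (lam + j%:R) p)) => j _; apply: sqi_trZ; apply: sqi_tr_gamma.
Qed.

Lemma Gamma_rising s n : 0 < s -> Gamma (s + n%:R) = rising s n * Gamma s.
Proof.
move=> s0; elim: n => [|n ih]; first by rewrite /rising big_ord0 mul1r addr0.
rewrite -[n.+1%:R]natr1 addrA GammaS; last exact: ltr_wpDr.
by rewrite ih risingSr mulrCA mulrA.
Qed.

(** The sum over k is an n-th difference of a polynomial of degree j <= m; when m < n it
    vanishes, and when m = n only the leading coefficient survives. *)
Lemma Rint_lag m n : \int[leb]_p (lag m p * lag n p) =
  (m == n)%:R * (expR (- (a * ln 2)) * (Gamma a ^+ 2 * n`!%:R / Gamma (a + n%:R))).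
Proof.
wlog mn : m n / (m <= n)%N.
  move=> h; case: (leqP m n) => [/h//|/ltnW/h e].
  rewrite (@eq_Rint _ _ (fun p => lag n p * lag m p)); last by move=> p; rewrite mulrC.
  rewrite e eq_sym; case: eqP => [->|_]; last by rewrite !mul0r.
  by [].
pose F j k p := lag_coef m j * lag_coef n k * (gamma_fun (lam + j%:R) p * gamma_fun (lam + k%:R) p).
have iG j k : integrable_line (fun p => gamma_fun (lam + j%:R) p * gamma_fun (lam + k%:R) p).
  have [K [_ hK]] := exp_decay_bounded (gamma_fun_decay (lamn_gt0 k)).
  apply: (@integrable_lineM _ _ _ K) => //.
    exact/exp_decay_integrable/gamma_fun_decay.
  by apply: measurable_continuous; have [] := gamma_fun_decay (lamn_gt0 k).
have iF j k : integrable_line (F j k) by exact: integrable_lineZ.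
have E p : lag m p * lag n p = \sum_(j < m.+1) \sum_(k < n.+1) F j k p.
  rewrite /lag mulr_suml; apply: eq_bigr => j _; rewrite mulr_sumr; apply: eq_bigr => k _.
  by rewrite /F mulrACA.
have R1 j := @Rint_sum _ n.+1 (F j) (fun k _ => iF j k).
have [_ R2] := @Rint_sum _ m.+1 (fun j p => \sum_(k < n.+1) F j k p) (fun j _ => (R1 j).1).
rewrite (eq_Rint E) R2.
pose C := expR (- (a * ln 2)) * Gamma a ^+ 2.
have T j k : \int[leb]_p F j k p = C * ((-1) ^+ j * 'C(m, j)%:R / Gamma (a + j%:R)) *
    ((-1) ^+ k * 'C(n, k)%:R * rising (a + k%:R) j).
  have -> : \int[leb]_p F j k p = lag_coef m j * lag_coef n k *
      (expR (- ((a + j%:R + k%:R) * ln 2)) * Gamma (a + k%:R + j%:R)).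
    rewrite (RintZ _ (iG j k)) (Rint_gamma_funM (lamn_gt0 j) (lamn_gt0 k)).
    have -> : lam + j%:R + (lam + k%:R) = a + j%:R + k%:R by rewrite /a; ring.
    by rewrite [a + k%:R + j%:R]addrAC.
  rewrite (Gamma_rising j (an_gt0 k)).
  have -> : expR (- ((a + j%:R + k%:R) * ln 2)) = expR (- (a * ln 2)) / (2 ^+ j * 2 ^+ k).
    rewrite (_ : - _ = - (a * ln 2) - (j%:R * ln 2 + k%:R * ln 2)); last by ring.
    by rewrite expRB expRD !expRM_natl lnK ?posrE.
  rewrite /lag_coef /C; have := Gamma_neq0 (an_gt0 k); have := Gamma_neq0 (an_gt0 j).
  have := expf_neq0 j two_neq0; have := expf_neq0 k two_neq0.
  move: (Gamma a) (Gamma (a + j%:R)) (Gamma (a + k%:R)) (expR _) (rising _ _) (2 ^+ j) (2 ^+ k)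
    => g gj gk e r tj tk k0 j0 h1 h2.
  by field; rewrite h1 h2 j0 k0.
under eq_bigr => j _.
  rewrite (R1 j).2; under eq_bigr => k _ do rewrite T.
  rewrite -mulr_sumr rising_difference.
  over.
case: (eqVneq m n) => [->|mneq]; last first.
  rewrite mul0r big1// => j _; rewrite ffact_small ?mulr0 ?mul0r ?mulr0//.
  by apply: leq_trans (ltn_ord j) _; rewrite ltn_neqAle mneq.
rewrite mul1r big_ord_recr /= big1 ?add0r; last first.
  by move=> j _; rewrite ffact_small ?mulr0 ?mul0r ?mulr0.
rewrite binn ffactnn subnn /rising big_ord0 /C !mulr1.
have := Gamma_neq0 (an_gt0 n) => h.
transitivity (expR (- (a * ln 2)) * (Gamma a ^+ 2 * n`!%:R / Gamma (a + n%:R)) * ((-1) ^+ n) ^+ 2).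
  ring.
by rewrite sqrr_sign mulr1.
Qed.

(** This is - tanh(y/2); the sign makes it equal to 1 - 2v with v = e^y / (1 + e^y). *)
Definition opp_tanh_half y : R := (1 - expR y) / (1 + expR y).
(** The moments to which the entries of the matrix reduce. *)
Definition tanh_moment N : R := \int[leb]_y (beta_fun a a y * opp_tanh_half y ^+ N).
Let v y : R := expR y / (1 + expR y).

Let u1_gt0 y : 0 < 1 + expR y. Proof. exact: expR1_gt0. Qed.

Let opp_tanh_halfE y : opp_tanh_half y = 1 - 2 * v y.
Proof. by rewrite /opp_tanh_half /v; field; rewrite gt_eqF. Qed.

Let is_derive_ln1expR y : is_derive y 1 (fun y => ln (1 + expR y)) (v y).
Proof.
have hd : is_derive y 1 (fun y => (1 + expR y)) (expR y).
  by apply: is_derive_eq (is_deriveD (is_derive_cst (1 : R) y 1) (is_derive_expR y)) _; rewrite add0r.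
have hl := is_derive_chain (g := fun y => 1 + expR y) (is_derive1_ln (u1_gt0 y)) hd.
by apply: is_derive_eq hl _; rewrite mulrC.
Qed.

Lemma is_derive_opp_tanh_half y : is_derive y 1 opp_tanh_half (- ((1 - opp_tanh_half y ^+ 2) / 2)).
Proof.
have vE z : v z = expR (z - ln (1 + expR z)) by rewrite expRB lnK ?posrE.
rewrite (_ : opp_tanh_half = (fun z => 1 - 2 * expR (z - ln (1 + expR z)))); last first.
  by apply/funext => z; rewrite opp_tanh_halfE vE.
have h := is_derive_chain (g := fun z => z - ln (1 + expR z)) (is_derive_expR _)
  (is_deriveB (is_derive_id y (1 : R)) (is_derive_ln1expR y)).
have h2 := is_deriveB (is_derive_cst (1 : R) y 1) (is_deriveZ (2 : R) h).
apply: is_derive_eq h2 _.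
transitivity (0 - 2 * (expR (y - ln (1 + expR y)) * (1 - v y))); first by [].
by rewrite -vE; field.
Qed.

Lemma opp_tanh_half_norm y : `|opp_tanh_half y| <= 1.
Proof.
have e := expR_gt0 y; rewrite /opp_tanh_half normrM normfV (gtr0_norm (u1_gt0 y)).
rewrite ler_pdivrMr// mul1r ler_norml; apply/andP; split; lra.
Qed.

Lemma continuous_opp_tanh_half : continuous opp_tanh_half.
Proof. exact: continuous_of_derive is_derive_opp_tanh_half. Qed.

Let hb : exp_decay (beta_fun a a). Proof. exact: beta_fun_decay. Qed.

Lemma exp_decay_tanh_moment N : exp_decay (fun y => beta_fun a a y * opp_tanh_half y ^+ N).
Proof.
apply: (@exp_decayM _ _ _ 1) => //.
  by move=> y; apply: (@continuous_comp _ _ _ opp_tanh_half (fun z => z ^+ N)); [exact: continuous_opp_tanh_half|exact: exprn_continuous].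
by move=> y; rewrite normrX exprn_ile1// opp_tanh_half_norm.
Qed.

Lemma is_derive_beta y : is_derive y 1 (beta_fun a a) (beta_fun a a y * (a * opp_tanh_half y)).
Proof.
have h := is_deriveB (is_derive_scale a y) (is_deriveZ (a + a) (is_derive_ln1expR y)).
apply: is_derive_eq (is_derive_chain (g := fun y => a * y - (a + a) * ln (1 + expR y)) (is_derive_expR _) h) _.
rewrite -/(beta_fun a a y); congr (_ * _).
transitivity (a - (a + a) * v y); first by [].
by rewrite opp_tanh_halfE; ring.
Qed.

(** The integral of the derivative of the beta kernel times the power N + 1 of tanh(y/2) is
    zero. *)
Lemma tanh_moment_rec N : (2 * a + N.+1%:R) * tanh_moment N.+2 = N.+1%:R * tanh_moment N.
Proof.
pose F y := beta_fun a a y * opp_tanh_half y ^+ N.+1.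
pose f y := (a + N.+1%:R / 2) * (beta_fun a a y * opp_tanh_half y ^+ N.+2) +
            - (N.+1%:R / 2) * (beta_fun a a y * opp_tanh_half y ^+ N).
have dF y : is_derive y 1 F (f y).
  have hp : is_derive y 1 (fun y => opp_tanh_half y ^+ N.+1)
      (N.+1%:R * opp_tanh_half y ^+ N * - ((1 - opp_tanh_half y ^+ 2) / 2)).
    rewrite (_ : (fun y => opp_tanh_half y ^+ N.+1) = opp_tanh_half ^+ N.+1); last first.
      by apply/funext => z; rewrite exprfctE.
    have h := is_deriveX N.+1 (is_derive_opp_tanh_half y).
    apply: is_derive_eq h _.
    by [].
  apply: is_derive_eq (is_deriveM (is_derive_beta y) hp) _.
  transitivity (beta_fun a a y * (N.+1%:R * opp_tanh_half y ^+ N * - ((1 - opp_tanh_half y ^+ 2) / 2)) +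
     opp_tanh_half y ^+ N.+1 * (beta_fun a a y * (a * opp_tanh_half y))); first by [].
  by rewrite /f !exprS; field.
have iN := exp_decay_integrable (exp_decay_tanh_moment N); have iN2 := exp_decay_integrable (exp_decay_tanh_moment N.+2).
have fd : exp_decay f by apply: exp_decayD; apply: exp_decayZ; exact: exp_decay_tanh_moment.
have [F1 F2] := exp_decay_cvg (exp_decay_tanh_moment N.+1).
have := FTC_line fd.1 dF F1 F2 (exp_decay_integrable fd).
rewrite (Rint_lin _ _ iN2 iN) -/(tanh_moment N) -/(tanh_moment N.+2) subr0 => /eqP.
rewrite mulNr subr_eq0 => /eqP e.
transitivity (2 * ((a + N.+1%:R / 2) * tanh_moment N.+2)); first by field.
by rewrite e; field.
Qed.

Lemma tanh_moment1 : tanh_moment 1 = 0.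
Proof.
have := Rint_odd (exp_decay_integrable (exp_decay_tanh_moment 1)); apply=> y.
have -> : opp_tanh_half (- y) = - opp_tanh_half y.
  by rewrite /opp_tanh_half expRN; field; rewrite !gt_eqF ?expR_gt0//; have := expR_gt0 y; lra.
have -> : beta_fun a a (- y) = beta_fun a a y.
  rewrite /beta_fun; congr expR.
  have -> : ln (1 + expR (- y)) = ln (1 + expR y) - y.
    have -> : 1 + expR (- y) = (1 + expR y) / expR y.
      by rewrite expRN; field; rewrite gt_eqF ?expR_gt0.
    by rewrite ln_div ?posrE ?expR_gt0// expRK.
  ring.
by rewrite !expr1 mulrN.
Qed.

Lemma tanh_moment_odd N : odd N -> tanh_moment N = 0.
Proof.
elim/ltn_ind: N => -[|[|N]] ih//= oN; first exact: tanh_moment1.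
have := tanh_moment_rec N; rewrite (ih N)//; last by rewrite negbK in oN.
rewrite mulr0 => /eqP; rewrite mulf_eq0 => /orP[|/eqP//].
by rewrite gt_eqF// addr_gt0 ?mulr_gt0.
Qed.

(** At r = 0 this is the duplication formula; the recursion matches the functional equation of
    Gamma. *)
Lemma tanh_moment_even r : expR ((2 * a - 1) * ln 2) * tanh_moment (2 * r) =
  Gamma a * Gamma (r%:R + 1 / 2) / Gamma (a + r%:R + 1 / 2).
Proof.
have h12 : 0 < 1 / 2 :> R by rewrite divr_gt0.
elim: r => [|r ih].
  rewrite muln0 add0r addr0 Gamma_half [Gamma a * _]mulrC.
  rewrite -(duplication a_gt0); congr (_ * _).
  rewrite /tanh_moment (@eq_Rint _ _ (beta_fun a a)); last by move=> y; rewrite expr0 mulr1.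
  by rewrite (Rint_beta_fun a_gt0 a_gt0) expr2; congr (_ / Gamma _); ring.
have r0 : 0 < r%:R + 1 / 2 :> R by rewrite ltr_wpDl.
have ar0 : 0 < a + r%:R + 1 / 2 by rewrite addr_gt0.
have -> : r.+1%:R + 1 / 2 = r%:R + 1 / 2 + 1 :> R by rewrite -natr1; ring.
have -> : a + r.+1%:R + 1 / 2 = a + r%:R + 1 / 2 + 1 by rewrite -natr1; ring.
rewrite (GammaS r0) (GammaS ar0).
have := tanh_moment_rec (2 * r); rewrite (_ : (2 * r).+2 = (2 * r.+1)%N); last by rewrite mulnS.
have -> : 2 * a + (2 * r).+1%:R = 2 * (a + r%:R + 1 / 2) by rewrite -[(2 * r).+1%:R]natr1 natrM; field.
have -> : (2 * r).+1%:R = 2 * (r%:R + 1 / 2) :> R by rewrite -[(2 * r).+1%:R]natr1 natrM; field.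
move=> e; have ar0' := lt0r_neq0 ar0.
have -> : tanh_moment (2 * r.+1) = (r%:R + 1 / 2) / (a + r%:R + 1 / 2) * tanh_moment (2 * r).
  move: e ar0'; set z := a + r%:R + 1 / 2; set w := r%:R + 1 / 2 => e z0.
  apply: (mulfI (x := 2 * z)); first by rewrite mulf_neq0// pnatr_eq0.
  by rewrite e; field; exact: z0.
rewrite mulrCA ih; move: (Gamma_neq0 ar0) ar0' => {e}.
set G1 := Gamma (a + _ + _); set z := a + _ + _ => h1 h2.
by field; rewrite h1 h2.
Qed.

Let W i N : R := \int[leb]_y (beta_fun a a y * opp_tanh_half y ^+ N * v y ^+ i).

Let v_norm y : `|v y| <= 1.
Proof.
have e := expR_gt0 y; rewrite /v normrM normfV (gtr0_norm (u1_gt0 y)) (gtr0_norm e).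
by rewrite ler_pdivrMr// mul1r lerDr.
Qed.

Let continuous_v : continuous v.
Proof.
move=> y; have := continuous_opp_tanh_half (x := y); rewrite /continuous_at => h.
rewrite (_ : v = (fun z => 2^-1 * (1 - opp_tanh_half z))); last first.
  by apply/funext => z; rewrite opp_tanh_halfE; field.
by apply: cvgMr; apply: cvgB => //; exact: cvg_cst.
Qed.

Let exp_decay_W i N : exp_decay (fun y => beta_fun a a y * opp_tanh_half y ^+ N * v y ^+ i).
Proof.
apply: (@exp_decayM _ _ _ 1); first exact: exp_decay_tanh_moment.
  by move=> y; apply: (@continuous_comp _ _ _ v (fun z => z ^+ i)); [exact: continuous_v|exact: exprn_continuous].
by move=> y; rewrite normrX exprn_ile1// v_norm.
Qed.

Let WS i N : W i N.+1 = W i N + -2 * W i.+1 N.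
Proof.
have h1 := exp_decay_integrable (exp_decay_W i N).
have h2 := exp_decay_integrable (exp_decay_W i.+1 N).
rewrite /W -(RintZ _ h2) -RintD//; last exact: integrable_lineZ.
by apply: eq_Rint => y; rewrite !exprS {1}opp_tanh_halfE; ring.
Qed.

Let W_binomial n i N :
  \sum_(k < n.+1) (-2) ^+ k * 'C(n, k)%:R * W (i + k)%N N = W i (N + n).
Proof.
elim: n i N => [|n ih] i N; first by rewrite big_ord1 /= bin0 expr0 !mul1r !addn0.
rewrite (binomial_recurrence n (-2) (fun k => W (i + k)%N N)).
by under eq_bigr => k _ do rewrite addnS -WS; rewrite ih addSnnS.
Qed.

Let W0 l : W l 0 = Gamma a * (Gamma (a + l%:R) / Gamma (2 * a + l%:R)).
Proof.
rewrite /W (@eq_Rint _ _ (beta_fun (a + l%:R) a)).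
  rewrite (Rint_beta_fun (an_gt0 l) a_gt0).
  have -> : a + l%:R + a = 2 * a + l%:R by ring.
  ring.
move=> y; rewrite expr0 mulr1 /v exprMn exprVn -expRM_natl.
have -> : (1 + expR y) ^- l = expR (- (l%:R * ln (1 + expR y))).
  by rewrite expRN expRM_natl lnK ?posrE.
by rewrite /beta_fun -!expRD; congr expR; ring.
Qed.

Lemma convol_lag m n y : convol (lag m) (lag n) y =
  \sum_(j < m.+1) \sum_(k < n.+1) lag_coef m j * lag_coef n k * Gamma (a + j%:R + k%:R) *
    beta_fun (lam + j%:R) (lam + k%:R) y.
Proof.
pose F j k q := lag_coef m j * lag_coef n k *
  (gamma_fun (lam + j%:R) (q + y) * gamma_fun (lam + k%:R) q).
have hg j := gamma_fun_decay (lamn_gt0 j).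
have iG j k : integrable_line (fun q => gamma_fun (lam + j%:R) (q + y) * gamma_fun (lam + k%:R) q).
  have [K [_ hK]] := exp_decay_bounded (hg k).
  apply: (@integrable_lineM _ _ _ K) => //.
    by apply: exp_decay_integrable; exact: exp_decay_shift.
  by apply: measurable_continuous; have [] := hg k.
have iF j k : integrable_line (F j k) by exact: integrable_lineZ.
have R1 j := @Rint_sum _ n.+1 (F j) (fun k _ => iF j k).
have [_ R2] := @Rint_sum _ m.+1 (fun j p => \sum_(k < n.+1) F j k p) (fun j _ => (R1 j).1).
transitivity (\int[leb]_q \sum_(j < m.+1) \sum_(k < n.+1) F j k q).
  apply: eq_Rint => q; rewrite /lag mulr_suml; apply: eq_bigr => j _.
  by rewrite mulr_sumr; apply: eq_bigr => k _; rewrite /F mulrACA.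
rewrite R2; apply: eq_bigr => j _; rewrite (R1 j).2; apply: eq_bigr => k _.
rewrite (RintZ _ (iG j k)) -[in RHS]mulrA; congr (_ * _).
have -> : a + j%:R + k%:R = lam + j%:R + (lam + k%:R) by rewrite /a; ring.
exact: (convol_gamma_fun y (lamn_gt0 j) (lamn_gt0 k)).
Qed.

(** The correlation of two Laguerre functions against the beta kernel becomes a double binomial
    sum, which is the expansion of (1 - 2v)^(m + n) with v = e^y / (1 + e^y). *)
Lemma Rint_beta_lag m n :
  \int[leb]_y (beta_fun lam lam y * convol (lag m) (lag n) y) = Gamma a * tanh_moment (m + n).
Proof.
pose F j k y := lag_coef m j * lag_coef n k * Gamma (a + j%:R + k%:R) *
  beta_fun (a + j%:R) (a + k%:R) y.
have ib j k := exp_decay_integrable (beta_fun_decay (an_gt0 j) (an_gt0 k)).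
have iF j k : integrable_line (F j k) by exact: integrable_lineZ.
have R1 j := @Rint_sum _ n.+1 (F j) (fun k _ => iF j k).
have [_ R2] := @Rint_sum _ m.+1 (fun j p => \sum_(k < n.+1) F j k p) (fun j _ => (R1 j).1).
transitivity (\int[leb]_y \sum_(j < m.+1) \sum_(k < n.+1) F j k y).
  apply: eq_Rint => y; rewrite convol_lag mulr_sumr; apply: eq_bigr => j _.
  rewrite mulr_sumr; apply: eq_bigr => k _; rewrite mulrCA beta_funM /F.
  have e (z : R) : lam + (lam + z) = a + z by rewrite /a; ring.
  by rewrite !e.
have E j k : \int[leb]_y F j k y = Gamma a *
    ((-2) ^+ j * 'C(m, j)%:R * ((-2) ^+ k * 'C(n, k)%:R * W (j + k)%N 0)).
  rewrite (RintZ _ (ib j k)) (Rint_beta_fun (an_gt0 j) (an_gt0 k)) W0 natrD.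
  have -> : a + j%:R + (a + k%:R) = 2 * a + (j%:R + k%:R) by ring.
  have -> : a + j%:R + k%:R = a + (j%:R + k%:R) by ring.
  have p (i : nat) : (-2) ^+ i = (-1) ^+ i * 2 ^+ i :> R by rewrite -exprMn mulN1r.
  rewrite /lag_coef !p.
  have := Gamma_neq0 (an_gt0 j); have := Gamma_neq0 (an_gt0 k).
  have : Gamma (2 * a + (j%:R + k%:R)) != 0.
    by apply: Gamma_neq0; rewrite ltr_pwDl ?addr_ge0// mulr_gt0.
  move: (Gamma a) (Gamma (a + j%:R)) (Gamma (a + k%:R)) (Gamma (2 * a + _)) (Gamma (a + (_ + _)))
    ((-1) ^+ j) (2 ^+ j) ((-1) ^+ k) (2 ^+ k) ('C(m, j)%:R : R) ('C(n, k)%:R : R)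
    => g gj gk g2 g1 sj tj sk tk cj ck h1 h2 h3.
  by field; rewrite h1 h2 h3.
rewrite R2; under eq_bigr => j _.
  rewrite (R1 j).2; under eq_bigr => k _ do rewrite E.
  rewrite -mulr_sumr -mulr_sumr W_binomial add0n.
  over.
rewrite -mulr_sumr; congr (_ * _).
have := W_binomial m 0 n; under eq_bigr => j _ do rewrite add0n.
move=> ->; rewrite /W addnC /tanh_moment; apply: eq_Rint => y; by rewrite expr0 mulr1.
Qed.

End laguerre.

(** * Orthonormal bases of inner product spaces *)

Local Notation Re := complex.Re.
Local Notation Im := complex.Im.

Section complex_basics.
Context {R : realType}.
Implicit Types (z w : R[i]).

Lemma sqrmodC z : (sqrmod z)%:C = z * z^*. Proof. by rewrite mulcJ. Qed.

Lemma sqrmod_real (x : R) : sqrmod x%:C = x ^+ 2.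
Proof. by rewrite /sqrmod /= expr0n addr0. Qed.

Lemma sqrmod0 : sqrmod (0 : R[i]) = 0.
Proof. by rewrite /sqrmod /= expr0n addr0. Qed.

Lemma sqrmodN z : sqrmod (- z) = sqrmod z.
Proof. by case: z => a b; rewrite /sqrmod /= !sqrrN. Qed.

Lemma Re_sqr_le z : Re z ^+ 2 <= sqrmod z. Proof. by rewrite /sqrmod lerDl sqr_ge0. Qed.
Lemma Im_sqr_le z : Im z ^+ 2 <= sqrmod z. Proof. by rewrite /sqrmod lerDr sqr_ge0. Qed.

Lemma ReD z w : Re (z + w) = Re z + Re w. Proof. by case: z w => [? ?] [? ?]. Qed.
Lemma ImD z w : Im (z + w) = Im z + Im w. Proof. by case: z w => [? ?] [? ?]. Qed.
Lemma ReN z : Re (- z) = - Re z. Proof. by case: z. Qed.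
Lemma ImN z : Im (- z) = - Im z. Proof. by case: z. Qed.

Lemma Re_sum n (f : nat -> R[i]) : Re (\sum_(i < n) f i) = \sum_(i < n) Re (f i).
Proof. by elim: n => [|n ih]; rewrite ?big_ord0// !big_ord_recr /= ReD ih. Qed.

Lemma Im_sum n (f : nat -> R[i]) : Im (\sum_(i < n) f i) = \sum_(i < n) Im (f i).
Proof. by elim: n => [|n ih]; rewrite ?big_ord0// !big_ord_recr /= ImD ih. Qed.

Lemma is_csum_of_dist (f : nat -> R[i]) (s : R[i]) (e : nat -> R) :
  (forall n, sqrmod (s - \sum_(i < n) f i) <= e n) -> e @ \oo --> (0 : R) ->
  is_csum f s.
Proof.
move=> fe e0.
have aux (u : nat -> R) (l : R) : (forall n, (l - u n) ^+ 2 <= e n) -> u @ \oo --> l.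
  move=> ue; apply/cvgrPdist_lt => eps eps0; near=> n.
  rewrite -ltr_sqr ?nnegrE ?(ltW eps0)// real_normK ?num_real//.
  apply: (le_lt_trans (ue n)); near: n.
  by apply: (cvgr_lt (0 : R) e0); exact: exprn_gt0.
have E (h : nat -> R) n : series h n = \sum_(i < n) h i by rewrite /series /= big_mkord.
split; apply: aux => n.
- rewrite E -Re_sum; apply: le_trans (fe n); rewrite -ReN -ReD; exact: Re_sqr_le.
- rewrite E -Im_sum; apply: le_trans (fe n); rewrite -ImN -ImD; exact: Im_sqr_le.
Unshelve. all: by end_near. Qed.

Lemma is_csum_inj (f : nat -> R[i]) s t : is_csum f s -> is_csum f t -> s = t.
Proof. by move=> /is_csum_unique <- /is_csum_unique. Qed.

Lemma is_csum_delta (x : R[i]) (f : nat -> R[i]) n :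
  (forall k, f k = if k == n then x else 0) -> is_csum f x.
Proof.
move=> fE; apply: (@is_csum_of_dist _ _ (fun m => if (m <= n)%N then sqrmod x else 0)).
  move=> m; have -> : \sum_(i < m) f i = if (n < m)%N then x else 0.
    elim: m => [|m ih]; first by rewrite big_ord0.
    rewrite big_ord_recr /= ih fE ltnS.
    by case: (ltngtP n m) => //= _; rewrite ?addr0 ?add0r.
  by case: ltnP => _; rewrite ?subrr ?subr0 ?sqrmod0.
apply: cvg_near_cst; exists n.+1 => // m /= nm.
by rewrite leqNgt nm.
Qed.

End complex_basics.

Section inner_product.
Context {R : realType} {V : innerProductSpace R}.
Implicit Types (u v w : V) (a : R[i]).

Lemma dotpDl u v w : dotp (u + v) w = dotp u w + dotp v w.
Proof. by have := dotp_linear w 1 u v; rewrite scale1r mul1r. Qed.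

Lemma dotp0l w : dotp 0 w = 0.
Proof. by apply: (addrI (dotp 0 w)); rewrite -dotpDl !addr0. Qed.

Lemma dotpZl a u w : dotp (a *: u) w = a * dotp u w.
Proof. by have := dotp_linear w a u 0; rewrite !addr0 dotp0l addr0. Qed.

Lemma dotpNl u w : dotp (- u) w = - dotp u w.
Proof. by rewrite -scaleN1r dotpZl mulN1r. Qed.

Lemma dotpBl u v w : dotp (u - v) w = dotp u w - dotp v w.
Proof. by rewrite dotpDl dotpNl. Qed.

Lemma dotpZr a u w : dotp u (a *: w) = a^* * dotp u w.
Proof. by rewrite dotpC dotpZl rmorphM /= -dotpC. Qed.

Lemma dotp0r u : dotp u 0 = 0.
Proof. by rewrite dotpC dotp0l conjc0. Qed.

Lemma dotpBr u v w : dotp u (v - w) = dotp u v - dotp u w.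
Proof. by rewrite dotpC dotpBl rmorphB /= -!dotpC. Qed.

Lemma dotp_suml n (c : nat -> R[i]) (P : nat -> V) w :
  dotp (\sum_(i < n) c i *: P i) w = \sum_(i < n) c i * dotp (P i) w.
Proof.
by elim: n => [|n ih]; rewrite ?big_ord0 ?dotp0l// !big_ord_recr /= dotpDl dotpZl ih.
Qed.

(** The squared norm as a real number, to stay away from square roots and from the order on
    complex numbers. *)
Definition nsq u : R := Re (dotp u u).

Lemma dotpuu u : dotp u u = (nsq u)%:C.
Proof.
rewrite /nsq; have := dotp_ge0 u; rewrite lecE => /andP[/eqP /= i0 _].
by case: (dotp u u) i0 => r i /= ->.
Qed.

Lemma nsq_ge0 u : 0 <= nsq u.
Proof. by have := dotp_ge0 u; rewrite dotpuu ler0c. Qed.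

Lemma nsq_eq0 u : nsq u = 0 -> u = 0.
Proof. by move=> h; apply: dotp_eq0; rewrite dotpuu h. Qed.

Lemma nsq0 : nsq (0 : V) = 0. Proof. by rewrite /nsq dotp0l. Qed.

Lemma nsqZ a u : nsq (a *: u) = sqrmod a * nsq u.
Proof. by apply: complexI; rewrite rmorphM /= -!dotpuu dotpZl dotpZr sqrmodC mulrA. Qed.

Lemma nsqB u v : nsq (u - v) = nsq u + nsq v - 2 * Re (dotp u v).
Proof.
rewrite /nsq dotpBl !dotpBr (dotpC v u).
by case: (dotp u u) (dotp u v) (dotp v v) => [? ?] [? ?] [? ?] /=; ring.
Qed.

Lemma cauchy_schwarz u v : sqrmod (dotp u v) <= nsq u * nsq v.
Proof.
have [v0|v0] := eqVneq (nsq v) 0.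
  by rewrite (nsq_eq0 v0) dotp0r sqrmod0 nsq0 mulr0.
have vp : 0 < nsq v by rewrite lt_neqAle eq_sym v0 nsq_ge0.
(* c *: v is the projection of u on v *)
pose c := ((nsq v)^-1)%:C * dotp u v.
have := nsq_ge0 (u - c *: v); rewrite nsqB nsqZ dotpZr.
have -> : Re (c^* * dotp u v) = sqrmod (dotp u v) / nsq v.
  by rewrite /c; case: (dotp u v) => a b; rewrite /sqrmod /=; field.
have -> : sqrmod c * nsq v = sqrmod (dotp u v) / nsq v.
  by rewrite /c sqrmodM sqrmod_real; field.
move=> h; have : sqrmod (dotp u v) / nsq v <= nsq u by lra.
by rewrite ler_pdivrMr.
Qed.

Lemma hnormE u : hnorm u = Num.sqrt (nsq u). Proof. by []. Qed.

Lemma hnorm_sqr u : hnorm u ^+ 2 = nsq u.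
Proof. by rewrite hnormE sqr_sqrtr// nsq_ge0. Qed.

Lemma hnorm_ge0 u : 0 <= hnorm u. Proof. exact: sqrtr_ge0. Qed.

Lemma hnorm_le u (K : R) : 0 <= K -> nsq u <= K ^+ 2 -> hnorm u <= K.
Proof.
by move=> K0 h; rewrite -ler_sqr ?nnegrE ?hnorm_ge0// hnorm_sqr.
Qed.

Lemma hnorm_lt u (K : R) : 0 < K -> nsq u < K ^+ 2 -> hnorm u < K.
Proof.
by move=> K0 h; rewrite -ltr_sqr ?nnegrE ?hnorm_ge0// ?hnorm_sqr// ltW.
Qed.

Lemma nsqD_le u v : nsq (u + v) <= 2 * nsq u + 2 * nsq v.
Proof.
have h := nsq_ge0 (u - v).
have e : nsq (u + v) + nsq (u - v) = 2 * nsq u + 2 * nsq v.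
  have := nsqB u v; have := nsqB u (- v); rewrite opprK => -> ->.
  have -> : nsq (- v) = nsq v by rewrite -scaleN1r nsqZ sqrmodN sqrmod_real expr1n mul1r.
  have -> : Re (dotp u (- v)) = - Re (dotp u v).
    by have := dotpBr u 0 v; rewrite sub0r dotp0r sub0r => ->; rewrite ReN.
  ring.
lra.
Qed.

End inner_product.

Section orthonormal.
Context {R : realType} {V : innerProductSpace R}.
Variable P : nat -> V.
Hypothesis Ponb : orthonormal_basis P.
Implicit Types (u v w : V).

Let orth m n : dotp (P m) (P n) = (m == n)%:R. Proof. exact: Ponb.1. Qed.

Definition fpart u N : V := \sum_(i < N) dotp u (P i) *: P i.

Lemma dotp_lin_comb N (c : nat -> R[i]) k : (k < N)%N ->
  dotp (\sum_(i < N) c i *: P i) (P k) = c k.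
Proof.
move=> kN; rewrite dotp_suml (bigD1 (Ordinal kN))//= orth eqxx mulr1 big1 ?addr0// => i ik.
by rewrite orth (_ : (i == k :> nat) = false) ?mulr0//; apply/negbTE.
Qed.

Lemma nsq_lin_comb N (c : nat -> R[i]) :
  nsq (\sum_(i < N) c i *: P i) = \sum_(i < N) sqrmod (c i).
Proof.
apply: complexI; rewrite -dotpuu dotp_suml rmorph_sum /=; apply: eq_bigr => i _.
by rewrite dotpC dotp_lin_comb// sqrmodC.
Qed.

(** Pythagoras' theorem: among all combinations, the partial sum of the Fourier series is the
    closest one. *)
Lemma nsq_sub_lin_comb u N (c : nat -> R[i]) :
  nsq (u - \sum_(i < N) c i *: P i) =
  nsq u - \sum_(i < N) sqrmod (dotp u (P i)) + \sum_(i < N) sqrmod (c i - dotp u (P i)).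
Proof.
rewrite nsqB nsq_lin_comb.
have -> : dotp u (\sum_(i < N) c i *: P i) = \sum_(i < N) ((c i)^* * dotp u (P i)).
  rewrite dotpC dotp_suml rmorph_sum /=; apply: eq_bigr => i _.
  by rewrite rmorphM /= -dotpC.
rewrite (Re_sum N (fun i => (c i)^* * dotp u (P i))).
rewrite mulr_sumr -!addrA; congr (_ + _); rewrite -sumrN -sumrN -!big_split /=.
apply: eq_bigr => i _; case: (c i) (dotp u (P i)) => [? ?] [? ?]; rewrite /sqrmod /=; ring.
Qed.

Lemma nsq_sub_fpart u N :
  nsq (u - fpart u N) = nsq u - \sum_(i < N) sqrmod (dotp u (P i)).
Proof.
rewrite /fpart (nsq_sub_lin_comb u N (fun i => dotp u (P i))) [X in _ + X]big1 ?addr0// => i _.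
by rewrite subrr sqrmod0.
Qed.

Lemma fpart_cvg u : (fun N => nsq (u - fpart u N)) @ \oo --> (0 : R).
Proof.
apply/cvgrPdist_lt => e e0.
have [y [N [c ->]] h] := Ponb.2 u (Num.sqrt e) (etrans (sqrtr_gt0 e) e0).
near=> n; rewrite sub0r normrN ger0_norm ?nsq_ge0//.
have hN : nsq (u - \sum_(i < N) c i *: P i) < e.
  move: h; rewrite /hnorm ltr_sqrt//; apply.
apply: le_lt_trans hN; rewrite nsq_sub_fpart nsq_sub_lin_comb.
apply: (@le_trans _ _ (nsq u - \sum_(i < N) sqrmod (dotp u (P i)))); last first.
  by rewrite lerDl sumr_ge0// => i _; exact: sqrmod_ge0.
rewrite lerD2l lerN2.
have Nn : (N <= n)%N by near: n; exact: nbhs_infty_ge.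
rewrite -!(big_mkord xpredT (fun i => sqrmod (dotp u (P i)))).
rewrite [leRHS](big_cat_nat (n := N))//=.
by rewrite lerDl sumr_ge0// => i _; exact: sqrmod_ge0.
Unshelve. all: by end_near. Qed.

Lemma parseval_dotp u v :
  is_csum (fun n => dotp u (P n) * (dotp v (P n))^*) (dotp u v).
Proof.
apply: (@is_csum_of_dist _ _ _ (fun N => nsq (u - fpart u N) * nsq v)); last first.
  by rewrite -[X in _ --> X](mul0r (nsq v)); apply: cvgMl; exact: fpart_cvg.
move=> N; have -> : \sum_(i < N) dotp u (P i) * (dotp v (P i))^* = dotp (fpart u N) v.
  rewrite /fpart (dotp_suml _ (fun i => dotp u (P i))).
  by apply: eq_bigr => i _; congr (_ * _); rewrite [RHS]dotpC.
by rewrite -dotpBl; exact: cauchy_schwarz.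
Qed.

Lemma coef_square_summable u : (fun n => dotp u (P n)) \in square_summable.
Proof.
apply/asboolP; have [h _] := parseval_dotp u u.
apply/cvg_ex; exists (Re (dotp u u)).
have -> : (fun n => sqrmod (dotp u (P n))) =
    (fun n => Re (dotp u (P n) * (dotp u (P n))^*)).
  by apply/funext => n; rewrite mulcJ.
exact: h.
Qed.

Definition coef u : ell2 R := Ell2 (coef_square_summable u).

Lemma coef_inj u v : (forall n, dotp u (P n) = dotp v (P n)) -> u = v.
Proof.
move=> h; apply/eqP; rewrite -subr_eq0; apply/eqP/dotp_eq0.
apply: is_csum_inj (parseval_dotp _ _) _; apply: (@is_csum_delta _ _ _ 0%N) => k.
by rewrite dotpBl h subrr mul0r; case: ifP.
Qed.

Lemma dotp_coef u v : dotp u v = dotp (coef u) (coef v).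
Proof. exact: is_csum_inj (parseval_dotp _ _) (ell2_dotP (coef u) (coef v)). Qed.

Lemma ell2_dot_basis (x : ell2 R) n : dotp x (ell2_basis n) = x n.
Proof.
apply: is_csum_inj (ell2_dotP x (ell2_basis n)) _.
apply: (@is_csum_delta _ _ _ n) => k /=.
by case: eqP => [->|_]; case: (x _) => a b; apply/eqP; rewrite eq_complex /=;
  apply/andP; split; apply/eqP; ring.
Qed.

Lemma unitary_dotp (U : ell2 R -> V) (x : ell2 R) n : unitary U ->
  (forall n, U (ell2_basis n) = P n) -> dotp (U x) (P n) = x n.
Proof. by move=> [_ Uiso _] UP; rewrite -UP Uiso ell2_dot_basis. Qed.

(** Given Riesz-Fischer surjectivity, U sends a sequence to the vector with these coefficients.
    Uniqueness needs no continuity: an isometry preserves the coefficients. *)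
Lemma ex_unique_unitary :
  (forall x : ell2 R, exists w : V, forall n, dotp w (P n) = x n) ->
  exists! U : ell2 R -> V, unitary U /\ forall n, U (ell2_basis n) = P n.
Proof.
move=> /choice[U UE].
have coefU x : coef (U x) = x by apply/val_inj/funext => n /=; exact: UE.
exists U; split; last first.
  move=> U' [uU' UP']; apply/funext => x; apply: coef_inj => n.
  by rewrite UE (unitary_dotp _ _ uU').
split; last first.
  by move=> n; apply: coef_inj => m; rewrite UE orth /= eq_sym.
split.
- move=> a x y; apply: coef_inj => n.
  by rewrite UE dotpDl dotpZl !UE.
- by move=> x y; rewrite dotp_coef !coefU.
- by move=> w; exists (coef w); apply: coef_inj => n; rewrite UE.
Qed.

End orthonormal.

(** * Square-integrable functions and the Riesz-Fischer theorem *)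

Lemma sum_half_le2 (R : realType) n : \sum_(0 <= k < n) (1 / 2) ^+ k <= 2 :> R.
Proof.
have -> : \sum_(0 <= k < n) (1 / 2) ^+ k = 2 - 2 * (1 / 2) ^+ n :> R.
  elim: n => [|n ih]; first by rewrite big_geq// expr0; lra.
  by rewrite big_nat_recr//= ih exprS; lra.
have : 0 <= (1 / 2 : R) ^+ n by rewrite exprn_ge0.
lra.
Qed.

Section L2_theory.
Local Open Scope quotient_scope.
Context d (T : measurableType d) (R : realType).
Variable mu : {measure set T -> \bar R}.
Implicit Types (p q : L2 mu) (f g : T -> R[i]).

Definition cmeasurable f :=
  measurable_fun setT (fun x => Re (f x)) /\ measurable_fun setT (fun x => Im (f x)).

Lemma cmeasurable_sqrmod f : cmeasurable f -> measurable_fun setT (fun x => sqrmod (f x)).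
Proof. by move=> [mr mi]; apply: measurable_funD; exact: measurable_funX. Qed.

Lemma cmeasurableM f g : cmeasurable f -> cmeasurable g -> cmeasurable (fun x => f x * g x).
Proof.
move=> [f1 f2] [g1 g2]; split.
  rewrite (_ : (fun x => _) = (fun x => Re (f x) * Re (g x) - Im (f x) * Im (g x))).
    by apply: measurable_funB; exact: measurable_funM.
  by apply/funext => x; case: (f x) (g x) => [? ?] [? ?].
rewrite (_ : (fun x => _) = (fun x => Re (f x) * Im (g x) + Im (f x) * Re (g x))).
  by apply: measurable_funD; exact: measurable_funM.
by apply/funext => x; case: (f x) (g x) => [? ?] [? ?].
Qed.

Lemma cmeasurableD f g : cmeasurable f -> cmeasurable g -> cmeasurable (fun x => f x + g x).
Proof.
move=> [f1 f2] [g1 g2]; split.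
  by under eq_fun do rewrite ReD; exact: measurable_funD.
by under eq_fun do rewrite ImD; exact: measurable_funD.
Qed.

Lemma cmeasurableB f g : cmeasurable f -> cmeasurable g -> cmeasurable (fun x => f x - g x).
Proof.
move=> [f1 f2] [g1 g2]; split.
  by under eq_fun do rewrite ReD ReN; exact: measurable_funB.
by under eq_fun do rewrite ImD ImN; exact: measurable_funB.
Qed.

Lemma cmeasurable_conj f : cmeasurable f -> cmeasurable (fun x => (f x)^*).
Proof.
move=> [f1 f2]; split.
  by rewrite (_ : (fun x => _) = (fun x => Re (f x)))//; apply/funext => x; case: (f x).
rewrite (_ : (fun x => _) = (fun x => - Im (f x))).
  exact: measurableT_comp.
by apply/funext => x; case: (f x).
Qed.

Lemma cmeasurable_real (h : T -> R) : measurable_fun setT h -> cmeasurable (fun x => (h x)%:C).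
Proof. by move=> mh; split => //=; exact: measurable_cst. Qed.

Lemma cmeasurable_cst (c : R[i]) : cmeasurable (fun=> c).
Proof. by split; exact: measurable_cst. Qed.

Lemma Lfun2P (u : T -> R) : measurable_fun setT u ->
  (\int[mu]_x ((u x) ^+ 2)%:E < +oo)%E -> u \in Lfun mu 2%:E.
Proof.
move=> mu_ iu; rewrite inE; apply/andP; split; rewrite inE/= ?/finite_norm//.
rewrite unlock/= (_ : (fun x => _) = (fun x => ((u x) ^+ 2)%:E)).
  by rewrite poweR_lty.
by apply/funext => x; rewrite powR_mulrn// real_normK// num_real.
Qed.

Lemma square_integrableP f : cmeasurable f ->
  (\int[mu]_x (sqrmod (f x))%:E < +oo)%E -> f \in square_integrable mu.
Proof.
move=> [f1 f2] fi; have mf := cmeasurable_sqrmod (conj f1 f2).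
have aux (u : T -> R) : measurable_fun setT u -> (forall x, u x ^+ 2 <= sqrmod (f x)) ->
    u \in Lfun mu 2%:E.
  move=> mu_ ule; apply: Lfun2P => //; apply: le_lt_trans fi.
  apply: ge0_le_integral => //.
  - by move=> x _; rewrite lee_fin sqr_ge0.
  - by apply/measurable_EFinP; exact: measurable_funX.
  - exact/measurable_EFinP.
  - by move=> x _; rewrite lee_fin.
by apply/andP; split; apply: aux => // x; [exact: Re_sqr_le|exact: Im_sqr_le].
Qed.

Lemma square_integrable_cmeasurable f : f \in square_integrable mu -> cmeasurable f.
Proof.
by rewrite /square_integrable => /andP[];
  rewrite !inE => /andP[+ _] /andP[+ _]; rewrite !inE /=.
Qed.

Lemma L2_cmeasurable p : cmeasurable p.
Proof. exact: square_integrable_cmeasurable (L2funP (repr p)). Qed.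

Lemma L2_integrable p : mu.-integrable setT (EFin \o (fun x => sqrmod (p x))).
Proof.
have [iR _] := L2_dot_integrable p p.
by apply: eq_integrable iR => // x _ /=; rewrite mulcJ.
Qed.

Lemma nsqE p : (\int[mu]_x (sqrmod (p x))%:E)%E = (nsq p)%:E.
Proof.
have -> : nsq p = \int[mu]_x sqrmod (p x) by rewrite /nsq [dotp p p]L2_dotpp.
by rewrite /Rintegral fineK//; exact: integrable_fin_num (L2_integrable p).
Qed.

Lemma mkL2 f : cmeasurable f -> (\int[mu]_x (sqrmod (f x))%:E < +oo)%E ->
  exists p : L2 mu, {ae mu, forall x, p x = f x}.
Proof.
move=> mf fi; exists (\pi_(L2 mu) (MkL2fun (square_integrableP mf fi))).
exact: L2_piE.
Qed.

Lemma nsq_ae p f : cmeasurable f -> {ae mu, forall x, p x = f x} ->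
  (nsq p)%:E = (\int[mu]_x (sqrmod (f x))%:E)%E.
Proof.
move=> mf pf; rewrite -nsqE; apply: ae_eq_integral => //.
- by apply/measurable_EFinP; apply: cmeasurable_sqrmod; exact: L2_cmeasurable.
- by apply/measurable_EFinP; exact: cmeasurable_sqrmod.
- by apply: filterS pf => x /= -> _.
Qed.

Lemma integrable_ae_eq (u v : T -> R) : measurable_fun setT v ->
  {ae mu, forall x, u x = v x} ->
  mu.-integrable setT (EFin \o u) -> mu.-integrable setT (EFin \o v).
Proof.
move=> mv uv /integrableP[mu_ iu]; apply/integrableP; split.
  exact/measurable_EFinP.
apply: le_lt_trans iu; rewrite le_eqVlt; apply/orP; left; apply/eqP.
apply: ae_eq_integral => //.
- by apply: measurableT_comp => //; exact/measurable_EFinP.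
- exact: measurableT_comp.
- by apply: filterS uv => x /= -> _.
Qed.

Lemma dotp_ae p q f g : cmeasurable f -> cmeasurable g ->
  {ae mu, forall x, p x = f x} -> {ae mu, forall x, q x = g x} ->
  cintegrable mu (fun x => f x * (g x)^*) /\
  dotp p q = cintegral mu (fun x => f x * (g x)^*).
Proof.
move=> mf mg pf qg.
have [m1 m2] : cmeasurable (fun x => f x * (g x)^*).
  by apply: cmeasurableM => //; exact: cmeasurable_conj.
have [h1 h2] := L2_dot_integrable p q.
have e : (fun x => p x * (q x)^*) = (fun x => f x * (g x)^*) %[ae mu].
  by apply: filterS2 pf qg => x /= -> ->.
have hi : cintegrable mu (fun x => f x * (g x)^*).
  split.
    by apply: integrable_ae_eq h1 => //; apply: filterS e => x /= ->.
  by apply: integrable_ae_eq h2 => //; apply: filterS e => x /= ->.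
split => //.
exact: (ae_eq_cintegral (L2_dot_integrable p q) hi e).
Qed.

Lemma L2_sub_ae p q : {ae mu, forall x, (p - q : L2 mu) x = p x - q x}.
Proof.
have := L2_addE p (- q); have := L2_scaleE (-1) q.
apply: filterS2 => x h1 ->; congr (_ + _).
by rewrite -scaleN1r [LHS]h1 mulN1r.
Qed.

Lemma L2_sum_ae n (c : nat -> R[i]) (P : nat -> L2 mu) (f : nat -> T -> R[i]) :
  (forall i, {ae mu, forall x, P i x = f i x}) ->
  {ae mu, forall x, (\sum_(i < n) c i *: P i : L2 mu) x = \sum_(i < n) c i * f i x}.
Proof.
move=> Pf; elim: n => [|n ih].
  rewrite big_ord0; have -> : (0 : L2 mu) = \pi_(L2 mu) 0 by rewrite raddf0.
  by apply: filterS (L2_piE 0) => x ->; rewrite big_ord0.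
rewrite big_ord_recr /=.
have h1 := L2_addE (\sum_(i < n) c i *: P i) (c n *: P n).
have h2 := L2_scaleE (c n) (P n); have h3 := Pf n.
near=> x; rewrite big_ord_recr /= (near h1 x)// (near ih x)//; congr (_ + _).
by rewrite [LHS](near h2 x)// (near h3 x).
Unshelve. all: by end_near. Qed.

(** From |g| <= 2^n g^2 + 2^-n, a sequence whose squared norms are at most 4^-n is absolutely
    summable almost everywhere. *)
Lemma ae_cvg_series (g : nat -> T -> R) : (forall n, measurable_fun setT (g n)) ->
  (forall n, \int[mu]_x ((g n x) ^+ 2)%:E <= ((1 / 4) ^+ n)%:E)%E ->
  {ae mu, forall x, cvgn (series (fun n => g n x))}.
Proof.
move=> mg ig; (* the weighted series is integrable, hence finite almost everywhere *)
pose F n x := (2 ^+ n * g n x ^+ 2)%:E : \bar R.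
have mF n : measurable_fun setT (F n).
  by apply/measurable_EFinP; apply: measurable_funM => //; exact: measurable_funX.
have G0 n x : 0 <= 2 ^+ n * g n x ^+ 2.
  by apply: mulr_ge0; [exact: exprn_ge0|exact: sqr_ge0].
have F0 n x : (0 <= F n x)%E by rewrite lee_fin G0.
have FS : (\int[mu]_x (\sum_(n <oo) F n x) <= 2%:E)%E.
  rewrite integral_nneseries//; apply: lime_le.
    by apply: is_cvg_nneseries => n _ _; exact: integral_ge0.
  apply: nearW => n; apply: (@le_trans _ _ (\sum_(0 <= k < n) ((1 / 2) ^+ k)%:E)%E).
    apply: lee_sum => k _; rewrite /F; under eq_integral do rewrite EFinM.
    rewrite ge0_integralZl//; last 2 first.
    - by apply/measurable_EFinP; exact: measurable_funX.
    - by move=> x _; rewrite lee_fin sqr_ge0.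
    apply: (@le_trans _ _ ((2 ^+ k)%:E * ((1 / 4) ^+ k)%:E)%E).
      by apply: lee_wpmul2l (ig k); rewrite lee_fin exprn_ge0.
    rewrite -EFinM lee_fin -exprMn (_ : 2 * (1 / 4) = 1 / 2 :> R)//; lra.
  rewrite sumEFin lee_fin.
  exact: sum_half_le2.
have S0 x : (0 <= \sum_(n <oo) F n x)%E by exact: nneseries_ge0.
have iF : mu.-integrable setT (fun x => \sum_(n <oo) F n x)%E.
  apply/integrableP; split; first exact: ge0_emeasurable_sum.
  under eq_integral do rewrite gee0_abs//.
  exact: le_lt_trans FS (ltry _).
apply: filterS (integrable_ae measurableT iF) => x /(_ I) fx.
have c1 : cvgn (series (fun n => 2 ^+ n * g n x ^+ 2)).
  apply: nnseries_is_cvg => [//|].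
  by move: fx; rewrite ge0_fin_numE.
have c2 : cvgn (series (fun n => (1 / 2 : R) ^+ n)).
  have -> : (fun n => (1 / 2 : R) ^+ n) = geometric 1 (1 / 2).
    by apply/funext => n; rewrite /geometric /= [RHS]mul1r.
  by apply: is_cvg_geometric_series; rewrite ger0_norm; lra.
apply: normed_cvg; apply: series_le_cvg (is_cvg_seriesD c1 c2) => n.
- exact: normr_ge0.
- by rewrite fctE addr_ge0// exprn_ge0// divr_ge0.
- rewrite fctE; set t := g n x.
  have h2 : (1 / 2 : R) ^+ n * 2 ^+ n = 1 by rewrite -exprMn (_ : 1 / 2 * 2 = 1) ?expr1n//; lra.
  have p2 : 0 < 2 ^+ n :> R by exact: exprn_gt0.
  have -> : t ^+ 2 = `|t| ^+ 2 by rewrite real_normK// num_real.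
  rewrite -(ler_pM2l p2) mulrDr [_ * (1 / 2) ^+ n]mulrC h2 /= -/t.
  have := sqr_ge0 (2 ^+ n * `|t| - 1); have := normr_ge0 t.
  move: (`|t|) => v; move: (2 ^+ n : R) p2 => y y0 v0 h.
  have : 0 <= y * v by rewrite mulr_ge0// ltW.
  have -> : y * (y * v ^+ 2) = (y * v) ^+ 2 by ring.
  by move: h; move: (y * v) => z; nra.
Qed.

(** A fast Cauchy sequence converges almost everywhere by [ae_cvg_series], and Fatou's lemma
    gives the rate of convergence in norm. *)
Lemma L2_fast_complete (s : nat -> L2 mu) :
  (forall j k, (k <= j)%N -> nsq (s j - s k) <= (1 / 4) ^+ k) ->
  exists w : L2 mu, forall k, nsq (w - s k) <= (1 / 4) ^+ k.
Proof.
move=> hs.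
have mp (p : L2 mu) := L2_cmeasurable p.
have step (proj : R[i] -> R) : (forall z w, proj (z - w) = proj z - proj w) ->
    (forall z, proj z ^+ 2 <= sqrmod z) ->
    (forall p : L2 mu, measurable_fun setT (fun x => proj (p x))) ->
    exists2 w : T -> R, measurable_fun setT w &
      {ae mu, forall x, (fun n => proj (s n x)) @ \oo --> w x}.
  move=> projB proj_le mproj.
  (* the upper limit is measurable even where the sequence diverges *)
  exists (fun x => fine (limn_esup (fun n => (proj (s n x))%:E))).
    apply: measurableT_comp => //; apply: measurable_fun_limn_esup => n.
    exact/measurable_EFinP.
  pose g n x := proj (s n.+1 x) - proj (s n x).
  have mg n : measurable_fun setT (g n) by exact: measurable_funB.
  have ig n : (\int[mu]_x ((g n x) ^+ 2)%:E <= ((1 / 4) ^+ n)%:E)%E.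
    apply: le_trans (_ : (nsq (s n.+1 - s n))%:E <= _)%E; last first.
      by rewrite lee_fin; exact: hs.
    have hB := L2_sub_ae (s n.+1) (s n).
    have mB : cmeasurable (fun x => s n.+1 x - s n x) by exact: cmeasurableB.
    rewrite (nsq_ae mB hB); apply: ge0_le_integral => //.
    - by move=> x _; rewrite lee_fin sqr_ge0.
    - by apply/measurable_EFinP; exact: measurable_funX.
    - by apply/measurable_EFinP; exact: cmeasurable_sqrmod.
    - by move=> x _; rewrite lee_fin /g -projB.
  apply: filterS (ae_cvg_series mg ig) => x /cvg_ex[l hl].
  have E n : series (g^~ x) n = proj (s n x) - proj (s 0%N x).
    rewrite /series /=; elim: n => [|n ih]; first by rewrite big_geq// subrr.
    by rewrite big_nat_recr//= ih /g; ring.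
  have hc : (fun n => proj (s n x)) @ \oo --> l + proj (s 0%N x).
    have -> : (fun n => proj (s n x)) = (fun n => series (g^~ x) n + proj (s 0%N x)).
      by apply/funext => n; rewrite E subrK.
    by apply: cvgD => //; exact: cvg_cst.
  have hE : (fun n => (proj (s n x))%:E) @ \oo --> (l + proj (s 0%N x))%:E.
    by apply: cvg_EFin; [exact: nearW|exact: hc].
  rewrite is_cvg_limn_esupE; last by apply/cvg_ex; eexists; exact: hE.
  by rewrite (cvg_lim _ hE).
have [u mu_ hu] := step (@complex.Re R) (fun z w => etrans (ReD z (- w)) (congr1 _ (ReN w)))
  Re_sqr_le (fun p => (mp p).1).
have [v mv hv] := step (@complex.Im R) (fun z w => etrans (ImD z (- w)) (congr1 _ (ImN w)))
  Im_sqr_le (fun p => (mp p).2).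
pose W x : R[i] := u x +i* v x.
have mW : cmeasurable W by split.
have mWs k : cmeasurable (fun x => W x - s k x) by exact: cmeasurableB.
have mss j k : cmeasurable (fun x => s j x - s k x) by exact: cmeasurableB.
have key k : (\int[mu]_x (sqrmod (W x - s k x))%:E <= ((1 / 4) ^+ k)%:E)%E.
  pose F j x := (sqrmod (s (k + j)%N x - s k x))%:E : \bar R.
  have mF j : measurable_fun setT (F j).
    by apply/measurable_EFinP; exact: cmeasurable_sqrmod.
  have F0 j x : setT x -> (0 <= F j x)%E by move=> _; rewrite lee_fin sqrmod_ge0.
  have -> : (\int[mu]_x (sqrmod (W x - s k x))%:E = \int[mu]_x limn_einf (F^~ x))%E.
    apply: ae_eq_integral => //.
    - by apply/measurable_EFinP; exact: cmeasurable_sqrmod.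
    - rewrite (_ : (fun x => _) = (fun x => - limn_esup (fun j => - F j x))%E)//.
      apply: measurableT_comp => //; apply: measurable_fun_limn_esup => j.
      exact: measurableT_comp.
    - apply: filterS2 hu hv => x hux hvx _.
      have hc : (F^~ x) @ \oo --> (sqrmod (W x - s k x))%:E.
        apply: cvg_EFin; first exact: nearW.
        rewrite /sqrmod ReD ImD ReN ImN.
        have -> : fine \o F^~ x = (fun j => (Re (s (k + j)%N x) - Re (s k x)) * (Re (s (k + j)%N x) - Re (s k x))
            + (Im (s (k + j)%N x) - Im (s k x)) * (Im (s (k + j)%N x) - Im (s k x))).
          by apply/funext => j; rewrite /F /sqrmod /= ReD ImD ReN ImN !expr2.
        have sh (f : nat -> R) (l : R) : f @ \oo --> l -> (fun j => f (k + j)%N) @ \oo --> l.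
          by move=> fl; rewrite -(cvg_shiftn k) in fl; under eq_fun do rewrite addnC.
        rewrite !expr2; apply: cvgD.
          by apply: cvgM; apply: cvgB; [exact: sh hux|exact: cvg_cst|exact: sh hux|exact: cvg_cst].
        by apply: cvgM; apply: cvgB; [exact: sh hvx|exact: cvg_cst|exact: sh hvx|exact: cvg_cst].
      by rewrite is_cvg_limn_einfE ?(cvg_lim _ hc)//; apply/cvg_ex; eexists; exact: hc.
  apply: (le_trans (fatou mu measurableT mF F0)).
  rewrite limn_einf_lim; apply: lime_le; first exact: is_cvg_einfs.
  apply: nearW => n; apply: le_trans (_ : \int[mu]_x F n x <= _)%E.
    by apply: ereal_inf_lbound; exists n => /=.
  rewrite /F -(nsq_ae (mss _ _) (L2_sub_ae (s (k + n)%N) (s k))) lee_fin.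
  by apply: hs; rewrite leq_addr.
have [w0 hw0] : exists w0 : L2 mu, {ae mu, forall x, w0 x = W x - s 0%N x}.
  by apply: mkL2 => //; exact: le_lt_trans (key 0%N) (ltry _).
exists (w0 + s 0%N) => k; rewrite -lee_fin.
rewrite (@nsq_ae _ (fun x => W x - s k x))//.
have h1 := L2_sub_ae (w0 + s 0%N) (s k); have h2 := L2_addE w0 (s 0%N).
near=> x; rewrite [LHS](near h1 x)// [X in X - _](near h2 x)// (near hw0 x)//.
by rewrite subrK.
Unshelve. all: by end_near. Qed.

(** Along a subsequence with remainders at most 4^-k the partial sums form a fast Cauchy
    sequence, to which [L2_fast_complete] applies. *)
Lemma riesz_fischer (P : nat -> L2 mu) (x : ell2 R) : orthonormal_basis P ->
  exists w : L2 mu, forall n, dotp w (P n) = x n.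
Proof.
move=> oP; pose S n := \sum_(i < n) x i *: P i.
pose a n := \sum_(i < n) sqrmod (x i).
have ha : a @ \oo --> limn a.
  have := asboolW (ell2P x); rewrite (_ : series _ = a)//.
  by apply/funext => n; rewrite /series /= big_mkord.
have anon m n : (m <= n)%N -> a m <= a n.
  move=> mn; rewrite /a -!(big_mkord xpredT (fun i => sqrmod (x i))).
  rewrite [leRHS](big_cat_nat (n := m))//= lerDl sumr_ge0// => i _.
  exact: sqrmod_ge0.
have ale n : a n <= limn a.
  by apply: nondecreasing_cvgn_le; [move=> ? ?; exact: anon|apply/cvg_ex; exists (limn a)].
have SB m n : (m <= n)%N -> nsq (S n - S m) = a n - a m.
  move=> mn; rewrite /S (nsq_sub_lin_comb oP).
  have -> : \sum_(i < m) sqrmod (dotp (\sum_(j < n) x j *: P j) (P i)) = a m.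
    by apply: eq_bigr => i _; rewrite (dotp_lin_comb oP)//; exact: leq_trans (ltn_ord i) mn.
  rewrite [X in _ + X]big1 ?addr0 ?(nsq_lin_comb oP)// => i _.
  rewrite (dotp_lin_comb oP) ?subrr ?sqrmod0//; exact: leq_trans (ltn_ord i) mn.
have /choice[N hN] : forall k, exists n, (k <= n)%N /\ limn a - a n <= (1 / 4) ^+ k.
  move=> k; have e0 : 0 < (1 / 4 : R) ^+ k by rewrite exprn_gt0.
  have /cvgrPdist_le/(_ _ e0)[n _ hn] := ha; exists (maxn k n); rewrite leq_maxl; split=> //.
  by have := hn (maxn k n) (leq_maxr k n) => /=; rewrite ger0_norm// subr_ge0.
have hS j k : (k <= j)%N -> nsq (S (N j) - S (N k)) <= (1 / 4) ^+ k.
  move=> kj; have [nkj|njk] := leqP (N k) (N j).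
    by rewrite SB//; apply: le_trans (hN k).2; rewrite lerD2r.
  have -> : nsq (S (N j) - S (N k)) = a (N k) - a (N j).
    rewrite -opprB -scaleN1r nsqZ sqrmodN.
    by rewrite (_ : sqrmod 1 = 1 :> R) ?mul1r ?SB ?(ltnW njk)// /sqrmod /= expr1n expr0n addr0.
  apply: (@le_trans _ _ ((1 / 4) ^+ j)); last by apply: ler_wiXn2l => //; lra.
  by apply: le_trans (hN j).2; rewrite lerD2r.
have [w hw] := L2_fast_complete hS.
exists w => n; apply/eqP; rewrite -subr_eq0; apply/eqP/sqrmod_eq0/le_anti.
rewrite sqrmod_ge0 andbT leNgt; apply/negP => e0.
have g0 : (fun k => (1 / 4 : R) ^+ k) @ \oo --> (0 : R).
  by apply: cvg_expr; rewrite ger0_norm; lra.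
near \oo => k.
have nk : (n < k)%N by near: k; exact: nbhs_infty_gt.
have : (1 / 4 : R) ^+ k < sqrmod (dotp w (P n) - x n).
  by near: k; apply: (cvgr_lt (0 : R) g0).
apply/negP; rewrite -leNgt.
have <- : dotp (S (N k)) (P n) = x n.
  by apply: (dotp_lin_comb oP); exact: leq_trans nk (hN k).1.
rewrite -dotpBl; apply: (le_trans (cauchy_schwarz _ _)).
by have -> : nsq (P n) = 1; [rewrite /nsq oP.1 eqxx|rewrite mulr1; exact: hw].
Unshelve. all: by end_near. Qed.

End L2_theory.

(** * Density of polynomials under an exponential moment *)

Section poly_density.
Context {R : realType}.
Variable nu : {measure set (measurableTypeR R) -> \bar R}.
Variable b : R.
Hypothesis b_gt0 : 0 < b.
Hypothesis exp_moment :
  (\int[nu]_x (expR (b * x) + expR (- (b * x)))%:E < +oo)%E.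
Implicit Types (f g m : measurableTypeR R -> R) (q : {poly R}).

Definition sq_dist f g : \bar R := (\int[nu]_x ((f x - g x) ^+ 2)%:E)%E.
Definition sqi f := measurable_fun setT f /\ (\int[nu]_x ((f x) ^+ 2)%:E < +oo)%E.
(** Membership in the closure of the polynomials in the real space L^2(nu). *)
Definition poly_approx f :=
  sqi f /\ forall e, 0 < e -> exists q, (sq_dist f (fun x => q.[x]) < e%:E)%E.

Lemma le_sq_int f g : measurable_fun setT f -> measurable_fun setT g ->
  (forall x, f x ^+ 2 <= g x) ->
  (\int[nu]_x ((f x) ^+ 2)%:E <= \int[nu]_x (g x)%:E)%E.
Proof.
move=> mf mg fg; apply: ge0_le_integral => //.
- by move=> x _; rewrite lee_fin sqr_ge0.
- by apply/measurable_EFinP; exact: measurable_funX.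
- exact/measurable_EFinP.
- by move=> x _; rewrite lee_fin.
Qed.

Lemma sq_int_lin f g (c d : R) : measurable_fun setT f -> measurable_fun setT g ->
  0 <= c -> 0 <= d ->
  (\int[nu]_x (c * f x ^+ 2 + d * g x ^+ 2)%:E =
   c%:E * \int[nu]_x (f x ^+ 2)%:E + d%:E * \int[nu]_x (g x ^+ 2)%:E)%E.
Proof.
move=> mf mg c0 d0.
have aux (u : measurableTypeR R -> R) (k : R) : measurable_fun setT u -> 0 <= k ->
    measurable_fun setT (fun x => (k * u x ^+ 2)%:E) /\
    (\int[nu]_x (k * u x ^+ 2)%:E = k%:E * \int[nu]_x (u x ^+ 2)%:E)%E.
  move=> mu k0; split.
    by apply/measurable_EFinP; apply: measurable_funM => //; exact: measurable_funX.
  under eq_integral do rewrite EFinM.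
  rewrite ge0_integralZl//.
  - by apply/measurable_EFinP; exact: measurable_funX.
  - by move=> x _; rewrite lee_fin sqr_ge0.
have [m1 e1] := aux f c mf c0; have [m2 e2] := aux g d mg d0.
under eq_integral do rewrite EFinD.
rewrite ge0_integralD ?e1 ?e2//.
- by move=> x _; rewrite lee_fin mulr_ge0// sqr_ge0.
- by move=> x _; rewrite lee_fin mulr_ge0// sqr_ge0.
Qed.

Lemma sqi_le f g : measurable_fun setT f -> (forall x, `|f x| <= g x) ->
  sqi g -> sqi f.
Proof.
move=> mf fg [mg ig]; split => //; apply: le_lt_trans ig.
apply: le_sq_int => //; first exact: measurable_funX.
move=> x; rewrite -[f x ^+ 2]real_normK ?num_real// lerXn2r ?nnegrE//.
exact: le_trans (fg x).
Qed.

Lemma sqi_lin c f d g : sqi f -> sqi g -> sqi (fun x => c * f x + d * g x).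
Proof.
move=> [mf fi] [mg gi]; have mh : measurable_fun setT (fun x => c * f x + d * g x).
  by apply: measurable_funD; exact: measurable_funM.
split => //; apply: (@le_lt_trans _ _ (\int[nu]_x
    (2 * c ^+ 2 * f x ^+ 2 + 2 * d ^+ 2 * g x ^+ 2)%:E)%E).
  apply: le_sq_int => //.
    by apply: measurable_funD; apply: measurable_funM => //; exact: measurable_funX.
  move=> x; have := sqr_ge0 (c * f x - d * g x).
  have -> : 2 * c ^+ 2 * f x ^+ 2 + 2 * d ^+ 2 * g x ^+ 2 =
    2 * (c * f x) ^+ 2 + 2 * (d * g x) ^+ 2 by ring.
  move: (c * f x) (d * g x) => u v; nra.
have [c0 d0] : 0 <= 2 * c ^+ 2 /\ 0 <= 2 * d ^+ 2.
  by split; apply: mulr_ge0 => //; exact: sqr_ge0.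
rewrite sq_int_lin//.
by rewrite lte_add_pinfty// lte_mul_pinfty.
Qed.

Lemma sq_dist_triangle f g u : measurable_fun setT f -> measurable_fun setT g ->
  measurable_fun setT u ->
  (sq_dist f u <= 2%:E * sq_dist f g + 2%:E * sq_dist g u)%E.
Proof.
move=> mf mg mu; rewrite /sq_dist -sq_int_lin//; last 2 first.
- exact: measurable_funB.
- exact: measurable_funB.
apply: le_sq_int; first exact: measurable_funB.
  by apply: measurable_funD; apply: measurable_funM => //;
    apply: measurable_funX; exact: measurable_funB.
move=> x; have := sqr_ge0 ((f x - g x) - (g x - u x)).
have -> : f x - u x = (f x - g x) + (g x - u x) by ring.
by move: (f x - g x) (g x - u x) => v w; nra.
Qed.

Lemma measurable_poly q : measurable_fun setT (fun x : measurableTypeR R => q.[x]).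
Proof. by apply: measurable_continuous => x; exact: continuous_horner. Qed.

Lemma poly_approx_closed f : sqi f ->
  (forall e, 0 < e -> exists2 g, poly_approx g & (sq_dist f g < e%:E)%E) ->
  poly_approx f.
Proof.
move=> sf h; split => // e e0; have e4 : 0 < e / 4 by rewrite divr_gt0.
have [g [[mg _] hg] fg] := h _ e4; have [q gq] := hg _ e4; exists q.
apply: le_lt_trans (sq_dist_triangle sf.1 mg (measurable_poly q)) _.
have -> : e%:E = (2%:E * (e / 4)%:E + 2%:E * (e / 4)%:E)%E.
  by rewrite -!EFinM -EFinD; congr EFin; field.
by apply: lteD; rewrite lte_pmul2l.
Qed.

Lemma poly_approx_lin c f d g : poly_approx f -> poly_approx g ->
  poly_approx (fun x => c * f x + d * g x).
Proof.
move=> [sf hf] [sg hg]; split; first exact: sqi_lin.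
move=> e e0; pose K := 2 * c ^+ 2 + 2 * d ^+ 2 + 1.
have K0 : 0 < K by rewrite ltr_wpDl// addr_ge0// mulr_ge0// sqr_ge0.
have eK : 0 < e / K by rewrite divr_gt0.
have [q hq] := hf _ eK; have [r hr] := hg _ eK.
exists (c *: q + d *: r).
have mfq : measurable_fun setT (fun x => f x - q.[x]).
  by apply: measurable_funB (measurable_poly q); exact: sf.1.
have mgr : measurable_fun setT (fun x => g x - r.[x]).
  by apply: measurable_funB (measurable_poly r); exact: sg.1.
apply: (@le_lt_trans _ _ (\int[nu]_x
    (2 * c ^+ 2 * (f x - q.[x]) ^+ 2 + 2 * d ^+ 2 * (g x - r.[x]) ^+ 2)%:E)%E).
  apply: le_sq_int.
  - apply: measurable_funB; last exact: measurable_poly.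
    by apply: measurable_funD; apply: measurable_funM => //; [exact: sf.1|exact: sg.1].
  - by apply: measurable_funD; apply: measurable_funM => //; exact: measurable_funX.
  - move=> x; have := sqr_ge0 (c * (f x - q.[x]) - d * (g x - r.[x])).
    have -> : c * f x + d * g x - (c *: q + d *: r).[x] =
       c * (f x - q.[x]) + d * (g x - r.[x]) by rewrite !hornerE; ring.
    have -> : 2 * c ^+ 2 * (f x - q.[x]) ^+ 2 + 2 * d ^+ 2 * (g x - r.[x]) ^+ 2 =
      2 * (c * (f x - q.[x])) ^+ 2 + 2 * (d * (g x - r.[x])) ^+ 2 by ring.
    move: (c * _) (d * _) => u v; nra.
have [c0 d0] : 0 <= 2 * c ^+ 2 /\ 0 <= 2 * d ^+ 2.
  by split; apply: mulr_ge0 => //; exact: sqr_ge0.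
rewrite sq_int_lin//.
apply: (@le_lt_trans _ _ ((2 * c ^+ 2)%:E * (e / K)%:E + (2 * d ^+ 2)%:E * (e / K)%:E)%E).
  by apply: leeD; apply: lee_wpmul2l; rewrite ?lee_fin//; exact: ltW.
rewrite -!EFinM -EFinD lte_fin -mulrDl mulrA ltr_pdivrMr// mulrC ltr_pM2l//.
by rewrite /K ltrDl.
Qed.

Lemma poly_approx_lim (fn : nat -> measurableTypeR R -> R) f g :
  (forall n, poly_approx (fn n)) -> (forall n x, `|fn n x| <= g x) -> sqi g ->
  (forall x, fn n x @[n --> \oo] --> f x) -> poly_approx f.
Proof.
move=> hfn fg [mg ig] fnf.
have mf : measurable_fun setT f.
  apply: (measurable_fun_cvg (h := fn)) => [n|x _]; [exact: (hfn n).1.1|exact: fnf].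
have fle x : `|f x| <= g x.
  have h : (fun n => `|fn n x|) @ \oo --> `|f x| by apply: cvg_norm; exact: fnf.
  rewrite -(cvg_lim _ h)//; apply: limr_le; first by apply/cvg_ex; eexists; exact: h.
  exact: nearW.
have g0 x : 0 <= g x by exact: le_trans (fg 0%N x).
apply: poly_approx_closed; first exact: sqi_le fle _.
have [|||||_ _] := @dominated_convergence _ _ _ nu setT measurableT
    (fun n x => ((f x - fn n x) ^+ 2)%:E) (cst 0%E) (fun x => (4 * g x ^+ 2)%:E).
- move=> n; apply/measurable_EFinP; apply: measurable_funX; apply: measurable_funB => //.
  exact: (hfn n).1.1.
- exact: measurable_cst.
- apply: aeW => x _; apply: cvg_EFin; first exact: nearW.
  have h : (fun n => (f x - fn n x) * (f x - fn n x)) @ \oo --> (f x - f x) * (f x - f x).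
    by apply: cvgM; apply: cvgB; first [exact: cvg_cst|exact: fnf].
  by move: h; rewrite subrr mul0r; under eq_fun do rewrite -expr2.
- apply/integrableP; split.
    by apply/measurable_EFinP; apply: measurable_funM => //; exact: measurable_funX.
  under eq_integral do rewrite /= ger0_norm ?mulr_ge0 ?sqr_ge0// EFinM.
  rewrite ge0_integralZl//.
  + by rewrite lte_mul_pinfty.
  + by apply/measurable_EFinP; exact: measurable_funX.
  + by move=> x _; rewrite lee_fin sqr_ge0.
- apply: aeW => x n _; rewrite lee_fin ger0_norm ?sqr_ge0//.
  have := fle x; have := fg n x; rewrite !ler_norml => /andP[? ?] /andP[? ?].
  have := g0 x; nra.
rewrite integral_cst// mul0e => h e e0.
have /fine_cvgP[hfin] := h; move=> /cvgrPdist_lt/(_ _ e0) hd.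
near \oo => n; exists (fn n) => //.
have hn : sq_dist f (fn n) \is a fin_num by near: n.
have : `|0 - fine (sq_dist f (fn n))| < e by near: n.
rewrite sub0r normrN => hlt; rewrite -(fineK hn) lte_fin.
exact: le_lt_trans (ler_norm _) hlt.
Unshelve. all: by end_near. Qed.

(** The one place where the exponential moment enters. *)
Lemma sqi_exp f C : measurable_fun setT f ->
  (forall x, `|f x| <= C * expR (b / 2 * `|x|)) -> sqi f.
Proof.
move=> mf fC; split => //.
have me : measurable_fun setT (fun x : measurableTypeR R => expR (b * x) + expR (- (b * x))).
  apply: measurable_continuous => x.
  apply: cvgD; (apply: continuous_comp; last exact: continuous_expR).
    by apply: cvgM; [exact: cvg_cst|exact: cvg_id].
  by apply: cvgN; apply: cvgM; [exact: cvg_cst|exact: cvg_id].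
have e0 x : 0 <= expR (b * x) + expR (- (b * x)) by rewrite addr_ge0 ?expR_ge0.
apply: (@le_lt_trans _ _ (\int[nu]_x (C ^+ 2 * (expR (b * x) + expR (- (b * x))))%:E)%E).
  apply: le_sq_int => //; first exact: measurable_funM.
  move=> x; rewrite -[f x ^+ 2]real_normK ?num_real//.
  apply: (@le_trans _ _ ((C * expR (b / 2 * `|x|)) ^+ 2)).
    by rewrite lerXn2r ?nnegrE//; exact: le_trans (fC x).
  rewrite exprMn ler_wpM2l ?sqr_ge0// expr2 -expRD.
  have -> : b / 2 * `|x| + b / 2 * `|x| = b * `|x| by field.
  have [x0|x0] := lerP 0 x.
    by rewrite ger0_norm// lerDl expR_ge0.
  by rewrite ltr0_norm// mulrN lerDr expR_ge0.
under eq_integral do rewrite EFinM.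
rewrite ge0_integralZl//.
- by rewrite lte_mul_pinfty// lee_fin sqr_ge0.
- exact/measurable_EFinP.
- by rewrite lee_fin sqr_ge0.
Qed.

Lemma poly_exp_bound q c : 0 < c ->
  exists2 C, 0 <= C & forall x : R, `|q.[x]| <= C * expR (c * `|x|).
Proof.
elim/poly_ind: q c => [|q a ih] c c0.
  by exists 0 => // x; rewrite horner0 normr0 mul0r.
have c2 : 0 < c / 2 by rewrite divr_gt0.
have [C C0 hC] := ih _ c2.
have i0 : 0 <= 2 / c by rewrite divr_ge0// ltW.
pose D := C * (2 / c).
exists (D + `|a|); first by rewrite addr_ge0// mulr_ge0.
move=> x; rewrite !hornerE; apply: (le_trans (ler_normD _ _)).
rewrite mulrDl; apply: lerD; last first.
  by rewrite ler_peMr// -expR0 ler_expR mulr_ge0// ltW.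
rewrite normrM.
have -> : c * `|x| = c / 2 * `|x| + c / 2 * `|x| by field.
rewrite expRD; set E := expR _.
have -> : D * (E * E) = C * E * (2 / c * E) by rewrite /D; ring.
apply: ler_pM => //; rewrite /E.
have := expR_ge1Dx (c / 2 * `|x|) => h.
rewrite -(ler_pM2l c2).
have -> : c / 2 * (2 / c * expR (c / 2 * `|x|)) = expR (c / 2 * `|x|).
  by rewrite mulrA (_ : c / 2 * (2 / c) = 1) ?mul1r//; field; rewrite gt_eqF.
lra.
Qed.

Lemma poly_approx_poly q : poly_approx (fun x => q.[x]).
Proof.
have b2 : 0 < b / 2 by rewrite divr_gt0.
have [C _ hC] := poly_exp_bound q b2.
split; first exact: sqi_exp (measurable_poly q) hC.
move=> e e0; exists q; rewrite /sq_dist.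
under eq_integral do rewrite subrr expr0n /=.
by rewrite integral_cst// mul0e lte_fin.
Qed.

(** A bounded function under which the closure of the polynomials is stable.  These functions
    form an algebra closed under bounded pointwise limits; showing that it contains all Borel
    indicators gives density, since 1 is a polynomial. *)
Definition multiplier m := [/\ measurable_fun setT m, exists K, forall x, `|m x| <= K &
  forall f, poly_approx f -> poly_approx (fun x => m x * f x)].

Lemma sqiM m f (K : R) : measurable_fun setT m -> (forall x, `|m x| <= K) -> sqi f ->
  sqi (fun x => m x * f x).
Proof.
move=> mm mK sf.
have sa : sqi (fun x => `|f x|).
  split; first by apply: measurableT_comp => //; exact: sf.1.
  by under eq_integral do rewrite real_normK ?num_real//; exact: sf.2.
have sK := sqi_lin K 0 sa sa.
apply: (sqi_le _ _ sK); first by apply: measurable_funM => //; exact: sf.1.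
by move=> x; rewrite mul0r addr0 normrM ler_wpM2r.
Qed.

(** Multiplication by a bounded function is continuous, so stability may be tested on
    polynomials. *)
Lemma multiplier_of_poly m K : measurable_fun setT m -> (forall x, `|m x| <= K) ->
  (forall q, poly_approx (fun x => m x * q.[x])) -> multiplier m.
Proof.
move=> mm mK hq; have K0 : 0 <= K by exact: le_trans (mK 0).
split => //; first by exists K.
move=> f [sf hf]; apply: poly_approx_closed; first exact: sqiM mK sf.
move=> e e0; have k0 : 0 < K ^+ 2 + 1 by rewrite ltr_wpDl// sqr_ge0.
have [q qf] := hf _ (divr_gt0 e0 k0); exists (fun x => m x * q.[x]); first exact: hq.
have mB : measurable_fun setT (fun x => f x - q.[x]).
  by apply: measurable_funB (measurable_poly q); exact: sf.1.
apply: (@le_lt_trans _ _ (\int[nu]_x (K ^+ 2 * (f x - q.[x]) ^+ 2 + 0 * (f x - q.[x]) ^+ 2)%:E)%E).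
  apply: le_sq_int.
  - by apply: measurable_funB; apply: measurable_funM => //; [exact: sf.1|exact: measurable_poly].
  - by apply: measurable_funD; apply: measurable_funM => //; exact: measurable_funX.
  - move=> x; rewrite mul0r addr0 -mulrBr exprMn ler_wpM2r ?sqr_ge0//.
    by rewrite -[m x ^+ 2]real_normK ?num_real// lerXn2r ?nnegrE.
rewrite sq_int_lin ?sqr_ge0// mul0e adde0.
apply: (@le_lt_trans _ _ ((K ^+ 2)%:E * (e / (K ^+ 2 + 1))%:E)%E).
  by apply: lee_wpmul2l; rewrite ?lee_fin ?sqr_ge0//; exact: ltW.
by rewrite -EFinM lte_fin mulrCA gtr_pMr// ltr_pdivrMr// mul1r ltrDl.
Qed.

Lemma multiplier_lin c m d m' : multiplier m -> multiplier m' ->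
  multiplier (fun x => c * m x + d * m' x).
Proof.
move=> [mm [K mK] hm] [mm' [K' mK'] hm']; split.
- by apply: measurable_funD; exact: measurable_funM.
- exists (`|c| * K + `|d| * K') => x; apply: (le_trans (ler_normD _ _)).
  by rewrite !normrM lerD// ler_wpM2l.
- move=> f hf; have -> : (fun x => (c * m x + d * m' x) * f x) =
     (fun x => c * (m x * f x) + d * (m' x * f x)) by apply/funext => x; ring.
  by apply: poly_approx_lin; [exact: hm|exact: hm'].
Qed.

Lemma multiplierM m m' : multiplier m -> multiplier m' -> multiplier (fun x => m x * m' x).
Proof.
move=> [mm [K mK] hm] [mm' [K' mK'] hm']; split.
- exact: measurable_funM.
- by exists (K * K') => x; rewrite normrM; apply: ler_pM.
- move=> f hf; under eq_fun do rewrite -mulrA.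
  by apply: (hm (fun x => m' x * f x)); exact: hm'.
Qed.

Lemma multiplier_cst c : multiplier (fun=> c).
Proof.
split; [exact: measurable_cst|by exists `|c| |] => f hf.
have -> : (fun x => c * f x) = (fun x => c * f x + 0 * f x).
  by apply/funext => x; ring.
exact: poly_approx_lin.
Qed.

Lemma multiplierX m n : multiplier m -> multiplier (fun x => m x ^+ n).
Proof.
move=> hm; elim: n => [|n ih]; first by under eq_fun do rewrite expr0; exact: multiplier_cst.
by under eq_fun do rewrite exprS; exact: multiplierM.
Qed.

Lemma multiplier_lim (mn : nat -> measurableTypeR R -> R) m K :
  (forall n, multiplier (mn n)) -> (forall n x, `|mn n x| <= K) ->
  (forall x, mn n x @[n --> \oo] --> m x) -> multiplier m.
Proof.
move=> hmn mnK mnm.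
have mm : measurable_fun setT m.
  apply: (measurable_fun_cvg (h := mn)) => [n|x _]; [by case: (hmn n)|exact: mnm].
split => //.
  exists K => x; have h : (fun n => `|mn n x|) @ \oo --> `|m x|.
    by apply: cvg_norm; exact: mnm.
  rewrite -(cvg_lim _ h)//; apply: limr_le; first by apply/cvg_ex; eexists; exact: h.
  exact: nearW.
move=> f hf; apply: (@poly_approx_lim (fun n x => mn n x * f x) _ (fun x => K * `|f x|)).
- by move=> n; case: (hmn n) => _ _; exact.
- by move=> n x; rewrite normrM ler_wpM2r.
- have sa : sqi (fun x => `|f x|).
    split; first by apply: measurableT_comp => //; exact: hf.1.1.
    by under eq_integral do rewrite real_normK ?num_real//; exact: hf.1.2.
  by have := sqi_lin K 0 sa sa; under eq_fun do rewrite mul0r addr0.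
- by move=> x; apply: cvgM; [exact: mnm|exact: cvg_cst].
Qed.

(** The iteration u + (t^2 - u^2)/2 multiplies the error |t| - u by 1 - (|t| + u)/2; hence |t|
    is a limit of polynomials in t. *)
Lemma abs_approx (t : R) : `|t| <= 1 ->
  let p := fun n => iter n (fun u => u + (t ^+ 2 - u ^+ 2) / 2) 0 in
  forall n, 0 <= p n <= `|t| /\ `|t| - p n <= `|t| * (1 - `|t| / 2) ^+ n.
Proof.
move=> t1 p; elim=> [|n [/andP[p0 pt] h]]; first by rewrite lexx normr_ge0 subr0 expr0 mulr1.
have t0 := normr_ge0 t; rewrite /= -/(p n).
have -> : t ^+ 2 = `|t| ^+ 2 by rewrite real_normK// num_real.
move: (`|t|) t0 t1 pt h => s s0 s1 ps h; move: (p n) p0 ps h => u u0 us h.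
have -> : u + (s ^+ 2 - u ^+ 2) / 2 = s - (s - u) * (1 - (s + u) / 2) by field.
have h2 : 0 <= (s - u) * (1 - (s + u) / 2) by apply: mulr_ge0; lra.
have h3 : (s - u) * (1 - (s + u) / 2) <= (s - u) * (1 - s / 2).
  by apply: ler_wpM2l; lra.
have h4 : (s - u) * (1 - s / 2) <= s * (1 - s / 2) ^+ n * (1 - s / 2).
  by apply: ler_wpM2r => //; lra.
split; last by rewrite exprSr mulrA; lra.
apply/andP; split; last by lra.
have h5 : (s - u) * (1 - (s + u) / 2) <= (s - u) * 1 by apply: ler_wpM2l; lra.
lra.
Qed.

Lemma expr_cvg0 (t : R) : 0 <= t < 1 -> (fun n => t ^+ n) @ \oo --> (0 : R).
Proof. by move=> /andP[t0 t1]; apply: cvg_expr; rewrite ger0_norm. Qed.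

Lemma multiplier_abs m : multiplier m -> (forall x, `|m x| <= 1) ->
  multiplier (fun x => `|m x|).
Proof.
move=> hm m1; pose p n x := iter n (fun u => u + (m x ^+ 2 - u ^+ 2) / 2) (0 : R).
have hp n : multiplier (p n).
  elim: n => [|n ih]; first exact: multiplier_cst.
  have -> : p n.+1 = (fun x => 1 * p n x + 1 * ((1 / 2) * m x ^+ 2 + (- (1 / 2)) * p n x ^+ 2)).
    by apply/funext => x; rewrite /p /=; field.
  by apply: multiplier_lin => //; apply: multiplier_lin; exact: multiplierX.
have ph n x : 0 <= p n x <= `|m x| /\ `|m x| - p n x <= `|m x| * (1 - `|m x| / 2) ^+ n.
  exact: abs_approx (m1 x) n.
apply: (multiplier_lim (K := 1) hp) => [n x|x].
  by have [/andP[h0 h1] _] := ph n x; rewrite ger0_norm//; exact: le_trans (m1 x).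
have [t0|t0] := eqVneq (`|m x|) 0.
  have -> : (fun n => p n x) = cst `|m x|; last exact: cvg_cst.
  by apply/funext => n; have [/andP[h0 h1] _] := ph n x; apply/le_anti; rewrite h1 t0 h0.
have tp : 0 < `|m x| by rewrite lt_neqAle eq_sym t0 normr_ge0.
have q0 : 0 <= 1 - `|m x| / 2 < 1 by have := m1 x; lra.
have l1 : (fun n => `|m x| - `|m x| * (1 - `|m x| / 2) ^+ n) @ \oo --> `|m x|.
  rewrite -[X in _ --> X]subr0 -[X in _ --> _ - X](mulr0 `|m x|).
  by apply: cvgB; [exact: cvg_cst|apply: cvgM; [exact: cvg_cst|exact: expr_cvg0]].
have l2 : (fun _ : nat => `|m x|) @ \oo --> `|m x| by exact: cvg_cst.
refine (squeeze_cvgr _ l1 l2); apply: nearW => n.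
have [/andP[h0 h1] h2] := ph n x; rewrite h1 andbT; lra.
Qed.

Lemma half_pos (t : R) : `|t| <= 1 -> 0 <= 1 / 2 * t + 1 / 2 * `|t| <= 1.
Proof. by have [?|?] := ger0P t => ?; lra. Qed.

Lemma half_gt0 (t : R) : 0 < t -> 0 < 1 / 2 * t + 1 / 2 * `|t|.
Proof. by move=> t0; rewrite gtr0_norm//; lra. Qed.

(** The positive part g of m has values in [0, 1], and 1 - (1 - g)^n tends to the indicator of
    the set where g > 0. *)
Lemma multiplier_gt0 m : multiplier m -> (forall x, `|m x| <= 1) ->
  multiplier (\1_[set x | 0 < m x]).
Proof.
move=> hm m1; have ha := multiplier_abs hm m1.
(* linear combinations keep the form of [multiplier_lin], whence the factors 1 * and -1 * *)
pose g x := (1 / 2) * m x + (1 / 2) * `|m x|.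
have hg : multiplier g by exact: multiplier_lin.
have g01 x : 0 <= g x <= 1.
  exact: half_pos (m1 x).
pose f n x := 1 * 1 + (-1) * (1 * 1 + (-1) * g x) ^+ n.
have hf n : multiplier (f n).
  apply: multiplier_lin; first exact: multiplier_cst.
  by apply: multiplierX; apply: multiplier_lin => //; exact: multiplier_cst.
have fE n x : f n x = 1 - (1 - g x) ^+ n by rewrite /f !mul1r !mulN1r.
apply: (multiplier_lim (K := 1) hf) => [n x|x].
  rewrite fE; have h0 : 0 <= (1 - g x) ^+ n by apply: exprn_ge0; have := g01 x; lra.
  have h1 : (1 - g x) ^+ n <= 1 by apply: exprn_ile1; have := g01 x; lra.
  by rewrite ger0_norm; lra.
under eq_fun do rewrite fE.
have [mx|mx] := ltrP 0 (m x).
  have -> : \1_[set x | 0 < m x] x = 1 - 0 :> R by rewrite indicE mem_set// subr0.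
  apply: cvgB; [exact: cvg_cst|apply: expr_cvg0].
  by have := g01 x; have : 0 < g x by [exact: half_gt0]; lra.
have -> : \1_[set x | 0 < m x] x = 0 :> R.
  by rewrite indicE memNset//= => h; move: mx; rewrite leNgt h.
have -> : g x = 0 by rewrite /g ler0_norm//; ring.
rewrite (_ : (fun n => _) = cst 0); first exact: cvg_cst.
by apply/funext => n; rewrite subr0 expr1n subrr.
Qed.

Lemma expR_partial (y : R) n : \sum_(0 <= k < n) `|y| ^+ k / k`!%:R <= expR `|y|.
Proof.
have -> : expR `|y| = limn (series (exp_coeff `|y|)) by [].
apply: (@nondecreasing_cvgn_le _ (series (exp_coeff `|y|)) _ _ n); last exact: is_cvg_series_exp_coeff.
by apply: nondecreasing_series => k _ _; apply: exp_coeff_ge0.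
Qed.

Lemma sin_partial_le (y : R) n : `|series (sin_coeff y) n| <= expR `|y|.
Proof.
apply: le_trans (expR_partial y n); apply: (le_trans (ler_norm_sum _ _ _)).
apply: ler_sum => k _; rewrite /sin_coeff /= !normrM normfV !normrX normrN1 expr1n mulr1.
rewrite (ger0_norm (ler0n _ k`!)) ger0_norm ?ler0n//.
by case: (odd k); rewrite ?mul1r// !mul0r divr_ge0// exprn_ge0.
Qed.

(** The Taylor sums of the sine are polynomials dominated by e^(s |x - a|); for small s this
    stays square integrable after multiplication by a polynomial. *)
Lemma multiplier_sin (s a : R) : 0 < s -> s <= b / 4 ->
  multiplier (fun x => sin (s * (x - a))).
Proof.
move=> s0 sb; have b4 : 0 < b / 4 by rewrite divr_gt0.
have ms : measurable_fun setT (fun x : measurableTypeR R => sin (s * (x - a))).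
  apply: measurable_continuous => x; apply: continuous_comp; last exact: continuous_sin.
  by apply: cvgM; [exact: cvg_cst|apply: cvgB; [exact: cvg_id|exact: cvg_cst]].
apply: (multiplier_of_poly (K := 1) ms) => [x|q]; first exact: norm_sin_le1.
have [C C0 hC] := poly_exp_bound q b4.
pose p n : {poly R} := \sum_(0 <= k < n)
  ((odd k)%:R * (-1) ^+ k.-1./2 / k`!%:R) *: (s *: ('X - a%:P)) ^+ k.
have pE n x : (p n).[x] = series (sin_coeff (s * (x - a))) n.
  rewrite /p horner_sum /series /=; apply: eq_bigr => k _.
  by rewrite /sin_coeff /= !hornerE; ring.
pose D := expR (s * `|a|) * C.
have D0 : 0 <= D by rewrite mulr_ge0 ?expR_ge0.
apply: (@poly_approx_lim (fun n x => (p n * q).[x]) _ (fun x => D * expR (b / 2 * `|x|))).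
- by move=> n; exact: poly_approx_poly.
- move=> n x; rewrite hornerM normrM pE.
  have -> : D * expR (b / 2 * `|x|) = expR (s * `|a| + b / 4 * `|x|) * (C * expR (b / 4 * `|x|)).
    rewrite expRD /D (_ : b / 2 * `|x| = b / 4 * `|x| + b / 4 * `|x|); last by field.
    by rewrite expRD; ring.
  apply: ler_pM => //; apply: (le_trans (sin_partial_le _ _)).
  rewrite ler_expR normrM gtr0_norm//.
  apply: (@le_trans _ _ (s * (`|a| + `|x|))).
    by apply: ler_wpM2l; [exact: ltW|apply: le_trans (ler_normB _ _) _; rewrite addrC].
  by rewrite mulrDr lerD2l ler_wpM2r.
- apply: (@sqi_exp _ D) => [|x]; last by rewrite ger0_norm// mulr_ge0 ?expR_ge0.
  apply: measurable_continuous => x; apply: cvgM; first exact: cvg_cst.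
  apply: continuous_comp; last exact: continuous_expR.
  by apply: cvgM; [exact: cvg_cst|exact: norm_continuous].
- move=> x; under eq_fun do rewrite hornerM pE.
  apply: cvgM; last exact: cvg_cst.
  have -> : sin (s * (x - a)) = limn (series (sin_coeff (s * (x - a)))) by rewrite unlock.
  exact: is_cvg_series_sin_coeff.
Qed.

(** For a fixed x and small s > 0, sin(s (x - a)) has the sign of x - a. *)
Lemma multiplier_ray (a : R) : multiplier (\1_`]a, +oo[%classic).
Proof.
pose s n : R := b / 4 / n.+1%:R.
have b4 : 0 < b / 4 by rewrite divr_gt0.
have s0 n : 0 < s n by rewrite divr_gt0.
have sb n : s n <= b / 4 by rewrite /s ler_piMr ?(ltW b4)// invf_le1 ?ler1n.
have hm n := multiplier_gt0 (multiplier_sin a (s0 n) (sb n)) (fun x => norm_sin_le1 _).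
apply: (multiplier_lim (K := 1) hm) => [n x|x].
  by rewrite indicE; case: (_ \in _); rewrite ?normr1 ?normr0.
have sc : (fun n => s n * `|x - a|) @ \oo --> (0 : R).
  rewrite -(mul0r `|x - a|) -(mulr0 (b / 4)); apply: cvgM; last exact: cvg_cst.
  apply: cvgM; first exact: cvg_cst.
  exact: cvg_harmonic.
apply: cvg_near_cst; near=> n.
have h : s n * `|x - a| < pi by near: n; apply: (cvgr_lt (0 : R) sc); exact: pi_gt0.
rewrite !indicE; congr (nat_of_bool _)%:R; apply/idP/idP; rewrite !inE /= in_itv /= andbT.
  move=> hs; rewrite ltNge; apply/negP => xa.
  move: hs; rewrite ltNge => /negP; apply.
  rewrite -oppr_ge0 -sinN -mulrN opprB; apply: sin_ge0_pi.
  move: h; rewrite ler0_norm ?subr_le0// opprB => /ltW ->.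
  by rewrite andbT mulr_ge0 ?subr_ge0// ltW.
move=> ax; apply: sin_gt0_pi; rewrite mulr_gt0 ?subr_gt0//=.
by move: h; rewrite gtr0_norm ?subr_gt0.
Unshelve. all: by end_near. Qed.

Lemma multiplier_setC (A : set (measurableTypeR R)) : multiplier (\1_A) -> multiplier (\1_(~` A)).
Proof.
move=> hA; have -> : \1_(~` A) = (fun x : measurableTypeR R => 1 * 1 + (-1) * \1_A x) :> (_ -> R).
  apply/funext => x; rewrite !indicE in_setC; case: (x \in A) => /=; ring.
by apply: multiplier_lin => //; exact: multiplier_cst.
Qed.

Lemma multiplier_bigcup (F : nat -> set (measurableTypeR R)) :
  (forall n, multiplier (\1_(F n))) -> multiplier (\1_(\bigcup_n F n)).
Proof.
move=> hF; pose G n := \big[setU/set0]_(i < n) F i.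
have hG n : multiplier (\1_(G n)).
  elim: n => [|n ih].
    rewrite /G big_ord0 (_ : \1_set0 = (fun=> 0)); first exact: multiplier_cst.
    by apply/funext => x; rewrite indic0.
  have -> : \1_(G n.+1) = (fun x : measurableTypeR R =>
      1 * (1 * \1_(G n) x + 1 * \1_(F n) x) + (-1) * (\1_(G n) x * \1_(F n) x)) :> (_ -> R).
    apply/funext => x; rewrite /G big_ord_recr /= !indicE in_setU.
    by case: (x \in \big[_/_]_(_ < _) _); case: (x \in F n) => /=; ring.
  by apply: multiplier_lin; [exact: multiplier_lin|exact: multiplierM].
apply: (multiplier_lim (K := 1) hG) => [n x|x].
  by rewrite indicE; case: (_ \in _); rewrite ?normr1 ?normr0.
apply: cvg_near_cst; have [[k _ Fk]|nF] := pselect ((\bigcup_n F n) x).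
  near=> n; rewrite !indicE !mem_set//; first by exists k.
  rewrite /G -bigcup_mkord; exists k => //=; near: n; exact: nbhs_infty_gt.
apply: nearW => n; rewrite !indicE !memNset//.
by rewrite /G -bigcup_mkord => -[k /= _ Fk]; apply: nF; exists k.
Unshelve. all: by end_near. Qed.

Lemma multiplier_measurable (A : set (measurableTypeR R)) : measurable A -> multiplier (\1_A).
Proof.
move=> mA; (* open half-lines generate the Borel sets *)
have {}mA : (@RGenOInfty.G R).-sigma.-measurable A by rewrite -RGenOInfty.measurableE.
have sub := @smallest_sub _ (sigma_algebra setT) (@RGenOInfty.G R)
  (fun A : set (measurableTypeR R) => multiplier (\1_A)).
apply: (sub _ _ A mA).
  split.
  - rewrite (_ : \1_set0 = (fun=> 0)); first exact: multiplier_cst.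
    by apply/funext => x; rewrite indic0.
  - by move=> B hB; rewrite setTD; exact: multiplier_setC.
  - exact: multiplier_bigcup.
by move=> _ [a ->]; exact: multiplier_ray.
Qed.

Lemma poly_approx_indic (A : set (measurableTypeR R)) : measurable A -> poly_approx (\1_A).
Proof.
move=> mA; have [_ _ h] := multiplier_measurable mA.
have := h _ (poly_approx_poly 1); congr poly_approx.
by apply/funext => x; rewrite hornerC mulr1.
Qed.

Lemma poly_approx_sum (I : Type) (r : seq I) (c : I -> R) (F : I -> measurableTypeR R -> R) :
  (forall i, poly_approx (F i)) -> poly_approx (fun x => \sum_(i <- r) c i * F i x).
Proof.
move=> hF; elim: r => [|i r ih].
  have := poly_approx_poly 0; congr poly_approx.
  by apply/funext => x; rewrite big_nil horner0.
under eq_fun do rewrite big_cons -[X in _ + X]mul1r.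
exact: poly_approx_lin.
Qed.

Import HBNNSimple.

Lemma poly_approx_ge0 f : sqi f -> (forall x, 0 <= f x) -> poly_approx f.
Proof.
move=> [mf fi] f0.
have mEf : measurable_fun setT (EFin \o f) by exact/measurable_EFinP.
pose h := nnsfun_approx measurableT mEf.
have f0' x : setT x -> (0 <= (EFin \o f) x)%E by rewrite lee_fin.
have hc x : (fun n => h n x) @ \oo --> f x.
  have := cvg_nnsfun_approx measurableT mEf f0' (I : setT x).
  by move/fine_cvg.
apply: (@poly_approx_lim h f f) => //.
- move=> n; have -> : (h n : _ -> R) = (fun x => \sum_(y <- finmap.enum_fset (fset_set (range (h n)))) y * \1_(h n @^-1` [set y]) x).
    apply/funext => x; rewrite (fimfunE (h n)) fsbig_finite//.
  by apply: poly_approx_sum => y; apply: poly_approx_indic.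
- move=> n x; rewrite ger0_norm//.
  rewrite -(cvg_lim _ (hc x))//; apply: nondecreasing_cvgn_le.
    by move=> i j ij; have /lefP := nd_nnsfun_approx measurableT mEf ij; exact.
  by apply/cvg_ex; exists (f x).
Qed.

Lemma poly_approx_all f : sqi f -> poly_approx f.
Proof.
move=> [mf fi].
have aux (g : measurableTypeR R -> R) : measurable_fun setT g ->
    (forall x, 0 <= g x) -> (forall x, g x <= `|f x|) -> poly_approx g.
  move=> mg g0 gf; apply: poly_approx_ge0 => //.
  apply: (sqi_le (g := fun x => `|f x|)) => //; first by move=> x; rewrite ger0_norm.
  split; first exact: measurableT_comp.
  by under eq_integral do rewrite real_normK ?num_real//.
have hp : poly_approx (fun x => (1 / 2) * `|f x| + (1 / 2) * f x).
  apply: aux.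
  - by apply: measurable_funD; apply: measurable_funM => //; exact: measurableT_comp.
  - by move=> x; case: (ger0P (f x)) => ?; lra.
  - by move=> x; case: (ger0P (f x)) => ?; lra.
have hn : poly_approx (fun x => (1 / 2) * `|f x| + (- (1 / 2)) * f x).
  apply: aux.
  - by apply: measurable_funD; apply: measurable_funM => //; exact: measurableT_comp.
  - by move=> x; case: (ger0P (f x)) => ?; lra.
  - by move=> x; case: (ger0P (f x)) => ?; lra.
have := poly_approx_lin 1 (-1) hp hn; congr poly_approx.
by apply/funext => x; field.
Qed.

End poly_density.

(** * The Meixner-Pollaczek measure *)

Section density.
Context d (T : measurableType d) (R : realType).
Variables (nu mu : {measure set T -> \bar R}) (w : T -> R).
Hypothesis mw : measurable_fun setT w.
Hypothesis w0 : forall x, 0 <= w x.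
Hypothesis nuE : forall B, measurable B -> nu B = (\int[mu]_(x in B) (w x)%:E)%E.

Import HBNNSimple.
Local Open Scope ereal_scope.

(** Simple functions and monotone convergence, from the formula for sets. *)
Lemma ge0_integral_density (f : T -> \bar R) : (forall x, 0 <= f x) ->
  measurable_fun setT f -> \int[nu]_x f x = \int[mu]_x (f x * (w x)%:E).
Proof.
move=> f0 mf; have w0' x : 0 <= (w x)%:E by rewrite lee_fin.
have mw' : measurable_fun setT (EFin \o w) by exact/measurable_EFinP.
pose h := nnsfun_approx measurableT mf.
have f0' x : setT x -> 0 <= f x by [].
have hc x := cvg_nnsfun_approx measurableT mf f0' (I : setT x).
have hn x a b : (a <= b)%N -> ((h a x)%:E <= (h b x)%:E).
  by move=> ab; rewrite lee_fin; have /lefP := nd_nnsfun_approx measurableT mf ab; exact.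
have -> : \int[nu]_x f x = lim (\int[nu]_x (EFin \o h n) x @[n --> \oo]).
  rewrite -monotone_convergence//; last 3 first.
  - by move=> n; exact/measurable_EFinP.
  - by move=> n x _ /=; rewrite lee_fin.
  - by move=> x _ a b ab; exact: hn.
  by apply: eq_integral => x _; apply/esym/cvg_lim => //; exact: hc.
have -> : \int[mu]_x (f x * (w x)%:E) = lim (\int[mu]_x ((h n x)%:E * (w x)%:E) @[n --> \oo]).
  rewrite -monotone_convergence//; last 3 first.
  - by move=> n; apply: emeasurable_funM => //; exact/measurable_EFinP.
  - by move=> n x _ /=; rewrite mule_ge0// lee_fin.
  - by move=> x _ a b ab; apply: lee_wpmul2r => //; exact: hn.
  apply: eq_integral => x _; apply/esym/cvg_lim => //.
  by apply: cvgeZr => //; exact: hc.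
congr (lim _); congr (_ @ \oo); apply/funext => n /=.
have hE x : (h n x)%:E = \sum_(y \in range (h n)) (y * \1_(h n @^-1` [set y]) x)%:E.
  by rewrite fimfunE -fsumEFin.
under eq_integral do rewrite hE.
rewrite ge0_integral_fsum//; last 2 first.
- by move=> y; apply/measurable_EFinP; exact: measurable_funM.
- by move=> m y _; exact: nnfun_muleindic_ge0.
transitivity (\int[mu]_x ((\sum_(y \in range (h n)) (y * \1_(h n @^-1` [set y]) x)%:E) * (w x)%:E)); last first.
  by apply: eq_integral => x _; rewrite hE.
transitivity (\int[mu]_x (\sum_(y \in range (h n)) ((y * \1_(h n @^-1` [set y]) x)%:E * (w x)%:E))); last first.
  apply: eq_integral => x _; rewrite -ge0_mule_fsuml// => y.
  exact: nnfun_muleindic_ge0.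
rewrite ge0_integral_fsum//; last 2 first.
- by move=> y; apply: emeasurable_funM => //; apply/measurable_EFinP; exact: measurable_funM.
- by move=> m y _; rewrite mule_ge0//; exact: nnfun_muleindic_ge0.
apply: eq_fsbigr => y /set_mem[x0 _ yE].
have y0 : (0 <= y)%R by rewrite -yE.
have mB : measurable (h n @^-1` [set y]) by [].
under eq_integral do rewrite EFinM.
rewrite ge0_integralZl//; last by exact/measurable_EFinP.
rewrite integral_indic// setIT nuE//.
under [in RHS]eq_integral do rewrite EFinM -muleA.
rewrite ge0_integralZl//; last 2 first.
- by apply: emeasurable_funM => //; exact/measurable_EFinP.
- by move=> x _; rewrite mule_ge0// lee_fin.
congr (_ * _); rewrite [LHS]integral_mkcond; apply: eq_integral => x _.
rewrite patchE indicE; case: (x \in _) => /=; by rewrite ?mul1e ?mul0e.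
Qed.

Lemma Rintegral_density (g : T -> R) : measurable_fun setT g ->
  (\int[nu]_x g x = \int[mu]_x (g x * w x))%R.
Proof.
move=> mg; have mg' : measurable_fun setT (EFin \o g) by exact/measurable_EFinP.
rewrite /Rintegral [X in fine X = _]integralE [X in _ = fine X]integralE !ge0_integral_density//; last 2 first.
- exact: measurable_funeneg.
- exact: measurable_funepos.
have aux (u v : R) : (0 <= v)%R -> maxe u%:E 0 * v%:E = maxe (u * v)%:E 0.
  move=> v0; have [u0|u0] := leP 0%R u.
    by rewrite !max_l ?lee_fin ?mulr_ge0.
  by rewrite !max_r ?lee_fin ?mulr_le0_ge0 ?(ltW u0)// mul0e.
congr (fine (_ - _)); apply: eq_integral => x _; first by rewrite !funeposE aux.
by rewrite !funenegE -!EFinN aux// mulNr.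
Qed.

Lemma integrable_density (g : T -> R) : measurable_fun setT g ->
  mu.-integrable setT (EFin \o (fun x => g x * w x)%R) -> nu.-integrable setT (EFin \o g).
Proof.
move=> mg /integrableP[_ ig]; apply/integrableP; split; first exact/measurable_EFinP.
rewrite ge0_integral_density//; last by apply: measurableT_comp => //; exact/measurable_EFinP.
rewrite (le_lt_trans _ ig)// le_eqVlt; apply/orP; left; apply/eqP.
by apply: eq_integral => x _ /=; rewrite -EFinM normrM (ger0_norm (w0 x)).
Qed.

End density.

Section MP.
Context {R : realType} (lam : R).
Hypothesis lam_gt0 : 0 < lam.
Notation leb := (@lebesgue_measure R).
Notation mu := (MP_measure lam : {measure set (measurableTypeR R) -> \bar R}).
Notation a := (2 * lam).
Notation S := (sq_tr (gamma_fun lam)).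

Let a_gt0 : 0 < a. Proof. by rewrite mulr_gt0. Qed.
Let Ga : Gamma a != 0. Proof. exact: Gamma_neq0. Qed.
Let pi_neq0 : pi != 0 :> R. Proof. by rewrite gt_eqF// pi_gt0. Qed.

(** The density is MP_cst |Gamma(lam + ix)|^2, and the symbol is pi times the density. *)
Definition MP_cst : R := expR ((a - 1) * ln 2) / (pi * Gamma a).

Lemma MP_cst_gt0 : 0 < MP_cst.
Proof. by rewrite divr_gt0 ?expR_gt0// mulr_gt0 ?pi_gt0// Gamma_gt0. Qed.

Let powE : 2 `^ (a - 1) = expR ((a - 1) * ln 2) :> R.
Proof. by rewrite /powR gt_eqF. Qed.

Lemma MP_densityE x : MP_density lam x = MP_cst * S x.
Proof. by rewrite /MP_density sqrmod_cGamma// powE. Qed.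

Lemma MP_symbolE x : MP_symbol lam x = pi * MP_cst * S x.
Proof.
rewrite /MP_symbol sqrmod_cGamma// powE /MP_cst; congr (_ * _).
by move: (pi : R) pi_neq0 (Gamma a) Ga => p p0 g g0; field; rewrite p0 g0.
Qed.

Lemma MP_density_gt0 x : 0 < MP_density lam x.
Proof. by rewrite MP_densityE mulr_gt0 ?MP_cst_gt0// sq_tr_gamma_gt0. Qed.

Lemma measurable_S : measurable_fun setT (S : R -> R).
Proof. exact: measurable_continuous (continuous_sq_tr_gamma lam_gt0). Qed.

Let muE (B : set (measurableTypeR R)) : measurable B ->
  mu B = (\int[leb]_(x in B) (MP_density lam x)%:E)%E.
Proof. by []. Qed.

Lemma Rint_MP (g : R -> R) : measurable_fun setT g ->
  integrable_line (fun x => g x * S x) ->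
  mu.-integrable setT (EFin \o g) /\
  \int[mu]_x g x = MP_cst * \int[leb]_x (g x * S x).
Proof.
move=> mg ig; have m1 := measurable_MP_density lam; have p1 := MP_density_ge0 lam.
have e x : g x * MP_density lam x = MP_cst * (g x * S x).
  by rewrite MP_densityE mulrCA.
split.
  apply: (integrable_density m1 p1 muE) => //.
  have := integrable_lineZ MP_cst ig; rewrite /integrable_line.
  by apply: eq_integrable => // x _; rewrite /= e.
rewrite (Rintegral_density m1 p1 muE)// -(RintZ _ ig).
by apply: eq_Rint => x; rewrite e.
Qed.

(** The cosh series is integrated term by term: with b = 1 / (2 lam + 1) the moment bounds make
    the term of degree 2n at most 2 K 4^-n. *)
Lemma exp_moment_MP :
  (\int[mu]_x (expR ((a + 1)^-1 * x) + expR (- ((a + 1)^-1 * x)))%:E < +oo)%E.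
Proof.
set b := (a + 1)^-1; have b0 : 0 < b by rewrite invr_gt0 ltr_wpDl// ltW.
have m1 := measurable_MP_density lam; have p1 := MP_density_ge0 lam.
have me : measurable_fun setT (fun x : measurableTypeR R => expR (b * x) + expR (- (b * x))).
  apply: measurable_continuous => x.
  apply: cvgD; (apply: continuous_comp; last exact: continuous_expR).
    by apply: cvgM; [exact: cvg_cst|exact: cvg_id].
  by apply: cvgN; apply: cvgM; [exact: cvg_cst|exact: cvg_id].
rewrite (ge0_integral_density m1 p1 muE); last 2 first.
- by move=> x; rewrite lee_fin addr_ge0 ?expR_ge0.
- exact/measurable_EFinP.
(* the terms of the series of 2 cosh (b x), times the density; those of odd degree vanish *)
pose u k (x : R) := (exp_coeff (b * x) k + exp_coeff (- (b * x)) k) * (MP_cst * S x).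
have uodd k x : odd k -> u k x = 0.
  move=> ok; rewrite /u /exp_coeff /= exprNn -signr_odd ok expr1 mulN1r mulNr.
  by rewrite subrr mul0r.
have ueven n x : u (2 * n)%N x = (2 * b ^+ (2 * n) / (2 * n)`!%:R * MP_cst) * (x ^+ (2 * n) * S x).
  rewrite /u /exp_coeff /= exprNn -signr_odd oddM /= expr0 mul1r exprMn.
  by move: ((2 * n)`!%:R^-1) => z; ring.
have u0 k x : 0 <= u k x.
  have [ok|] := boolP (odd k); first by rewrite uodd.
  rewrite -dvdn2 => /dvdnP[n ->]; rewrite mulnC ueven.
  rewrite mulr_ge0//; last by rewrite mulr_ge0 ?sq_tr_ge0// exprM exprn_ge0// sqr_ge0.
  rewrite mulr_ge0 ?(ltW MP_cst_gt0)// divr_ge0// mulr_ge0// exprn_ge0// ltW//.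
pose K := MP_cst * (2 * pi * (expR (- (a * ln 2)) * Gamma a)).
have K0 : 0 <= K.
  rewrite mulr_ge0 ?(ltW MP_cst_gt0)// mulr_ge0 ?mulr_ge0 ?pi_ge0// ?expR_ge0//.
  by rewrite ltW// Gamma_gt0.
have mu_ k : measurable_fun setT (u k).
  apply: measurable_funM; last by apply: measurable_funM => //; exact: measurable_S.
  rewrite /exp_coeff /=; apply: measurable_funD; apply: measurable_funM => //;
    apply: measurable_funX; first exact: measurable_funM.
  by apply: measurableT_comp => //; exact: measurable_funM.
have iu k : (\int[leb]_x (u k x)%:E <= (2 * K * (1 / 2) ^+ k)%:E)%E.
  have [ok|] := boolP (odd k).
    under eq_integral do rewrite uodd//.
    rewrite integral_cst// mul0e lee_fin; apply: mulr_ge0; first exact: mulr_ge0.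
    by apply: exprn_ge0; exact: divr_ge0.
  rewrite -dvdn2 => /dvdnP[n ->]; rewrite mulnC.
  under eq_integral do rewrite ueven.
  have [im bm] := moment_sq_tr_gamma n lam_gt0.
  rewrite EFin_Rint; last exact: integrable_lineZ.
  rewrite lee_fin RintZ//.
  have c0 : 0 <= 2 * b ^+ (2 * n) / (2 * n)`!%:R * MP_cst.
    rewrite mulr_ge0 ?(ltW MP_cst_gt0)// divr_ge0// mulr_ge0// exprn_ge0// ltW//.
  apply: (le_trans (ler_wpM2l c0 (le_trans bm (moment_fact_bound n lam_gt0)))).
  have f0 : (2 * n)`!%:R != 0 :> R by rewrite pnatr_eq0 -lt0n fact_gt0.
  have bb : b ^+ (2 * n) * ((a + 1) ^+ 2 / 4) ^+ n = (1 / 2) ^+ (2 * n) :> R.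
    rewrite !exprM -exprMn; congr (_ ^+ n); rewrite /b; field.
    by rewrite gt_eqF// ltr_wpDl// ltW.
  rewrite -bb /K; move: ((2 * n)`!%:R : R) f0 (b ^+ _) (_ ^+ n) (expR _) => f f0 x y z.
  by move: (Gamma a) MP_cst => g c; rewrite le_eqVlt; apply/orP; left; apply/eqP; field.
have -> : (\int[leb]_x ((expR (b * x) + expR (- (b * x)))%:E * (MP_density lam x)%:E) =
    \int[leb]_x (\sum_(k <oo) (u k x)%:E))%E.
  apply: eq_integral => x _; rewrite -EFinM; apply/esym/cvg_lim => //.
  have -> : (fun n => \sum_(0 <= k < n) (u k x)%:E)%E = EFin \o series (fun k => u k x).
    by apply/funext => n; rewrite sumEFin.
  apply: cvg_EFin; first exact: nearW.
  have -> : fine \o (EFin \o series (fun k => u k x)) =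
      (fun n => (series (exp_coeff (b * x)) n + series (exp_coeff (- (b * x))) n) * MP_density lam x).
    apply/funext => n; rewrite /= /series /= -big_split /= mulr_suml MP_densityE.
    by apply: eq_bigr.
  apply: cvgM; last exact: cvg_cst.
  by apply: cvgD; exact: is_cvg_series_exp_coeff.
rewrite integral_nneseries//; last 2 first.
- by move=> n; apply/measurable_EFinP; exact: mu_.
- by move=> n x _; rewrite lee_fin.
apply: (@le_lt_trans _ _ (4 * K)%:E); last exact: ltry.
apply: lime_le.
  by apply: is_cvg_nneseries => n _ _; apply: integral_ge0 => x _; rewrite lee_fin.
apply: nearW => n; apply: (@le_trans _ _ (\sum_(0 <= k < n) (2 * K * (1 / 2) ^+ k)%:E)%E).
  by apply: lee_sum => k _.
rewrite sumEFin lee_fin -mulr_sumr.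
have := @sum_half_le2 R n; move: (\sum_(_ <= _ < _) _) => z z0; nra.
Qed.

Lemma MP_dominated : mu `<< leb.
Proof.
move=> N hN B mB BN; have := hN B mB BN => B0.
rewrite muE//; apply: null_set_integral => //.
by apply/measurable_funTS/measurable_EFinP; exact: measurable_MP_density.
Qed.

(** The density is positive everywhere, so mu has no other null sets than the Lebesgue measure.
    *)
Lemma MP_null (B : set (measurableTypeR R)) : measurable B -> mu B = 0%E -> leb B = 0%E.
Proof.
move=> mB; rewrite muE// => B0.
have mD : measurable_fun B (EFin \o MP_density lam).
  by apply/measurable_funTS/measurable_EFinP; exact: measurable_MP_density.
have : ae_eq leb B (EFin \o MP_density lam) (cst 0%E).
  apply/(ae_eq_integral_abs leb mB mD); rewrite -[RHS]B0; apply: eq_integral => x _ /=.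
  by rewrite ger0_norm// MP_density_ge0.
move=> h; have : leb.-negligible B.
  apply: (negligibleS _ h) => x Bx /= H.
  by have [/eqP] := H Bx; rewrite gt_eqF// MP_density_gt0.
by move=> /negligibleP; apply.
Qed.

Lemma MP_support : measure_support mu = setT.
Proof.
apply/seteqP; split => // x _ B oB Bx.
have mB : measurable (B : set (measurableTypeR R)) by exact: open_measurable.
rewrite lt_neqAle measure_ge0 andbT; apply/eqP => /esym B0.
have L0 := MP_null mB B0.
have /nbhs_ballP[e /= e0 eB] : nbhs x B by exact: open_nbhs_nbhs.
have : (leb (ball x e) <= leb B)%E.
  by apply: le_measure; rewrite ?inE//; exact: measurable_ball.
move=> h; have : ((e *+ 2)%:E <= 0%:E)%E.
  by rewrite -(lebesgue_measure_ball x (ltW e0)) -[X in (_ <= X)%E]L0.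
by rewrite lee_fin pmulrn_lle0// leNgt e0.
Qed.

End MP.

#[local] Opaque cGamma.

(** * Meixner-Pollaczek polynomials as Fourier transforms *)

Section MP_polynomials.
Context {R : realType} (lam : R).
Hypothesis lam_gt0 : 0 < lam.
Notation leb := (@lebesgue_measure R).
Notation mu := (MP_measure lam : {measure set (measurableTypeR R) -> \bar R}).
Notation a := (2 * lam).
Notation S := (sq_tr (gamma_fun lam)).
Notation N := (MP_normalized lam).
Implicit Types (f g : R -> R) (x : R).

Let a_gt0 : 0 < a. Proof. by rewrite mulr_gt0. Qed.
Let an_gt0 n : 0 < a + n%:R. Proof. by rewrite ltr_wpDr. Qed.
Let lamn_gt0 n : 0 < lam + n%:R. Proof. by rewrite ltr_wpDr. Qed.
Let Ga : Gamma a != 0. Proof. exact: Gamma_neq0. Qed.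
Let Gan n : Gamma (a + n%:R) != 0. Proof. exact: Gamma_neq0. Qed.
Let pi_neq0 : pi != 0 :> R. Proof. by rewrite gt_eqF// pi_gt0. Qed.
Let fact_neq0 n : n`!%:R != 0 :> R. Proof. by rewrite pnatr_eq0 -lt0n fact_gt0. Qed.

Lemma cexpi_half_pi n : cexpi (n%:R * (pi / 2)) = ('i : R[i]) ^+ n.
Proof.
elim: n => [|n ih]; first by rewrite mul0r /cexpi cos0 sin0 expr0.
rewrite exprS -ih -natr1 mulrDl mul1r /cexpi cosDpihalf sinDpihalf.
by apply/eqP; rewrite eq_complex /=; apply/andP; split; apply/eqP; ring.
Qed.

Lemma is_csum_finite (f : nat -> R[i]) n : (forall k, (n <= k)%N -> f k = 0) ->
  is_csum f (\sum_(i < n) f i).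
Proof.
move=> fk; apply: (@is_csum_of_dist _ _ _ (fun m => sqrmod (\sum_(i < n) f i - \sum_(i < m) f i))) => //.
apply: cvg_near_cst; exists n => // m /= nm.
rewrite -!(big_mkord xpredT f) (@big_cat_nat _ _ _ n 0 m)//=.
have -> : \sum_(n <= i < m) f i = 0.
  by rewrite big_nat_cond big1// => i /andP[/andP[ni _] _]; exact: fk.
by rewrite addr0 subrr sqrmod0.
Qed.

Lemma pochhammerS (z : R[i]) j : pochhammer z j.+1 = pochhammer z j * (z + j%:R).
Proof. by rewrite /pochhammer big_ord_recr. Qed.

Lemma pochhammer_opp n j : pochhammer (- n%:R : R[i]) j = ((-1) ^+ j * (n ^_ j)%:R)%:C.
Proof.
elim: j => [|j ih]; first by rewrite /pochhammer big_ord0 ffactn0 expr0 mulr1.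
rewrite pochhammerS ih ffactnSr; have [jn|nj] := leqP j n.
  rewrite natrM natrB// !rmorphM /= rmorphB /= !rmorph_nat exprS.
  by rewrite !rmorphM /= rmorphN1 !rmorphXn /= rmorphN1; ring.
by rewrite ffact_small// mul0n mulr0 mulr0 mul0r.
Qed.

Lemma pochhammer_real (s : R) j : pochhammer s%:C j = (rising s j)%:C.
Proof.
elim: j => [|j ih]; first by rewrite /pochhammer /rising !big_ord0.
by rewrite pochhammerS ih risingSr rmorphM rmorphD /= rmorph_nat.
Qed.

Definition MP_poly n x : R[i] :=
  \sum_(j < n.+1) (lag_coef lam n j)%:C * pochhammer (lam +i* x) j.

(** The series terminates because (-n)_j vanishes for j > n. *)
Lemma hyp2F1_MP n x : hyp2F1 (- n%:R) (lam +i* x) a%:C 2 = MP_poly n x.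
Proof.
apply: is_csum_unique.
have E j : pochhammer (- n%:R) j * pochhammer (lam +i* x) j / pochhammer a%:C j *
    (2 ^+ j / j`!%:R) = (lag_coef lam n j)%:C * pochhammer (lam +i* x) j.
  have rj : rising a j = Gamma (a + j%:R) / Gamma a by rewrite Gamma_rising// mulfK.
  rewrite pochhammer_opp pochhammer_real rj -bin_ffact natrM.
  have -> : (2 : R[i]) ^+ j = (2 ^+ j : R)%:C by rewrite rmorphXn /= rmorph_nat.
  have -> : (j`!%:R : R[i]) = (j`!%:R : R)%:C by rewrite rmorph_nat.
  rewrite mulrAC -mulrA -!fmorphV /= [_ * pochhammer _ _]mulrC -!mulrA -!rmorphM /= mulrC.
  congr (_%:C * _); rewrite /lag_coef.
  have := fact_neq0 j; have := Gan j; move: (Gamma a) (Gamma _) Ga => g g' g0 g'0 f0.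
  by field; rewrite f0 g0 g'0.
have := @is_csum_finite (fun j => (lag_coef lam n j)%:C * pochhammer (lam +i* x) j) n.+1.
rewrite (_ : (fun j => _ * (2 ^+ j / _)) = (fun j => (lag_coef lam n j)%:C * pochhammer (lam +i* x) j)).
  by apply => k nk; rewrite /lag_coef bin_small// mulr0 !mul0r.
by apply/funext => j; exact: E.
Qed.

Definition MP_kappa n : R := Num.sqrt (Gamma (a + n%:R) / (Gamma a * n`!%:R)).

Lemma MP_normalizedE n x : N n x = (MP_kappa n)%:C * 'i ^+ n * MP_poly n x.
Proof.
rewrite /MP_normalized /meixner_pollaczek cexpi_half_pi.
have -> : cexpi (-2 * (pi / 2)) = -1 :> R[i].
  rewrite (_ : -2 * (pi / 2) = - pi :> R); last by field.
  by rewrite /cexpi cosN sinN cospi sinpi; apply/eqP; rewrite eq_complex /= oppr0 !eqxx.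
have -> : 1 - (-1) = 2 :> R[i] by ring.
rewrite hyp2F1_MP !mulrA; congr (_ * _ * _).
rewrite pochhammer_real (_ : (n`!%:R : R[i]) = (n`!%:R : R)%:C); last by rewrite rmorph_nat.
rewrite -fmorphV /= -!rmorphM /=; congr (_%:C).
have -> : rising a n = Gamma (a + n%:R) / Gamma a by rewrite Gamma_rising// mulfK.
rewrite [n%:R + a]addrC /MP_kappa.
set X := Gamma (a + n%:R) / (Gamma a * n`!%:R).
have X0 : 0 < X by rewrite divr_gt0 ?mulr_gt0 ?Gamma_gt0// ltr0n fact_gt0.
have -> : Gamma a * n`!%:R / Gamma (a + n%:R) = X^-1 by rewrite /X invf_div.
rewrite -mulrA; have -> : Gamma (a + n%:R) / Gamma a / n`!%:R = X by rewrite /X invfM mulrA.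
rewrite sqrtrV ?ltW// -[X in _ * X](sqr_sqrtr (ltW X0)) expr2 mulrA mulVf ?mul1r//.
by rewrite gt_eqF// sqrtr_gt0.
Qed.

Definition fourier_tr f x : R[i] := cos_tr f x +i* sin_tr f x.

Lemma fourier_tr_gammaS s x : 0 < s ->
  fourier_tr (gamma_fun (s + 1)) x = fourier_tr (gamma_fun s) x * (s +i* x).
Proof.
move=> s0; have [e1 e2] := gamma_tr_rec x s0; rewrite /fourier_tr e1 e2.
by apply/eqP; rewrite eq_complex /=; apply/andP; split; apply/eqP; ring.
Qed.

Lemma pochhammer_cGamma j x :
  pochhammer (lam +i* x) j * cGamma (lam +i* x) = fourier_tr (gamma_fun (lam + j%:R)) x.
Proof.
elim: j => [|j ih]; first by rewrite /pochhammer big_ord0 mul1r addr0 cGammaE.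
rewrite pochhammerS mulrAC ih -[j.+1%:R]natr1 addrA (fourier_tr_gammaS x (lamn_gt0 j)); congr (_ * _).
have -> : (j%:R : R[i]) = (j%:R : R)%:C by rewrite rmorph_nat.
by apply/eqP; rewrite eq_complex /= addr0 !eqxx.
Qed.

Lemma fourier_tr_sum n (c : nat -> R) (F : nat -> R -> R) x : (forall i, exp_decay (F i)) ->
  fourier_tr (fun p => \sum_(i < n) c i * F i p) x = \sum_(i < n) (c i)%:C * fourier_tr (F i) x.
Proof.
move=> hF; have hS m : exp_decay (fun p => \sum_(i < m) c i * F i p).
  by apply: (exp_decay_sum (F := fun i p => c i * F i p)) => i _; exact: exp_decayZ.
elim: n => [|n ih].
  rewrite big_ord0 (_ : (fun p => _) = (fun p => 0 * F 0%N p)).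
    by rewrite /fourier_tr cos_trZ// sin_trZ// !mul0r.
  by apply/funext => p; rewrite big_ord0 mul0r.
rewrite big_ord_recr /= -ih (_ : (fun p => _) =
   (fun p => \sum_(i < n) c i * F i p + c n * F n p)).
  have hn : exp_decay (fun p => c n * F n p) by exact: exp_decayZ.
  rewrite /fourier_tr cos_trD// sin_trD// cos_trZ// sin_trZ//.
  by apply/eqP; rewrite eq_complex /=; apply/andP; split; apply/eqP; ring.
by apply/funext => p; rewrite big_ord_recr.
Qed.

(** The link between polynomials and Laguerre functions: (lam + ix)_j Gamma(lam + ix) =
    Gamma(lam + j + ix). *)
Lemma MP_poly_cGamma n x : MP_poly n x * cGamma (lam +i* x) = fourier_tr (lag lam n) x.
Proof.
rewrite /MP_poly mulr_suml (fourier_tr_sum n.+1 (lag_coef lam n) (F := fun j => gamma_fun (lam + j%:R))).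
  by apply: eq_bigr => j _; rewrite -mulrA pochhammer_cGamma.
by move=> i; exact: gamma_fun_decay.
Qed.

Lemma fourier_tr_convol f g x : exp_decay f -> exp_decay g ->
  fourier_tr f x * (fourier_tr g x)^* = fourier_tr (convol f g) x.
Proof.
move=> hf hg; rewrite /fourier_tr cos_tr_convol// sin_tr_convol//.
by apply/eqP; rewrite eq_complex /=; apply/andP; split; apply/eqP; ring.
Qed.

Let product_rearrange (k1 k2 : R) (i1 i2 p1 p2 g : R[i]) :
  (k1%:C * i1 * p1) * (k2%:C * i2 * p2)^* * (g * g^*) =
  (k1 * k2)%:C * (i1 * i2^*) * ((p1 * g) * (p2 * g)^*).
Proof.
move: i1 i2 p1 p2 g => [? ?] [? ?] [? ?] [? ?] [? ?].
by apply/eqP; rewrite eq_complex /=; apply/andP; split; apply/eqP; ring.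
Qed.

(** The constant in front of the transform in products of two polynomials; the powers of i come
    from e^(in phi) at phi = pi/2. *)
Definition MP_phase m n : R[i] := (MP_kappa m * MP_kappa n)%:C * ('i ^+ m * ('i ^+ n)^*).

(** Parseval applies to this identity, as the right-hand side is a transform of a real function
    up to a constant. *)
Lemma MP_product m n x : N m x * (N n x)^* * (S x)%:C =
  MP_phase m n * fourier_tr (convol (lag lam m) (lag lam n)) x.
Proof.
rewrite -sqrmod_cGamma// -mulcJ !MP_normalizedE.
have hl k : exp_decay (lag lam k) := (sqi_tr_lag lam_gt0 k).1.
rewrite -(fourier_tr_convol _ (hl m) (hl n)) -!MP_poly_cGamma.
exact: product_rearrange.
Qed.

Lemma cmeasurable_MP n : cmeasurable (N n : measurableTypeR R -> R[i]).
Proof.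
have -> : N n = (fun x => (MP_kappa n)%:C * 'i ^+ n * MP_poly n x).
  by apply/funext => x; exact: MP_normalizedE.
apply: cmeasurableM; first exact: cmeasurable_cst.
have hp j : cmeasurable (fun x : measurableTypeR R => pochhammer (lam +i* x) j).
  elim: j => [|j ih].
    by rewrite (_ : (fun _ => _) = fun=> 1); [exact: cmeasurable_cst|apply/funext => x; rewrite /pochhammer big_ord0].
  under eq_fun do rewrite pochhammerS.
  apply: cmeasurableM => //; apply: cmeasurableD; last exact: cmeasurable_cst.
  by split => /=; [exact: measurable_cst|exact: measurable_id].
have hs m : cmeasurable (fun x : measurableTypeR R => \sum_(j < m) (lag_coef lam n j)%:C * pochhammer (lam +i* x) j).
  elim: m => [|m ih].
    by rewrite (_ : (fun _ => _) = fun=> 0); [exact: cmeasurable_cst|apply/funext => x; rewrite big_ord0].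
  under eq_fun do rewrite big_ord_recr /=.
  by apply: cmeasurableD => //; apply: cmeasurableM => //; exact: cmeasurable_cst.
exact: hs.
Qed.

(** The imaginary part of the transform of a real function is odd, whence the hypothesis that
    its integral vanishes. *)
Lemma cintegral_MP (G : measurableTypeR R -> R[i]) (c : R[i]) (k0 : R -> R) :
  cmeasurable G -> (forall x, G x * (S x)%:C = c * fourier_tr k0 x) ->
  integrable_line (cos_tr k0) -> integrable_line (sin_tr k0) ->
  \int[leb]_x sin_tr k0 x = 0 ->
  cintegrable mu G /\ cintegral mu G = c * (MP_cst lam * \int[leb]_x cos_tr k0 x)%:C.
Proof.
move=> [mG1 mG2] GE ic is_ s0; case: c GE => c1 c2 GE.
have e1 x : Re (G x) * S x = c1 * cos_tr k0 x - c2 * sin_tr k0 x.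
  have := GE x; rewrite /fourier_tr; case: (G x) => u v [h1 h2] /=.
  by rewrite -h1; ring.
have e2 x : Im (G x) * S x = c2 * cos_tr k0 x + c1 * sin_tr k0 x.
  have := GE x; rewrite /fourier_tr; case: (G x) => u v [h1 h2] /=.
  by rewrite addrC -h2; ring.
have i1 : integrable_line (fun x => Re (G x) * S x).
  rewrite (_ : (fun x => _) = (fun x => c1 * cos_tr k0 x - c2 * sin_tr k0 x)).
    by apply: integrable_lineB; exact: integrable_lineZ.
  by apply/funext => x; exact: e1.
have i2 : integrable_line (fun x => Im (G x) * S x).
  rewrite (_ : (fun x => _) = (fun x => c2 * cos_tr k0 x + c1 * sin_tr k0 x)).
    by apply: integrable_lineD; exact: integrable_lineZ.
  by apply/funext => x; exact: e2.
split; first by split; [exact: (Rint_MP lam_gt0 mG1 i1).1|exact: (Rint_MP lam_gt0 mG2 i2).1].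
rewrite /cintegral (Rint_MP lam_gt0 mG1 i1).2 (Rint_MP lam_gt0 mG2 i2).2.
rewrite (eq_Rint e1) (eq_Rint e2) (RintB (integrable_lineZ c1 ic) (integrable_lineZ c2 is_)).
rewrite (RintD (integrable_lineZ c2 ic) (integrable_lineZ c1 is_)) (RintZ c1 ic) (RintZ c2 ic).
rewrite (RintZ c1 is_) (RintZ c2 is_) s0.
by apply/eqP; rewrite eq_complex /=; apply/andP; split; apply/eqP; ring.
Qed.

Let cstE : MP_cst lam * (2 * pi) * expR (- (a * ln 2)) = (Gamma a)^-1.
Proof.
rewrite /MP_cst; have -> : expR ((a - 1) * ln 2) = expR (a * ln 2) / 2 :> R.
  by rewrite mulrBl mul1r expRD expRN lnK// posrE.
have e0 : expR (a * ln 2) != 0 :> R by rewrite gt_eqF ?expR_gt0.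
rewrite expRN; move: (expR _) e0 (pi : R) pi_neq0 (Gamma a) Ga => e e0 p p0 g g0.
by field; rewrite g0 p0 e0.
Qed.

Lemma MP_phase_diag n : MP_phase n n = (Gamma (a + n%:R) / (Gamma a * n`!%:R))%:C.
Proof.
have X0 : 0 <= Gamma (a + n%:R) / (Gamma a * n`!%:R).
  by rewrite ltW// divr_gt0 ?mulr_gt0 ?Gamma_gt0// ltr0n fact_gt0.
have hi : ('i : R[i]) ^+ n * ('i ^+ n)^* = 1.
  rewrite mulcJ; elim: n {X0} => [|n ih]; first by rewrite expr0 /sqrmod /= expr1n expr0n addr0.
  rewrite exprS sqrmodM rmorphM /= ih mulr1 /sqrmod /= expr0n expr1n add0r//.
by rewrite /MP_phase hi mulr1 -expr2 /MP_kappa sqr_sqrtr.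
Qed.

Lemma MP_orthonormal m n : cintegrable mu (fun x => N m x * (N n x)^*) /\
  cintegral mu (fun x => N m x * (N n x)^*) = (m == n)%:R.
Proof.
have hm := sqi_tr_lag lam_gt0 m; have hn := sqi_tr_lag lam_gt0 n.
have [i1 i2] := sqi_tr_integrable hm hn; have [p1 p2] := sqi_tr_parseval hm hn.
have mG : cmeasurable (fun x : measurableTypeR R => N m x * (N n x)^*).
  by apply: cmeasurableM; [|apply: cmeasurable_conj]; exact: cmeasurable_MP.
have [hi ->] := cintegral_MP mG (MP_product m n) i1 i2 p2; split => //.
rewrite p1 Rint_lag//.
case: eqP => [<-|_]; last by rewrite !mul0r !mulr0.
rewrite MP_phase_diag mul1r -rmorphM /=.
set X := _ / _; set E := expR _.
have -> : X * (MP_cst lam * (2 * pi * (E * (Gamma a ^+ 2 * m`!%:R / Gamma (a + m%:R))))) =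
   MP_cst lam * (2 * pi) * E * (X * (Gamma a ^+ 2 * m`!%:R / Gamma (a + m%:R))) by ring.
rewrite /E cstE /X.
rewrite (_ : _^-1 * _ = 1)//.
have := Gan m; move: (Gamma (a + m%:R)) (Gamma a) Ga (m`!%:R : R) (fact_neq0 m) => h g g0 f f0 h0.
by field; rewrite h0 g0 f0.
Qed.

Let betaE y : beta_fun lam lam y = (Gamma a)^-1 * convol (gamma_fun lam) (gamma_fun lam) y.
Proof.
have e : lam + lam = a by ring.
by rewrite (convol_gamma_fun y lam_gt0 lam_gt0) e mulrA mulVf ?mul1r.
Qed.

Lemma sqi_tr_beta : sqi_tr (beta_fun lam lam : R -> R).
Proof.
have h := sqi_trZ (Gamma a)^-1 (sqi_tr_convol (sqi_tr_gamma lam_gt0) (sqi_tr_gamma lam_gt0)).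
by rewrite (_ : beta_fun lam lam = (fun y => (Gamma a)^-1 * convol (gamma_fun lam) (gamma_fun lam) y))//;
  apply/funext => y; exact: betaE.
Qed.

Lemma fourier_tr_beta x : fourier_tr (beta_fun lam lam) x = (cos_tr (beta_fun lam lam) x)%:C.
Proof.
have h := (sqi_tr_gamma lam_gt0).1.
have -> : beta_fun lam lam = (fun y => (Gamma a)^-1 * convol (gamma_fun lam) (gamma_fun lam) y).
  by apply/funext => y; exact: betaE.
rewrite /fourier_tr (sin_trZ _ _ (exp_decay_convol h h)) (sin_tr_convol _ h h).
by congr (_ +i* _); ring.
Qed.

(** The factor |Gamma(lam + ix)|^2 of the symbol is itself a transform; it plays the role of one
    factor in Parseval's identity, the weight of mu being absorbed by the two polynomials. *)
Lemma MP_symbol_beta x : MP_symbol lam x = expR ((a - 1) * ln 2) * cos_tr (beta_fun lam lam) x.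
Proof.
rewrite (MP_symbolE lam_gt0) (sq_tr_gamma x lam_gt0) /MP_cst.
move: (Gamma a) Ga (pi : R) pi_neq0 (expR _) (cos_tr _ _) => g g0 p p0 e c.
by field; rewrite g0 p0.
Qed.

Let symbol_rearrange (k q s : R) (u v p w : R[i]) : u * v^* * s%:C = p * w ->
  (k * q)%:C * u * v^* * s%:C = k%:C * p * (w * (q%:C)^*).
Proof.
move=> e; have -> : (k * q)%:C * u * v^* * s%:C = (k * q)%:C * (u * v^* * s%:C) by ring.
rewrite e; case: p w {e} => [? ?] [? ?].
by apply/eqP; rewrite eq_complex /=; apply/andP; split; apply/eqP; ring.
Qed.

Let scalar_rearrange (x y z : R) (p : R[i]) : x * y = z -> x%:C * p * y%:C = p * z%:C.
Proof. by move=> <-; rewrite rmorphM /=; ring. Qed.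

Lemma MP_symbol_product m n x : (MP_symbol lam x)%:C * N m x * (N n x)^* * (S x)%:C =
  (expR ((a - 1) * ln 2))%:C * MP_phase m n *
    fourier_tr (convol (convol (lag lam m) (lag lam n)) (beta_fun lam lam)) x.
Proof.
have hm := (sqi_tr_lag lam_gt0 m).1; have hn := (sqi_tr_lag lam_gt0 n).1.
rewrite -(fourier_tr_convol x (exp_decay_convol hm hn) sqi_tr_beta.1) fourier_tr_beta.
rewrite MP_symbol_beta; apply: symbol_rearrange; exact: MP_product.
Qed.

Lemma MP_symbol_entry m n :
  cintegral mu (fun x => (MP_symbol lam x)%:C * N m x * (N n x)^*) =
  MP_phase m n * (expR ((2 * a - 1) * ln 2) * tanh_moment lam (m + n))%:C.
Proof.
have hm := sqi_tr_lag lam_gt0 m; have hn := sqi_tr_lag lam_gt0 n.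
have hc := sqi_tr_convol hm hn.
have [i1 i2] := sqi_tr_integrable hc sqi_tr_beta; have [p1 p2] := sqi_tr_parseval hc sqi_tr_beta.
have mG : cmeasurable (fun x : measurableTypeR R => (MP_symbol lam x)%:C * N m x * (N n x)^*).
  apply: cmeasurableM; last by apply: cmeasurable_conj; exact: cmeasurable_MP.
  apply: cmeasurableM; last exact: cmeasurable_MP.
  apply: cmeasurable_real; rewrite (_ : MP_symbol lam = (fun x => pi * MP_cst lam * S x)).
    by apply: measurable_funM => //; exact: measurable_S.
  by apply/funext => x; exact: MP_symbolE.
rewrite (cintegral_MP mG (MP_symbol_product m n) i1 i2 p2).2 p1.
have -> : \int[leb]_p (convol (lag lam m) (lag lam n) p * beta_fun lam lam p) = Gamma a * tanh_moment lam (m + n).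
  by rewrite -(Rint_beta_lag lam_gt0); apply: eq_Rint => y; rewrite mulrC.
apply: scalar_rearrange; rewrite /MP_cst.
have -> : expR ((2 * a - 1) * ln 2) = 2 * (expR ((a - 1) * ln 2) * expR ((a - 1) * ln 2)) :> R.
  rewrite -expRD -[X in X * expR _](@lnK R 2) ?posrE// -expRD; congr expR; ring.
move: (Gamma a) Ga (pi : R) pi_neq0 (expR _) (tanh_moment _ _) => g g0 p p0 e c.
by field; rewrite g0 p0.
Qed.

(** For m and n of equal parity, i^m times the conjugate of i^n is the sign (-1)^(floor(m/2) +
    floor(n/2)), and m (m - 1) / 2 has the parity of floor(m/2). *)
Lemma MP_phaseE m n : ~~ odd (m + n) ->
  MP_phase m n = ((-1) ^+ (m * (m - 1) %/ 2 + n * (n - 1) %/ 2)%N *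
    Num.sqrt (Gamma (m%:R + a) * Gamma (n%:R + a) / (m`!%:R * n`!%:R)) / Gamma a)%:C.
Proof.
move=> mn.
have half k : ((-1) ^+ (k * (k - 1) %/ 2)%N = (-1) ^+ k./2 :> R) /\
    ('i : R[i]) ^+ k = ((-1) ^+ k./2)%:C * 'i ^+ odd k.
  split; last first.
    rewrite -{1}[k](odd_double_half k) exprD -mul2n exprM sqr_i mulrC.
    by rewrite rmorphXn /= rmorphN1.
  rewrite -[LHS]signr_odd -[RHS]signr_odd; congr (_ ^+ _); congr nat_of_bool.
  rewrite divn2 -[in LHS](odd_double_half k); move: (k./2) => p; case: (odd k) => /=.
    by rewrite add1n subn1 /= -doubleMr doubleK oddM /= odd_double.
  rewrite add0n -doubleMl doubleK oddM; case: p => [//|p].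
  by rewrite doubleS subn1 /= odd_double andbT.
have [h1 i1] := half m; have [h2 i2] := half n.
have hk : MP_kappa m * MP_kappa n =
    Num.sqrt (Gamma (m%:R + a) * Gamma (n%:R + a) / (m`!%:R * n`!%:R)) / Gamma a.
  have g0 := Gamma_gt0 a_gt0.
  have X0 k : 0 <= Gamma (a + k%:R) / (Gamma a * k`!%:R).
    by rewrite ltW// divr_gt0 ?mulr_gt0 ?Gamma_gt0// ltr0n fact_gt0.
  have Y0 : 0 <= Gamma (m%:R + a) * Gamma (n%:R + a) / (m`!%:R * n`!%:R).
    rewrite ![_ + a]addrC; apply: divr_ge0; last by rewrite -natrM ler0n.
    by apply: mulr_ge0; apply: ltW; exact: Gamma_gt0.
  have <- : Num.sqrt ((Gamma a)^-1 ^+ 2) = (Gamma a)^-1.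
    by rewrite sqrtr_sqr ger0_norm// invr_ge0 ltW.
  rewrite /MP_kappa -!sqrtrM//; congr Num.sqrt; rewrite ![_ + a]addrC.
  move: (Gamma (a + m%:R)) (Gamma (a + n%:R)) (Gamma a) Ga => x y g g1.
  by field; rewrite !fact_neq0 g1.
rewrite /MP_phase hk exprD h1 h2 i1 i2.
have -> : odd n = odd m by move: mn; rewrite oddD; case: (odd m); case: (odd n).
move: (Num.sqrt _) (Gamma a)^-1 ((-1) ^+ m./2) ((-1) ^+ n./2) => y g s t.
by case: (odd m); rewrite ?expr0 ?expr1; apply/eqP; rewrite eq_complex /=; apply/andP; split; apply/eqP; ring.
Qed.

Lemma MP_matrix_entry m n :
  cintegral mu (fun x => (MP_symbol lam x)%:C * N n x * (N m x)^*) = (matrix_H2 lam m n)%:C.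
Proof.
rewrite MP_symbol_entry /matrix_H2; have [mo|me] := boolP (odd (m + n)%N).
  by rewrite tanh_moment_odd ?mulr0 // addnC.
rewrite (MP_phaseE (_ : ~~ odd (n + m))) 1?addnC//; have [r rE] : exists r, (m + n = 2 * r)%N.
  by exists (m + n)./2; rewrite mul2n halfK (negbTE me) subn0.
rewrite [(n + m)%N]addnC rE (tanh_moment_even lam_gt0) -rmorphM /=; congr (_%:C).
rewrite [Gamma (n%:R + a) * _]mulrC [n`!%:R * _]mulrC.
have -> : (2 * r + 1)%N%:R / 2 = r%:R + 1 / 2 :> R by rewrite natrD natrM; field.
rewrite -[a + r%:R + _]addrA.
move: (Gamma a) Ga (Gamma (a + _)) (Gamma (r%:R + _)) => g g0 u v.
move: (Num.sqrt _) ((-1) ^+ _) => y z.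
by move: (u^-1) => w; field.
Qed.

(** The duplication formula again: this is the top of the spectrum. *)
Lemma MP_symbol0 : MP_symbol lam 0 = Num.sqrt pi * Gamma lam / Gamma (lam + 1 / 2).
Proof.
rewrite (MP_symbolE lam_gt0) (sq_tr_gamma0 lam_gt0) -(duplication lam_gt0) /MP_cst.
move: (Gamma a) Ga (pi : R) pi_neq0 (expR _) (Gamma lam) => g g0 p p0 e c.
by field; rewrite g0 p0.
Qed.

End MP_polynomials.

(** * Completeness of the polynomials *)

Section MP_basis.
Context {R : realType} (lam : R).
Hypothesis lam_gt0 : 0 < lam.
Notation mu := (MP_measure lam : {measure set (measurableTypeR R) -> \bar R}).
Notation a := (2 * lam).
Notation N := (MP_normalized lam).
Implicit Types (f g : R -> R[i]) (x : R).

Let a_gt0 : 0 < a. Proof. by rewrite mulr_gt0. Qed.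
Let an_gt0 n : 0 < a + n%:R. Proof. by rewrite ltr_wpDr. Qed.
Let kappa_pos n : 0 < Gamma (a + n%:R) / (Gamma a * n`!%:R).
Proof. by rewrite divr_gt0 ?mulr_gt0 ?Gamma_gt0// ltr0n fact_gt0. Qed.

Lemma MP_square_integrable n : (\int[mu]_x (sqrmod (N n x))%:E < +oo)%E.
Proof.
have [[hi _] _] := MP_orthonormal lam_gt0 n n.
apply: le_lt_trans (integrable_lty measurableT hi).
by rewrite le_eqVlt; apply/orP; left; apply/eqP/eq_integral => x _; rewrite /= mulcJ.
Qed.

Definition in_span (F : nat -> R -> R[i]) (f : R -> R[i]) : Prop :=
  exists m (d : nat -> R[i]), forall x, f x = \sum_(i < m) d i * F i x.

Lemma in_span_gen F i : in_span F (F i).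
Proof.
exists i.+1, (fun k => (k == i)%:R) => x; rewrite big_ord_recr /= eqxx mul1r.
rewrite big1 ?add0r// => k _; rewrite (_ : (k == i :> nat) = false) ?mul0r//.
by rewrite ltn_eqF.
Qed.

Lemma in_span_widen (F : nat -> R -> R[i]) m m' (d : nat -> R[i]) x : (m <= m')%N ->
  \sum_(i < m) d i * F i x = \sum_(i < m') (if (i < m)%N then d i else 0) * F i x.
Proof.
move=> mm; rewrite -!(big_mkord xpredT (fun i => (if (i < m)%N then d i else 0) * F i x)).
rewrite -(big_mkord xpredT (fun i => d i * F i x)) [RHS](big_cat_nat (n := m))//=.
rewrite [X in _ + X]big_nat_cond [X in _ + X]big1 ?addr0; last first.
  by move=> i /andP[/andP[mi _] _]; rewrite ltnNge mi mul0r.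
by apply: eq_big_nat => i /andP[_ im]; rewrite im.
Qed.

Lemma in_span_lin F f g (c c' : R[i]) : in_span F f -> in_span F g ->
  in_span F (fun x => c * f x + c' * g x).
Proof.
move=> [m [d fd]] [m' [d' gd']]; exists (maxn m m').
exists (fun i => c * (if (i < m)%N then d i else 0) + c' * (if (i < m')%N then d' i else 0)) => x.
rewrite fd gd' (in_span_widen _ _ _ (leq_maxl m m')) (in_span_widen _ _ _ (leq_maxr m m')).
rewrite !mulr_sumr -big_split /=; apply: eq_bigr => i _.
by rewrite mulrDl !mulrA.
Qed.

Lemma in_span_ext F f g : f =1 g -> in_span F f -> in_span F g.
Proof. by move=> fg [m [d h]]; exists m, d => x; rewrite -fg. Qed.

Lemma in_span_sum F m (c : nat -> R[i]) (G : nat -> R -> R[i]) :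
  (forall i, (i < m)%N -> in_span F (G i)) -> in_span F (fun x => \sum_(i < m) c i * G i x).
Proof.
elim: m => [|m ih] hG.
  by exists 0%N, (fun=> 0) => x; rewrite !big_ord0.
have h1 := ih (fun i im => hG i (ltnW im)).
apply: in_span_ext (in_span_lin 1 (c m) h1 (hG m (ltnSn m))) => x.
by rewrite big_ord_recr /= mul1r.
Qed.

Lemma in_span_trans F G f : (forall i, in_span F (G i)) -> in_span G f -> in_span F f.
Proof.
move=> FG [m [d fE]]; apply: in_span_ext (@in_span_sum F m d G (fun i _ => FG i)) => x.
by rewrite fE.
Qed.

Let poch j x := pochhammer (lam +i* x) j : R[i].

(** The passage from Pochhammer symbols to polynomials is triangular with nonzero diagonal. *)
Lemma in_span_pochhammer j : in_span N (poch j).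
Proof.
have [n jn] := ubnP j; elim: n j jn => // n ih j jn.
have cj0 : lag_coef lam j j != 0.
  by rewrite /lag_coef binn !mulf_neq0 ?invr_neq0 ?expf_neq0 ?oppr_eq0 ?oner_eq0 ?pnatr_eq0 ?Gamma_neq0.
have k0 : MP_kappa lam j != 0 by rewrite gt_eqF// sqrtr_gt0.
pose z : R[i] := (lag_coef lam j j)%:C; pose y : R[i] := (MP_kappa lam j)%:C * 'i ^+ j.
have z0 : z != 0 by rewrite /z (inj_eq (@complexI _) _ 0).
have i0 : 'i != 0 :> R[i] by rewrite eq_complex /= oner_eq0 andbF.
have y0 : y != 0 by rewrite /y mulf_neq0 ?expf_neq0// (inj_eq (@complexI _) _ 0).
have hs := @in_span_sum N j (fun k => (lag_coef lam j k)%:C) poch (fun k kj => ih k (leq_trans kj jn)).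
apply: in_span_ext (in_span_lin (z^-1 * y^-1) (- z^-1) (in_span_gen N j) hs) => x.
rewrite (MP_normalizedE lam_gt0) -/y /MP_poly big_ord_recr /= -/z.
set s := \sum_(k < j) _; rewrite /poch; move: (pochhammer _ _) => p.
by field; rewrite z0 y0.
Qed.

(** As (lam + ix)_(j+1) = (lam + j + ix) (lam + ix)_j, multiplication by x preserves the span of
    the Pochhammer symbols. *)
Lemma in_span_X k : in_span N (fun x => (x ^+ k)%:C).
Proof.
apply: (in_span_trans in_span_pochhammer); elim: k => [|k [m [d h]]].
  apply: in_span_ext (in_span_gen poch 0%N) => x.
  by rewrite /poch /pochhammer big_ord0 expr0.
have hx j : in_span poch (fun x => x%:C * poch j x).
  apply: in_span_ext (in_span_lin (- 'i) ('i * (lam + j%:R)%:C) (in_span_gen poch j.+1) (in_span_gen poch j)) => x.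
  rewrite /poch pochhammerS; move: (pochhammer _ _) => p.
  have -> : lam +i* x + j%:R = (lam + j%:R)%:C + 'i * x%:C :> R[i].
    rewrite (_ : (j%:R : R[i]) = (j%:R : R)%:C); last by rewrite rmorph_nat.
    by apply/eqP; rewrite eq_complex /=; apply/andP; split; apply/eqP; ring.
  have -> : - 'i * (p * ((lam + j%:R)%:C + 'i * x%:C)) + 'i * (lam + j%:R)%:C * p =
    - ('i ^+ 2) * (x%:C * p) by ring.
  by rewrite sqr_i opprK mul1r.
apply: in_span_ext (@in_span_sum poch m d (fun j x => x%:C * poch j x) (fun j _ => hx j)) => x.
rewrite exprS rmorphM /= h mulr_sumr; apply: eq_bigr => i _; ring.
Qed.

Lemma in_span_poly (q1 q2 : {poly R}) : in_span N (fun x => q1.[x] +i* q2.[x]).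
Proof.
have hp (q : {poly R}) : in_span N (fun x => (q.[x])%:C).
  apply: in_span_ext (@in_span_sum N (size q) (fun k => (q`_k)%:C) (fun k x => (x ^+ k)%:C) (fun k _ => in_span_X k)) => x.
  by rewrite horner_coef rmorph_sum /=; apply: eq_bigr => i _; rewrite rmorphM.
apply: in_span_ext (in_span_lin 1 'i (hp q1) (hp q2)) => x.
by apply/eqP; rewrite eq_complex /=; apply/andP; split; apply/eqP; ring.
Qed.

(** Real and imaginary parts are approximated separately by real polynomials. *)
Lemma MP_dense (P : nat -> L2 mu) (w : L2 mu) (e : R) :
  (forall n, {ae mu, forall x, P n x = N n x}) -> 0 < e ->
  exists m (d : nat -> R[i]), hnorm (w - \sum_(i < m) d i *: P i) < e.
Proof.
move=> PE e0; have [mw1 mw2] := L2_cmeasurable w.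
have b0 : 0 < (a + 1)^-1 :> R by rewrite invr_gt0 ltr_wpDl// ltW.
have sq (f : measurableTypeR R -> R) : measurable_fun setT f ->
    (forall x, f x ^+ 2 <= sqrmod (w x)) -> sqi mu f.
  move=> mf fw; split => //; apply: le_lt_trans (_ : (nsq w)%:E < +oo)%E; last exact: ltry.
  rewrite -nsqE; apply: le_sq_int => //.
  by apply: cmeasurable_sqrmod; exact: L2_cmeasurable.
have e2 : 0 < e ^+ 2 / 2 by rewrite divr_gt0// exprn_gt0.
have [_ h1] := poly_approx_all b0 (exp_moment_MP lam_gt0) (sq _ mw1 (fun x => Re_sqr_le (w x))).
have [_ h2] := poly_approx_all b0 (exp_moment_MP lam_gt0) (sq _ mw2 (fun x => Im_sqr_le (w x))).
have [q1 hq1] := h1 _ e2; have [q2 hq2] := h2 _ e2.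
have [m [d hd]] := in_span_poly q1 q2.
exists m, d.
apply: hnorm_lt => //; rewrite -lte_fin.
have mq (q : {poly R}) := measurable_poly q.
have m1 := measurable_funB mw1 (mq q1); have m2 := measurable_funB mw2 (mq q2).
rewrite (@nsq_ae _ _ _ mu _ (fun x => w x - (q1.[x] +i* q2.[x]))); last 2 first.
- by split; [under eq_fun do rewrite ReD ReN|under eq_fun do rewrite ImD ImN].
- have hs := L2_sum_ae m d PE; have hb := L2_sub_ae w (\sum_(i < m) d i *: P i).
  by apply: filterS2 hs hb => x h ->; rewrite h hd.
have -> : (\int[mu]_x (sqrmod (w x - (q1.[x] +i* q2.[x])))%:E =
   \int[mu]_x (((Re (w x) - q1.[x]) ^+ 2)%:E + ((Im (w x) - q2.[x]) ^+ 2)%:E))%E.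
  by apply: eq_integral => x _; rewrite /sqrmod ReD ImD ReN ImN EFinD.
rewrite ge0_integralD//; last 4 first.
- by move=> x _; rewrite lee_fin sqr_ge0.
- by apply/measurable_EFinP; exact: measurable_funX.
- by move=> x _; rewrite lee_fin sqr_ge0.
- by apply/measurable_EFinP; exact: measurable_funX.
have -> : ((e ^+ 2)%:E = (e ^+ 2 / 2)%:E + (e ^+ 2 / 2)%:E)%E by rewrite -EFinD -splitr.
exact: lteD.
Qed.

Theorem MP_orthonormal_basis : exists P : nat -> L2 mu,
  (forall n, {ae mu, forall x, P n x = N n x}) /\ orthonormal_basis P.
Proof.
have /choice[P PE] : forall n, exists p : L2 mu, {ae mu, forall x, p x = N n x}.
  by move=> n; exact: mkL2 (cmeasurable_MP lam_gt0 n) (MP_square_integrable n).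
exists P; split => //; split.
  move=> m n; have [_ ->] := dotp_ae (cmeasurable_MP lam_gt0 m) (cmeasurable_MP lam_gt0 n) (PE m) (PE n).
  exact: (MP_orthonormal lam_gt0 m n).2.
move=> w e e0; have [m [d h]] := MP_dense w PE e0.
by exists (\sum_(i < m) d i *: P i) => //; exists m, d.
Qed.

End MP_basis.

(** * Preimages of null sets *)

Section expansive.
Context {R : realType}.
Notation leb := (@lebesgue_measure R).
Implicit Types (f : R -> R) (J B : set (measurableTypeR R)).

Lemma lebesgue_le_diameter (E : set (measurableTypeR R)) (d : R) : measurable E -> 0 <= d ->
  (forall x y : R, E x -> E y -> y - x <= d) -> (leb E <= d%:E)%E.
Proof.
move=> mE d0 hd; have [->|/set0P[x0 Ex0]] := eqVneq E set0.
  by rewrite measure0 lee_fin.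
pose s : R := inf (E : set R).
have lbE : has_inf (E : set R).
  split; first by exists x0.
  by exists (x0 - d) => y Ey; rewrite lerBlDr -lerBlDl; exact: hd.
have sub : E `<=` `[s, s + d]%classic.
  move=> y Ey /=; rewrite in_itv /=; apply/andP; split.
    by apply: ge_inf => //; exact: lbE.2.
  rewrite -lerBlDr; apply: lb_le_inf; first by exists x0.
  by move=> x Ex; rewrite lerBlDr -lerBlDl; exact: hd.
apply: (le_trans (le_measure leb _ _ sub)); rewrite ?inE//.
rewrite [X in (X <= _)%E](lebesgue_measure_itv `[s, s + d]) /= lte_fin.
case: ifP => _; last by rewrite lee_fin.
by rewrite -EFinB lee_fin addrAC subrr add0r.
Qed.

(** Cover B by half-open intervals of small total length; the preimage in J of an interval of
    length l has diameter at most l / c. *)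
Lemma null_preimage_expansive f J c B : measurable_fun setT (f : measurableTypeR R -> R) ->
  measurable J -> 0 < c ->
  (forall x y : R, J x -> J y -> c * `|x - y| <= `|f x - f y|) ->
  measurable B -> leb B = 0%E -> leb (f @^-1` B `&` J) = 0%E.
Proof.
move=> mf mJ c0 exp mB B0.
have mpre (A : set (measurableTypeR R)) : measurable A -> measurable (f @^-1` A `&` J : set (measurableTypeR R)).
  by move=> mA; apply: measurableI => //; rewrite -[_ @^-1` _]setTI; exact: mf.
apply/eqP; rewrite eq_le measure_ge0 andbT; apply/lee_addgt0Pr => e e0; rewrite add0e.
have : (leb B < (c * e)%:E)%E by rewrite B0 lte_fin mulr_gt0.
move=> /ereal_inf_lt[z [/= M [mM BM] sMz ze]].
have mM' n : measurable (M n : set (measurableTypeR R)).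
  by apply: sub_sigma_algebra; exact: mM.
have key n : (leb (f @^-1` (M n) `&` J) <= (c^-1)%:E * leb (M n))%E.
  have /ocitvP[->|[[a b] /= ab ->]] := mM n.
    by rewrite preimage_set0 set0I measure0 mule0.
  rewrite lebesgue_measure_itv /= lte_fin ab -EFinB -EFinM.
  apply: lebesgue_le_diameter.
  - by apply: mpre; exact: measurable_itv.
  - by apply: mulr_ge0; [rewrite invr_ge0 ltW|rewrite subr_ge0 ltW].
  move=> x y [/= fx Jx] [/= fy Jy]; rewrite mulrC ler_pdivlMr// mulrC.
  apply: (le_trans (_ : _ <= c * `|x - y|)).
    by rewrite ler_pM2l// distrC ler_norm.
  apply: (le_trans (exp _ _ Jx Jy)).
  by move: fx fy; rewrite !in_itv /= => /andP[? ?] /andP[? ?]; rewrite ler_norml; lra.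
apply: (@le_trans _ _ (\sum_(n <oo) leb (f @^-1` (M n) `&` J))%E).
  apply: measure_sigma_subadditive => //.
  - by move=> n; exact: mpre.
  - exact: mpre.
  - by move=> x [/= /BM[n _ Mx] Jx]; exists n.
apply: (@le_trans _ _ (\sum_(n <oo) (c^-1)%:E * leb (M n))%E).
  exact: lee_nneseries.
rewrite nneseriesZl// -[e%:E]mul1e -(_ : (c^-1)%:E * c%:E = 1%:E)%E; last first.
  by rewrite -EFinM mulVf// gt_eqF.
rewrite -muleA; apply: lee_wpmul2l; first by rewrite lee_fin invr_ge0 ltW.
rewrite -EFinM.
apply: le_trans (ltW ze); rewrite -sMz.
apply: lee_nneseries => // n _.
have /ocitvP[->|[[u v] /= uv ->]] := mM n; first by rewrite measure0 wlength0.
by rewrite lebesgue_measure_itv wlength_itv.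
Qed.

End expansive.

(** * Multiplication operators in an orthonormal basis *)

Section multiplication.
Context d (T : measurableType d) (R : realType).
Variables (mu : {measure set T -> \bar R}) (h : T -> R) (M : R).
Hypothesis mh : measurable_fun setT h.
Hypothesis h0M : forall x, 0 <= h x <= M.
Implicit Types (u v w : L2 mu) (x y : ell2 R).

Lemma nsq_le_ae u v (f g : T -> R[i]) : cmeasurable f -> cmeasurable g ->
  {ae mu, forall t, u t = f t} -> {ae mu, forall t, v t = g t} ->
  (forall t, sqrmod (f t) <= sqrmod (g t)) -> nsq u <= nsq v.
Proof.
move=> mf mg uf vg fg; rewrite -lee_fin (nsq_ae mf uf) (nsq_ae mg vg).
apply: ge0_le_integral => //.
- by move=> t _; rewrite lee_fin sqrmod_ge0.
- by apply/measurable_EFinP; exact: cmeasurable_sqrmod.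
- by apply/measurable_EFinP; exact: cmeasurable_sqrmod.
- by move=> t _; rewrite lee_fin.
Qed.

Lemma L2_mul (b : T -> R[i]) (K : R) w : cmeasurable b -> (forall t, sqrmod (b t) <= K ^+ 2) ->
  exists q : L2 mu, {ae mu, forall t, q t = b t * w t} /\ nsq q <= K ^+ 2 * nsq w.
Proof.
move=> mb bK; have mw := L2_cmeasurable w; have mbw := cmeasurableM mb mw.
have ms := cmeasurable_sqrmod mw.
have le : (\int[mu]_t (sqrmod (b t * w t))%:E <= (K ^+ 2 * nsq w)%:E)%E.
  rewrite EFinM -nsqE -ge0_integralZl//; last 3 first.
  - exact/measurable_EFinP.
  - by move=> t _; rewrite lee_fin sqrmod_ge0.
  - by rewrite lee_fin sqr_ge0.
  apply: ge0_le_integral => //.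
  - by move=> t _; rewrite lee_fin sqrmod_ge0.
  - by apply/measurable_EFinP; exact: cmeasurable_sqrmod.
  - by apply: emeasurable_funM => //; exact/measurable_EFinP.
  - by move=> t _; rewrite -EFinM lee_fin sqrmodM ler_wpM2r ?sqrmod_ge0.
have [q qE] := mkL2 mbw (le_lt_trans le (ltry _)).
by exists q; split => //; rewrite -lee_fin (nsq_ae mbw qE).
Qed.

Let hK t : sqrmod (h t)%:C <= M ^+ 2.
Proof.
have /andP[h0 hM] := h0M t.
by rewrite sqrmod_real lerXn2r ?nnegrE//; exact: le_trans hM.
Qed.

Let mhc : cmeasurable (fun t => (h t)%:C). Proof. exact: cmeasurable_real. Qed.

Lemma hmul_ex w : exists q : L2 mu, {ae mu, forall t, q t = (h t)%:C * w t} /\ nsq q <= M ^+ 2 * nsq w.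
Proof. exact: L2_mul. Qed.

(** Multiplication by h as a total function on L^2, available because h is bounded. *)
Definition hmul w : L2 mu := projT1 (cid (hmul_ex w)).

Lemma hmulE w : {ae mu, forall t, hmul w t = (h t)%:C * w t}.
Proof. by rewrite /hmul; case: (cid _) => q []. Qed.

Lemma hmul_le w : nsq (hmul w) <= M ^+ 2 * nsq w.
Proof. by rewrite /hmul; case: (cid _) => q []. Qed.

Lemma hmulP u v : {ae mu, forall t, v t = (h t)%:C * u t} <-> v = hmul u.
Proof.
split=> [vE|->]; last exact: hmulE.
by apply: L2P; apply: filterS2 vE (hmulE u) => t -> ->.
Qed.

Lemma hmulB u v : hmul (u - v) = hmul u - hmul v.
Proof.
apply/esym/hmulP; have h1 := hmulE u; have h2 := hmulE v.
have h3 := L2_sub_ae (hmul u) (hmul v); have h4 := L2_sub_ae u v.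
near=> t; rewrite (near h3 t)// (near h4 t)// (near h1 t)// (near h2 t)//.
by rewrite mulrBr.
Unshelve. all: by end_near. Qed.

Lemma hmul_sym u v : dotp (hmul u) v = dotp u (hmul v).
Proof.
have mu1 := L2_cmeasurable u; have mv := L2_cmeasurable v.
have r w : {ae mu, forall t, w t = w t} by exact: aeW.
have [_ ->] := dotp_ae (cmeasurableM mhc mu1) mv (hmulE u) (r v).
have [_ ->] := dotp_ae mu1 (cmeasurableM mhc mv) (r u) (hmulE v).
congr cintegral; apply/funext => t; case: (u t) (v t) => [? ?] [? ?].
by apply/eqP; rewrite eq_complex /=; apply/andP; split; apply/eqP; ring.
Qed.

Lemma mul_opE (p : L2 mu * L2 mu) : mul_op mu h p <-> p.2 = hmul p.1.
Proof. exact: hmulP. Qed.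

Variables (P : nat -> L2 mu) (A : nat -> nat -> R) (U : ell2 R -> L2 mu).
Hypothesis oP : orthonormal_basis P.
Hypothesis AE : forall m n, dotp (hmul (P n)) (P m) = (A m n)%:C.
Hypothesis uU : unitary U.
Hypothesis UP : forall n, U (ell2_basis n) = P n.

Let Udot x n : dotp (U x) (P n) = x n. Proof. exact: unitary_dotp. Qed.

Let Unsq x : nsq (U x) = nsq x. Proof. by rewrite /nsq; case: uU => _ -> _. Qed.

Let Uhnorm x : hnorm (U x) = hnorm x. Proof. by rewrite !hnormE Unsq. Qed.

Let Ulin c x y : U (c *: x + y) = c *: U x + U y.
Proof. by have [lU _ _] := uU; exact: lU. Qed.

Let UB x y : U (x - y) = U x - U y.
Proof. by rewrite addrC -scaleN1r Ulin scaleN1r addrC. Qed.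

Let U0 : U 0 = 0. Proof. by have := UB 0 0; rewrite !subrr. Qed.

Let UZ c x : U (c *: x) = c *: U x.
Proof. by rewrite -[c *: x]addr0 Ulin U0 addr0. Qed.

Let Uinj x y : U x = U y -> x = y.
Proof. by move=> e; apply/val_inj/funext => n /=; rewrite -!Udot e. Qed.

Let Usurj w : exists x, U x = w. Proof. by case: uU. Qed.

Let AT m n : A m n = A n m.
Proof.
have : (A m n)%:C = ((A n m)%:C)^* :> R[i] by rewrite -!AE -dotpC hmul_sym.
by rewrite (_ : _^* = (A n m)%:C); [case|exact: conjc_real].
Qed.

(** By Parseval and the symmetry of multiplication, the m-th entry of the formal product of the
    matrix with x is the m-th coefficient of h U x. *)
Lemma op_maxP (p : ell2 R * ell2 R) : op_max A p <-> U p.2 = hmul (U p.1).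
Proof.
have key x y : U y = hmul (U x) -> op_max A (x, y).
  move=> yE m /=; rewrite -[y m]Udot yE hmul_sym.
  have := parseval_dotp oP (U x) (hmul (P m)); congr is_csum.
  apply/funext => n; rewrite Udot mulrC; congr (_ * _).
  by transitivity (dotp (P n) (hmul (P m))); [exact/esym/dotpC|rewrite -hmul_sym AE].
split; last by case: p => x y; exact: key.
move=> hp; have [y yE] := Usurj (hmul (U p.1)).
have -> : p.2 = y; last by [].
apply/val_inj/funext => m /=; exact: is_csum_inj (hp m) (key _ _ yE m).
Qed.

Lemma op_conj_max : op_conj U (op_max A) = mul_op mu h.
Proof.
apply/seteqP; split.
  by move=> _ [p /op_maxP pE <-]; apply/mul_opE.
move=> [u v] /mul_opE /= vE; have [x xE] := Usurj u; have [y yE] := Usurj v.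
by exists (x, y); rewrite /= ?xE ?yE//; apply/op_maxP; rewrite /= xE yE.
Qed.

Let op_total x : exists y, op_max A (x, y).
Proof. by have [y yE] := Usurj (hmul (U x)); exists y; apply/op_maxP. Qed.

Lemma op_max_le p : op_max A p -> nsq p.2 <= M ^+ 2 * nsq p.1.
Proof. by move=> /op_maxP e; rewrite -!Unsq e hmul_le. Qed.

Lemma op_max_sub p q : op_max A p -> op_max A q -> op_max A (p.1 - q.1, p.2 - q.2).
Proof. by move=> /op_maxP e /op_maxP f; apply/op_maxP; rewrite /= !UB e f hmulB. Qed.

Let basis_dense x e : 0 < e -> exists N (c : nat -> R[i]),
  hnorm (x - \sum_(i < N) c i *: ell2_basis i) < e.
Proof.
move=> e0; have [_ [N [c ->]] hN] := oP.2 (U x) e e0; exists N, c.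
rewrite -Uhnorm UB; suff -> : U (\sum_(i < N) c i *: ell2_basis i) = \sum_(i < N) c i *: P i by [].
elim: N {hN} => [|N ih]; first by rewrite !big_ord0 U0.
by rewrite !big_ord_recr /= addrC Ulin ih UP addrC.
Qed.

Lemma nsq_small (V : innerProductSpace R) (u : V) (K : R) :
  (forall e, 0 < e -> nsq u <= K * e ^+ 2) -> u = 0.
Proof.
move=> hK'; apply: nsq_eq0; apply/eqP; rewrite eq_le nsq_ge0 andbT leNgt; apply/negP => u0.
have K1 : 0 < `|K| + 1 by rewrite ltr_wpDl.
pose e := Num.sqrt (nsq u / (`|K| + 1)).
have q0 : 0 < nsq u / (`|K| + 1) by rewrite divr_gt0.
have e0 : 0 < e by rewrite sqrtr_gt0.
have := hK' e e0; rewrite /e sqr_sqrtr ?(ltW q0)// leNgt => /negP; apply.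
rewrite mulrA ltr_pdivrMr// mulrC ltr_pM2l//.
by rewrite (le_lt_trans (ler_norm K))// ltrDl.
Qed.

(** A bounded operator is determined by its values on finite vectors: the graph of the maximal
    operator is closed, and finite vectors are dense. *)
Lemma op_min_max : op_min A = op_max A.
Proof.
apply/seteqP; split=> p; last first.
  move=> hp e e0; have k0 : 0 < `|M| + 1 by rewrite ltr_wpDl.
  have ek : 0 < e / (`|M| + 1) by rewrite divr_gt0.
  have [N [c hN]] := basis_dense p.1 ek.
  set x := \sum_(i < N) _ in hN; have [y hy] := op_total x.
  exists (x, y); first by split => //; exists N, c.
  have hx : hnorm (p.1 - x) ^+ 2 < (e / (`|M| + 1)) ^+ 2.
    by rewrite ltrXn2r// hnorm_ge0.
  split => /=.
    apply: (lt_le_trans hN); rewrite ler_pdivrMr// -[X in X <= _]mulr1 ler_pM2l//.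
    by rewrite lerDr.
  apply: hnorm_lt => //.
  apply: (le_lt_trans (op_max_le (op_max_sub hp hy))) => /=.
  apply: (@le_lt_trans _ _ ((`|M| + 1) ^+ 2 * nsq (p.1 - x))).
    apply: ler_wpM2r; first exact: nsq_ge0.
    by rewrite -[M ^+ 2]real_normK ?num_real// lerXn2r ?nnegrE ?addr_ge0// lerDl.
  rewrite -hnorm_sqr; have := hx; rewrite -(ltr_pM2l (exprn_gt0 2 k0)).
  by rewrite -[X in _ < X]exprMn [_ * (e / _)]mulrC divfK// gt_eqF.
move=> hp; have [y hy] := op_total p.1.
suff e : p.2 - y = 0.
  by move/eqP: e; rewrite subr_eq0 => /eqP e; case: p e hy {hp} => a b /= ->.
apply: (@nsq_small _ _ (2 + 2 * M ^+ 2)) => e e0.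
have [q [hq _] [h1 h2]] := hp e e0.
have -> : p.2 - y = (p.2 - q.2) + (q.2 - y) by rewrite addrA subrK.
apply: (le_trans (nsqD_le _ _)); rewrite [leRHS](mulrDl 2 (2 * M ^+ 2)); apply: lerD.
  by rewrite ler_pM2l// -hnorm_sqr lerXn2r ?nnegrE ?hnorm_ge0 ?ltW.
rewrite -mulrA ler_pM2l//.
apply: (le_trans (op_max_le (op_max_sub hq hy))) => /=.
rewrite ler_wpM2l ?sqr_ge0// -opprB -hnorm_sqr.
have -> : hnorm (- (p.1 - q.1)) = hnorm (p.1 - q.1).
  by rewrite !hnormE -scaleN1r nsqZ sqrmodN (_ : sqrmod 1 = 1) ?mul1r// /sqrmod /= expr1n expr0n addr0.
by rewrite lerXn2r ?nnegrE ?hnorm_ge0 ?ltW.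
Qed.

Lemma determines_max : determines_operator A (op_max A).
Proof.
split => //; last exact: op_min_max.
move=> n; have := coef_square_summable oP (hmul (P n)).
by rewrite (_ : (fun m => dotp _ _) = (fun m => (A m n)%:C))//; apply/funext => m; exact: AE.
Qed.

Lemma self_adjoint_max : self_adjoint (op_max A).
Proof.
split.
  move=> x e e0; have [y hy] := op_total x; exists x; first by exists y.
  by rewrite subrr hnormE nsq0 sqrtr0.
have Ud x y : dotp (U x) (U y) = dotp x y by case: uU.
apply/seteqP; split=> p.
  move=> hp; apply/op_maxP.
  apply: (coef_inj oP) => n.
  have [y hy] := op_total (ell2_basis n).
  have := hp _ hy => /=; rewrite -!Ud; move/op_maxP: hy => /= ->.
  rewrite hmul_sym UP => e.
  by transitivity ((dotp (P n) (U p.2))^*); [exact: dotpC|rewrite -e; exact/esym/dotpC].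
by move=> /op_maxP hp q /op_maxP hq; rewrite -!Ud hp hq hmul_sym.
Qed.

Lemma op_bounded_max : op_bounded (op_max A).
Proof.
split; first by apply/seteqP; split => // x _; exact: op_total.
exists `|M| => p /op_max_le hp; apply: hnorm_le.
  by rewrite mulr_ge0// hnorm_ge0.
by rewrite exprMn real_normK ?num_real// hnorm_sqr.
Qed.

(** The resolvent is multiplication by 1 / (h - z), bounded by 1 / e. *)
Lemma resolvent_of_gap z (e : R) : 0 < e -> (forall t, e ^+ 2 <= sqrmod ((h t)%:C - z)) ->
  resolvent_set_on setT (op_max A) z.
Proof.
move=> e0 gap.
have nz t : (h t)%:C - z != 0.
  apply/eqP => h1; have := gap t; rewrite h1 sqrmod0; apply/negP; rewrite -ltNge.
  exact: exprn_gt0.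
have mz : cmeasurable (fun t => (h t)%:C - z).
  by apply: (cmeasurableD mhc); exact: cmeasurable_cst.
(* 1 / (h t - z), written with the conjugate so that measurability is visible *)
pose b t : R[i] := ((sqrmod ((h t)%:C - z))^-1)%:C * ((h t)%:C - z)^*.
have bE t : b t * ((h t)%:C - z) = 1.
  rewrite /b -mulrA [_^* * _]mulrC mulcJ -rmorphM /= mulVf ?rmorph1//.
  by apply: contra (nz t) => /eqP/sqrmod_eq0 ->.
have mb : cmeasurable b.
  apply: cmeasurableM; last exact: cmeasurable_conj.
  apply: cmeasurable_real.
  rewrite (_ : (fun t => _) = (fun t => (sqrmod ((h t)%:C - z)) `^ (-1))).
    by apply: (measurableT_comp (measurable_powR _)); exact: cmeasurable_sqrmod.
  by apply/funext => t; rewrite powRN powRr1// sqrmod_ge0.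
have bK t : sqrmod (b t) <= (e^-1) ^+ 2.
  have h1 : sqrmod (b t) * sqrmod ((h t)%:C - z) = 1.
    by rewrite -sqrmodM bE /sqrmod /= expr1n expr0n addr0.
  have s0 : 0 < sqrmod ((h t)%:C - z) by apply: lt_le_trans (gap t); exact: exprn_gt0.
  rewrite -(ler_pM2r s0) h1 exprVn -ler_pdivrMl ?invr_gt0 ?exprn_gt0//.
  by rewrite invrK mulr1.
have key (w : ell2 R) (q : L2 mu) : {ae mu, forall t, q t = b t * U w t} ->
    forall x : ell2 R, op_max A (x, w + z *: x) <-> U x = q.
  move=> qE x; rewrite op_maxP /= addrC Ulin -hmulP.
  have h2 := L2_addE (z *: U x) (U w); have h3 := L2_scaleE z (U x).
  split=> [h1|xq].
    apply: L2P; near=> t; rewrite (near qE t)//.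
    have e1 : (h t)%:C * U x t = z * U x t + U w t.
      rewrite -(near h1 t)// (near h2 t)//; congr (_ + _); exact: (near h3 t).
    have -> : U w t = ((h t)%:C - z) * U x t by rewrite mulrBl e1 addrAC subrr add0r.
    by rewrite mulrA bE mul1r.
  near=> t; rewrite (near h2 t)//.
  have -> : (z *: U x : L2 mu) t = z * U x t by exact: (near h3 t).
  have -> : U w t = ((h t)%:C - z) * U x t.
    by rewrite xq (near qE t)// mulrA [_ * b t]mulrC bE mul1r.
  ring.
split.
  move=> w _; have [q [qE _]] := L2_mul (U w) mb bK; have [x xq] := Usurj q.
  exists x; split; first exact/(key _ _ qE).
  by move=> y /(key _ _ qE) yq; apply: Uinj; rewrite xq yq.
exists e^-1 => x w _; have [q [qE qle]] := L2_mul (U w) mb bK.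
move=> /(key _ _ qE) xq; apply: hnorm_le.
  by rewrite mulr_ge0 ?hnorm_ge0// invr_ge0 ltW.
by rewrite exprMn hnorm_sqr -Unsq xq -[nsq w]Unsq.
Unshelve. all: by end_near. Qed.

(** The indicator of a set on which h is within e of c is an approximate eigenvector for c. *)
Lemma test_vector (B : set T) (c e : R) : measurable B -> (0 < mu B < +oo)%E ->
  (forall t, B t -> `|h t - c| <= e) ->
  exists x y : ell2 R, [/\ op_max A (x, y), 0 < nsq x & nsq (y - c%:C *: x) <= e ^+ 2 * nsq x].
Proof.
move=> mB /andP[muB muBy] hB.
have mi : cmeasurable (fun t : T => (\1_B t)%:C : R[i]) by exact: cmeasurable_real.
have sqE t : sqrmod ((\1_B t)%:C : R[i]) = \1_B t.
  by rewrite sqrmod_real indicE; case: (t \in B); rewrite ?expr1n ?expr0n.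
have iB : (\int[mu]_t (sqrmod ((\1_B t)%:C : R[i]))%:E = mu B)%E.
  by under eq_integral do rewrite sqE; rewrite integral_indic// setIT.
have [w wE] : exists w : L2 mu, {ae mu, forall t, w t = (\1_B t)%:C}.
  by apply: mkL2 => //; rewrite iB.
have [x xE] := Usurj w; have [y hy] := op_total x; exists x, y; split => //.
  by rewrite -lte_fin -Unsq xE (nsq_ae mi wE) iB.
have mg : cmeasurable (fun t => ((h t - c) * \1_B t)%:C : R[i]).
  by apply: cmeasurable_real; apply: measurable_funM => //; exact: measurable_funB.
have -> : e ^+ 2 * nsq x = nsq ((e%:C : R[i]) *: U x) by rewrite nsqZ sqrmod_real Unsq.
have me : cmeasurable (fun t : T => (e%:C : R[i]) * (\1_B t)%:C : R[i]).
  by apply: (cmeasurableM _ mi); exact: cmeasurable_cst.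
(* h - c is dominated by e on B, and both functions vanish off B *)
have main := @nsq_le_ae (U (y - c%:C *: x)) (e%:C *: U x) _ _ mg me.
rewrite -Unsq; apply: main.
- rewrite UB UZ; move/op_maxP: hy => /= ->; rewrite xE.
  have h1 := L2_sub_ae (hmul w) (c%:C *: w); have h2 := L2_scaleE c%:C w.
  have h3 := hmulE w.
  near=> t; rewrite (near h1 t)// (near h3 t)// (_ : (c%:C *: w : L2 mu) t = c%:C * w t).
    by rewrite (near wE t)// -rmorphM -rmorphM -rmorphB /= mulrBl.
  by exact: (near h2 t).
- rewrite xE; apply: filterS2 wE (L2_scaleE e%:C w) => t h1 h2.
  by transitivity (e%:C * w t); [exact: h2|rewrite h1].
- move=> t; rewrite sqrmodM sqE !sqrmod_real exprMn.
  rewrite (_ : \1_B t ^+ 2 = \1_B t :> R); last first.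
    by rewrite indicE; case: (t \in B); rewrite ?expr1n ?expr0n.
  rewrite indicE; have [tB|] := boolP (t \in B); last by rewrite !mulr0.
  rewrite !mulr1 -[(h t - c) ^+ 2]real_normK ?num_real//.
  have := hB t (set_mem tB) => he.
  by rewrite lerXn2r ?nnegrE//; exact: le_trans he.
Unshelve. all: by end_near. Qed.

Hypothesis h_dense : forall c e, 0 <= c <= M -> 0 < e -> exists B : set T,
  [/\ measurable B, (0 < mu B < +oo)%E & forall t, B t -> `|h t - c| <= e].

(** Approximate eigenvectors forbid a bounded inverse of H - c. *)
Lemma spectrum_max : spectrum (op_max A) = [set x%:C | x in `[0, M]].
Proof.
apply/seteqP; split.
  move=> z nz; apply: contrapT => zM; apply: nz.
  case: z zM => z1 z2 zM.
  have sq t : sqrmod ((h t)%:C - (z1 +i* z2)) = (h t - z1) ^+ 2 + z2 ^+ 2.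
    by rewrite /sqrmod /= add0r sqrrN.
  have [z20|z20] := eqVneq z2 0; last first.
    have z2p : 0 < `|z2| by rewrite normr_gt0.
    apply: (resolvent_of_gap z2p) => t.
    by rewrite sq real_normK ?num_real// lerDr sqr_ge0.
  have [z1l|z1l] := ltrP z1 0.
    have e0 : 0 < - z1 by rewrite oppr_gt0.
    apply: (resolvent_of_gap e0) => t; rewrite sq z20 expr0n addr0.
    by apply: lerXn2r; rewrite ?nnegrE; have /andP[? ?] := h0M t; lra.
  have [z1g|z1g] := ltrP M z1.
    have e0 : 0 < z1 - M by rewrite subr_gt0.
    apply: (resolvent_of_gap e0) => t; rewrite sq z20 expr0n addr0.
    rewrite -[(h t - z1) ^+ 2]sqrrN.
    by apply: lerXn2r; rewrite ?nnegrE; have /andP[? ?] := h0M t; lra.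
  by exfalso; apply: zM; exists z1; [rewrite /= in_itv /= z1l z1g|rewrite z20].
move=> _ [c /= cM <-]; rewrite in_itv /= in cM => -[_ [K hK']].
have k0 : 0 < `|K| + 1 by rewrite ltr_wpDl.
have e0 : 0 < (`|K| + 1)^-1 by rewrite invr_gt0.
have [B [mB muB hB]] := h_dense cM e0.
have [x [y [hy x0 le]]] := test_vector mB muB hB.
have := hK' x (y - c%:C *: x) I; rewrite subrK => /(_ hy) hx.
have hx0 : 0 < hnorm x by rewrite hnormE sqrtr_gt0.
have h2 : hnorm (y - c%:C *: x) <= (`|K| + 1)^-1 * hnorm x.
  by apply: hnorm_le; [rewrite mulr_ge0// ltW|rewrite exprMn hnorm_sqr].
have h3 : hnorm x <= `|K| * ((`|K| + 1)^-1 * hnorm x).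
  apply: (le_trans hx); apply: (@le_trans _ _ (`|K| * hnorm (y - c%:C *: x))).
    by apply: ler_wpM2r (ler_norm K); exact: hnorm_ge0.
  exact: ler_wpM2l.
move: h3; rewrite leNgt => /negP; apply; rewrite mulrA gtr_pMl//.
by rewrite ltr_pdivrMr// mul1r ltrDl.
Qed.

(** The bound M is approached along approximate eigenvectors for M. *)
Lemma op_norm_max : 0 < M -> op_norm (op_max A) = M.
Proof.
move=> M0; have Mge : 0 <= M by exact: ltW.
pose S := [set hnorm p.2 | p in [set p | op_max A p /\ hnorm p.1 <= 1]].
have ub : ubound S M.
  move=> _ [p [hp hp1] <-]; apply: hnorm_le => //; apply: (le_trans (op_max_le hp)).
  by rewrite ler_piMr ?sqr_ge0// -hnorm_sqr expr_le1// hnorm_ge0.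
have [y0 hy0] := op_total 0.
have S0 : S !=set0.
  by exists (hnorm y0); exists (0, y0) => //; split => //=; rewrite hnormE nsq0 sqrtr0.
apply/eqP; rewrite eq_le; apply/andP; split; first exact: ge_sup.
apply/ler_addgt0Pl => e e0.
have MM : 0 <= M <= M by rewrite Mge lexx.
have [B [mB muB hB]] := h_dense MM e0.
have [x [y [hy x0 le]]] := test_vector mB muB hB.
have hx0 : 0 < hnorm x by rewrite hnormE sqrtr_gt0.
pose c : R := (hnorm x)^-1.
have hc : 0 < c by rewrite invr_gt0.
have nZ (v : ell2 R) : hnorm (c%:C *: v) = c * hnorm v.
  by rewrite !hnormE nsqZ sqrmod_real sqrtrM ?sqr_ge0// sqrtr_sqr ger0_norm// ltW.
have hcx : op_max A (c%:C *: x, c%:C *: y).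
  apply/op_maxP; rewrite /= !UZ; move/op_maxP: hy => /= ->.
  apply/hmulP; have h1 := L2_scaleE c%:C (hmul (U x)); have h2 := L2_scaleE c%:C (U x).
  have h3 := hmulE (U x).
  near=> t; transitivity (c%:C * hmul (U x) t); first exact: (near h1 t).
  rewrite (near h3 t)// (_ : (c%:C *: U x : L2 mu) t = c%:C * U x t); first by rewrite mulrCA.
  exact: (near h2 t).
have inS : S (c * hnorm y).
  exists (c%:C *: x, c%:C *: y); last exact: nZ.
  by split => //=; rewrite nZ mulVf ?gt_eqF.
apply: (@le_trans _ _ (e + c * hnorm y)); last first.
  by rewrite lerD2l; apply: ub_le_sup => //; exists M.
rewrite -(ler_pM2r hx0) mulrDl mulrAC [c * _]mulVf ?mul1r ?gt_eqF//.
have tri (u v : ell2 R) : hnorm (u - v) <= hnorm u + hnorm v.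
  apply: hnorm_le; first by rewrite addr_ge0 ?hnorm_ge0.
  rewrite nsqB sqrrD !hnorm_sqr -addrA -addrA lerD2l addrC lerD2r.
  have h1 : (Re (dotp u v)) ^+ 2 <= (hnorm u * hnorm v) ^+ 2.
    by rewrite exprMn !hnorm_sqr; apply: le_trans (cauchy_schwarz u v); exact: Re_sqr_le.
  have h2 : `|Re (dotp u v)| <= hnorm u * hnorm v.
    by rewrite -ler_sqr ?nnegrE ?mulr_ge0 ?hnorm_ge0// real_normK ?num_real.
  by move: h2; rewrite ler_norml -mulr_natl => /andP[? ?]; lra.
have -> : M * hnorm x = hnorm (M%:C *: x).
  by rewrite !hnormE nsqZ sqrmod_real sqrtrM ?sqr_ge0// sqrtr_sqr ger0_norm.
have -> : M%:C *: x = y - (y - M%:C *: x) by rewrite opprB addrC subrK.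
apply: (le_trans (tri _ _)); rewrite addrC lerD2r.
by apply: hnorm_le; [rewrite mulr_ge0// ltW|rewrite exprMn hnorm_sqr].
Unshelve. all: by end_near. Qed.

End multiplication.

(** * Spectral measures *)

Section L2_density.
Context d (T : measurableType d) (R : realType).
Variables (mu : {measure set T -> \bar R}) (w : L2 mu).

(** The measure |w|^2 mu; the spectral measure of x is its image under h for w = U x. *)
Definition L2_measure (B : set T) : \bar R := (\int[mu]_(t in B) (sqrmod (w t))%:E)%E.

Let L2_measure0 : L2_measure set0 = 0%E.
Proof. exact: integral_set0. Qed.

Let L2_measure_ge0 B : (0 <= L2_measure B)%E.
Proof. by apply: integral_ge0 => t _; rewrite lee_fin sqrmod_ge0. Qed.

Let L2_measure_sigma_additive : semi_sigma_additive L2_measure.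
Proof.
apply: semi_sigma_additive_nng_induced => [|t].
  by apply/measurable_EFinP; apply: cmeasurable_sqrmod; exact: L2_cmeasurable.
by rewrite lee_fin sqrmod_ge0.
Qed.

HB.instance Definition _ := isMeasure.Build _ _ _ L2_measure
  L2_measure0 L2_measure_ge0 L2_measure_sigma_additive.

End L2_density.

Section spectral_measure.
Context d (T : measurableType d) (R : realType).
Variables (mu : {measure set T -> \bar R}) (h : T -> R) (M : R).
Hypothesis mh : measurable_fun setT (h : T -> measurableTypeR R).
Hypothesis h0M : forall t, 0 <= h t <= M.
Variables (P : nat -> L2 mu) (A : nat -> nat -> R) (U : ell2 R -> L2 mu).
Hypothesis oP : orthonormal_basis P.
Hypothesis AE : forall m n, dotp (hmul mh h0M (P n)) (P m) = (A m n)%:C.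
Hypothesis uU : unitary U.
Hypothesis UP : forall n, U (ell2_basis n) = P n.
Notation leb := (@lebesgue_measure R).
Hypothesis h_ac : forall B : set (measurableTypeR R), measurable B ->
  leb B = 0%E -> mu (h @^-1` B) = 0%E.
Implicit Types (B : set (measurableTypeR R)) (x y : ell2 R).

Let mpre B : measurable B -> measurable (h @^-1` B).
Proof. by move=> mB; rewrite -[_ @^-1` _]setTI; exact: mh. Qed.

Let spec_proj_ex B x : exists y, measurable B ->
  {ae mu, forall t, U y t = (\1_(h @^-1` B) t)%:C * U x t}.
Proof.
have [mB|nB] := pselect (measurable B); last by exists 0.
have mi : cmeasurable (fun t => (\1_(h @^-1` B) t)%:C : R[i]).
  by apply: cmeasurable_real; apply: measurable_indic; exact: mpre.
have bd t : sqrmod ((\1_(h @^-1` B) t)%:C : R[i]) <= 1 ^+ 2.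
  by rewrite sqrmod_real indicE; case: (_ \in _); rewrite ?expr1n ?expr0n.
have [q [qE _]] := L2_mul (U x) mi bd; have [_ _ sU] := uU.
by have [y yq] := sU q; exists y => _; rewrite yq.
Qed.

(** Multiplication by the indicator of h^-1 B, carried back by U. *)
Definition spec_proj B x : ell2 R := projT1 (cid (spec_proj_ex B x)).

Let spec_projE B x : measurable B ->
  {ae mu, forall t, U (spec_proj B x) t = (\1_(h @^-1` B) t)%:C * U x t}.
Proof. by rewrite /spec_proj; case: (cid _) => y /= hy /hy. Qed.

Definition spec_meas x : {measure set (measurableTypeR R) -> \bar R} :=
  measure_function_pushforward__canonical__measure_function_Measure (L2_measure (U x)) mh.

Let spec_measE x B : spec_meas x B = (\int[mu]_(t in h @^-1` B) (sqrmod (U x t))%:E)%E.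
Proof. by []. Qed.

Let Uinj x y : U x = U y -> x = y.
Proof. by move=> e; apply/val_inj/funext => n /=; rewrite -!(unitary_dotp _ _ uU UP) e. Qed.

Let Ud x y : dotp (U x) (U y) = dotp x y. Proof. by case: uU. Qed.

Let mUs x : measurable_fun setT (fun t => (sqrmod (U x t))).
Proof. by apply: cmeasurable_sqrmod; exact: L2_cmeasurable. Qed.

Let ind2 (C : set T) t : (\1_C t)%:C * (\1_C t)%:C = (\1_C t)%:C :> R[i].
Proof. by rewrite indicE; case: (_ \in _); rewrite ?mulr1 ?mulr0. Qed.

Let mind B : measurable B -> cmeasurable (fun t => (\1_(h @^-1` B) t)%:C : R[i]).
Proof. by move=> mB; apply: cmeasurable_real; apply: measurable_indic; exact: mpre. Qed.

Let refl_ae (w : L2 mu) : {ae mu, forall t, w t = w t}. Proof. exact: aeW. Qed.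

Lemma spec_proj_dotp B x y : measurable B ->
  dotp (spec_proj B x) y = cintegral mu (fun t => (\1_(h @^-1` B) t)%:C * U x t * (U y t)^*).
Proof.
move=> mB; rewrite -Ud.
have [_ ->] := dotp_ae (cmeasurableM (mind mB) (L2_cmeasurable (U x))) (L2_cmeasurable (U y))
  (spec_projE x mB) (refl_ae (U y)).
by [].
Qed.

(** Integrals against the spectral measure of x become integrals of functions of h against |U
    x|^2 mu; those of r^2 and r compute the norm and the expectation of H. *)
Lemma is_spectral_measure_max : is_spectral_measure (op_max A) spec_proj spec_meas.
Proof.
have opP := op_maxP oP AE uU UP.
split.
- move=> B x mB; apply: Uinj; apply: L2P.
  have h1 := spec_projE (spec_proj B x) mB; have h2 := spec_projE x mB.
  by apply: filterS2 h1 h2 => t -> ->; rewrite mulrA ind2.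
- move=> B x y mB; rewrite spec_proj_dotp//.
  transitivity ((dotp (spec_proj B y) x)^*); last exact/esym/dotpC.
  rewrite spec_proj_dotp// -cintegral_conj.
    congr cintegral; apply/funext => t; move: (\1_ _ t) (U x t) (U y t) => r [? ?] [? ?].
    by apply/eqP; rewrite eq_complex /=; apply/andP; split; apply/eqP; ring.
  have [hi _] := dotp_ae (cmeasurableM (mind mB) (L2_cmeasurable (U y))) (L2_cmeasurable (U x))
    (spec_projE y mB) (refl_ae (U x)).
  exact: hi.
- move=> x; apply: Uinj; apply: L2P; apply: filterS (spec_projE x measurableT) => t ->.
  by rewrite preimage_setT indicT mul1r.
- move=> B x mB; rewrite spec_measE spec_proj_dotp// /cintegral /= /Rintegral.
  have -> : (\int[mu]_t (Re ((\1_(h @^-1` B) t)%:C * U x t * (U x t)^*))%:E =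
    \int[mu]_(t in h @^-1` B) (sqrmod (U x t))%:E)%E.
    rewrite [RHS]integral_mkcond; apply: eq_integral => t _.
    rewrite patchE -mulrA mulcJ indicE; case: (t \in _) => /=.
      by rewrite !mul1r mul0r subr0.
    by rewrite !mul0r subr0.
  rewrite fineK// ge0_fin_numE; last by apply: integral_ge0 => t _; rewrite lee_fin sqrmod_ge0.
  apply: (@le_lt_trans _ _ (\int[mu]_t (sqrmod (U x t))%:E)%E).
    apply: ge0_subset_integral => //; first exact: mpre.
      exact/measurable_EFinP.
    by move=> t _; rewrite lee_fin sqrmod_ge0.
  by rewrite nsqE ltry.
have tot x : exists y, op_max A (x, y).
  have [_ _ sU] := uU; have [y yE] := sU (hmul mh h0M (U x)).
  by exists y; apply/opP.
have dens x (f : R -> R) : measurable_fun setT (f : measurableTypeR R -> R) -> (forall r, 0 <= f r) ->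
  (\int[spec_meas x]_r (f r)%:E = \int[mu]_t ((f (h t)) * sqrmod (U x t))%:E)%E.
  move=> mf f0; rewrite ge0_integral_pushforward//; last 2 first.
  - by apply/measurable_EFinP.
  - by move=> r _; rewrite lee_fin.
  rewrite preimage_setT (@ge0_integral_density _ _ _ _ mu (fun t => sqrmod (U x t)))//.
  - by move=> t; exact: sqrmod_ge0.
  - by move=> t; rewrite lee_fin.
  - by apply/measurable_EFinP; exact: measurableT_comp.
split.
  move=> x; split=> _; last exact: tot.
  have sq := dens x (fun r => r ^+ 2) (measurable_funX 2 (@measurable_id _ _ setT)) (fun r => sqr_ge0 r).
  rewrite [X in (X < _)%E]sq.
  apply: (@le_lt_trans _ _ (nsq (hmul mh h0M (U x)))%:E); last exact: ltry.
  rewrite (nsq_ae (cmeasurableM (cmeasurable_real mh) (L2_cmeasurable (U x))) (hmulE mh h0M (U x))).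
  rewrite le_eqVlt; apply/orP; left; apply/eqP; apply: eq_integral => t _.
  by rewrite sqrmodM sqrmod_real.
move=> x y /opP /= yE; rewrite -Ud yE.
have [_ ->] := dotp_ae (cmeasurableM (cmeasurable_real mh) (L2_cmeasurable (U x))) (L2_cmeasurable (U x))
  (hmulE mh h0M (U x)) (refl_ae (U x)).
have e t : (h t)%:C * U x t * (U x t)^* = (h t * sqrmod (U x t))%:C by rewrite -mulrA mulcJ rmorphM.
rewrite /cintegral; under eq_fun do rewrite e.
under [X in _ +i* Rintegral _ _ X]eq_fun do rewrite e.
rewrite /= Rintegral_cst// mul0r; congr (_ +i* _).
rewrite /Rintegral; congr fine; rewrite [RHS]integralE.
have mp : measurable_fun setT (fun r : measurableTypeR R => Num.max r 0).
  by apply: measurable_maxr => //; exact: measurable_id.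
have mn : measurable_fun setT (fun r : measurableTypeR R => Num.max (- r) 0).
  by apply: measurable_maxr => //; exact: measurableT_comp.
have d1 := dens x (fun r => Num.max r 0) mp (fun r => _).
have d2 := dens x (fun r => Num.max (- r) 0) mn (fun r => _).
have -> : (\int[spec_meas x]_r (fun r => r%:E)^\- r = 0)%E.
  transitivity (\int[spec_meas x]_r (Num.max (- r) 0)%:E)%E.
    by apply: eq_integral => r _; rewrite funenegE EFin_max.
  rewrite d2 => [|r]; last by rewrite le_max lexx orbT.
  rewrite (_ : (fun t => _) = cst 0%E) ?integral0//; apply/funext => t.
  by rewrite max_r ?mul0r// oppr_le0; have /andP[] := h0M t.
have -> : (\int[spec_meas x]_r (fun r => r%:E)^\+ r = \int[mu]_t (h t * sqrmod (U x t))%:E)%E.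
  transitivity (\int[spec_meas x]_r (Num.max r 0)%:E)%E.
    by apply: eq_integral => r _; rewrite funeposE EFin_max.
  rewrite d1 => [|r]; last by rewrite le_max lexx orbT.
  by apply: eq_integral => t _; rewrite max_l//; have /andP[] := h0M t.
by rewrite sube0.
Qed.

Lemma spec_meas_ac x : spec_meas x `<< leb.
Proof.
move=> N hN B mB BN; rewrite spec_measE.
have B0 : leb B = 0%E by exact: hN.
apply: null_set_integral => //.
- exact: mpre.
- by apply/measurable_funTS/measurable_EFinP; exact: mUs.
- exact: h_ac.
Qed.

Lemma ac_subspace_max : ac_subspace (op_max A) = setT.
Proof.
apply/seteqP; split => // x _; exists spec_proj, spec_meas; split.
  exact: is_spectral_measure_max.
exact: spec_meas_ac.
Qed.

Lemma spectrum_ac_max : spectrum_ac (op_max A) = spectrum (op_max A).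
Proof.
rewrite /spectrum_ac /spectrum ac_subspace_max; congr spectrum_on.
by apply/seteqP; split => p; [case|split].
Qed.

End spectral_measure.

(** * The symbol *)

Section symbol.
Context {R : realType} (lam : R).
Hypothesis lam_gt0 : 0 < lam.
Notation leb := (@lebesgue_measure R).
Notation mu := (MP_measure lam : {measure set (measurableTypeR R) -> \bar R}).
Notation S := (sq_tr (gamma_fun lam)).
Notation h := (MP_symbol lam).
Notation M := (h 0).
Notation C := (pi * MP_cst lam).

Let C0 : 0 < C. Proof. by rewrite mulr_gt0 ?pi_gt0// MP_cst_gt0. Qed.
Let hE x : h x = C * S x. Proof. exact: MP_symbolE. Qed.

Lemma MP_symbol_gt0 x : 0 < h x.
Proof. by rewrite hE mulr_gt0// sq_tr_gamma_gt0. Qed.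

Lemma MP_symbol_range x : 0 <= h x <= M.
Proof.
rewrite ltW ?MP_symbol_gt0//= !hE ler_pM2l//; apply: sq_tr_gamma_homo => //.
by rewrite expr0n sqr_ge0.
Qed.

Lemma continuous_MP_symbol : continuous (h : R -> R).
Proof.
rewrite (_ : h = (fun x => C * S x)); last by apply/funext => x; exact: hE.
by move=> x; apply: cvgM; [exact: cvg_cst|exact: continuous_sq_tr_gamma].
Qed.

Lemma measurable_MP_symbol : measurable_fun setT (h : measurableTypeR R -> measurableTypeR R).
Proof. exact: measurable_continuous continuous_MP_symbol. Qed.

(** From |Gamma(lam + ix)|^2 <= Gamma(lam + 1)^2 / x^2. *)
Lemma MP_symbol_small e : 0 < e -> exists2 t, 0 <= t & h t < e.
Proof.
move=> e0; pose G := Gamma (lam + 1) ^+ 2.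
have G0 : 0 <= G by exact: sqr_ge0.
(* h t <= C G / t^2, and the summand 1 makes t positive *)
exists (Num.sqrt (C * G / e + 1)); first exact: sqrtr_ge0.
set t := Num.sqrt _; have q0 : 0 < C * G / e + 1.
  by apply: ltr_wpDl => //; apply: divr_ge0 (ltW e0); exact: mulr_ge0 (ltW C0) G0.
have t2 : t ^+ 2 = C * G / e + 1 by rewrite sqr_sqrtr// ltW.
have tp : 0 < t ^+ 2 by rewrite t2.
rewrite -(ltr_pM2l tp); apply: (@le_lt_trans _ _ (C * G)).
  rewrite hE mulrCA ler_pM2l//; apply: (@le_trans _ _ ((lam ^+ 2 + t ^+ 2) * S t)).
    by apply: ler_wpM2r; [exact: sq_tr_ge0|rewrite lerDr sqr_ge0].
  rewrite -sq_tr_gammaS//; apply: sq_tr_gamma_le; exact: addr_gt0.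
have -> : t ^+ 2 * e = C * G + e by rewrite t2; field; rewrite gt_eqF.
by rewrite ltrDl.
Qed.

Lemma MP_symbol_onto c e : 0 <= c <= M -> 0 < e -> exists t, `|h t - c| < e.
Proof.
move=> /andP[c0 cM] e0; have [t t0 ht] := MP_symbol_small e0.
have hp := MP_symbol_gt0 t.
have [ce|ec] := ltrP c e; first by exists t; rewrite ltr_norml; lra.
have hc : {within `[0, t], continuous (h : R -> R)}.
  by apply: continuous_subspaceT; exact: continuous_MP_symbol.
have hv : Num.min (h 0) (h t) <= c <= Num.max (h 0) (h t).
  by rewrite ge_min le_max cM (le_trans (ltW ht) ec) !orbT.
have [x _ hx] := IVT t0 hc hv.
by exists x; rewrite hx subrr normr0.
Qed.

Lemma MP_measure_finite : (mu setT < +oo)%E.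
Proof.
have b0 : 0 < (2 * lam + 1)^-1 :> R by rewrite invr_gt0 addr_gt0// mulr_gt0.
have [[_ h1] _] := poly_approx_poly b0 (exp_moment_MP lam_gt0) 1.
apply: le_lt_trans h1; under eq_integral do rewrite hornerC expr1n.
by rewrite integral_cst// mul1e.
Qed.

(** Every value in [0, h 0] is approached by h on a nonempty open set, which mu charges. *)
Lemma MP_symbol_level c e : 0 <= c <= M -> 0 < e -> exists B : set (measurableTypeR R),
  [/\ measurable B, (0 < mu B < +oo)%E & forall t, B t -> `|h t - c| <= e].
Proof.
move=> cM e0; have [x hx] := MP_symbol_onto cM e0.
pose B : set R := [set t | `|h t - c| < e].
have oB : open B.
  have -> : B = h @^-1` (ball c e).
    by apply/seteqP; split => t; rewrite /B /ball /= distrC.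
  apply: open_comp; last exact: ball_open.
  by move=> t _; exact: continuous_MP_symbol.
have mB : measurable (B : set (measurableTypeR R)) by exact: open_measurable.
exists B; split => //; last by move=> t /ltW.
apply/andP; split.
  have : measure_support mu x by rewrite MP_support.
  by apply.
by apply: le_lt_trans MP_measure_finite; apply: le_measure; rewrite ?inE.
Qed.

Let J (s : R) (n : nat) : set (measurableTypeR R) :=
  [set x | n.+1%:R^-1 <= s * x <= n.+1%:R].

(** The sign s = 1 or -1 selects a half-line.  On the part 1/(n+1) <= |x| <= n+1 of it, y^2 -
    x^2 is comparable to y - x, and [sq_tr_gamma_gap] applies. *)
Lemma MP_symbol_expansive (s : R) n : s ^+ 2 = 1 ->
  exists2 c, 0 < c & forall x y : R, J s n x -> J s n y -> c * `|x - y| <= `|h x - h y|.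
Proof.
move=> s1; have [N NE] : exists N : R, N = n.+1%:R by exists n.+1%:R.
have N0 : 0 < N by rewrite NE ltr0n.
have SN := sq_tr_gamma_gt0 N lam_gt0.
have L0 : 0 < lam ^+ 2 + N ^+ 2 by rewrite addr_gt0 ?exprn_gt0.
(* on the set considered, S x >= S N, |x| + |y| >= 1 / N and |y| <= N *)
exists (C * (S N * (N^-1 / (lam ^+ 2 + N ^+ 2)))).
  by rewrite mulr_gt0// mulr_gt0// divr_gt0// invr_gt0.
have key (x y : R) : J s n x -> J s n y -> x ^+ 2 <= y ^+ 2 ->
    C * (S N * (N^-1 / (lam ^+ 2 + N ^+ 2))) * `|x - y| <= `|h x - h y|.
  rewrite /J /= -NE => /andP[x1 x2] /andP[y1 y2] xy.
  have sq z : z ^+ 2 = (s * z) ^+ 2 by rewrite exprMn s1 mul1r.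
  have i0 : 0 < N^-1 by rewrite invr_gt0.
  have xN : x ^+ 2 <= N ^+ 2 by rewrite sq; apply: lerXn2r; rewrite ?nnegrE; lra.
  have yN : y ^+ 2 <= N ^+ 2 by rewrite [y ^+ 2]sq; apply: lerXn2r; rewrite ?nnegrE; lra.
  have gap := sq_tr_gamma_gap lam_gt0 xy.
  rewrite !hE -mulrBr normrM (gtr0_norm C0) -mulrA ler_pM2l//.
  apply: le_trans (ler_norm _); apply: le_trans gap.
  have SxN : S N <= S x by exact: sq_tr_gamma_homo.
  rewrite -mulrA; apply: ler_pM => //; first exact: ltW.
    by rewrite mulr_ge0// divr_ge0 ?ltW.
  have d1 : N^-1 * `|x - y| <= y ^+ 2 - x ^+ 2.
    have e1 : `|x - y| = `|s * x - s * y|.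
      by rewrite -mulrBr normrM (_ : `|s| = 1) ?mul1r//; apply/eqP; rewrite -sqrp_eq1// real_normK ?num_real// s1.
    rewrite e1 [x ^+ 2]sq [y ^+ 2]sq; have := xy; rewrite [x ^+ 2]sq [y ^+ 2]sq.
    move: (s * x) (s * y) x1 x2 y1 y2 => u v u1 u2 v1 v2 uv.
    have uv' : u <= v by nra.
    by rewrite distrC ger0_norm ?subr_ge0//; nra.
  have yl : 0 < lam ^+ 2 + y ^+ 2 by rewrite ltr_wpDr ?sqr_ge0// exprn_gt0.
  rewrite mulrAC; apply: ler_pM => //.
  - by rewrite mulr_ge0// ltW.
  - by rewrite invr_ge0 ltW.
  - by rewrite lef_pV2 ?posrE// lerD2l.
move=> x y Jx Jy; have [xy|yx] := lerP (x ^+ 2) (y ^+ 2); first exact: key.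
by rewrite distrC [leRHS]distrC; apply: key => //; exact: ltW.
Qed.

(** The line minus the origin is a countable union of sets on which h is expansive. *)
Lemma MP_symbol_null (B : set (measurableTypeR R)) : measurable B -> leb B = 0%E ->
  mu (h @^-1` B) = 0%E.
Proof.
move=> mB B0; have mpre : measurable (h @^-1` B : set (measurableTypeR R)).
  by rewrite -[_ @^-1` _]setTI; exact: measurable_MP_symbol.
suff hnull : leb.-negligible (h @^-1` B).
  apply: (@null_set_integral _ _ _ leb (h @^-1` B) (EFin \o MP_density lam)) => //.
    by apply/measurable_funTS/measurable_EFinP; exact: measurable_MP_density.
  by move/negligibleP : hnull; apply.
have mJ s n : measurable (J s n).
  rewrite (_ : J s n = (fun x : measurableTypeR R => s * x) @^-1` `[n.+1%:R^-1, n.+1%:R]%classic).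
    rewrite -[_ @^-1` _]setTI; apply: measurable_funM => //; exact: measurable_itv.
  by apply/seteqP; split => x; rewrite /J /= in_itv.
have nJ s n : s ^+ 2 = 1 -> leb.-negligible (h @^-1` B `&` J s n).
  move=> s1; have [c c0 hc] := MP_symbol_expansive n s1.
  apply/negligibleP; first exact: measurableI.
  exact: (null_preimage_expansive measurable_MP_symbol (mJ s n) c0 hc mB B0).
have : leb.-negligible ([set 0 : R] `|` ((\bigcup_n (h @^-1` B `&` J 1 n)) `|`
    (\bigcup_n (h @^-1` B `&` J (-1) n)))).
  apply: negligibleU.
    by apply/negligibleP; [exact: measurable_set1|exact: lebesgue_measure_set1].
  apply: negligibleU; apply: negligible_bigcup => n; apply: nJ; first exact: expr1n.
  by rewrite sqrrN expr1n.
apply: negligibleS => x Bx.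
have [->|x0] := eqVneq x 0; first by left.
have ax : 0 < `|x| by rewrite normr_gt0.
have [n hn] : exists n : nat, n.+1%:R^-1 <= `|x| <= n.+1%:R.
  (* large enough for both |x| and 1 / |x| *)
  pose m := (Num.truncn `|x| + Num.truncn `|x|^-1)%N; exists m.
  have b1 := truncnS_gt `|x|; have b2 := truncnS_gt `|x|^-1.
  apply/andP; split.
    rewrite invf_ple ?posrE ?ltr0n//; apply: (le_trans (ltW b2)).
    by rewrite ler_nat ltnS leq_addl.
  by apply: (le_trans (ltW b1)); rewrite ler_nat ltnS leq_addr.
right; have [xp|xn] := ltrP 0 x; [left|right]; exists n => //; split => //; rewrite /J /=.
  by move: hn; rewrite gtr0_norm// mul1r.
by move: hn; rewrite ler0_norm// mulN1r.
Qed.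

End symbol.

(** * Diagonalisation *)

Theorem theorem2 (R : realType) (lambda : R) (lambda_gt0 : 0 < lambda) :
  let mu : {measure set (measurableTypeR R) -> \bar R} := MP_measure lambda in
  let M := Num.sqrt pi * Gamma lambda / Gamma (lambda + 1 / 2) in
  exists H : set (ell2 R * ell2 R),
  [/\ determines_operator (matrix_H2 lambda) H,
      self_adjoint H,
      mu `<< @lebesgue_measure R /\ measure_support mu = setT,
      exists P : nat -> L2 mu,
        [/\ forall n, {ae mu, forall x, P n x = MP_normalized lambda n x},
            orthonormal_basis P,
            exists! U : ell2 R -> L2 mu,
              unitary U /\ forall n, U (ell2_basis n) = P n &
            forall U : ell2 R -> L2 mu,
              unitary U -> (forall n, U (ell2_basis n) = P n) ->
              op_conj U H = mul_op mu (MP_symbol lambda)] &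
      [/\ op_bounded H,
          spectrum H = [set x%:C | x in `[0, M]],
          spectrum_ac H = [set x%:C | x in `[0, M]] &
          op_norm H = M]].
Proof.
move=> mu M.
have ME : MP_symbol lambda 0 = M by exact: MP_symbol0.
have mh := measurable_MP_symbol lambda_gt0.
have h0M : forall t : measurableTypeR R, 0 <= MP_symbol lambda t <= M.
  by move=> t; rewrite -ME; exact: MP_symbol_range.
have M0 : 0 < M by rewrite -ME; exact: MP_symbol_gt0.
have [P [PE oP]] := MP_orthonormal_basis lambda_gt0.
have AE m n : dotp (hmul mh h0M (P n)) (P m) = (matrix_H2 lambda m n)%:C.
  have mc := cmeasurable_real mh; have mN k := cmeasurable_MP lambda_gt0 k.
  have hPE : {ae mu, forall x, hmul mh h0M (P n) x = (MP_symbol lambda x)%:C * MP_normalized lambda n x}.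
    by apply: filterS2 (hmulE mh h0M (P n)) (PE n) => x -> ->.
  have [_ ->] := dotp_ae (cmeasurableM mc (mN n)) (mN m) hPE (PE m).
  exact: MP_matrix_entry.
have exU := ex_unique_unitary oP (fun x => riesz_fischer x oP).
have [U [[uU UP] _]] := exU.
have hd c e : 0 <= c <= M -> 0 < e -> exists B : set (measurableTypeR R),
    [/\ measurable B, (0 < mu B < +oo)%E & forall t, B t -> `|MP_symbol lambda t - c| <= e].
  by rewrite -ME; exact: MP_symbol_level.
have spE := spectrum_max oP AE uU UP hd.
exists (op_max (matrix_H2 lambda)); split.
- exact: determines_max oP AE uU UP.
- exact: self_adjoint_max oP AE uU UP.
- by split; [exact: MP_dominated|exact: MP_support].
- exists P; split => // V uV VP; exact: op_conj_max oP AE uV VP.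
- split => //.
  + exact: op_bounded_max oP AE uU UP.
  + rewrite (spectrum_ac_max oP AE uU UP)//; exact: MP_symbol_null.
  + exact: op_norm_max oP AE uU UP hd M0.
Qed.
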